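(* Let $N\ge3$, $V_0>0$, $T\in(0,\infty)$, and let $D\subset\mathbb{R}^N$ be a bounded domain with smooth boundary and $0\notin\overline{D}$. Assume that $(w_0,w_1)\in H^1_0(D)\times L^2(D)$ and $F\in C([0,T];L^2(D))$, and let $w$ be the solution of $$\begin{cases}\partial_t^2w-\Delta w+\dfrac{V_0}{|x|}\partial_tw=F&\text{in }D\times(0,T),\\ w=0&\text{on }\partial D\times(0,T),\\ (w,\partial_tw)(0)=(w_0,w_1).\end{cases}$$ If $0<m<\min\{N-1,V_0-1\}$, then there exist positive constants $\delta_m$, $K_m$ (depending only on $N$ and $m$) such that for every $t\in[0,T]$, $$E^{\Psi}_{m+1}(w;t)+\delta_m\int_0^tE^{\Psi}_{m}(w;s)\,ds\leq K_m\left(E^{\Psi}_{m+1}(w;0)+\int_0^t\int_DF(x,s)^2\,\Psi(x,s)^{m+1}|x|\,dx\,ds\right).$$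
   Context: Here $\Psi(x,t)=1+t+|x|$ and, for $k\in\mathbb{R}$, $$E^{\Psi}_{k}(w;t)=\int_D\Big(|\nabla w(x,t)|^2+\big(\partial_tw(x,t)\big)^2\Big)\Psi(x,t)^{k}\,dx.$$ The solution $w$ is understood in the mild (semigroup) sense, so that $w\in C([0,T];H^1_0(D))\cap C^1([0,T];L^2(D))$. In particular the constants do not depend on the shape of $D$.
   Formalization: The constants δ_m and K_m are allowed to depend on V_0 as well as on N and m (not on T, D or the data); a K_m independent of V_0 is impossible, since for F=0, w_1=0, t=τV_0 the energy grows like V_0^{m+1}. *)

(* Defs.v *)
From HB Require Import structures.
From mathcomp Require Import all_boot all_order all_algebra.
From mathcomp Require Import all_classical all_reals all_analysis.

Set Implicit Arguments.
Unset Strict Implicit.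
Unset Printing Implicit Defensive.

Import Order.TTheory GRing.Theory Num.Theory.
Import numFieldNormedType.Exports.

Local Open Scope classical_set_scope.
Local Open Scope ring_scope.

(* Row vectors carry the sigma-algebra generated by the coordinates, as the
   library does for tuples. *)
Definition measure_rV_display : measure_display -> measure_display.
Proof. exact. Qed.

Section measurable_rV.
Context {d : measure_display} {T : sigmaRingType d}.
Variable n : nat.

Let coors : 'I_n -> 'rV[T]_n -> T := fun i x => x 0 i.

Let rV_set0 : g_sigma_preimage coors set0.
Proof. exact: sigma_algebra0. Qed.

Let rV_setC A : g_sigma_preimage coors A -> g_sigma_preimage coors (~` A).
Proof. exact: sigma_algebraC. Qed.

Let rV_bigcup (F : nat -> set 'rV[T]_n) :
  (forall i, g_sigma_preimage coors (F i)) ->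
  g_sigma_preimage coors (\bigcup_i (F i)).
Proof. exact: sigma_algebra_bigcup. Qed.

HB.instance Definition _ := @isMeasurable.Build (measure_rV_display d)
  'rV[T]_n (g_sigma_preimage coors) rV_set0 rV_setC rV_bigcup.

End measurable_rV.

Lemma measurable_coord (d : measure_display) (T : sigmaRingType d) (n : nat)
  (i : 'I_n) : measurable_fun [set: 'rV[T]_n] (fun x : 'rV[T]_n => x 0 i).
Proof.
move=> _ Y mY; rewrite setTI; apply: sub_sigma_algebra => /=.
rewrite -bigcup_seq/=; exists i => /=; first by rewrite mem_index_enum.
by exists Y => //; rewrite setTI.
Qed.

Lemma measurable_fun_rVP (d1 d2 : measure_display) (T1 : measurableType d1)
    (T2 : measurableType d2) (n : nat) (f : T1 -> 'rV[T2]_n) :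
  (forall i, measurable_fun [set: T1] (fun x => f x 0 i)) ->
  measurable_fun [set: T1] f.
Proof.
move=> mf _ A mA; rewrite setTI.
suff : preimage_set_system setT f
    (g_sigma_preimage (fun i (x : 'rV[T2]_n) => x 0 i)) `<=` measurable.
  by apply; exists A => //; rewrite setTI.
rewrite -g_sigma_preimageE.
apply: smallest_sub; first exact: sigma_algebra_measurable.
move=> B [C + <-]; rewrite -bigcup_seq => -[i _ [D mD <-]].
by rewrite !setTI -[X in measurable X]setTI; exact: mf.
Qed.

Section lebesgue_measure_rV.
Context {R : realType}.

Definition cons_rV (n : nat) (z : R * 'rV[R]_n) : 'rV[R]_n.+1 :=
  \row_i (if unlift ord0 i is Some j then z.2 0 j else z.1).

Lemma measurable_cons_rV (n : nat) :
  measurable_fun [set: R * 'rV[R]_n] (@cons_rV n).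
Proof.
apply: measurable_fun_rVP => i; rewrite /cons_rV.
under eq_fun do rewrite mxE.
case: (unlift ord0 i) => [j|]; last exact: measurable_fst.
apply: (@measurableT_comp _ _ _ _ _ _ (fun v : 'rV[R]_n => v 0 j)) => //.
exact: measurable_coord.
Qed.

Definition lebesgue_step (n : nat) (mu : {measure set 'rV[R]_n -> \bar R}) :
    {measure set 'rV[R]_n.+1 -> \bar R} :=
  measure_function_pushforward__canonical__measure_function_Measure
    (product_measure2 (@lebesgue_measure R) mu) (measurable_cons_rV (n := n)).

Fixpoint lebesgue_rV (n : nat) : {measure set 'rV[R]_n -> \bar R} :=
  if n is k.+1 then lebesgue_step (lebesgue_rV k) else dirac (0 : 'rV[R]_0).

Lemma lebesgue_rV_box (n : nat) (A : 'I_n -> set R) :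
  (forall i, measurable (A i)) ->
  lebesgue_rV n [set x | forall i, A i (x 0 i)] =
  (\prod_(i < n) lebesgue_measure (A i))%E.
Proof.
elim: n A => [|n IH] A mA /=.
  by rewrite big_ord0 diracE mem_set// => -[].
have mB (k : nat) (B : 'I_k -> set R) : (forall i, measurable (B i)) ->
    measurable [set x : 'rV[R]_k | forall i, B i (x 0 i)].
  move=> mB; rewrite (_ : mkset _ =
      \big[setI/setT]_(i < k) ((fun x : 'rV[R]_k => x 0 i) @^-1` B i)).
    apply: bigsetI_measurable => i _; rewrite -[X in measurable X]setTI.
    exact: measurable_coord.
  by rewrite -bigcap_seq; apply/seteqP; split=> x /= H i => [_|];
    [exact: H|apply: H; rewrite /= mem_index_enum].
rewrite /pushforward.
have -> : @cons_rV n @^-1` [set x | forall i, A i (x 0 i)] =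
    A ord0 `*` [set x : 'rV[R]_n | forall i : 'I_n, A (lift ord0 i) (x 0 i)].
  apply/seteqP; split=> -[a x] /=.
    move=> H; split=> [|i]; first by have := H ord0; rewrite mxE unlift_none.
    by have := H (lift ord0 i); rewrite mxE liftK.
  by case=> A0 H i; rewrite mxE; case: unliftP => [j ->|->].
rewrite product_measure2E; [|exact: mA|
  exact: (mB n (fun i => A (lift ord0 i)))].
rewrite big_ord_recl; congr (_ * _)%E.
exact: (IH (fun i => A (lift ord0 i))).
Qed.

End lebesgue_measure_rV.

Section function_spaces.
Context {R : realType} {N : nat}.
Implicit Types (D : set 'rV[R]_N) (f u v : 'rV[R]_N -> R).

Local Notation E := 'rV[R]_N.
Local Notation leb := (@lebesgue_rV R N).

(* The library norm on row vectors is the sup norm. *)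
Definition enorm (x : E) : R := Num.sqrt (\sum_i x 0 i ^+ 2).

Definition partial (i : 'I_N) f : E -> R := fun x => 'D_(delta_mx 0 i) f x.

Definition partials (s : seq 'I_N) f : E -> R := foldr partial f s.

Definition gradient f : E -> E := fun x => \row_i partial i f x.

Definition laplacian f : E -> R := fun x => \sum_i partials [:: i; i] f x.

Definition smooth_on D f : Prop := forall x, D x -> forall s : seq 'I_N,
  {for x, continuous (partials s f)} /\
  forall i, derivable (partials s f) x (delta_mx 0 i).

(* Near each boundary point, D is a strict sublevel set of a smooth function
   with nonvanishing gradient. *)
Definition smooth_boundary D : Prop :=
  forall p, closure D p -> ~ D p ->
  exists (U : set E) (rho : E -> R),
    [/\ open_nbhs p U, smooth_on U rho, gradient rho p != 0 &
        forall x, U x -> (D x <-> rho x < 0)].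

Definition smooth_bounded_domain D : Prop :=
  [/\ D !=set0, open D, connected D, bounded_set D & smooth_boundary D].

Definition test_fun D f : Prop :=
  smooth_on setT f /\
  exists2 K : set E, compact K & K `<=` D /\ forall x, ~ K x -> f x = 0.

(* Elements of L^2(D) and H^1_0(D) are represented by functions on R^N, of
   which only the values on D matter, up to Lebesgue-null sets; ||.||^2 is
   written with suffix [_sq]. *)
Definition L2_sq D f : \bar R := (\int[leb]_(x in D) (f x ^+ 2)%:E)%E.

Definition L2 D f : Prop := measurable_fun D f /\ (L2_sq D f < +oo)%E.

Definition weak_gradient D u (g : E -> E) : Prop :=
  (forall i, L2 D (fun x => g x 0 i)) /\
  forall phi, test_fun D phi -> forall i,
    \int[leb]_(x in D) (u x * partial i phi x) =
    - \int[leb]_(x in D) (g x 0 i * phi x).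

Definition weak_laplacian D u (h : E -> R) : Prop :=
  L2 D h /\
  forall phi, test_fun D phi ->
    \int[leb]_(x in D) (u x * laplacian phi x) =
    \int[leb]_(x in D) (h x * phi x).

(* u lies in the H^1-closure of the test functions, and g is its gradient. *)
Definition H10_gradient D u (g : E -> E) : Prop :=
  [/\ L2 D u, weak_gradient D u g &
      forall e : R, 0 < e -> exists2 phi, test_fun D phi &
        (\int[leb]_(x in D) ((u x - phi x) ^+ 2 +
                             enorm (g x - gradient phi x) ^+ 2)%:E < e%:E)%E].

Definition H10 D u : Prop := exists g, H10_gradient D u g.

(* The gradient of an element of H^1_0(D); it is determined almost everywhere
   on D. *)
Definition nabla D u : E -> E := xget (fun=> 0) [set g | H10_gradient D u g].

Definition H1_sq D u : \bar R :=
  (\int[leb]_(x in D) (u x ^+ 2 + enorm (nabla D u x) ^+ 2)%:E)%E.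

Definition continuous_L2 D (T : R) (f : R -> E -> R) : Prop :=
  forall s, 0 <= s <= T ->
    L2 D (f s) /\
    L2_sq D (f s' - f s) @[s' --> within `[0, T]%classic (nbhs s)] --> 0%E.

Definition continuous_H10 D (T : R) (f : R -> E -> R) : Prop :=
  forall s, 0 <= s <= T ->
    H10 D (f s) /\
    H1_sq D (f s' - f s) @[s' --> within `[0, T]%classic (nbhs s)] --> 0%E.

Definition derivative_L2 D (T : R) (f f' : R -> E -> R) : Prop :=
  forall s, 0 <= s <= T ->
    L2_sq D (fun x => (f s' x - f s x) / (s' - s) - f' s x)
      @[s' --> within `[0, T]%classic (dnbhs s)] --> 0%E.

End function_spaces.

Section damped_wave_semigroup.
Context {R : realType} {N : nat}.
Variables (D : set 'rV[R]_N) (V0 : R).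

Local Notation E := 'rV[R]_N.
Local Notation leb := (@lebesgue_rV R N).

(* Representatives of elements of H^1_0(D) x L^2(D). *)
Definition state : Type := ((E -> R) * (E -> R))%type.

HB.instance Definition _ := GRing.Zmodule.on state.

Definition scale_state (a : R) (U : state) : state :=
  (fun x => a * U.1 x, fun x => a * U.2 x).

Definition phase_space : set state := [set U | H10 D U.1 /\ L2 D U.2].

Definition phase_sq (U : state) : \bar R := (H1_sq D U.1 + L2_sq D U.2)%E.

Definition phase_eq (U W : state) : Prop := phase_sq (U - W) = 0%E.

Definition C0_semigroup (S : R -> state -> state) : Prop :=
  [/\ forall t, 0 <= t ->
        [/\ forall U, phase_space U -> phase_space (S t U),
            forall a U W, phase_space U -> phase_space W ->
              phase_eq (S t (scale_state a U + W))
                       (scale_state a (S t U) + S t W) &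
            exists C : R, forall U, phase_space U ->
              (phase_sq (S t U) <= C%:E * phase_sq U)%E],
      forall U, phase_space U -> phase_eq (S 0 U) U,
      forall s t U, 0 <= s -> 0 <= t -> phase_space U ->
        phase_eq (S (s + t) U) (S s (S t U)) &
      forall U, phase_space U -> phase_sq (S t U - U) @[t --> 0^'+] --> 0%E].

(* U is in the domain of A and A U = Z, where
   A (u, v) = (v, Delta u - V0 / |x| v),
   D(A) = {(u, v) | u, v in H^1_0(D), Delta u in L^2(D)}. *)
Definition wave_operator (U Z : state) : Prop :=
  [/\ H10 D U.1, H10 D U.2 &
      exists2 h, weak_laplacian D U.1 h &
        phase_eq Z (U.2, fun x => h x - V0 / enorm x * U.2 x)].

Definition generated_by_wave_operator (S : R -> state -> state) : Prop :=
  forall U Z, phase_space U -> phase_space Z ->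
    (phase_sq (scale_state t^-1 (S t U - U) - Z) @[t --> 0^'+] --> 0%E) <->
    wave_operator U Z.

(* Riemann integral over [a, b] of a phase_space-valued function, as a limit
   of tagged Riemann sums. *)
Definition phase_integral (a b : R) (G : R -> state) (I : state) : Prop :=
  phase_space I /\
  forall e : R, 0 < e -> exists2 eta : R, 0 < eta &
    forall (n : nat) (p c : nat -> R), p 0%N = a -> p n = b ->
      (forall i, (i < n)%N -> p i <= c i <= p i.+1 /\ p i.+1 - p i < eta) ->
      (phase_sq (\sum_(i < n) scale_state (p i.+1 - p i) (G (c i)) - I)%R
        < e%:E)%E.

(* (w, w') is given by Duhamel's formula for the semigroup S generated by the
   wave operator, and w' is the time derivative of w in L^2(D). *)
Definition mild_solution (T : R) (F : R -> E -> R) (w0 w1 : E -> R)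
    (w w' : R -> E -> R) : Prop :=
  [/\ continuous_H10 D T w,
      continuous_L2 D T w',
      derivative_L2 D T w w' &
      exists S : R -> state -> state,
        [/\ C0_semigroup S,
            generated_by_wave_operator S &
            forall t, 0 <= t <= T -> exists2 I : state,
              phase_integral 0 t (fun s => S (t - s) (0, F s)) I &
              phase_eq (w t, w' t) (S t (w0, w1) + I)]].

End damped_wave_semigroup.

Section weighted_energy.
Context {R : realType} {N : nat}.

Definition Psi (x : 'rV[R]_N) (t : R) : R := 1 + t + enorm x.

Definition weighted_energy (D : set 'rV[R]_N) (k : R)
    (w w' : R -> 'rV[R]_N -> R) (t : R) : \bar R :=
  (\int[lebesgue_rV N]_(x in D)
     ((enorm (nabla D (w t) x) ^+ 2 + w' t x ^+ 2) * Psi x t `^ k)%:E)%E.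

End weighted_energy.

(* Main.v *)
Require Import Defs.
From HB Require Import structures.
From mathcomp Require Import all_boot all_order all_algebra.
From mathcomp Require Import all_classical all_reals all_analysis.
From mathcomp Require Import measurable_realfun ring lra.

(* Let Psi = 1 + t + lam |x| with lam large. To the weighted energy of
   U = (u, v) one adds a cross term and a zero order term, which gives the forms
   S(mu, kap) = int Psi^(mu+1) (|grad u|^2 + v^2) + 2 phi u v + rho u^2 with
   phi = (V lam / 2) Psi^mu. Along the free flow they dissipate
   int Psi^mu |grad u|^2 + Psi^(mu+1) v^2 / |x|, up to an error
   int Psi^(mu-1) u^2 / |x|; integrating the divergence of a(|x|) u^2 x / |x|
   for a suitable a absorbs this error when m = mu = kap < N - 2.
   If N - 2 <= m < N - 1, let A be the wave operator and K = A^-1 U: the second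
   component of K is u, so the form S(m - 2, kap) at K dissipates exactly
   int Psi^(m-1) u^2 / |x|, and a large multiple of it is added. The force
   enters K through A^-1 (0, F) = (Theta, 0) with Delta Theta = F, which a
   weighted elliptic estimate controls; subtracting a small multiple of a form
   with the weight (1+t)^e Psi^(m-1-e) creates the dissipation that pays for
   the resulting product.
   A mild solution need not be differentiable in the phase space, so the energy
   inequality is proved for the right Dini derivative: the free flow is
   differentiated on the domain of the generator, the inequality extends by
   density because the forms are bounded, and U (t + h) agrees with
   S h (U t) + h (0, F t) up to o(h). *)

(** The estimates reduce to pointwise algebra: integral identities are kept as integrands of
    integral zero and added to the density, which leaves the sign of a quadratic form in [v], [u_r],
    [u / Psi] and [|grad u|^2] whose coefficients depend on the position only through the ratio
    [p = Psi / |x| >= lam]. A large [lam] lets the highest power of [lam] decide: for [kap = mu] and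
    [p = lam] the coefficient of [u^2] starts with [V lam^3 mu (mu + 2 - N) / 2], whence the
    threshold [N - 2], while [m + 1 < V] beats the product of [v] and [u_r] that the gradient of the
    weight produces. The threshold [N - 1] is that of the elliptic estimate with weight close to
    [Psi^(m - 1)], whose exponent must stay below [N - 2]. Passing from [U] to [A^-1 U] costs two
    powers of the weight, which is why the second form has the exponent [m - 2]. The constants must
    not see [D]: quantities that depend on it, such as bounds of the weights or the Poincare
    constant, serve only integrability, continuity and solvability. *)

Set Implicit Arguments.
Unset Strict Implicit.
Unset Printing Implicit Defensive.

Import Order.TTheory GRing.Theory Num.Theory.
Import numFieldNormedType.Exports.

Local Open Scope classical_set_scope.
Local Open Scope ring_scope.

(** * Square-integrable functions *)

Section square_integrable.
Context {d : measure_display} {T : measurableType d} {R : realType}.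
Variables (mu : {measure set T -> \bar R}) (D : set T).
Hypothesis mD : measurable D.
Implicit Types f g w v : T -> R.

Definition intg (f : T -> R) := mu.-integrable D (EFin \o f).
Definition Int (f : T -> R) : R := \int[mu]_(x in D) f x.
Definition l2 (f : T -> R) : Prop :=
  measurable_fun D f /\ (\int[mu]_(x in D) (f x ^+ 2)%:E < +oo)%E.
Definition bmf (w : T -> R) : Prop :=
  measurable_fun D w /\ exists C, forall x, D x -> `|w x| <= C.

Lemma Int_EFin f : intg f -> (Int f)%:E = (\int[mu]_(x in D) (f x)%:E)%E.
Proof. by move=> fi; rewrite /Int /Rintegral fineK//; exact: integrable_fin_num. Qed.

Lemma eq_Int f g : (forall x, D x -> f x = g x) -> Int f = Int g.
Proof. by move=> fg; apply: eq_Rintegral => x /set_mem; exact: fg. Qed.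

Lemma intg_eq f g : (forall x, D x -> f x = g x) -> intg f -> intg g.
Proof.
move=> fg; apply: eq_integrable => // x /set_mem Dx /=.
by rewrite fg.
Qed.

Lemma intgD f g : intg f -> intg g -> intg (fun x => f x + g x).
Proof.
by move=> fi gi; apply: eq_integrable (integrableD mD fi gi) => // x _.
Qed.

Lemma intgB f g : intg f -> intg g -> intg (fun x => f x - g x).
Proof.
by move=> fi gi; apply: eq_integrable (integrableB mD fi gi) => // x _.
Qed.

Lemma intgZ c f : intg f -> intg (fun x => c * f x).
Proof.
by move=> fi; apply: eq_integrable (integrableZl mD c fi) => // x _.
Qed.

Lemma intg0 : intg (fun=> 0).
Proof. exact: integrable0. Qed.

Lemma intg_sum (I : Type) (r : seq I) (F : I -> T -> R) :
  (forall i, intg (F i)) -> intg (fun x => \sum_(i <- r) F i x).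
Proof.
move=> Fi; elim: r => [|i r IH].
  by under eq_fun do rewrite big_nil; exact: intg0.
by under eq_fun do rewrite big_cons; apply: intgD.
Qed.

Lemma intg_bmf w f : bmf w -> intg f -> intg (fun x => w x * f x).
Proof.
move=> [mw [C Cw]] fi.
apply: eq_integrable (integrableMr mD (h := w) mw _ fi) => //.
exists C; split; first exact: num_real.
by move=> M CM x Dx; rewrite /= (le_trans (Cw _ Dx))// ltW.
Qed.

Lemma IntD f g : intg f -> intg g -> Int (fun x => f x + g x) = Int f + Int g.
Proof. exact: RintegralD. Qed.

Lemma IntB f g : intg f -> intg g -> Int (fun x => f x - g x) = Int f - Int g.
Proof. exact: RintegralB. Qed.

Lemma IntZ c f : intg f -> Int (fun x => c * f x) = c * Int f.
Proof. exact: RintegralZl. Qed.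

Lemma Int0 : Int (fun=> 0) = 0.
Proof. by rewrite /Int Rintegral_cst// mul0r. Qed.

Lemma Int_sum (I : Type) (r : seq I) (F : I -> T -> R) :
  (forall i, intg (F i)) ->
  Int (fun x => \sum_(i <- r) F i x) = \sum_(i <- r) Int (F i).
Proof.
move=> Fi; elim: r => [|i r IH].
  rewrite big_nil -[RHS]Int0; apply: eq_Int => x _.
  by rewrite big_nil.
rewrite big_cons -IH -IntD//; last exact: intg_sum.
by apply: eq_Int => x _; rewrite big_cons.
Qed.

Lemma le_Int f g : intg f -> intg g -> (forall x, D x -> f x <= g x) ->
  Int f <= Int g.
Proof. exact: le_Rintegral. Qed.

Lemma Int_ge0 f : (forall x, D x -> 0 <= f x) -> 0 <= Int f.
Proof. exact: Rintegral_ge0. Qed.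

Lemma intg_le f g : measurable_fun D f -> intg g ->
  (forall x, D x -> `|f x| <= g x) -> intg f.
Proof.
move=> mf gi fg; apply: le_integrable gi => //; first exact/measurable_EFinP.
move=> x Dx /=; rewrite lee_fin (le_trans (fg _ Dx))//; exact: ler_norm.
Qed.

Lemma l2_sqr f : l2 f -> intg (fun x => f x ^+ 2).
Proof.
move=> [mf foo]; apply/integrableP; split.
  by apply/measurable_EFinP; exact: measurable_funX.
rewrite (eq_integral (fun x => (f x ^+ 2)%:E))// => x _ /=.
by rewrite ger0_norm// sqr_ge0.
Qed.

Lemma l2P f : measurable_fun D f -> intg (fun x => f x ^+ 2) -> l2 f.
Proof.
move=> mf /integrableP[_ foo]; split => //.
apply: le_lt_trans foo; apply: ge0_le_integral => //.
- by move=> x _; rewrite lee_fin sqr_ge0.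
- by apply/measurable_EFinP; exact: measurable_funX.
- by do 2!apply: measurableT_comp => //; exact: measurable_funX.
- by move=> x _ /=; rewrite lee_fin ler_norm.
Qed.

Lemma l2_mul f g : l2 f -> l2 g -> intg (fun x => f x * g x).
Proof.
move=> lf lg; apply: (@intg_le _ (fun x => f x ^+ 2 + g x ^+ 2)).
- by case: lf lg => mf _ [mg _]; exact: measurable_funM.
- by apply: intgD; exact: l2_sqr.
- move=> x _; rewrite normrM -(real_normK (num_real (f x))).
  rewrite -(real_normK (num_real (g x))).
  have := normr_ge0 (f x); have := normr_ge0 (g x).
  by set a := `|f x|; set b := `|g x|; nra.
Qed.

Lemma l2D f g : l2 f -> l2 g -> l2 (fun x => f x + g x).
Proof.
move=> lf lg; apply: l2P.
  by case: lf lg => mf _ [mg _]; exact: measurable_funD.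
apply: (@intg_eq (fun x => (f x ^+ 2 + 2 * (f x * g x)) + g x ^+ 2)).
  by move=> x _; ring.
apply: intgD; last exact: l2_sqr.
by apply: intgD; [exact: l2_sqr|apply: intgZ; exact: l2_mul].
Qed.

Lemma l2_bmf w f : bmf w -> l2 f -> l2 (fun x => w x * f x).
Proof.
move=> [mw [C Cw]] lf; apply: l2P.
  by case: lf => mf _; exact: measurable_funM.
apply: (@intg_le _ (fun x => C ^+ 2 * f x ^+ 2)).
- apply: measurable_funX; case: lf => mf _; exact: measurable_funM.
- by apply: intgZ; exact: l2_sqr.
- move=> x Dx; rewrite ger0_norm ?sqr_ge0// exprMn ler_wpM2r ?sqr_ge0//.
  rewrite -(real_normK (num_real (w x))) ler_sqr ?nnegrE//; first exact: Cw.
  by rewrite (le_trans _ (Cw _ Dx)).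
Qed.

Lemma bmf_cst c : bmf (fun=> c).
Proof. by split => //; exists `|c|. Qed.

Lemma l2Z c f : l2 f -> l2 (fun x => c * f x).
Proof. exact/l2_bmf/bmf_cst. Qed.

Lemma l2B f g : l2 f -> l2 g -> l2 (fun x => f x - g x).
Proof.
move=> lf lg; have := l2D lf (l2Z (-1) lg).
by congr l2; apply/funext => x; rewrite mulN1r.
Qed.

Lemma l2_0 : l2 (fun=> 0).
Proof. by apply: l2P => //; rewrite expr0n; exact: intg0. Qed.

Lemma bmfD w v : bmf w -> bmf v -> bmf (fun x => w x + v x).
Proof.
move=> [mw [C Cw]] [mv [B Bv]]; split; first exact: measurable_funD.
exists (C + B) => x Dx; rewrite (le_trans (ler_normD _ _))//.
by rewrite lerD ?Cw ?Bv.
Qed.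

Lemma bmfM w v : bmf w -> bmf v -> bmf (fun x => w x * v x).
Proof.
move=> [mw [C Cw]] [mv [B Bv]]; split; first exact: measurable_funM.
by exists (C * B) => x Dx; rewrite normrM ler_pM ?Cw ?Bv.
Qed.

Lemma intg_bmf2 w f g : bmf w -> l2 f -> l2 g ->
  intg (fun x => w x * (f x * g x)).
Proof. by move=> bw lf lg; apply: intg_bmf => //; exact: l2_mul. Qed.

(* Cauchy-Schwarz, from the nonnegativity of the quadratic
   [c |-> Int ((f + c g)^2)]. *)
Lemma Int_CS f g : l2 f -> l2 g ->
  Int (fun x => f x * g x) ^+ 2 <=
  Int (fun x => f x ^+ 2) * Int (fun x => g x ^+ 2).
Proof.
move=> lf lg.
have quad c : 0 <= Int (fun x => f x ^+ 2) + 2 * c * Int (fun x => f x * g x)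
    + c ^+ 2 * Int (fun x => g x ^+ 2).
  have -> : Int (fun x => f x ^+ 2) + 2 * c * Int (fun x => f x * g x)
    + c ^+ 2 * Int (fun x => g x ^+ 2) = Int (fun x => (f x + c * g x) ^+ 2).
    have i1 := l2_sqr lf; have i2 := intgZ (2 * c) (l2_mul lf lg).
    have i3 := intgZ (c ^+ 2) (l2_sqr lg).
    rewrite -(IntZ _ (l2_mul lf lg)) -(IntZ _ (l2_sqr lg)).
    rewrite -(IntD i1 i2) -(IntD (intgD i1 i2) i3).
    by apply: eq_Int => x _; ring.
  by apply: Int_ge0 => x _; exact: sqr_ge0.
have A0 : 0 <= Int (fun x => f x ^+ 2) by apply: Int_ge0 => x _; exact: sqr_ge0.
have B0 : 0 <= Int (fun x => g x ^+ 2) by apply: Int_ge0 => x _; exact: sqr_ge0.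
move: quad A0 B0; set A := Int _; set C := Int (fun x => f x * g x).
set B := Int _ => quad A0 B0.
have [B00|Bn0] := eqVneq B 0.
  suff -> : C = 0 by rewrite expr0n mulr_ge0.
  apply/eqP/negPn/negP => Cn0.
  have := quad (- (A + 1) / (2 * C)); rewrite B00.
  have -> : A + 2 * (- (A + 1) / (2 * C)) * C + (- (A + 1) / (2 * C)) ^+ 2 * 0 = -1.
    by field.
  by lra.
have Bp : 0 < B by rewrite lt_def Bn0.
have := quad (- C / B).
have -> : A + 2 * (- C / B) * C + (- C / B) ^+ 2 * B = (A * B - C ^+ 2) / B.
  by field.
by rewrite pmulr_lge0 ?invr_gt0// subr_ge0.
Qed.

Lemma ae_Int f g : {ae mu, forall x, D x -> f x = g x} ->
  intg f -> intg g -> Int f = Int g.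
Proof.
move=> fg fi gi; rewrite /Int /Rintegral; congr fine.
apply: ae_eq_integral => //.
- by case/integrableP: fi.
- by case/integrableP: gi.
- by move: fg; apply: filterS => x h Dx; rewrite h.
Qed.

End square_integrable.

(** * Completeness of L^2 *)

Section l2_complete.
Context {d : measure_display} {T : measurableType d} {R : realType}.
Variables (mu : {measure set T -> \bar R}) (D : set T).
Hypothesis mD : measurable D.
Implicit Types f g w v : T -> R.

Local Notation l2 := (l2 mu D).
Local Notation Int := (Int mu D).

(** Fatou's lemma for the squares. A liminf sees only large [n], so the bound may fail at first;
    this lets one index of a Cauchy estimate stay fixed while the other goes to infinity. *)
Lemma fatou_sqr (h : nat -> T -> R) f (e : R) :
  (forall n, l2 (h n)) -> (forall x, D x -> h^~ x @ \oo --> f x) ->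
  (exists n0, forall n, (n0 <= n)%N -> Int (fun x => h n x ^+ 2) <= e) ->
  l2 f /\ Int (fun x => f x ^+ 2) <= e.
Proof.
move=> lh hf [n0 he].
have mf : measurable_fun D f.
  by apply: (measurable_fun_cvg (h := h)) => // n; case: (lh n).
have lef : (\int[mu]_(x in D) (f x ^+ 2)%:E <= e%:E)%E.
  have mh n : measurable_fun D (fun x => (h n x ^+ 2)%:E).
    by apply/measurable_EFinP; apply: measurable_funX; case: (lh n).
  have h0 n x : D x -> (0 <= (h n x ^+ 2)%:E)%E by rewrite lee_fin sqr_ge0.
  have := fatou mu mD mh h0.
  rewrite (eq_integral (fun x => (f x ^+ 2)%:E)); last first.
    move=> x /set_mem Dx; apply: (cvg_limn_einf_sup _).1.
    apply: cvg_EFin; first by exists 0%N.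
    rewrite [X in X @ _ --> _](_ : _ = (fun n => h n x ^+ 2)); last exact/funext.
    rewrite expr2 (_ : (fun n => h n x ^+ 2) = (fun n => h n x * h n x)).
      by apply: cvgM; exact: hf.
    by apply/funext => n; rewrite expr2.
  move=> /le_trans; apply.
  rewrite limn_einf_lim; apply: lime_le; first exact: is_cvg_einfs.
  near=> n; apply: (@le_trans _ _ (\int[mu]_(x in D) (h n x ^+ 2)%:E)%E).
    by apply: ereal_inf_lbound; exists n => /=.
  rewrite -Int_EFin//; last exact: l2_sqr.
  rewrite lee_fin; apply: he.
  by near: n; exists n0.
have lf : l2 f by split => //; apply: le_lt_trans lef _; rewrite ltry.
by split => //; rewrite -lee_fin Int_EFin//; exact: l2_sqr.
Unshelve. all: by end_near. Qed.

Let sumpow (c : R) (u : nat -> R) : 0 <= c ->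
  (forall n, 0 <= u n) -> (forall n, \sum_(0 <= k < n) u k <= c) ->
  cvgn (series u).
Proof.
move=> c0 u0 uc; apply: nondecreasing_is_cvgn.
  by apply/nondecreasing_seqP => n; rewrite -subr_ge0 seriesSB.
by exists c => _ [n _ <-]; exact: uc.
Qed.

Let geo2 n : \sum_(0 <= k < n) (2^-1 : R) ^+ k <= 2.
Proof.
suff -> : \sum_(0 <= k < n) (2^-1 : R) ^+ k = 2 - 2 * 2^-1 ^+ n.
  by rewrite gerBl mulr_ge0// exprn_ge0// invr_ge0.
elim: n => [|n IH]; first by rewrite big_nil expr0 mulr1 subrr.
by rewrite big_nat_recr//= IH exprS; field.
Qed.

(* Along a rapidly converging subsequence [h], [sum 2^k (h_(k+1) - h_k)^2] is
   finite almost everywhere, hence [h] converges there. *)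
Lemma l2_complete_fast (h : nat -> T -> R) :
  (forall n, l2 (h n)) ->
  (forall n m, (n <= m)%N ->
     Int (fun x => (h m x - h n x) ^+ 2) <= (4^-1) ^+ n) ->
  exists2 f, l2 f & forall n, Int (fun x => (f x - h n x) ^+ 2) <= (4^-1) ^+ n.
Proof.
move=> lh hC.
(* The bound [4^-n] leaves no room for the weights [2^n]; along [h (2 n)] it
   becomes [16^-n]. *)
pose k n := h n.*2.
have lk n : l2 (k n) by exact: lh.
have kC n : Int (fun x => (k n.+1 x - k n x) ^+ 2) <= (16^-1) ^+ n.
  apply: le_trans (hC n.*2 n.+1.*2 _) _; first by rewrite leq_double.
  by rewrite -mul2n exprM; apply: lerXn2r; rewrite ?nnegrE//; lra.
pose a n x := (2 ^+ n * (k n.+1 x - k n x) ^+ 2)%:E : \bar R.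
have a0 n x : (0 <= a n x)%E.
  by rewrite lee_fin mulr_ge0 ?sqr_ge0// exprn_ge0.
have la n : l2 (fun x => k n.+1 x - k n x) by exact: l2B.
have ma n : measurable_fun D (a n).
  apply/measurable_EFinP; apply: measurable_funM => //.
  by apply: measurable_funX; case: (la n).
pose G x := (\sum_(n <oo) a n x)%E.
have mG : measurable_fun D G.
  exact: (@ge0_emeasurable_sum _ _ _ _ a predT).
have G0 x : (0 <= G x)%E by apply: nneseries_ge0 => n _ _; exact: a0.
have iG : (\int[mu]_(x in D) G x < +oo)%E.
  rewrite integral_nneseries//.
  apply: (@le_lt_trans _ _ 2%:E); last by rewrite ltry.
  apply: lime_le.
    by apply: is_cvg_nneseries => n _ _; apply: integral_ge0 => x _; exact: a0.
  near=> N.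
  apply: (@le_trans _ _ (\sum_(0 <= n < N) (2^-1 ^+ n)%:E)%E); last first.
    by rewrite sumEFin lee_fin; exact: geo2.
  apply: lee_sum => n _.
  rewrite /a -Int_EFin//; last by apply: intgZ => //; exact: l2_sqr.
  rewrite IntZ//; last exact: l2_sqr.
  rewrite lee_fin; apply: (@le_trans _ _ (2 ^+ n * 16^-1 ^+ n)).
    by rewrite ler_wpM2l// exprn_ge0.
  by rewrite -exprMn; apply: lerXn2r; rewrite ?nnegrE//; lra.
(* Cutting off to the set where [G] is finite gives convergence at every point and changes nothing
   almost everywhere. *)
pose E := D `&` [set x | G x < +oo]%E.
have mE : measurable E by apply: emeasurable_fun_infty_o.
pose e x : R := \1_E x.
have be : bmf D e.
  split; first exact: measurable_indic.
  by exists 1 => x _; rewrite /e indicE; case: (_ \in _); rewrite ?normr1 ?normr0.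
have ae_e : {ae mu, forall x, D x -> e x = 1}.
  have : mu.-integrable D G.
    apply/integrableP; split => //.
    by under eq_integral do rewrite gee0_abs//.
  move=> /(integrable_ae mD); apply: filterS => x + Dx => /(_ Dx).
  rewrite ge0_fin_numE// => Gx; rewrite /e indicE mem_set//.
have k_cvg x : cvgn (fun n => e x * k n x).
  rewrite /e indicE; case: (boolP (x \in E)) => [/set_mem [Dx /= Gx]|_]; last first.
    under eq_fun do rewrite mul0r; exact: is_cvg_cst.
  under eq_fun do rewrite mul1r.
  have -> : (fun n => k n x) = (fun n => k 0%N x + series (fun n => k n.+1 x - k n x) n).
    by apply/funext => n; rewrite /series/= telescope_sumr// addrC subrK.
  apply: is_cvgD; first exact: is_cvg_cst.
  apply: normed_cvg.
  apply: (@sumpow (2 + fine (G x)) (fun n => `|k n.+1 x - k n x|)) => //.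
    by rewrite addr_ge0// fine_ge0.
  (* Young's inequality [b <= 2^-i + 2^i b^2] splits each increment into a geometric part and a part
     that [G] sums. *)
  move=> n; apply: (@le_trans _ _ (\sum_(0 <= i < n) (2^-1 ^+ i +
      2 ^+ i * (k i.+1 x - k i x) ^+ 2))).
    apply: ler_sum => i _ /=.
    rewrite -(real_normK (num_real (k i.+1 x - k i x))).
    rewrite exprVn; set b := `|_|; have b0 : 0 <= b by exact: normr_ge0.
    have : 0 < (2 : R) ^+ i by rewrite exprn_gt0.
    set p := 2 ^+ i => p0.
    have pV : p * p^-1 = 1 by rewrite divff// gt_eqF.
    have pV0 : 0 < p^-1 by rewrite invr_gt0.
    have h1 : 0 <= p * (b - p^-1 / 2) ^+ 2 by rewrite mulr_ge0 ?sqr_ge0 // ltW.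
    have : p * (b - p^-1 / 2) ^+ 2 = p * b ^+ 2 - (p * p^-1) * b + (p * p^-1) * p^-1 / 4.
      by move: p^-1 => q; field.
    rewrite pV; lra.
  rewrite big_split/= lerD ?geo2//.
  rewrite -lee_fin fineK; last by rewrite ge0_fin_numE.
  rewrite -sumEFin.
  exact: (@nneseries_lim_ge _ (fun n => a n x) predT 0%N).
pose f x := limn (fun n => e x * k n x).
have lek n : l2 (fun x => e x * k n x) by exact: l2_bmf.
have ek m n : (n <= m)%N -> Int (fun x => (e x * k m x - e x * h n x) ^+ 2) <= 4^-1 ^+ n.
  move=> nm; apply: le_trans (hC n m.*2 _); last first.
    by rewrite -addnn (leq_trans nm)// leq_addr.
  rewrite le_eqVlt; apply/orP; left; apply/eqP.
  apply: ae_Int => //.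
  - by move: ae_e; apply: filterS => x ex Dx; rewrite ex// !mul1r.
  - by apply: l2_sqr => //; apply: l2B => //; exact: l2_bmf.
  - by apply: l2_sqr => //; exact: l2B.
have fat n : l2 (fun x => f x - e x * h n x) /\
    Int (fun x => (f x - e x * h n x) ^+ 2) <= 4^-1 ^+ n.
  apply: (fatou_sqr (h := fun m x => e x * k m x - e x * h n x)).
  - by move=> m; apply: l2B => //; exact: l2_bmf.
  - by move=> x Dx; apply: cvgB; [exact: k_cvg|exact: cvg_cst].
  - by exists n => m nm; exact: ek.
have lf : l2 f.
  have := l2D mD (fat 0%N).1 (l2_bmf mD be (lh 0%N)).
  by congr l2; apply/funext => x; rewrite subrK.
exists f => // n; apply: le_trans (fat n).2.
rewrite le_eqVlt; apply/orP; left; apply/eqP.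
apply: ae_Int => //.
- by move: ae_e; apply: filterS => x ex Dx; rewrite ex// !mul1r.
- by apply: l2_sqr => //; exact: l2B.
- by apply: l2_sqr => //; exact: (fat n).1.
Unshelve. all: by end_near. Qed.

Lemma Int_sqrD f g : l2 f -> l2 g ->
  Int (fun x => (f x + g x) ^+ 2) <=
  2 * Int (fun x => f x ^+ 2) + 2 * Int (fun x => g x ^+ 2).
Proof.
move=> lf lg; have i1 := l2_sqr lf; have i2 := l2_sqr lg.
rewrite -(IntZ mD _ i1) -(IntZ mD _ i2) -(IntD mD (intgZ mD _ i1) (intgZ mD _ i2)).
apply: le_Int => //.
- by apply: l2_sqr => //; exact: l2D.
- by apply: intgD => //; exact: intgZ.
- by move=> x _; have := sqr_ge0 (f x - g x); nra.
Qed.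

Lemma l2_complete (f_ : nat -> T -> R) :
  (forall n, l2 (f_ n)) ->
  (forall e : R, 0 < e -> exists n0, forall n m, (n0 <= n)%N -> (n0 <= m)%N ->
     Int (fun x => (f_ n x - f_ m x) ^+ 2) <= e) ->
  exists2 f, l2 f & forall e : R, 0 < e -> exists n0, forall n, (n0 <= n)%N ->
     Int (fun x => (f x - f_ n x) ^+ 2) <= e.
Proof.
move=> lf fC.
have [N NP] : {N : nat -> nat & forall k n m, (N k <= n)%N -> (N k <= m)%N ->
    Int (fun x => (f_ n x - f_ m x) ^+ 2) <= 4^-1 ^+ k}.
  apply: (@choice _ _ (fun k N => forall n m, (N <= n)%N -> (N <= m)%N ->
    Int (fun x => (f_ n x - f_ m x) ^+ 2) <= 4^-1 ^+ k)) => k.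
  by apply: fC; rewrite exprn_gt0// invr_gt0.
(* Partial sums, because they dominate [N k] and increase with [k]. *)
pose s k := (\sum_(0 <= j < k.+1) N j)%N.
have sN k : (N k <= s k)%N by rewrite /s big_nat_recr//= leq_addl.
have s_mono k m : (k <= m)%N -> (s k <= s m)%N.
  move=> km; rewrite /s (@big_cat_nat _ _ _ k.+1 0 m.+1)//=; exact: leq_addr.
have [f lf' fP] := @l2_complete_fast (fun k => f_ (s k)) (fun k => lf _)
  (fun n m nm => NP _ _ _ (leq_trans (sN n) (s_mono _ _ nm)) (sN n)).
exists f => // e e0.
have [K KP] : exists K, 4 * 4^-1 ^+ K <= e.
  have : (fun n => 4 * (4^-1 : R) ^+ n) @ \oo --> 4 * (0 : R).
    by apply: cvgMr; apply: cvg_expr; rewrite ger0_norm; lra.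
  rewrite mulr0 => /cvgrPdist_le /(_ _ e0) [K _ /(_ K (leqnn _))] /=.
  rewrite sub0r normrN ger0_norm; last by rewrite mulr_ge0// exprn_ge0// invr_ge0.
  by exists K.
exists (s K) => n Kn.
have -> : (fun x => (f x - f_ n x) ^+ 2) =
    (fun x => ((f x - f_ (s K) x) + (f_ (s K) x - f_ n x)) ^+ 2).
  by apply/funext => x; congr (_ ^+ 2); ring.
apply: le_trans (Int_sqrD _ _) _; [exact: l2B|exact: l2B|].
have := fP K; have := NP K (s K) n (sN K) (leq_trans (sN K) Kn).
by move: KP; lra.
Qed.

End l2_complete.

(** * The L^2 seminorm and convergence in it *)

Section l2_norm.
Context {d : measure_display} {T : measurableType d} {R : realType}.
Variables (mu : {measure set T -> \bar R}) (D : set T).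
Hypothesis mD : measurable D.
Implicit Types f g h w v : T -> R.
Implicit Types F G : nat -> T -> R.

Local Notation l2 := (l2 mu D).
Local Notation Int := (Int mu D).
Local Notation bmf := (bmf D).

Definition n2 f : R := Num.sqrt (Int (fun x => f x ^+ 2)).

Lemma Int_sqr_ge0 f : 0 <= Int (fun x => f x ^+ 2).
Proof. by apply: Int_ge0 => x _; exact: sqr_ge0. Qed.

Lemma n2_ge0 f : 0 <= n2 f. Proof. exact: sqrtr_ge0. Qed.

Lemma sqr_n2 f : n2 f ^+ 2 = Int (fun x => f x ^+ 2).
Proof. by rewrite sqr_sqrtr// Int_sqr_ge0. Qed.

Lemma n2_CS f g : l2 f -> l2 g -> `|Int (fun x => f x * g x)| <= n2 f * n2 g.
Proof.
move=> lf lg; rewrite -(@ler_pXn2r _ 2)// ?nnegrE ?mulr_ge0 ?n2_ge0//.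
by rewrite real_normK ?num_real// exprMn !sqr_n2; exact: Int_CS.
Qed.

Lemma n2D f g : l2 f -> l2 g -> n2 (fun x => f x + g x) <= n2 f + n2 g.
Proof.
move=> lf lg; rewrite -(@ler_pXn2r _ 2)// ?nnegrE ?addr_ge0 ?n2_ge0//.
rewrite sqr_n2.
have -> : Int (fun x => (f x + g x) ^+ 2) =
    n2 f ^+ 2 + 2 * Int (fun x => f x * g x) + n2 g ^+ 2.
  have i1 := l2_sqr lf; have i2 := intgZ mD 2 (l2_mul mD lf lg).
  rewrite !sqr_n2 -IntZ//; last exact: l2_mul.
  rewrite -(IntD mD i1 i2) -(IntD mD (intgD mD i1 i2) (l2_sqr lg)).
  by apply: eq_Int => x _; ring.
have := n2_CS lf lg; have := ler_norm (Int (fun x => f x * g x)).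
by nra.
Qed.

Lemma n2Z c f : l2 f -> n2 (fun x => c * f x) = `|c| * n2 f.
Proof.
move=> lf; rewrite /n2 -sqrtr_sqr -sqrtrM ?sqr_ge0//; congr Num.sqrt.
rewrite -IntZ//; last exact: l2_sqr.
by apply: eq_Int => x _; rewrite exprMn.
Qed.

Lemma eq_n2 f g : (forall x, D x -> f x = g x) -> n2 f = n2 g.
Proof. by move=> fg; congr Num.sqrt; apply: eq_Int => x Dx; rewrite fg. Qed.

Lemma n2N f : n2 (fun x => - f x) = n2 f.
Proof. by congr Num.sqrt; apply: eq_Int => x _; rewrite sqrrN. Qed.

Lemma n2_le_bmf C w f : (forall x, D x -> `|w x| <= C) -> measurable_fun D w ->
  0 <= C -> l2 f -> n2 (fun x => w x * f x) <= C * n2 f.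
Proof.
move=> wC mw C0 lf; rewrite -(ger0_norm C0) -n2Z//.
have lwf : l2 (fun x => w x * f x) by apply: l2_bmf => //; split => //; exists C.
rewrite ler_sqrt; last exact: Int_sqr_ge0.
apply: le_Int => //; [exact: l2_sqr|by apply: l2_sqr; exact: l2Z|].
move=> x Dx; rewrite !exprMn ler_wpM2r ?sqr_ge0//.
by rewrite -(real_normK (num_real (w x))) ler_sqr ?nnegrE// wC.
Qed.

Lemma n2_bmf3 C w f g : (forall x, D x -> `|w x| <= C) -> measurable_fun D w ->
  0 <= C -> l2 f -> l2 g -> `|Int (fun x => w x * (f x * g x))| <= C * (n2 f * n2 g).
Proof.
move=> wC mw C0 lf lg.
have lwf : l2 (fun x => w x * f x) by apply: l2_bmf => //; split => //; exists C.
have -> : Int (fun x => w x * (f x * g x)) = Int (fun x => (w x * f x) * g x).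
  by apply: eq_Int => x _; rewrite mulrA.
rewrite (le_trans (n2_CS lwf lg))// mulrA ler_wpM2r ?n2_ge0//.
exact: n2_le_bmf.
Qed.

Definition l2cv (F : nat -> T -> R) f : Prop :=
  [/\ forall n, l2 (F n), l2 f & (fun n => n2 (fun x => F n x - f x)) @ \oo --> 0].

Lemma l2cv_cst f : l2 f -> l2cv (fun=> f) f.
Proof.
move=> lf; split => //; rewrite (_ : (fun n : nat => _) = cst 0); first exact: cvg_cst.
apply/funext => n; rewrite /n2 (_ : Int _ = 0) ?sqrtr0//.
by rewrite -[RHS](Int0 mu mD); apply: eq_Int => x _; rewrite subrr expr0n.
Qed.

Lemma l2cvD F f G g (c : R) : l2cv F f -> l2cv G g ->
  l2cv (fun n x => F n x + c * G n x) (fun x => f x + c * g x).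
Proof.
move=> [lf_ lf cf] [lg_ lg cg]; split.
- by move=> n; apply: l2D => //; exact: l2Z.
- by apply: l2D => //; exact: l2Z.
apply: (@squeeze_cvgr _ _ _ _ (cst 0)
    (fun n => n2 (fun x => F n x - f x) + `|c| * n2 (fun x => G n x - g x))).
- near=> n; rewrite n2_ge0/= -n2Z; last exact: l2B.
  rewrite (@eq_n2 _ (fun x => (F n x - f x) + c * (G n x - g x))); last first.
    by move=> x _; ring.
  by apply: n2D; [exact: l2B|apply: l2Z => //; exact: l2B].
- exact: cvg_cst.
- rewrite -[X in _ --> X]addr0 -[X in _ --> _ + X](mulr0 `|c|).
  by apply: cvgD => //; exact: cvgMr.
Unshelve. all: by end_near. Qed.

Lemma l2cv_bmf w F f : bmf w -> l2cv F f ->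
  l2cv (fun n x => w x * F n x) (fun x => w x * f x).
Proof.
move=> bw [lf_ lf cf]; split; [by move=> n; exact: l2_bmf|exact: l2_bmf|].
have [mw [C wC]] := bw.
have wC' x : D x -> `|w x| <= `|C| by move=> Dx; rewrite (le_trans (wC _ Dx))// ler_norm.
apply: (@squeeze_cvgr _ _ _ _ (cst 0) (fun n => `|C| * n2 (fun x => F n x - f x))).
- near=> n; rewrite n2_ge0/=.
  rewrite (@eq_n2 _ (fun x => w x * (F n x - f x))); last by move=> x _; ring.
  by apply: n2_le_bmf => //; exact: l2B.
- exact: cvg_cst.
- by rewrite -[X in _ --> X](mulr0 `|C|); exact: cvgMr.
Unshelve. all: by end_near. Qed.

Lemma cvg_dist0 (u : nat -> R) (l : R) (b : nat -> R) :
  (forall n, `|u n - l| <= b n) -> b @ \oo --> 0 -> u @ \oo --> l.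
Proof.
move=> ub b0; apply/cvgrPdist_le => e e0.
have /cvgrPdist_le /(_ _ e0) := b0; apply: filterS => n.
rewrite sub0r normrN => bn; rewrite distrC (le_trans (ub n))// (le_trans _ bn)//.
exact: ler_norm.
Qed.

Lemma l2cv_mul F f G g : l2cv F f -> l2cv G g ->
  (fun n => Int (fun x => F n x * G n x)) @ \oo --> Int (fun x => f x * g x).
Proof.
move=> [lf_ lf cf] [lg_ lg cg].
pose a n := n2 (fun x => F n x - f x); pose b n := n2 (fun x => G n x - g x).
apply: (@cvg_dist0 _ _ (fun n => a n * b n + a n * n2 g + n2 f * b n)).
  move=> n; have lfn : l2 (fun x => F n x - f x) by exact: l2B.
  have lgn : l2 (fun x => G n x - g x) by exact: l2B.
  have i1 := l2_mul mD lfn lgn; have i2 := l2_mul mD lfn lg.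
  have i3 := l2_mul mD lf lgn.
  rewrite -IntB//; [|exact: l2_mul|exact: l2_mul].
  have -> : Int (fun x => F n x * G n x - f x * g x) =
      Int (fun x => (F n x - f x) * (G n x - g x)) +
      Int (fun x => (F n x - f x) * g x) + Int (fun x => f x * (G n x - g x)).
    rewrite -(IntD mD i1 i2) -(IntD mD (intgD mD i1 i2) i3).
    by apply: eq_Int => x _; ring.
  rewrite (le_trans (ler_normD _ _))// lerD ?n2_CS//.
  by rewrite (le_trans (ler_normD _ _))// lerD ?n2_CS.
rewrite -[X in _ --> X](_ : 0 * 0 + 0 * n2 g + n2 f * 0 = 0); last by rewrite !mul0r mulr0 !addr0.
apply: cvgD; last exact: cvgMr.
by apply: cvgD; [exact: cvgM|exact: cvgMl].
Qed.

Lemma l2cv_mul3 w F f G g : bmf w -> l2cv F f -> l2cv G g ->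
  (fun n => Int (fun x => w x * (F n x * G n x))) @ \oo -->
  Int (fun x => w x * (f x * g x)).
Proof.
move=> bw cf cg; have := l2cv_mul (l2cv_bmf bw cf) cg.
rewrite (@eq_Int _ _ _ _ _ (fun x => w x * (f x * g x)) (fun x => w x * f x * g x)).
  by rewrite (_ : (fun n => Int (fun x => w x * (F n x * G n x))) =
    (fun n => Int (fun x => w x * F n x * G n x)))//;
    apply/funext => n; apply: eq_Int => x _; rewrite mulrA.
by move=> x _; rewrite mulrA.
Qed.

Lemma l2cv_complete (F : nat -> T -> R) (b : nat -> R) :
  (forall n, l2 (F n)) -> b @ \oo --> 0 ->
  (forall n m, n2 (fun x => F n x - F m x) <= b n + b m) ->
  exists f, l2cv F f.
Proof.
move=> lf b0 fC.
have [e e0|f lf' fP] := l2_complete mD lf.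
  have se0 : 0 < Num.sqrt e / 2 by rewrite divr_gt0// sqrtr_gt0.
  have /cvgrPdist_le /(_ _ se0) [n0 _ n0P] := b0.
  exists n0 => n m nn nm; rewrite -sqr_n2 -[leRHS]sqr_sqrtr; last exact: ltW.
  rewrite ler_sqr ?nnegrE ?n2_ge0 ?sqrtr_ge0//.
  have := n0P _ nn; have := n0P _ nm; rewrite /= !sub0r !normrN => h1 h2.
  apply: le_trans (fC n m) _.
  have := ler_norm (b n); have := ler_norm (b m); lra.
exists f; split => //; apply/cvgrPdist_le => e e0.
have [n0 n0P] := fP (e ^+ 2) (exprn_gt0 2 e0).
exists n0 => // n /= nn; rewrite sub0r normrN ger0_norm ?n2_ge0//.
rewrite -(@ler_pXn2r _ 2)// ?nnegrE ?n2_ge0//; last exact: ltW.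
rewrite sqr_n2; apply: le_trans (n0P n nn).
rewrite le_eqVlt; apply/orP; left; apply/eqP; apply: eq_Int => x _; ring.
Qed.

End l2_norm.

(** * Test functions and radial weights *)

Section rV_measure.
Context {R : realType}.

(** The sigma-algebra is generated by the coordinates, so an open set must be exhausted by countably
    many boxes; those with rational centres and radii [1 / (k + 1)] suffice. *)
Lemma open_measurable_rV n (U : set 'rV[R]_n) : open U -> measurable U.
Proof.
move=> oU.
pose box (p : 'rV[rat]_n * nat) : set 'rV[R]_n :=
  [set x | forall i, ball (ratr (p.1 0 i) : R) (p.2.+1%:R^-1) (x 0 i)].
have mbox p : measurable (box p).
  rewrite (_ : box p = \big[setI/setT]_(i < n)
      ((fun x : 'rV[R]_n => x 0 i) @^-1` ball (ratr (p.1 0 i) : R) (p.2.+1%:R^-1))).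
    apply: bigsetI_measurable => i _; rewrite -[X in measurable X]setTI.
    by apply: measurable_coord => //; exact: measurable_ball.
  by rewrite -bigcap_seq; apply/seteqP; split=> x /= H i => [_|];
    [exact: H|apply: H; rewrite /= mem_index_enum].
have -> : U = \bigcup_p (if `[< box p `<=` U >] then box p else set0).
  apply/seteqP; split=> [x Ux|x [p _]]; last by case: asboolP => // pU /pU.
  have /nbhs_ballP [e /= e0 eU] : nbhs x U by exact: open_nbhs_nbhs.
  have [k ke] : exists k : nat, k.+1%:R^-1 < e / 2.
    exists (Num.truncn (e / 2)^-1).
    rewrite invf_plt ?posrE// ?divr_gt0//.
    by have := truncnS_gt (e / 2)^-1.
  have k0 : 0 < k.+1%:R^-1 :> R by rewrite invr_gt0.
  have /choice [q qx] : forall i : 'I_n, exists q : rat,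
      ratr q \in `](x 0 i - k.+1%:R^-1), (x 0 i + k.+1%:R^-1)[.
    by move=> i; apply: rat_in_itvoo; rewrite ltrD2l (lt_trans _ k0)// oppr_lt0.
  exists (\row_i q i, k) => //; case: asboolP => /= [pU i|].
    rewrite mxE; have := qx i; rewrite in_itv/= => /andP[? ?].
    by rewrite /ball/= ltr_distl; apply/andP.
  case=> y yb; apply: eU; split=> // i j; rewrite ord1.
  apply: (@le_ball _ _ _ (k.+1%:R^-1 + k.+1%:R^-1)).
    by rewrite [leRHS]splitr lerD// ltW.
  apply: ball_triangle (yb j); rewrite /= mxE; apply: ball_sym.
  by have := qx j; rewrite in_itv/= /ball/= ltr_distl.
apply: countable_bigcupT_measurable => // p; case: asboolP => _.
  exact: mbox.
exact: measurable0.
Qed.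

Lemma continuous_measurable_rV n (f : 'rV[R]_n -> R) :
  continuous f -> measurable_fun setT f.
Proof.
move=> cf; apply: (measurability _ (RGenOpens.measurableE R)).
move=> _ [_ [a [b ->] <-]]; rewrite setTI; apply: open_measurable_rV.
by apply: open_comp => //; exact: interval_open.
Qed.

Lemma continuous_on_measurable_rV n (D : set 'rV[R]_n) (f : 'rV[R]_n -> R) :
  open D -> (forall x, D x -> {for x, continuous f}) -> measurable_fun D f.
Proof.
move=> oD cf.
apply: (measurability _ (RGenOpens.measurableE R)).
move=> _ [_ [a [b ->] <-]]; apply: open_measurable_rV.
rewrite openE => x [Dx fx]; apply: filterI; first exact: open_nbhs_nbhs.
by apply: (cf _ Dx); apply: open_nbhs_nbhs; split => //; exact: interval_open.
Qed.

Definition cube n (M : R) : set 'rV[R]_n := [set x | forall i, `|x 0 i| <= M].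

Lemma measurable_cube n M : measurable (@cube n M).
Proof.
rewrite (_ : @cube n M = \big[setI/setT]_(i < n)
      ((fun x : 'rV[R]_n => x 0 i) @^-1` `[- M, M])).
  apply: bigsetI_measurable => i _; rewrite -[X in measurable X]setTI.
  exact: measurable_coord.
by rewrite -bigcap_seq; apply/seteqP; split=> x /= H i => [_|];
  have := H i; rewrite /= ?in_itv/= ler_norml//; apply; rewrite /= mem_index_enum.
Qed.

Lemma cube_lty n M : (lebesgue_rV n (@cube n M) < +oo)%E.
Proof.
rewrite (_ : @cube n M = [set x | forall i, `[- M, M]%classic (x 0 i)]); last first.
  by apply/seteqP; split=> x /= H i; have := H i; rewrite in_itv/= ler_norml.
rewrite (lebesgue_rV_box (A := fun=> `[- M, M]%classic))//.
have mM : lebesgue_measure `[- M, M] \is a @fin_num R.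
  by rewrite lebesgue_measure_itv/=; case: ifPn.
rewrite ltey_eq; apply/orP; left.
by elim/big_ind : _ => // x y; exact: fin_numM.
Qed.

(** A constant of its own, on which the sigma-finite structure can be declared; Fubini's theorem
    asks for it. *)
Definition leb_rV n : set 'rV[R]_n -> \bar R := lebesgue_rV n.

HB.instance Definition _ n := Measure.on (@leb_rV n).

Lemma leb_rV_sigma_finite n : sigma_finite setT (@leb_rV n).
Proof.
exists (fun k => @cube n k%:R).
  apply/seteqP; split=> // x _.
  exists (Num.truncn (\sum_i `|x 0 i|)).+1 => // i.
  rewrite (le_trans _ (ltW (truncnS_gt _)))//.
  by rewrite (bigD1 i)//= lerDl sumr_ge0.
move=> k; split; first exact: measurable_cube.
exact: cube_lty.
Qed.

HB.instance Definition _ n := Measure_isSigmaFinite.Build _ _ _ (@leb_rV n)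
  (@leb_rV_sigma_finite n).

End rV_measure.

(** * Integrals of partial derivatives of compactly supported functions *)

Section bounded_support.
Context d (T : measurableType d) (R : realType) (mu : {measure set T -> \bar R}).

Lemma bounded_support_integrable (A : set T) (f : T -> R) (C : R) :
  measurable A -> (mu A < +oo)%E -> measurable_fun setT f ->
  (forall x, `|f x| <= C) -> (forall x, ~ A x -> f x = 0) ->
  mu.-integrable setT (EFin \o f).
Proof.
move=> mA Aoo mf fC f0.
rewrite (_ : EFin \o f = (EFin \o f) \_ A).
  apply/(integrable_mkcond _ mA); apply: measurable_bounded_integrable => //.
    exact: measurable_funTS.
  exists C; split; first exact: num_real.
  by move=> M CM x _ /=; rewrite (le_trans (fC x))// ltW.
apply/funext => x; rewrite patchE; case: ifPn => // /negP Ax /=.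
by rewrite f0// => Ax'; apply: Ax; exact/mem_set.
Qed.

Lemma integral_pushforwardT d' (Y : measurableType d') (phi : T -> Y)
    (mphi : measurable_fun setT phi) (f : Y -> \bar R) :
  measurable_fun setT f -> mu.-integrable setT (f \o phi) ->
  (\int[pushforward mu phi]_x f x = \int[mu]_x f (phi x))%E.
Proof.
move=> mf fi; have := integral_pushforward mphi mf (D := setT) (mu := mu).
by rewrite preimage_setT; apply.
Qed.

End bounded_support.

Section partial_vanish.
Context {R : realType}.

Definition cube_supp n (f : 'rV[R]_n -> R) (M : R) : Prop :=
  forall x, ~ cube M x -> f x = 0.

Lemma closed_cube n M : closed (@cube R n M).
Proof.
rewrite (_ : @cube R n M = \bigcap_(i in [set: 'I_n])
    ((fun x : 'rV[R]_n => x 0 i) @^-1` [set y | `|y| <= M])).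
  apply: closed_bigI => i _; apply: closed_comp.
    by move=> x _; exact: coord_continuous.
  rewrite (_ : [set y | _] = `[- M, M]%classic); first exact: interval_closed.
  by apply/seteqP; split=> y /=; rewrite in_itv/= ler_norml.
by apply/seteqP; split=> x /= H i => [_|]; exact: H.
Qed.

Lemma compact_cube n M : compact (@cube R n M).
Proof.
rewrite (_ : @cube R n M = [set v | forall i, `[- M, M]%classic (v ord0 i)]).
  apply: (@rV_compact _ _ (fun=> `[- M, M]%classic)) => _.
  exact: segment_compact.
by apply/seteqP; split=> x /= H i; have := H i; rewrite in_itv/= ler_norml.
Qed.

Lemma derive0_on_open n (U : set 'rV[R]_n) (f : 'rV[R]_n -> R) x v :
  open U -> U x -> (forall y, U y -> f y = 0) -> 'D_v f x = 0.
Proof.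
move=> oU Ux f0; rewrite (@near_eq_derive _ _ _ f (cst 0)); first exact: derive_cst.
by near=> y; apply: f0; near: y; exact: open_nbhs_nbhs.
Unshelve. all: by end_near. Qed.

Lemma cube_supp_partial n (f : 'rV[R]_n -> R) M i :
  cube_supp f M -> cube_supp (partial i f) M.
Proof.
move=> f0 x Mx; apply: (@derive0_on_open _ (~` cube M)) => //.
exact/closed_openC/closed_cube.
Qed.

Lemma continuous_cube_supp_bounded n (f : 'rV[R]_n -> R) M :
  continuous f -> cube_supp f M -> exists C, forall x, `|f x| <= C.
Proof.
move=> cf f0.
have : compact (f @` cube M).
  apply: continuous_compact; last exact: compact_cube.
  exact: continuous_subspaceT.
move=> /compact_bounded [C [_ CP]].
exists (`|C| + 1) => x.
have C1 : C < `|C| + 1 by rewrite ltr_pwDr// ler_norm.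
have [Mx|Mx] := pselect (cube M x); first by apply: CP C1 _ _; exists x.
by rewrite f0// normr0 addr_ge0.
Qed.

Lemma eq_cvg_dnbhs0 (g1 g2 : R -> R) : g1 =1 g2 ->
  cvg (g1 @ 0^') -> cvg (g2 @ 0^').
Proof. by move=> /funext ->. Qed.

Lemma cons_rVE0 n (a h : R) (y : 'rV[R]_n) :
  cons_rV (h *: (1 : R) + a, y) = h *: delta_mx 0 ord0 + cons_rV (a, y).
Proof.
apply/rowP => j; rewrite !mxE/=; case: unliftP => [k ->|->]/=.
  by rewrite mulr0 add0r.
by [].
Qed.

Lemma cons_rVE n (a h : R) (y : 'rV[R]_n) i :
  cons_rV (a, h *: delta_mx 0 i + y) = h *: delta_mx 0 (lift ord0 i) + cons_rV (a, y).
Proof.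
apply/rowP => j; rewrite !mxE/=; case: unliftP => [k ->|->]/=.
  by rewrite !mxE/= (inj_eq lift_inj).
by rewrite mulr0 add0r.
Qed.

Lemma continuous_cons_rV n (a : R) (y : 'rV[R]_n) :
  {for a, continuous (fun t => cons_rV (t, y))} /\
  {for y, continuous (fun z => cons_rV (a, z))}.
Proof.
split; move=> U /nbhs_ballP [e /= e0 eU]; apply/nbhs_ballP; exists e => //= z [].
  move=> az; apply: eU; split=> // i j; rewrite !mxE; case: unlift => [k|//].
  exact: ballxx.
move=> _ yz; apply: eU; split=> // i j; rewrite !mxE; case: unlift => [k|].
  exact: yz.
exact: ballxx.
Qed.

Lemma cube_prod1_lty n (M : R) :
  (product_measure1 lebesgue_measure (@leb_rV R n) (`[(- M)%R, M] `*` cube M) < +oo)%E.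
Proof.
rewrite product_measure1E//; last exact: measurable_cube.
rewrite lte_mul_pinfty//; last exact: cube_lty.
suff : lebesgue_measure `[- M, M] \is a @fin_num R by [].
by rewrite lebesgue_measure_itv/=; case: ifPn.
Qed.

Lemma cube_prod2_lty n (M : R) :
  (product_measure2 lebesgue_measure (@leb_rV R n) (`[(- M)%R, M] `*` cube M) < +oo)%E.
Proof.
rewrite product_measure2E//; last exact: measurable_cube.
rewrite lte_mul_pinfty//; last exact: cube_lty.
suff : lebesgue_measure `[- M, M] \is a @fin_num R by [].
by rewrite lebesgue_measure_itv/=; case: ifPn.
Qed.

(** Fubini, by induction on the dimension. If [i] is the first coordinate, the inner integral over
    that coordinate vanishes by the fundamental theorem of calculus; otherwise the first coordinate
    is frozen and the induction hypothesis applies to the remaining ones. *)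
Lemma integral_partial_eq0 n (i : 'I_n) (f : 'rV[R]_n -> R) (M : R) :
  0 < M -> (forall x, derivable f x (delta_mx 0 i)) -> continuous f ->
  continuous (partial i f) -> cube_supp f M ->
  (\int[lebesgue_rV n]_x (partial i f x)%:E = 0)%E.
Proof.
move=> M0; elim: n i f => [|n IH] i f df cf cpf f0; first by have := ltn_ord i.
set G := partial i f.
have G0 : cube_supp G M by exact: cube_supp_partial.
have [C GC] := continuous_cube_supp_bounded cpf G0.
have mG := continuous_measurable_rV cpf.
have mGc : measurable_fun setT (G \o @cons_rV R n).
  by apply: measurableT_comp => //; exact: measurable_cons_rV.
have iG : (product_measure1 lebesgue_measure (@leb_rV R n)).-integrable setT (EFin \o (G \o @cons_rV R n)).
  apply: (@bounded_support_integrable _ _ R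
      (product_measure1 lebesgue_measure (@leb_rV R n))
      (`[- M, M] `*` cube M) (G \o @cons_rV R n) C) => //.
  - by apply: measurableX => //; exact: measurable_cube.
  - exact: cube_prod1_lty.
  - by move=> x; exact: GC.
  - move=> [a y] /= nay; apply: G0 => cay; apply: nay; split=> /= [|j].
      by have := cay ord0; rewrite mxE unlift_none in_itv/= ler_norml.
    by have := cay (lift ord0 j); rewrite mxE liftK.
have -> : (\int[lebesgue_rV n.+1]_x (G x)%:E =
    \int[product_measure2 lebesgue_measure (@leb_rV R n)]_z (EFin \o (G \o @cons_rV R n)) z)%E.
  have iG2 : (product_measure2 lebesgue_measure (@leb_rV R n)).-integrable setT (EFin \o (G \o @cons_rV R n)).
    apply: (@bounded_support_integrable _ _ R
      (product_measure2 lebesgue_measure (@leb_rV R n))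
      (`[- M, M] `*` cube M) (G \o @cons_rV R n) C) => //.
    - by apply: measurableX => //; exact: measurable_cube.
    - exact: cube_prod2_lty.
    - by move=> x; exact: GC.
    - move=> [a y] /= nay; apply: G0 => cay; apply: nay; split=> /= [|j].
        by have := cay ord0; rewrite mxE unlift_none in_itv/= ler_norml.
      by have := cay (lift ord0 j); rewrite mxE liftK.
  have mG' : measurable_fun setT (EFin \o G) by exact/measurable_EFinP.
  exact: (@integral_pushforwardT _ _ R
    (product_measure2 lebesgue_measure (@leb_rV R n)) _ _ (@cons_rV R n)
    (measurable_cons_rV (n := n)) (EFin \o G) mG' iG2).
have [j ij|i0] := unliftP ord0 i.
  rewrite -integral12_prod_meas2//.
  rewrite -[RHS](integral0 (@lebesgue_measure R) setT); apply: eq_integral => a _.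
  rewrite /fubini_F /=.
  rewrite (eq_integral (fun y => (partial j (fun z => f (cons_rV (a, z))) y)%:E)); last first.
    move=> y _; congr EFin; rewrite /G /partial /derive /= ij.
    apply: (congr1 (fun g : R -> R => lim (g @ 0^'))); apply/funext => h /=.
    by rewrite /= cons_rVE.
  apply: IH.
  - move=> y; have := df (cons_rV (a, y)); rewrite /derivable ij.
    by apply: eq_cvg_dnbhs0 => h /=; rewrite cons_rVE.
  - move=> y; apply: continuous_comp; last exact: cf.
    exact: (continuous_cons_rV a y).2.
  - have -> : partial j (fun z => f (cons_rV (a, z))) = (fun y => G (cons_rV (a, y))).
      apply/funext => y; rewrite /G /partial /derive /= ij.
      apply: (congr1 (fun g : R -> R => lim (g @ 0^'))); apply/funext => h /=; by rewrite cons_rVE.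
    move=> y; apply: continuous_comp; last exact: cpf.
    exact: (continuous_cons_rV a y).2.
  - move=> y ny; apply: f0 => cay; apply: ny => k.
    by have := cay (lift ord0 k); rewrite mxE liftK.
rewrite -integral21_prod_meas2//.
rewrite -[RHS](integral0 (@leb_rV R n) setT); apply: eq_integral => y _.
rewrite /fubini_G /=.
pose phi t := f (cons_rV (t, y)).
have dphi t : derivable phi t 1.
  have := df (cons_rV (t, y)); rewrite /derivable i0.
  by apply: eq_cvg_dnbhs0 => h /=; rewrite -cons_rVE0.
have phiE t : derive1 phi t = G (cons_rV (t, y)).
  rewrite derive1E /G /partial /derive /= i0.
  apply: (congr1 (fun g : R -> R => lim (g @ 0^'))); apply/funext => h /=; by rewrite -cons_rVE0.
have cphi : continuous phi.
  move=> t; apply: continuous_comp; last exact: cf.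
  exact: (continuous_cons_rV t y).1.
have phi0 t : M < `|t| -> phi t = 0.
  move=> Mt; apply: f0 => cty.
  by have := cty ord0; rewrite mxE unlift_none /= leNgt Mt.
have G0t t : M < `|t| -> G (cons_rV (t, y)) = 0.
  move=> Mt; apply: G0 => cty.
  by have := cty ord0; rewrite mxE unlift_none /= leNgt Mt.
(* The bound is [M + 1] rather than [M], because the function is known to vanish only at distances
   greater than [M]. *)
have -> : (\int[lebesgue_measure]_x (G (cons_rV (x, y)))%:E =
    \int[lebesgue_measure]_(x in `[(- (M + 1))%R, (M + 1)%R]) (G (cons_rV (x, y)))%:E)%E.
  rewrite [RHS]integral_mkcond; apply: eq_integral => t _.
  rewrite patchE; case: ifPn => // /negP nt; rewrite G0t// ltNge; apply/negP => tM.
  apply: nt; apply/mem_set; rewrite /= in_itv/= -ler_norml (le_trans tM)//.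
  by rewrite lerDl.
rewrite (@continuous_FTC2 _ _ phi).
- have h1 : M < `|M + 1| by rewrite ger0_norm; lra.
  have h2 : M < `|- (M + 1)| by rewrite normrN.
  by rewrite (phi0 _ h1) (phi0 _ h2) subee.
- by lra.
- apply: continuous_subspaceT => t; apply: continuous_comp; last exact: cpf.
  exact: (continuous_cons_rV t y).1.
- split; first by move=> t _; exact: dphi.
    by apply: cvg_at_right_filter; exact: cphi.
  by apply: cvg_at_left_filter; exact: cphi.
- by move=> t _; exact: phiE.
Qed.

End partial_vanish.

(** * Directional derivatives and smoothness of radial weights *)

Section smooth_weights.
Context {R : realType} {N : nat}.
Local Notation E := 'rV[R]_N.
Implicit Types (f g : E -> R) (x : E) (O : set E).

(** Restriction to a line makes a directional derivative a derivative in one variable, so the chain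
    rule follows without total differentiability. *)
Lemma is_derive_line f x (v : E) (df : R) :
  is_derive (0 : R) (1 : R) (fun h => f (h *: v + x)) df <-> is_derive x v f df.
Proof.
have e : (fun h : R => h^-1 *: (((fun h => f (h *: v + x)) \o shift (0 : R)) (h *: (1 : R)) -
    f ((0 : R) *: v + x))) = (fun h : R => h^-1 *: ((f \o shift x) (h *: v) - f x)).
  by apply/funext => h /=; rewrite scale0r add0r addr0 [h *: 1]mulr1.
by split=> -[d1 d2]; apply: DeriveDef; move: d1 d2;
  rewrite /derivable /derive e.
Qed.

Lemma is_derive_chain (g : R -> R) f x (v : E) (df dg : R) :
  is_derive x v f df -> is_derive (f x) 1 g dg ->
  is_derive x v (g \o f) (dg * df).
Proof.
move=> /is_derive_line df' dg'; apply/is_derive_line.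
have fx : f x = (fun h : R => f (h *: v + x)) 0 by rewrite scale0r add0r.
rewrite fx in dg'.
exact: (@is_derive1_comp _ g (fun h => f (h *: v + x)) 0 dg df).
Qed.

Lemma is_derive_coord x (i j : 'I_N) :
  is_derive x (delta_mx 0 i) (fun y : E => y 0 j) (j == i)%:R.
Proof.
apply/is_derive_line.
rewrite (_ : (fun h : R => _) = (fun h : R => (j == i)%:R * h + x 0 j)); last first.
  by apply/funext => h; rewrite !mxE eqxx/= mulrC.
apply: is_derive_eq; by rewrite ?addr0 ?scaler0 ?add0r [LHS]mulr1.
Qed.

Lemma is_derive_sqr_enorm x (i : 'I_N) :
  is_derive x (delta_mx 0 i) (fun y : E => \sum_j y 0 j ^+ 2) (2 * x 0 i).
Proof.
rewrite (_ : (fun y : E => _) = \sum_(j < N) (fun y : E => y 0 j) ^+ 2); last first.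
  by apply/funext => y; rewrite fct_sumE; apply: eq_bigr => j _; rewrite !fctE.
have h (j : 'I_N) : is_derive x (delta_mx 0 i) ((fun y : E => y 0 j) ^+ 2)
    (2 * x 0 j * (j == i)%:R).
  have := is_derive_coord x i j => hj.
  by apply: is_derive_eq; rewrite expr1 -mulr_natl.
apply: is_derive_eq.
rewrite (bigD1 i)//= eqxx mulr1 big1 ?addr0// => j /negPf ->.
by rewrite mulr0.
Qed.

Lemma enorm_ge0 x : 0 <= enorm x.
Proof. exact: sqrtr_ge0. Qed.

Lemma sqr_enorm x : enorm x ^+ 2 = \sum_i x 0 i ^+ 2.
Proof. by rewrite sqr_sqrtr// sumr_ge0// => i _; exact: sqr_ge0. Qed.

Lemma enorm_eq0 x : enorm x = 0 -> x = 0.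
Proof.
move=> x0; have : \sum_i x 0 i ^+ 2 = 0 by rewrite -sqr_enorm x0 expr0n.
move=> /psumr_eq0P h; apply/rowP => i; rewrite mxE; apply/eqP.
by rewrite -sqrf_eq0; apply/eqP; apply: h => // j _; exact: sqr_ge0.
Qed.

Lemma enorm_gt0 x : x != 0 -> 0 < enorm x.
Proof.
by rewrite lt_def enorm_ge0 andbT; apply: contraNN => /eqP/enorm_eq0 ->.
Qed.

Lemma coord_le_enorm x i : `|x 0 i| <= enorm x.
Proof.
rewrite -(@ler_pXn2r _ 2)// ?nnegrE ?enorm_ge0// real_normK ?num_real// sqr_enorm.
by rewrite (bigD1 i)//= lerDl sumr_ge0// => j _; exact: sqr_ge0.
Qed.

Lemma near_eq_continuous f g x : (\forall y \near x, f y = g y) ->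
  {for x, continuous g} -> {for x, continuous f}.
Proof.
move=> fg cg; suff : f y @[y --> x] --> f x by [].
have gf : {near nbhs x, g =1 f} by move: fg; apply: filterS => y ->.
rewrite (nbhs_singleton fg); exact: cvg_trans (near_eq_cvg gf) cg.
Qed.

Lemma eq_continuous f g x : f =1 g -> {for x, continuous g} -> {for x, continuous f}.
Proof. by move=> /funext ->. Qed.

Lemma continuous_sum (I : Type) (r : seq I) (F : I -> E -> R) x :
  (forall i, {for x, continuous (F i)}) ->
  {for x, continuous (fun x => \sum_(i <- r) F i x)}.
Proof.
move=> cF; elim: r => [|i r IH].
  by apply: (@eq_continuous _ (cst 0)) => [y|]; [rewrite big_nil|exact: cst_continuous].
apply: (@eq_continuous _ (fun x => F i x + \sum_(j <- r) F j x)) => [y|].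
  by rewrite big_cons.
by apply: (@continuousD _ _ _ (F i)).
Qed.

Lemma enorm_continuous : continuous (@enorm R N).
Proof.
move=> x; apply: continuous_comp; last exact: sqrt_continuous.
apply: continuous_sum => i.
apply: (@eq_continuous _ (fun y => y 0 i * y 0 i)) => [y|]; first by rewrite expr2.
by apply: continuousM; exact: coord_continuous.
Qed.

Lemma is_derive_enorm x (i : 'I_N) : x != 0 ->
  is_derive x (delta_mx 0 i) (@enorm R N) (x 0 i / enorm x).
Proof.
move=> x0; have xp : 0 < \sum_j x 0 j ^+ 2 by rewrite -sqr_enorm exprn_gt0// enorm_gt0.
have := is_derive_chain (is_derive_sqr_enorm x i) (is_derive1_sqrt xp).
rewrite (_ : _ * _ = x 0 i / enorm x)// -/(enorm x) invfM.
have := enorm_gt0 x0 => e0; field; rewrite gt_eqF//.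
Qed.

(* The powers of [tau + lam |x|] cover both the powers of [Psi] and
   those of [|x|]. *)
Definition pw (tau lam c : R) x : R := (tau + lam * enorm x) `^ c.

Lemma pw_base_gt0 (tau lam : R) x : 0 <= tau -> 0 < lam -> x != 0 ->
  0 < tau + lam * enorm x.
Proof. by move=> ? ? ?; rewrite ltr_wpDl// mulr_gt0// enorm_gt0. Qed.

Lemma is_derive_pw (tau lam c : R) x (i : 'I_N) : 0 <= tau -> 0 < lam -> x != 0 ->
  is_derive x (delta_mx 0 i) (pw tau lam c)
    (c * lam * pw tau lam (c - 1) x * (x 0 i / enorm x)).
Proof.
move=> tau0 lam0 x0; have de := is_derive_enorm i x0.
have dp : is_derive x (delta_mx 0 i) (fun y => tau + lam * enorm y) (lam * (x 0 i / enorm x)).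
  have := is_deriveD (is_derive_cst tau x (delta_mx 0 i)) (is_deriveZ lam de).
  by rewrite add0r.
have := is_derive_chain dp (is_derive1_powR c (pw_base_gt0 tau0 lam0 x0)).
rewrite (_ : _ * (lam * _) = c * lam * pw tau lam (c - 1) x * (x 0 i / enorm x))//.
by rewrite /pw; ring.
Qed.

Lemma pw_continuous (tau lam c : R) x : 0 <= tau -> 0 < lam -> x != 0 ->
  {for x, continuous (pw tau lam c)}.
Proof.
move=> tau0 lam0 x0.
apply: (@continuous_comp _ _ _ (fun y => tau + lam * enorm y) (fun z => z `^ c)).
  apply: (@continuousD _ _ _ (cst tau)); first exact: cst_continuous.
  by apply: (@continuousM _ _ (cst lam)); [exact: cst_continuous|exact: enorm_continuous].
apply: differentiable_continuous; apply/derivable1_diffP.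
by apply: derivable_powR; rewrite in_itv/= andbT pw_base_gt0.
Qed.

(** A syntactic class that is closed under partial derivatives away from the origin: one
    differentiation step then yields smoothness of every order by induction on the list of
    directions. *)
Inductive smooth_alg O : (E -> R) -> Prop :=
| alg_smooth f : smooth_on O f -> smooth_alg O f
| alg_cst c : smooth_alg O (fun=> c)
| alg_coord i : smooth_alg O (fun x => x 0 i)
| alg_pw tau lam c : 0 <= tau -> 0 < lam -> smooth_alg O (pw tau lam c)
| alg_add f g : smooth_alg O f -> smooth_alg O g -> smooth_alg O (fun x => f x + g x)
| alg_mul f g : smooth_alg O f -> smooth_alg O g -> smooth_alg O (fun x => f x * g x).

Lemma smooth_on_partial O f i : smooth_on O f -> smooth_on O (partial i f).
Proof.
move=> sf x Ox s; have := sf x Ox (rcons s i).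
by rewrite /partials foldr_rcons.
Qed.

Lemma is_derive_partial f x i : derivable f x (delta_mx 0 i) ->
  is_derive x (delta_mx 0 i) f (partial i f x).
Proof. by move=> df; apply: DeriveDef. Qed.

Lemma smooth_alg_step O f i : ~ O 0 -> smooth_alg O f ->
  (forall x, O x -> {for x, continuous f}) /\
  exists2 g, smooth_alg O g & forall x, O x -> is_derive x (delta_mx 0 i) f (g x).
Proof.
move=> O0; have On0 x : O x -> x != 0 by move=> Ox; apply: contra_notN O0 => /eqP <-.
elim=> {f} [f sf|c|j|tau lam c tau0 lam0|f g af [cf [f' af' df]] ag [cg [g' ag' dg]]
  |f g af [cf [f' af' df]] ag [cg [g' ag' dg]]].
- split=> [x Ox|]; first by have := (sf x Ox [::]).1.
  exists (partial i f); first exact/alg_smooth/smooth_on_partial.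
  by move=> x Ox; apply: is_derive_partial; have [_] := sf x Ox [::]; apply.
- split=> [x _|]; first exact: cst_continuous.
  by exists (fun=> 0); [exact: alg_cst|move=> x _; exact: is_derive_cst].
- split=> [x _|]; first exact: coord_continuous.
  exists (fun=> (j == i)%:R); first exact: alg_cst.
  by move=> x _; exact: is_derive_coord.
- split=> [x Ox|]; first by apply: pw_continuous => //; exact: On0.
  (* The factor [x_i / |x|] is written with [|x|^-1], itself a power of the family ([tau = 0],
     [lam = 1]), so that the derivative stays in the class. *)
  exists (fun x => (c * lam) * (pw tau lam (c - 1) x * (x 0 i * pw 0 1 (-1) x))).
    apply: alg_mul; first exact: alg_cst.
    apply: alg_mul; first exact: alg_pw.
    by apply: alg_mul; [exact: alg_coord|exact: alg_pw].
  move=> x Ox; have := is_derive_pw c i tau0 lam0 (On0 _ Ox).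
  by rewrite /(pw 0) add0r mul1r powR_inv1 ?enorm_ge0// -!mulrA.
- split=> [x Ox|]; first by apply: continuousD; [exact: cf|exact: cg].
  exists (fun x => f' x + g' x); first exact: alg_add.
  by move=> x Ox; apply: is_deriveD; [exact: df|exact: dg].
- split=> [x Ox|]; first by apply: continuousM; [exact: cf|exact: cg].
  exists (fun x => f x * g' x + g x * f' x).
    by apply: alg_add; exact: alg_mul.
  move=> x Ox; have := df x Ox; have := dg x Ox => dg1 df1.
  by have := is_deriveM df1 dg1.
Qed.

Lemma eq_near_derive O f g x v df : open O -> O x -> (forall y, O y -> f y = g y) ->
  is_derive x v g df -> is_derive x v f df.
Proof.
move=> oO Ox fg; apply: near_eq_is_derive.
by near=> y; apply/esym/fg; near: y; exact: open_nbhs_nbhs.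
Unshelve. all: by end_near. Qed.

Lemma smooth_alg_step1 O f : ~ O 0 -> smooth_alg O f ->
  (forall x, O x -> {for x, continuous f}) /\ True.
Proof.
move=> O0 af; split=> // x Ox.
have On0 y : O y -> y != 0 by move=> Oy; apply: contra_notN O0 => /eqP <-.
elim: af => {f} [f sf|c|j|tau lam c tau0 lam0|f g _ cf _ cg|f g _ cf _ cg].
- by have := (sf x Ox [::]).1.
- exact: cst_continuous.
- exact: coord_continuous.
- by apply: pw_continuous => //; exact: On0.
- exact: continuousD.
- exact: continuousM.
Qed.

Lemma smooth_alg_smooth O f : open O -> ~ O 0 -> smooth_alg O f -> smooth_on O f.
Proof.
move=> oO O0 af.
have key s : exists2 g, smooth_alg O g & forall x, O x -> partials s f x = g x.
  elim: s => [|i s [g ag fg]]; first by exists f.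
  have [_ [g' ag' dg]] := smooth_alg_step i O0 ag.
  exists g' => // x Ox /=.
  have := eq_near_derive oO Ox fg (dg x Ox) => -[_ <-].
  by [].
move=> x Ox s; have [g ag fg] := key s; split.
  have [cg _] := smooth_alg_step1 O0 ag.
  have : \forall y \near x, partials s f y = g y.
    by near=> y; apply: fg; near: y; exact: open_nbhs_nbhs.
  by move=> near_fg; apply: near_eq_continuous near_fg (cg _ Ox).
move=> i; have [_ [g' _ dg]] := smooth_alg_step i O0 ag.
by have [] := eq_near_derive oO Ox fg (dg x Ox).
Unshelve. all: by end_near. Qed.

(** The factor [g] may be singular at the origin, but the test function vanishes near it: the set
    [K] is closed and contained in [D], which misses the origin. *)
Lemma test_fun_alg (D : set E) g (psi : E -> R) : ~ D 0 ->
  smooth_alg [set x | x != 0] g -> test_fun D psi ->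
  test_fun D (fun x => g x * psi x).
Proof.
move=> D0 ag [spsi [K cK [KD psi0]]]; split; last first.
  by exists K => //; split=> // x nK; rewrite psi0// mulr0.
have clK : closed K by apply: compact_closed => //; exact: norm_hausdorff.
have oO : open [set x : E | x != 0].
  rewrite (_ : mkset _ = ~` [set 0]); last by apply/seteqP; split=> x /eqP.
  apply: closed_openC; apply: (@compact_closed _ _); first exact: norm_hausdorff.
  exact: compact_set1.
have sO : smooth_on [set x : E | x != 0] (fun x => g x * psi x).
  apply: smooth_alg_smooth => //; first by rewrite /= eqxx.
  apply: alg_mul => //; apply: alg_smooth => x _; exact: spsi.
move=> x _; have [->|x0] := eqVneq x 0; last exact: sO.
have nK0 : ~ K 0 by move=> /KD.
have oK : open (~` K) by exact: closed_openC.
have zero s : forall y, ~ K y -> partials s (fun x => g x * psi x) y = 0.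
  elim: s => [|i s IH] y nKy; first by rewrite /= psi0// mulr0.
  exact: (@derive0_on_open _ _ (~` K)).
move=> s; split.
  apply: (@near_eq_continuous _ (cst 0)); last exact: cst_continuous.
  by near=> y; apply: zero; near: y; exact: open_nbhs_nbhs.
move=> i; apply: (@near_eq_derivable _ _ _ (cst 0)); last exact: derivable_cst.
by near=> y; apply/esym/zero; near: y; exact: open_nbhs_nbhs.
Unshelve. all: by end_near. Qed.

Lemma test_fun_partial (D : set E) psi i : test_fun D psi -> test_fun D (partial i psi).
Proof.
move=> [spsi [K cK [KD psi0]]]; split; first exact: smooth_on_partial.
exists K => //; split => // x nK.
have clK : closed K by apply: compact_closed => //; exact: norm_hausdorff.
by apply: (@derive0_on_open _ _ (~` K)) => //; exact: closed_openC.
Qed.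

Lemma test_fun_continuous (D : set E) psi : test_fun D psi -> continuous psi.
Proof. by move=> [spsi _] x; have [] := spsi x I [::]. Qed.

Lemma test_fun_derivable (D : set E) psi x i : test_fun D psi ->
  derivable psi x (delta_mx 0 i).
Proof. by move=> [spsi _]; have [_] := spsi x I [::]; apply. Qed.

Lemma compact_cube_sub (K : set E) : compact K -> exists2 M : R, 0 < M & K `<=` cube M.
Proof.
move=> /compact_bounded [C [_ CP]]; exists (`|C| + 1); first by rewrite ltr_wpDl.
move=> x Kx i; have C1 : C < `|C| + 1 by rewrite ltr_pwDr// ler_norm.
apply: le_trans (CP _ C1 _ Kx); rewrite [leRHS]mx_normrE.
by apply: (le_bigmax _ (fun ij : 'I_1 * 'I_N => `|x ij.1 ij.2|) (0, i)).
Qed.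

Lemma integral_test_partial (D : set E) psi i : measurable D -> test_fun D psi ->
  \int[lebesgue_rV N]_(x in D) partial i psi x = 0.
Proof.
move=> mD tpsi; have [_ [K cK [KD psi0]]] := tpsi.
have [_ [K' cK' [KD' psi0']]] := test_fun_partial i tpsi.
rewrite Rintegral_mkcond /Rintegral.
rewrite (eq_integral (fun x => (partial i psi x)%:E)); last first.
  move=> x _; rewrite patchE; case: ifPn => // /negP xD; rewrite psi0'//.
  by move=> /KD' Dx; apply: xD; exact/mem_set.
have [M M0 KM] := compact_cube_sub cK.
rewrite (integral_partial_eq0 M0)//.
- by move=> x; exact: test_fun_derivable tpsi.
- exact: test_fun_continuous tpsi.
- exact: test_fun_continuous (test_fun_partial i tpsi).
- by move=> x nM; apply: psi0 => /KM.
Qed.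

End smooth_weights.

(** * The space H^1_0 and the Dirichlet problem *)

Section H10_theory.
Context {R : realType} {N : nat}.
Local Notation E := 'rV[R]_N.
Local Notation leb := (@lebesgue_rV R N).
Variable D : set E.
Hypotheses (oD : open D) (bD : bounded_set D) (D0 : ~ closure D 0).
Implicit Types (u w phi psi : E -> R) (g k : E -> E).

Local Notation Int := (Int leb D).
Local Notation l2 := (l2 leb D).
Local Notation n2 := (n2 leb D).
Local Notation l2cv := (l2cv leb D).
Local Notation bmf := (bmf D).

Let mD : measurable D := open_measurable_rV oD.
Local Hint Resolve mD : core.

(** These radii make every weight bounded on [D]. They depend on [D], hence serve only integrability
    and the boundedness of forms, never the constants of the final estimate. *)
Lemma domain_bounds : exists r0 R0 : R, [/\ 0 < r0, 0 < R0 &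
  forall x, D x -> r0 <= enorm x /\ enorm x <= R0].
Proof.
have [e e0 eD] : exists2 e : R, 0 < e & forall x, D x -> ~ ball (0 : E) e x.
  apply: contrapT => H; apply: D0 => B /nbhs_ballP [e /= e0 eB].
  apply: contrapT => nB; apply: H; exists e => // x Dx xe.
  by apply: nB; exists x; split=> //; exact: eB.
have [M [_ MP]] := bD.
have M1 : M < `|M| + 1 by rewrite ltr_pwDr// ler_norm.
exists e, (Num.sqrt (N%:R * (`|M| + 1) ^+ 2) + 1); split=> //.
move=> x Dx; split.
  rewrite leNgt; apply/negP => xe; apply: (eD _ Dx); split=> // i j.
  rewrite ord1 mxE /ball/= sub0r normrN; apply: le_lt_trans xe.
  exact: coord_le_enorm.
apply: (@le_trans _ _ (Num.sqrt (N%:R * (`|M| + 1) ^+ 2))); last by rewrite lerDl.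
rewrite ler_sqrt; last by rewrite mulr_ge0// sqr_ge0.
rewrite -[N in leRHS]card_ord -sum1_card natr_sum mulr_suml.
apply: ler_sum => i _; rewrite mul1r -(real_normK (num_real (x 0 i))).
rewrite ler_sqr ?nnegrE ?addr_ge0//.
apply: le_trans (MP _ M1 _ Dx); rewrite [leRHS]mx_normrE.
by apply: (le_bigmax _ (fun ij : 'I_1 * 'I_N => `|x ij.1 ij.2|) (0, i)).
Qed.

Lemma domain_n0 x : D x -> x != 0.
Proof. by move=> Dx; apply: contra_notN D0 => /eqP <-; exact: subset_closure. Qed.

Lemma D_0 : ~ D 0.
Proof. by move=> /domain_n0; rewrite eqxx. Qed.

Lemma domain_lty : (leb D < +oo)%E.
Proof.
have [M [_ MP]] := bD.
have M1 : M < `|M| + 1 by rewrite ltr_pwDr// ler_norm.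
apply: le_lt_trans (cube_lty N (`|M| + 1)); apply: le_measure; rewrite ?inE//.
  exact: measurable_cube.
move=> x Dx i; apply: le_trans (MP _ M1 _ Dx); rewrite [leRHS]mx_normrE.
by apply: (le_bigmax _ (fun ij : 'I_1 * 'I_N => `|x ij.1 ij.2|) (0, i)).
Qed.

Lemma bmf_l2 w : bmf w -> l2 w.
Proof.
move=> bw; have : l2 (fun x => w x * 1).
  apply: l2_bmf => //; split=> //; rewrite expr1n integral_cst// mul1e.
  exact: domain_lty.
by under eq_fun do rewrite mulr1.
Qed.

Lemma test_bmf phi : test_fun D phi -> bmf phi.
Proof.
move=> tphi; split.
  by apply: measurable_funTS; apply: continuous_measurable_rV; exact: test_fun_continuous tphi.
have [_ [K cK [_ phi0]]] := tphi.
have [M M0 KM] := compact_cube_sub cK.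
have [C CP] := continuous_cube_supp_bounded (test_fun_continuous tphi)
  (fun x nM => phi0 x (fun Kx => nM (KM _ Kx))).
by exists C => x _; exact: CP.
Qed.

Lemma test_l2 phi : test_fun D phi -> l2 phi.
Proof. by move=> /test_bmf; exact: bmf_l2. Qed.

Lemma partialsD phi psi (c : R) s : test_fun D phi -> test_fun D psi ->
  partials s (fun x => phi x + c * psi x) =
  (fun x => partials s phi x + c * partials s psi x).
Proof.
move=> [sphi _] [spsi _]; elim: s => // i s IH; rewrite /= IH; apply/funext => x.
have [_ /(_ i) d1] := sphi x I s; have [_ /(_ i) d2] := spsi x I s.
have := is_deriveD (is_derive_partial d1) (is_deriveZ c (is_derive_partial d2)).
by move=> [_ /= <-].
Qed.

Lemma testD phi psi (c : R) : test_fun D phi -> test_fun D psi ->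
  test_fun D (fun x => phi x + c * psi x).
Proof.
move=> tphi tpsi; have [sphi [K cK [KD phi0]]] := tphi.
have [spsi [L cL [LD psi0]]] := tpsi; split.
  move=> x _ s; rewrite partialsD//; split.
    apply: continuousD; first by have [] := sphi x I s.
    apply: (@continuousM _ _ (cst c)); first exact: cst_continuous.
    by have [] := spsi x I s.
  move=> i; have [_ /(_ i) d1] := sphi x I s; have [_ /(_ i) d2] := spsi x I s.
  by have [] := is_deriveD (is_derive_partial d1) (is_deriveZ c (is_derive_partial d2)).
exists (K `|` L); first exact: compactU.
split=> [x [/KD|/LD]//|x nKL].
by rewrite phi0 ?psi0 ?mulr0 ?addr0//; move=> ?; apply: nKL; [right|left].
Qed.

Lemma partialD phi psi (c : R) i : test_fun D phi -> test_fun D psi ->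
  partial i (fun x => phi x + c * psi x) =
  (fun x => partial i phi x + c * partial i psi x).
Proof. by move=> ? ?; exact: (partialsD c [:: i]). Qed.

Lemma test0 : test_fun D (fun=> 0).
Proof.
split.
  move=> x _ s; have -> : partials s (fun=> 0) = (fun=> 0) :> (E -> R).
    by elim: s => // i s /= ->; apply/funext => y; exact: derive_cst.
  by split=> [|i]; [exact: cst_continuous|exact: derivable_cst].
by exists set0; [exact: compact0|split=> // x []].
Qed.

Lemma test_alg (a : E -> R) psi : smooth_alg [set x | x != 0] a ->
  test_fun D psi -> test_fun D (fun x => a x * psi x).
Proof. exact: test_fun_alg D_0. Qed.

Lemma test_in_alg psi : test_fun D psi -> smooth_alg [set x | x != 0] psi.
Proof. by move=> [sp _]; apply: alg_smooth => x _; exact: sp. Qed.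

Lemma Int_partial psi i : test_fun D psi -> Int (partial i psi) = 0.
Proof. exact: integral_test_partial. Qed.

Lemma Int_test_byparts phi psi i : test_fun D phi -> test_fun D psi ->
  Int (fun x => phi x * partial i psi x) = - Int (fun x => partial i phi x * psi x).
Proof.
move=> tphi tpsi; apply/eqP; rewrite -addr_eq0; apply/eqP.
have l1 := test_l2 tphi; have l2' := test_l2 tpsi.
have l3 := test_l2 (test_fun_partial i tphi).
have l4 := test_l2 (test_fun_partial i tpsi).
rewrite -IntD//; [|exact: l2_mul|exact: l2_mul].
rewrite -[RHS](Int_partial i (test_alg (test_in_alg tphi) tpsi)).
apply: eq_Int => x _.
have d1 := is_derive_partial (@test_fun_derivable _ _ _ _ x i tphi).
have d2 := is_derive_partial (@test_fun_derivable _ _ _ _ x i tpsi).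
have [_ e] := is_deriveM d1 d2.
by apply: etrans (esym e); rewrite [partial i phi x * _]mulrC.
Qed.

Lemma sqr_enormB g phi x : enorm (g x - gradient phi x) ^+ 2 =
  \sum_i (g x 0 i - partial i phi x) ^+ 2.
Proof. by rewrite sqr_enorm; apply: eq_bigr => i _; rewrite !mxE. Qed.

Lemma sqr_total u g phi : l2 u -> (forall i, l2 (fun x => g x 0 i)) -> test_fun D phi ->
  (\int[leb]_(x in D) ((u x - phi x) ^+ 2 + enorm (g x - gradient phi x) ^+ 2)%:E)%E =
  (n2 (fun x => u x - phi x) ^+ 2 +
   \sum_i n2 (fun x => g x 0 i - partial i phi x) ^+ 2)%:E.
Proof.
move=> lu lg tphi.
have i1 : intg leb D (fun x => (u x - phi x) ^+ 2).
  by apply: l2_sqr; apply: l2B => //; exact: test_l2.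
have i2 i : intg leb D (fun x => (g x 0 i - partial i phi x) ^+ 2).
  by apply: l2_sqr; apply: l2B => //; apply: test_l2; exact: test_fun_partial.
rewrite sqr_n2; under [in RHS]eq_bigr do rewrite sqr_n2.
rewrite -Int_sum// -IntD//; last exact: intg_sum.
rewrite Int_EFin//; last by apply: intgD => //; exact: intg_sum.
by apply: eq_integral => x _; rewrite sqr_enormB.
Qed.

Lemma cvg_sumr (I : Type) (r : seq I) (f : I -> nat -> R) (l : I -> R) :
  (forall i, f i @ \oo --> l i) ->
  (fun n => \sum_(i <- r) f i n) @ \oo --> \sum_(i <- r) l i.
Proof.
move=> fl; elim: r => [|i r IH].
  by rewrite big_nil; under eq_fun do rewrite big_nil; exact: cvg_cst.
by rewrite big_cons; under eq_fun do rewrite big_cons; exact: cvgD.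
Qed.

(** One sequence of test functions approximates [u] and all components of its gradient. Identities
    on H^1_0 are proved for test functions and passed to the limit along such a sequence. *)
Lemma H10_gradientP u g : H10_gradient D u g <->
  exists F : nat -> E -> R, [/\ forall n, test_fun D (F n), l2cv F u &
    forall i, l2cv (fun n => partial i (F n)) (fun x => g x 0 i)].
Proof.
split=> [[lu [lg wg] H]|[F [tF cF cdF]]].
  have /choice [F FP] : forall n : nat, exists phi, test_fun D phi /\
      n2 (fun x => u x - phi x) ^+ 2 +
      \sum_i n2 (fun x => g x 0 i - partial i phi x) ^+ 2 < n.+1%:R^-1 ^+ 2.
    move=> n; have [|phi tphi] := H (n.+1%:R^-1 ^+ 2).
      by rewrite exprn_gt0// invr_gt0.
    by rewrite sqr_total// lte_fin => ?; exists phi.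
  have b0 : (fun n => n.+1%:R^-1 : R) @ \oo --> 0 by exact: cvg_harmonic.
  have small (x : R) n : 0 <= x -> x ^+ 2 < n.+1%:R^-1 ^+ 2 -> x <= n.+1%:R^-1.
    move=> x0 h; rewrite -(@ler_pXn2r _ 2)// ?nnegrE ?invr_ge0//; exact: ltW.
  exists F; split; first by move=> n; have [] := FP n.
    split=> //; first by move=> n; apply: test_l2; have [] := FP n.
    apply: (@squeeze_cvgr _ _ _ _ (cst 0) (fun n => n.+1%:R^-1)) => //; last exact: cvg_cst.
    near=> n; rewrite n2_ge0/=; apply: small; first exact: n2_ge0.
    have [_] := FP n; apply: le_lt_trans.
    rewrite (_ : n2 _ = n2 (fun x => u x - F n x)); last first.
      by rewrite -n2N; apply: eq_n2 => x _; ring.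
    by rewrite lerDl sumr_ge0// => i _; exact: sqr_ge0.
  move=> i; split=> //.
    by move=> n; apply: test_l2; apply: test_fun_partial; have [] := FP n.
    exact: lg.
  apply: (@squeeze_cvgr _ _ _ _ (cst 0) (fun n => n.+1%:R^-1)) => //; last exact: cvg_cst.
  near=> n; rewrite n2_ge0/=; apply: small; first exact: n2_ge0.
  have [_] := FP n; apply: le_lt_trans.
  rewrite (_ : n2 _ = n2 (fun x => g x 0 i - partial i (F n) x)); last first.
    by rewrite -n2N; apply: eq_n2 => x _; ring.
  rewrite (bigD1 i)//= addrCA lerDl addr_ge0 ?sqr_ge0// sumr_ge0// => j _.
  exact: sqr_ge0.
have [_ lu cu] := cF.
have lg i : l2 (fun x => g x 0 i) by have [] := cdF i.
split=> //.
  split=> // phi tphi i.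
  have c1 := l2cv_mul mD cF (l2cv_cst mD (test_l2 (test_fun_partial i tphi))).
  have c2 := l2cv_mul mD (cdF i) (l2cv_cst mD (test_l2 tphi)).
  apply: cvg_unique c1 _ => //=.
  rewrite (_ : (fun n : nat => _) = (fun n => - Int (fun x => partial i (F n) x * phi x))).
    exact: cvgN.
  by apply/funext => n; exact: Int_test_byparts.
move=> e e0.
have : (fun n => n2 (fun x => F n x - u x) ^+ 2 +
    \sum_i n2 (fun x => partial i (F n) x - g x 0 i) ^+ 2) @ \oo --> (0 : R).
  rewrite -[X in _ --> X](_ : 0 * 0 + \sum_(i < N) (0 * 0) = 0); last first.
    by rewrite mul0r add0r big1.
  apply: cvgD; first by under eq_fun do rewrite expr2; exact: cvgM.
  apply: cvg_sumr => i; have [_ _ ci] := cdF i.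
  by under eq_fun do rewrite expr2; exact: cvgM.
move=> /cvgrPdist_lt /(_ _ e0) [n _ /(_ n (leqnn n))] /=; rewrite sub0r normrN => ne.
exists (F n); first exact: tF.
rewrite sqr_total// lte_fin; apply: le_lt_trans ne; apply: le_trans (ler_norm _).
rewrite le_eqVlt; apply/orP; left; apply/eqP; congr (_ ^+ 2 + _).
  by rewrite -n2N; apply: eq_n2 => x _; ring.
apply: eq_bigr => i _; congr (_ ^+ 2).
by rewrite -n2N; apply: eq_n2 => x _; ring.
Unshelve. all: by end_near. Qed.

Lemma H10_l2 u g : H10_gradient D u g -> l2 u.
Proof. by case. Qed.

Lemma H10_grad_l2 u g i : H10_gradient D u g -> l2 (fun x => g x 0 i).
Proof. by move=> [_ [lg _] _]; exact: lg. Qed.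

Lemma nablaP u : H10 D u -> H10_gradient D u (nabla D u).
Proof. exact: xgetPex. Qed.

Lemma test_H10 phi : test_fun D phi -> H10_gradient D phi (gradient phi).
Proof.
move=> tphi; apply/H10_gradientP; exists (fun=> phi); split=> //.
  by apply: l2cv_cst => //; exact: test_l2.
move=> i; rewrite (_ : (fun x => _) = partial i phi).
  by apply: l2cv_cst => //; apply: test_l2; exact: test_fun_partial.
by apply/funext => x; rewrite mxE.
Qed.

Lemma H10_gradientD u g w k (c : R) : H10_gradient D u g -> H10_gradient D w k ->
  H10_gradient D (fun x => u x + c * w x) (fun x => g x + c *: k x).
Proof.
move=> /H10_gradientP [F [tF cF dF]] /H10_gradientP [G [tG cG dG]].
apply/H10_gradientP; exists (fun n x => F n x + c * G n x); split.
- by move=> n; exact: testD.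
- exact: l2cvD.
- move=> i; have := l2cvD mD c (dF i) (dG i).
  rewrite (_ : (fun n x => _) = (fun n => partial i (fun x => F n x + c * G n x))).
    by congr l2cv; apply/funext => x; rewrite !mxE.
  by apply/funext => n; rewrite partialD.
Qed.

(** The difference [G] of two gradients is a weak gradient of 0, hence orthogonal to every test
    function. Testing with the partial derivatives of the approximants, which converge to [G], gives
    [Int G^2 = 0]. *)
Lemma H10_gradient_uniq u g k i : H10_gradient D u g -> H10_gradient D u k ->
  n2 (fun x => g x 0 i - k x 0 i) = 0.
Proof.
move=> ug uk; have := H10_gradientD (-1) ug uk => H.
have [_ [lG wG] _] := H.
have /H10_gradientP [F [tF cF dF]] := H.
have e n : Int (fun x => (g x + -1 *: k x) 0 i * partial i (F n) x) = 0.
  apply: oppr_inj; rewrite oppr0.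
  rewrite -(wG _ (test_fun_partial i (tF n)) i) -[RHS](Int0 leb mD).
  by apply: eq_Int => x _; rewrite mulN1r subrr mul0r.
have c := l2cv_mul mD (l2cv_cst mD (lG i)) (dF i).
rewrite (_ : (fun n : nat => _) = cst 0) in c; last exact/funext.
have := cvg_unique _ c (cvg_cst _) => /= h.
rewrite /n2 (_ : Int _ = 0) ?sqrtr0//.
rewrite -h//; apply: eq_Int => x _; rewrite !mxE expr2; ring.
Qed.

Lemma H10D u w (c : R) : H10 D u -> H10 D w -> H10 D (fun x => u x + c * w x).
Proof.
by move=> [g ug] [k wk]; exists (fun x => g x + c *: k x); exact: H10_gradientD.
Qed.

(** [nabla] picks a gradient for each function separately, so it is additive only up to an L^2-null
    function. *)
Lemma nablaD u w (c : R) i : H10 D u -> H10 D w ->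
  n2 (fun x => nabla D (fun x => u x + c * w x) x 0 i -
    (nabla D u x 0 i + c * nabla D w x 0 i)) = 0.
Proof.
move=> hu hw; have hs := nablaP (H10D c hu hw).
have := H10_gradient_uniq i hs (H10_gradientD c (nablaP hu) (nablaP hw)).
by move=> <-; apply: eq_n2 => x _; rewrite !mxE.
Qed.

Lemma l2cv_n2_0 F (f h : E -> R) : l2cv F f -> l2 h -> n2 (fun x => f x - h x) = 0 -> l2cv F h.
Proof.
move=> [lF lf cF] lh fh; split=> //.
apply: (@squeeze_cvgr _ _ _ _ (cst 0) (fun n => n2 (fun x => F n x - f x))) => //.
  near=> n; rewrite n2_ge0/=.
  rewrite (_ : n2 _ = n2 (fun x => (F n x - f x) + (f x - h x))); last first.
    by apply: eq_n2 => x _; ring.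
  by rewrite -[leRHS]addr0 -[X in _ + X]fh; apply: n2D => //; exact: l2B.
exact: cvg_cst.
Unshelve. all: by end_near. Qed.

(** Diagonal argument: test functions [G n] at distance at most [1 / (n + 1)] from [F n], gradients
    included, share the limit, which therefore lies in the closure of the test functions. *)
Lemma H10_complete (F : nat -> E -> R) (b : nat -> R) :
  (forall n, H10 D (F n)) -> b @ \oo --> 0 ->
  (forall n m, n2 (fun x => F n x - F m x) <= b n + b m) ->
  (forall i n m, n2 (fun x => nabla D (F n) x 0 i - nabla D (F m) x 0 i) <= b n + b m) ->
  exists u, [/\ H10 D u, l2cv F u &
    forall i, l2cv (fun n x => nabla D (F n) x 0 i) (fun x => nabla D u x 0 i)].
Proof.
move=> hF b0 C1 C2.
have [u cu] := l2cv_complete mD (fun n => H10_l2 (nablaP (hF n))) b0 C1.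
have [g cg] : {g : 'I_N -> E -> R & forall i, l2cv (fun n x => nabla D (F n) x 0 i) (g i)}.
  apply: (@choice _ _ (fun i f => l2cv (fun n x => nabla D (F n) x 0 i) f)) => i.
  exact: (l2cv_complete mD (fun n => H10_grad_l2 i (nablaP (hF n))) b0 (C2 i)).
have /choice [G GP] : forall n : nat, exists phi, [/\ test_fun D phi,
    n2 (fun x => phi x - F n x) <= n.+1%:R^-1 &
    forall i, n2 (fun x => partial i phi x - nabla D (F n) x 0 i) <= n.+1%:R^-1].
  move=> n; have /H10_gradientP [G [tG [_ _ cG] dG]] := nablaP (hF n).
  have e0 : 0 < n.+1%:R^-1 :> R by rewrite invr_gt0.
  have n1 : \forall k \near \oo, n2 (fun x => G k x - F n x) <= n.+1%:R^-1.
    have /cvgrPdist_le /(_ _ e0) := cG; apply: filterS => k.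
    by rewrite sub0r normrN ger0_norm ?n2_ge0.
  have n3 : \forall k \near \oo, forall i,
      n2 (fun x => partial i (G k) x - nabla D (F n) x 0 i) <= n.+1%:R^-1.
    apply: filter_forall => i; have [_ _ ci] := dG i.
    have /cvgrPdist_le /(_ _ e0) := ci; apply: filterS => k.
    by rewrite sub0r normrN ger0_norm ?n2_ge0.
  near \oo => k; exists (G k); split => //; first by near: k.
  by near: k.
have harm : (fun n => n.+1%:R^-1 : R) @ \oo --> 0 by exact: cvg_harmonic.
have tri (P Q : nat -> E -> R) f : (forall n, l2 (P n)) -> l2cv Q f ->
    (forall n, n2 (fun x => P n x - Q n x) <= n.+1%:R^-1) -> l2cv P f.
  move=> lP [lQ lf cQ] PQ; split=> //.
  apply: (@squeeze_cvgr _ _ _ _ (cst 0)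
      (fun n => n.+1%:R^-1 + n2 (fun x => Q n x - f x))) => //.
  - near=> n; rewrite n2_ge0/=.
    rewrite (_ : n2 _ = n2 (fun x => (P n x - Q n x) + (Q n x - f x))); last first.
      by apply: eq_n2 => x _; ring.
    by rewrite (le_trans (n2D mD (l2B mD (lP n) (lQ n)) (l2B mD (lQ n) lf)))// lerD.
  - exact: cvg_cst.
  - by rewrite -[X in _ --> X](addr0 0); exact: cvgD.
have ug : H10_gradient D u (fun x => \row_i g i x).
  apply/H10_gradientP; exists G; split.
  - by move=> n; have [] := GP n.
  - apply: tri cu _ => n; last by have [] := GP n.
    by apply: test_l2; have [] := GP n.
  - move=> i; rewrite (_ : (fun x => _) = g i); last by apply/funext => x; rewrite mxE.
    apply: tri (cg i) _ => n; last by have [] := GP n.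
    by apply: test_l2; apply: test_fun_partial; have [] := GP n.
have hu : H10 D u by exists (fun x => \row_i g i x).
exists u; split=> // i.
apply: l2cv_n2_0 (cg i) _ _; first exact: H10_grad_l2 (nablaP hu).
rewrite -[RHS](H10_gradient_uniq i ug (nablaP hu)).
by apply: eq_n2 => x _; rewrite mxE.
Unshelve. all: by end_near. Qed.

End H10_theory.

(** * Integration by parts with radial weights *)

Section radial_identities.
Context {R : realType} {N : nat}.
Local Notation E := 'rV[R]_N.
Local Notation leb := (@lebesgue_rV R N).
Variable D : set E.
Hypotheses (oD : open D) (bD : bounded_set D) (D0 : ~ closure D 0).
Implicit Types (u w phi psi a b : E -> R) (g k : E -> E) (x : E).

Local Notation Int := (Int leb D).
Local Notation intg := (intg leb D).
Local Notation l2 := (l2 leb D).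
Local Notation n2 := (n2 leb D).
Local Notation l2cv := (l2cv leb D).
Local Notation bmf := (bmf D).

Let mD : measurable D := open_measurable_rV oD.
Local Hint Resolve mD : core.

(** An integral identity is stored as its integrand, so that it can be added to another integrand
    ([Int_null]); an inequality between integrals then becomes a pointwise algebraic one. *)
Definition null (f : E -> R) : Prop := intg f /\ Int f = 0.

Lemma nullD f h : null f -> null h -> null (fun x => f x + h x).
Proof. by move=> [fi f0] [hi h0]; split; [exact: intgD|rewrite IntD// f0 h0 addr0]. Qed.

Lemma nullZ c f : null f -> null (fun x => c * f x).
Proof. by move=> [fi f0]; split; [exact: intgZ|rewrite IntZ// f0 mulr0]. Qed.

Lemma null_sum (I : Type) (r : seq I) (f : I -> E -> R) : (forall i, null (f i)) ->
  null (fun x => \sum_(i <- r) f i x).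
Proof.
move=> nf; split; first by apply: intg_sum => // i; have [] := nf i.
by rewrite Int_sum//; [rewrite big1// => i _; have [] := nf i|move=> i; have [] := nf i].
Qed.

Lemma eq_null f h : (forall x, D x -> f x = h x) -> null f -> null h.
Proof.
by move=> fh [fi f0]; split; [exact: intg_eq fi|rewrite -f0; apply: eq_Int => x /fh].
Qed.

Lemma Int_null f n : intg f -> null n -> Int f = Int (fun x => f x + n x).
Proof. by move=> fi [ni n0]; rewrite IntD// n0 addr0. Qed.

Lemma l2_sum (I : Type) (r : seq I) (f : I -> E -> R) : (forall i, l2 (f i)) ->
  l2 (fun x => \sum_(i <- r) f i x).
Proof.
move=> lf; elim: r => [|i r IH].
  by under eq_fun do rewrite big_nil; exact: l2_0.
by under eq_fun do rewrite big_cons; exact: l2D.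
Qed.

(** A power is monotone in its base, increasing or decreasing according to the sign of [c], so one
    of the two end values is a bound; their sum covers both signs. *)
Lemma powR_le_ends (y0 y1 y c : R) : 0 < y0 -> y0 <= y <= y1 ->
  y `^ c <= y0 `^ c + y1 `^ c.
Proof.
move=> y00 /andP[h0 h1]; have yp : 0 < y := lt_le_trans y00 h0.
have y1p : 0 < y1 := lt_le_trans yp h1.
have [c0|c0] := leP 0 c.
  rewrite (le_trans (ge0_ler_powR c0 _ _ h1)) ?nnegrE ?ltW//.
  by rewrite ltrDr powR_gt0.
have yz (z : R) : 0 < z -> z `^ c = (z `^ (- c))^-1.
  by move=> z0; rewrite powRN invrK.
rewrite (@le_trans _ _ (y0 `^ c))//; last by rewrite ltW// ltrDl powR_gt0.
rewrite !yz// lef_pV2 ?posrE ?powR_gt0//.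
by apply: ge0_ler_powR; rewrite ?nnegrE ?oppr_ge0 ?(ltW c0) ?(ltW yp) ?(ltW y00).
Qed.

Lemma bmf_continuous w C : (forall x, x != 0 -> {for x, continuous w}) ->
  (forall x, D x -> `|w x| <= C) -> bmf w.
Proof.
move=> cw wC; split; last by exists C.
by apply: continuous_on_measurable_rV => // x Dx; apply: cw; exact: (domain_n0 D0).
Qed.

Lemma bmf_pw (tau lam c : R) : 0 <= tau -> 0 < lam -> bmf (pw tau lam c).
Proof.
move=> tau0 lam0; have [r0 [R0 [r00 R00 rP]]] := domain_bounds bD D0.
apply: (@bmf_continuous _ ((tau + lam * r0) `^ c + (tau + lam * R0) `^ c)).
  by move=> x x0; exact: pw_continuous.
move=> x Dx; rewrite ger0_norm ?powR_ge0//; have [h0 h1] := rP _ Dx.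
apply: powR_le_ends; first by rewrite ltr_wpDl// mulr_gt0.
by rewrite !lerD2l !ler_pM2l// h0.
Qed.

Definition omega (i : 'I_N) x : R := x 0 i / enorm x.

Lemma omegaE (i : 'I_N) : omega i = (fun x : E => x 0 i * pw 0 1 (-1) x).
Proof. by apply/funext => x; rewrite /pw add0r mul1r powR_inv1// enorm_ge0. Qed.

Lemma bmf_omega (i : 'I_N) : bmf (omega i).
Proof.
apply: (@bmf_continuous _ 1).
  move=> x x0; rewrite omegaE; apply: continuousM; first exact: coord_continuous.
  exact: pw_continuous.
move=> x Dx; have := enorm_gt0 (domain_n0 D0 Dx) => e0.
by rewrite /omega normrM [X in _ * X]gtr0_norm ?invr_gt0// ler_pdivrMr// mul1r coord_le_enorm.
Qed.

Lemma sum_sqr_omega x : x != 0 -> \sum_i omega i x ^+ 2 = 1.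
Proof.
move=> x0; under eq_bigr do rewrite /omega expr_div_n.
by rewrite -mulr_suml -sqr_enorm divff// expf_neq0// gt_eqF// enorm_gt0.
Qed.

(* [a] is a radial function, regular away from the origin, and [a'] its
   radial derivative. *)
Definition radial_weight (a a' : E -> R) : Prop :=
  [/\ smooth_alg [set x | x != 0] a,
      forall x i, x != 0 -> is_derive x (delta_mx 0 i) a (a' x * omega i x),
      bmf a & bmf a'].

Lemma is_derive_val (f : E -> R) x (v : E) (d d' : R) : d = d' ->
  is_derive x v f d -> is_derive x v f d'.
Proof. by move=> ->. Qed.

Lemma rw_pw (tau lam c : R) : 0 <= tau -> 0 < lam ->
  radial_weight (pw tau lam c) (fun x => c * lam * pw tau lam (c - 1) x).
Proof.
move=> tau0 lam0; split; first exact: alg_pw.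
- by move=> x i x0; exact: is_derive_pw.
- exact: bmf_pw.
- by apply: bmfM => //; [exact: bmf_cst|exact: bmf_pw].
Qed.

Lemma rw_cst (c : R) : radial_weight (fun=> c) (fun=> 0).
Proof.
split; first exact: alg_cst.
- by move=> x i _; rewrite mul0r; exact: is_derive_cst.
- exact: bmf_cst.
- exact: bmf_cst.
Qed.

Lemma rwM a a' b b' : radial_weight a a' -> radial_weight b b' ->
  radial_weight (fun x => a x * b x) (fun x => a' x * b x + a x * b' x).
Proof.
move=> [sa da ba ba'] [sb db bb bb']; split.
- exact: alg_mul.
- move=> x i x0; have h1 := da x i x0; have h2 := db x i x0.
  apply: is_derive_val (is_deriveM h1 h2); rewrite /GRing.scale/=.
  ring.
- exact: bmfM.
- by apply: bmfD => //; exact: bmfM.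
Qed.

Lemma rwZ c a a' : radial_weight a a' -> radial_weight (fun x => c * a x) (fun x => c * a' x).
Proof.
by move=> wa; have := rwM (rw_cst c) wa; congr radial_weight; apply/funext => x; rewrite mul0r add0r.
Qed.

Definition drad g x : R := \sum_i g x 0 i * omega i x.
Definition dotg g k x : R := \sum_i g x 0 i * k x 0 i.

Lemma l2_drad u g : H10_gradient D u g -> l2 (drad g).
Proof.
move=> ug; apply: l2_sum => i; under eq_fun do rewrite mulrC.
by apply: l2_bmf => //; [exact: bmf_omega|exact: H10_grad_l2 ug].
Qed.

Lemma intg_dotg w u g v k : bmf w -> H10_gradient D u g -> H10_gradient D v k ->
  intg (fun x => w x * dotg g k x).
Proof.
move=> bw ug vk; apply: intg_bmf => //; apply: intg_sum => // i.
by apply: l2_mul => //; [exact: H10_grad_l2 ug|exact: H10_grad_l2 vk].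
Qed.

(** The tangential part [g - g_r x / |x|] has a nonnegative square. *)
Lemma drad_sqr_le g x : x != 0 -> drad g x ^+ 2 <= dotg g g x.
Proof.
move=> x0.
have : 0 <= \sum_i (g x 0 i - drad g x * omega i x) ^+ 2.
  by apply: sumr_ge0 => i _; exact: sqr_ge0.
rewrite (_ : \sum_i _ = \sum_i (g x 0 i * g x 0 i -
  2 * drad g x * (g x 0 i * omega i x) + drad g x ^+ 2 * omega i x ^+ 2)); last first.
  by apply: eq_bigr => i _; ring.
rewrite big_split/= sumrB -!mulr_sumr sum_sqr_omega// -/(drad g x) -/(dotg g g x).
by rewrite expr2; lra.
Qed.

Lemma cvg_eq0 (f : nat -> R) (l : R) : (forall n, f n = 0) -> f @ \oo --> l -> l = 0.
Proof.
move=> f0 fl; apply: (cvg_unique _ fl) => //.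
by rewrite (_ : f = cst 0); [exact: cvg_cst|apply/funext].
Qed.

(** The integrand is the partial derivative of [a u^2] in the direction [i]. If [u] is a test
    function, so is [a u^2], and its partial derivative has integral zero; the general case is a
    limit. *)
Lemma byparts a a' i u g : smooth_alg [set x | x != 0] a ->
  (forall x, x != 0 -> is_derive x (delta_mx 0 i) a (a' x)) -> bmf a -> bmf a' ->
  H10_gradient D u g ->
  null (fun x => a' x * (u x * u x) + 2 * (a x * (u x * g x 0 i))).
Proof.
move=> sa da ba ba' ug; have lu := H10_l2 ug; have lg := H10_grad_l2 i ug.
have i1 : intg (fun x => a' x * (u x * u x)) by exact: intg_bmf2.
have i2 : intg (fun x => a x * (u x * g x 0 i)) by exact: intg_bmf2.
have i2' := intgZ mD 2 i2.
split; first exact: intgD.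
rewrite (IntD mD i1 i2') (IntZ mD _ i2).
have [F [tF cF dF]] := (H10_gradientP oD bD D0 u g).1 ug.
have /= c1 := l2cv_mul3 mD ba' cF cF; have /= c2 := l2cv_mul3 mD ba cF (dF i).
have e0 n : Int (fun x => a' x * (F n x * F n x)) +
    2 * Int (fun x => a x * (F n x * partial i (F n) x)) = 0.
  have tn := tF n; have ln := test_l2 oD bD tn.
  have lp := test_l2 oD bD (test_fun_partial i tn).
  have j1 : intg (fun x => a' x * (F n x * F n x)) by exact: intg_bmf2.
  have j2 : intg (fun x => a x * (F n x * partial i (F n) x)) by exact: intg_bmf2.
  rewrite -(IntZ mD _ j2) -(IntD mD j1 (intgZ mD 2 j2)).
  rewrite -[RHS](Int_partial oD i (test_alg D0 sa (test_alg D0 (test_in_alg tn) tn))).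
  apply: eq_Int => x Dx.
  have d1 := is_derive_partial (@test_fun_derivable _ _ _ _ x i tn).
  have d2 := da x (domain_n0 D0 Dx).
  have [_ e] := is_deriveM d2 (is_deriveM d1 d1).
  apply: etrans (esym e); rewrite -[X in _ + X *: _]/(F n x * F n x) /GRing.scale/=; ring.
apply: cvg_eq0; last exact: (cvgD c1 (cvgM (cvg_cst (2:R)) c2)).
move=> n; rewrite !fctE/=.
exact: e0.
Qed.

(* The divergence theorem for the field [a u^2 x/|x|]. *)
Lemma radial_current a a' u g : radial_weight a a' -> H10_gradient D u g ->
  null (fun x => (a' x + (N%:R - 1) * (a x / enorm x)) * u x ^+ 2
    + 2 * a x * (u x * drad g x)).
Proof.
move=> [sa da ba ba'] ug.
have binv : bmf (pw 0 1 (-1)) by exact: bmf_pw.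
(* The partial derivative of [a x_i / |x|] in the direction [i]. In the sum over [i] the squares of
   [omega] add up to 1, which leaves [a' + (N - 1) a / |x|]. *)
pose a2 i x := a' x * omega i x ^+ 2 + a x * (pw 0 1 (-1) x * (1 - omega i x ^+ 2)).
have bo2 i : bmf (fun x => omega i x ^+ 2).
  by under eq_fun do rewrite expr2; apply: bmfM => //; exact: bmf_omega.
have nI i : null (fun x => a2 i x * (u x * u x) + 2 * (a x * omega i x * (u x * g x 0 i))).
  apply: byparts ug.
  - by rewrite omegaE; apply: alg_mul => //; apply: alg_mul; [exact: alg_coord|exact: alg_pw].
  - move=> x x0; have d1 := da x i x0; have d2 := is_derive_coord x i i.
    have d3 := is_derive_pw (-1) i (lexx (0 : R)) ltr01 x0.
    rewrite (_ : (fun x => a x * omega i x) = a * ((fun y : E => y 0 i) * pw 0 1 (-1))); last first.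
      by rewrite omegaE.
    apply: is_derive_val (is_deriveM d1 (is_deriveM d2 d3)).
    rewrite -[X in _ + X *: _]/(x 0 i * pw 0 1 (-1) x) eqxx /a2 omegaE /GRing.scale/=.
    have e0 := enorm_gt0 x0.
    rewrite (_ : pw 0 1 (-1 - 1) x = pw 0 1 (-1) x * pw 0 1 (-1) x); last first.
      by rewrite /pw -powRD//; apply/implyP => _; rewrite add0r mul1r gt_eqF.
    rewrite (_ : (enorm x)^-1 = pw 0 1 (-1) x); last first.
      by rewrite /pw add0r mul1r powR_inv1 ?ltW.
    ring.
  - by apply: bmfM => //; exact: bmf_omega.
  - apply: bmfD => //; first exact: bmfM.
    apply: bmfM => //; apply: bmfM => //; apply: bmfD => //; first exact: bmf_cst.
    have := bmfM (bmf_cst D (-1)) (bo2 i); congr bmf; apply/funext => x; rewrite mulN1r//.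
apply: eq_null (null_sum (index_enum _) nI) => x Dx.
have x0 := domain_n0 D0 Dx; have e0 := enorm_gt0 x0.
rewrite big_split/= -mulr_suml /a2 big_split/= -!mulr_sumr sumrB sum_sqr_omega//.
rewrite sumr_const card_ord /drad.
rewrite (_ : pw 0 1 (-1) x = (enorm x)^-1); last first.
  by rewrite /pw add0r mul1r powR_inv1 ?ltW.
rewrite (_ : \sum_i a x * omega i x * (u x * g x 0 i) =
  a x * u x * \sum_i g x 0 i * omega i x); last first.
  by rewrite mulr_sumr; apply: eq_bigr => i _; ring.
ring.
Qed.

(** Green's formula. The definition of the weak Laplacian puts both derivatives on a test function;
    the weak gradient of [u] takes one of them back, and density replaces the test function by
    [w]. *)
Lemma weak_laplacian_H10 u g h w k : H10_gradient D u g -> H10_gradient D w k ->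
  weak_laplacian D u h -> null (fun x => h x * w x + dotg g k x).
Proof.
move=> ug wk [lh wh].
have lw := H10_l2 wk.
have i1 : intg (fun x => h x * w x) by exact: l2_mul.
have lgk i : intg (fun x => g x 0 i * k x 0 i).
  by apply: l2_mul => //; [exact: H10_grad_l2 ug|exact: H10_grad_l2 wk].
have i2 : intg (dotg g k) by exact: intg_sum.
split; first exact: intgD.
rewrite IntD// /dotg Int_sum//.
have [F [tF cF dF]] := (H10_gradientP oD bD D0 w k).1 wk.
have c1 := l2cv_mul mD (l2cv_cst mD lh) cF.
have c2 i := l2cv_mul mD (l2cv_cst mD (H10_grad_l2 i ug)) (dF i).
apply: cvg_eq0; last exact: (cvgD c1 (@cvg_sumr _ _ (index_enum 'I_N) _ _ c2)).
move=> n; rewrite !fctE/=.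
rewrite [X in X + _](_ : _ = \int[leb]_(x in D) (h x * F n x))// -(wh _ (tF n)).
have [_ [_ wg] _] := ug; have lu := H10_l2 ug.
have tpp i : test_fun D (partial i (partial i (F n))) by do 2!apply: test_fun_partial.
rewrite (_ : \int[leb]_(x in D) _ = \sum_i Int (fun x => u x * partial i (partial i (F n)) x)).
  rewrite -big_split/= big1// => i _.
  by apply/eqP; rewrite addr_eq0; apply/eqP; exact: (wg _ (test_fun_partial i (tF n)) i).
rewrite -Int_sum//; last by move=> i; apply: l2_mul => //; exact: test_l2.
by apply: eq_Int => x _; rewrite mulr_sumr.
Qed.

(** The integrand is the divergence of [b w grad u]. It is Green's formula tested with [b F_n], a
    test function because [b] is smooth away from the origin, in the limit [F_n -> w]. *)
Lemma radial_laplacian b b' u g h w k : radial_weight b b' ->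
  H10_gradient D u g -> H10_gradient D w k -> weak_laplacian D u h ->
  null (fun x => b x * (h x * w x) + b x * dotg g k x + b' x * (drad g x * w x)).
Proof.
move=> [sb db bb bb'] ug wk lap; have [lh _] := lap.
have lw := H10_l2 wk; have lr := l2_drad ug.
have i1 : intg (fun x => b x * (h x * w x)) by exact: intg_bmf2.
have i2 : intg (fun x => b x * dotg g k x) by exact: intg_dotg ug wk.
have i3 : intg (fun x => b' x * (drad g x * w x)) by exact: intg_bmf2.
have i12 := intgD mD i1 i2; split; first exact: intgD.
rewrite (IntD mD i12 i3) (IntD mD i1 i2).
have [F [tF cF dF]] := (H10_gradientP oD bD D0 w k).1 wk.
have c1 := l2cv_mul3 mD bb (l2cv_cst mD lh) cF.
have c2 i := l2cv_mul3 mD bb (l2cv_cst mD (H10_grad_l2 i ug)) (dF i).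
have c3 := l2cv_mul3 mD bb' (l2cv_cst mD lr) cF.
have -> : Int (fun x => b x * dotg g k x) =
    \sum_i Int (fun x => b x * (g x 0 i * k x 0 i)).
  rewrite -Int_sum//; first by apply: eq_Int => x _; rewrite mulr_sumr.
  move=> i; apply: intg_bmf2 => //; [exact: H10_grad_l2 ug|exact: H10_grad_l2 wk].
apply: cvg_eq0; last exact: (cvgD (cvgD c1 (@cvg_sumr _ _ (index_enum 'I_N) _ _ c2)) c3).
move=> n; rewrite !fctE/=.
have tn := tF n; have ln := test_l2 oD bD tn.
have lp i := test_l2 oD bD (test_fun_partial i tn).
have j1 : intg (fun x => b x * (h x * F n x)) by exact: intg_bmf2.
have j2 i : intg (fun x => b x * (g x 0 i * partial i (F n) x)).
  by apply: intg_bmf2 => //; exact: H10_grad_l2 ug.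
have j3 : intg (fun x => b' x * (drad g x * F n x)) by exact: intg_bmf2.
rewrite -Int_sum//; have j2' := intg_sum mD (index_enum _) j2.
rewrite -(IntD mD j1 j2') -(IntD mD (intgD mD j1 j2') j3).
rewrite -[RHS](weak_laplacian_H10 ug (test_H10 oD bD D0 (test_alg D0 sb tn)) lap).2.
apply: eq_Int => x Dx; have x0 := domain_n0 D0 Dx.
have dbF i : partial i (fun x => b x * F n x) x =
    b x * partial i (F n) x + F n x * (b' x * omega i x).
  have d1 := is_derive_partial (@test_fun_derivable _ _ _ _ x i tn).
  by have [_ e] := is_deriveM (db x i x0) d1; exact: e.
rewrite /dotg /drad; under [in RHS]eq_bigr do rewrite mxE dbF.
rewrite -addrA; congr (_ + _); first by ring.
rewrite mulr_suml mulr_sumr -big_split/=; apply: eq_bigr => i _; ring.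
Qed.

End radial_identities.

(** * Existence and a priori bound for the Dirichlet problem *)

Section dirichlet_problem.
Context {R : realType} {N : nat}.
Local Notation E := 'rV[R]_N.
Local Notation leb := (@lebesgue_rV R N).
Variable D : set E.
Hypotheses (oD : open D) (bD : bounded_set D) (D0 : ~ closure D 0).
Hypothesis N2 : (2 <= N)%N.
Implicit Types (u w phi psi a b f : E -> R) (g k : E -> E) (x : E).

Local Notation Int := (Int leb D).
Local Notation intg := (intg leb D).
Local Notation l2 := (l2 leb D).
Local Notation n2 := (n2 leb D).
Local Notation l2cv := (l2cv leb D).
Local Notation bmf := (bmf D).

Let mD : measurable D := open_measurable_rV oD.
Local Hint Resolve mD : core.

Lemma intg_dot u g w k : H10_gradient D u g -> H10_gradient D w k -> intg (dotg g k).
Proof.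
move=> ug wk; apply: intg_sum => // i.
by apply: l2_mul => //; [exact: H10_grad_l2 ug|exact: H10_grad_l2 wk].
Qed.

Lemma dotg_ge0 g x : 0 <= dotg g g x.
Proof. by apply: sumr_ge0 => i _; rewrite -expr2 sqr_ge0. Qed.

Lemma Int_dotg u g : H10_gradient D u g ->
  Int (dotg g g) = \sum_i n2 (fun x => g x 0 i) ^+ 2.
Proof.
move=> ug; rewrite /dotg Int_sum//; first by apply: eq_bigr => i _; rewrite sqr_n2.
by move=> i; apply: l2_mul => //; exact: H10_grad_l2 ug.
Qed.

Lemma n2_grad_le u g i : H10_gradient D u g -> n2 (fun x => g x 0 i) ^+ 2 <= Int (dotg g g).
Proof.
move=> ug; rewrite (Int_dotg ug) (bigD1 i)//= lerDl sumr_ge0// => j _; exact: sqr_ge0.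
Qed.

(** The field [u^2 x] has the divergence [N u^2 + 2 |x| u u_r], of integral zero; together with
    [(u + |x| u_r)^2 >= 0] and [N >= 2] this bounds [u^2] by [|x|^2 |grad u|^2] in the mean. The
    constant is the radius of a ball about the origin that contains [D]. *)
Lemma poincare : exists2 C : R, 0 < C & forall u g, H10_gradient D u g ->
  n2 u ^+ 2 <= C ^+ 2 * Int (dotg g g).
Proof.
have [r0 [R0 [r00 R00 rP]]] := domain_bounds bD D0; exists R0 => // u g ug.
have [ni n0] := nullZ oD (-1) (radial_current oD bD D0 (rw_pw oD bD D0 1 (lexx (0 : R)) ltr01) ug).
have lu := H10_l2 ug; have id := intg_dot ug ug.
rewrite sqr_n2 -subr_ge0 -(IntZ mD _ id) -IntB//; [|exact: intgZ|exact: l2_sqr].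
rewrite -n0; apply: le_Int => //; first by apply: intgB => //; [exact: intgZ|exact: l2_sqr].
move=> x Dx; have x0 := domain_n0 D0 Dx; have e0 := enorm_gt0 x0.
have [_ rx] := rP _ Dx; have dr := drad_sqr_le g x0.
rewrite /pw !add0r !mul1r subrr powRr0 powRr1 ?(ltW e0)// divff ?gt_eqF// !mulr1 addrCA subrr addr0.
have h1 : enorm x ^+ 2 * drad g x ^+ 2 <= R0 ^+ 2 * dotg g g x.
  apply: ler_pM => //; rewrite ?sqr_ge0//.
  by rewrite ler_sqr ?nnegrE ?(ltW e0) ?(ltW R00).
have h2 : 2 <= N%:R :> R by rewrite ler_nat.
have h3 := sqr_ge0 (u x + enorm x * drad g x).
have := sqr_ge0 (u x); rewrite mulN1r.
have h4 : 0 <= (N%:R - 2) * u x ^+ 2 by rewrite mulr_ge0 ?subr_ge0// sqr_ge0.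
move: (u x) (enorm x) (drad g x) (dotg g g x) (N%:R : R) h1 h3 h4 => a e d q n h1 h3 h4 _.
by lra.
Qed.

Lemma gradient_test u w (c : R) : test_fun D u -> test_fun D w ->
  gradient (fun x => u x + c * w x) = (fun x => gradient u x + c *: gradient w x).
Proof.
move=> tu tw; apply/funext => x; apply/rowP => i; rewrite !mxE.
by rewrite (partialD c i tu tw).
Qed.

Lemma dotgD g k (c : R) x : dotg (fun x => g x + c *: k x) (fun x => g x + c *: k x) x =
  dotg g g x + 2 * c * dotg g k x + c ^+ 2 * dotg k k x.
Proof.
rewrite /dotg !mulr_sumr -!big_split/=; apply: eq_bigr => i _; rewrite !mxE; ring.
Qed.

(** The direct method: [J] is bounded below on test functions by Poincare's inequality, a minimizing
    sequence is Cauchy in H^1, and the vanishing of the first variation at its limit is the weak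
    equation. *)
Lemma dirichlet_exists f : l2 f -> exists u, H10 D u /\ weak_laplacian D u f.
Proof.
move=> lf; have [C C0 CP] := poincare.
pose T phi psi := Int (dotg (gradient phi) (gradient psi)).
pose L phi := Int (fun x => f x * phi x).
pose J phi := T phi phi + 2 * L phi.
have JD phi psi (c : R) : test_fun D phi -> test_fun D psi ->
    J (fun x => phi x + c * psi x) =
    J phi + 2 * c * (T phi psi + L psi) + c ^+ 2 * T psi psi.
  move=> tp tq; have hp := test_H10 oD bD D0 tp; have hq := test_H10 oD bD D0 tq.
  have i1 := intg_dot hp hp; have i2 := intg_dot hp hq; have i3 := intg_dot hq hq.
  have i4 : intg (fun x => f x * phi x) by apply: l2_mul => //; exact: test_l2.
  have i5 : intg (fun x => f x * psi x) by apply: l2_mul => //; exact: test_l2.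
  have eL : L (fun x => phi x + c * psi x) = L phi + c * L psi.
    rewrite /L -(IntZ mD _ i5) -(IntD mD i4 (intgZ mD c i5)).
    by apply: eq_Int => x _; ring.
  have eT : T (fun x => phi x + c * psi x) (fun x => phi x + c * psi x) =
      T phi phi + 2 * c * T phi psi + c ^+ 2 * T psi psi.
    have j2 := intgZ mD (2 * c) i2; have j3 := intgZ mD (c ^+ 2) i3.
    rewrite /T -(IntZ mD _ i2) -(IntZ mD _ i3) -(IntD mD i1 j2) -(IntD mD (intgD mD i1 j2) j3).
    by rewrite gradient_test//; apply: eq_Int => x _; exact: dotgD.
  rewrite /J eL eT; move: (T phi phi) (T phi psi) (T psi psi) (L phi) (L psi) => *; ring.
have JB phi : test_fun D phi -> - (C ^+ 2 * n2 f ^+ 2) <= J phi.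
  move=> tp; have hp := test_H10 oD bD D0 tp; have := CP _ _ hp.
  have := n2_CS mD lf (test_l2 oD bD tp).
  rewrite -/(T phi phi) ler_norml -/(L phi) => /andP[h1 _] h2; rewrite /J.
  have := sqr_ge0 (C ^+ 2 * n2 f - n2 phi).
  have : 0 < C ^+ 2 by rewrite exprn_gt0.
  move: (n2 phi) (n2 f) (T _ _) (L _) (C ^+ 2) h1 h2 => p q t l c h1 h2 c0 h3.
  have h4 : 0 <= c * (t + c * q ^+ 2 - 2 * (q * p)) by nra.
  by have := h4; rewrite pmulr_rge0// => h5; lra.
pose S := [set J phi | phi in [set phi | test_fun D phi]].
have Sinf : has_inf S.
  split; first by exists (J (fun=> 0)), (fun=> 0) => //; exact: test0.
  by exists (- (C ^+ 2 * n2 f ^+ 2)) => _ [phi tp <-]; exact: JB.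
pose m := inf S; pose b n : R := n.+1%:R^-1.
have b0 n : 0 < b n by rewrite invr_gt0.
have Jm phi : test_fun D phi -> m <= J phi.
  by move=> tp; apply: ge_inf; [case: Sinf|exists phi].
have /choice [F FP] : forall n : nat, exists phi, test_fun D phi /\ J phi < m + b n ^+ 2.
  move=> n; have [_ [phi tp <-] lt] := inf_adherent (exprn_gt0 2 (b0 n)) Sinf.
  by exists phi.
have tF n : test_fun D (F n) by have [] := FP n.
(* Parallelogram identity: with [d] the difference of the two functions, [J (F n) + J (F p)] exceeds
   twice the value of [J] at their midpoint by half of [T d d], and that value is at least [m]. *)
have TF n p : T (fun x => F n x + -1 * F p x) (fun x => F n x + -1 * F p x) <=
    (2 * (b n + b p)) ^+ 2.
  have td : test_fun D (fun x => F n x + -1 * F p x) by exact: testD.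
  set d := (fun x => _) in td *.
  have := JD _ _ 1 (tF p) td; have := JD _ _ (1/2) (tF p) td.
  rewrite (_ : (fun x => F p x + 1 * d x) = F n); last by apply/funext => x; rewrite /d; ring.
  have h0 := Jm _ (testD (1/2) (tF p) td).
  have [_ h1] := FP n; have [_ h2] := FP p; have h3 : 0 <= b n * b p by rewrite mulr_ge0 ?ltW.
  move: (J _) (J (F n)) (J (F p)) (T _ _ + L _) (T d d) (b n) (b p) h0 h1 h2 h3 => j1 j2 j3 q t y z h0 h1 h2 h3 h4 h5.
  have := sqr_ge0 (y - z); lra.
have Td phi psi : test_fun D phi -> test_fun D psi -> forall i,
    n2 (fun x => partial i phi x - partial i psi x) ^+ 2 <=
    T (fun x => phi x + -1 * psi x) (fun x => phi x + -1 * psi x).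
  move=> tp tq i; have := n2_grad_le i (test_H10 oD bD D0 (testD (-1) tp tq)).
  rewrite /T; apply: le_trans; rewrite le_eqVlt; apply/orP; left; apply/eqP.
  congr (_ ^+ 2); apply: eq_n2 => x _; by rewrite mxE (partialD (-1) i tp tq) mulN1r.
have harm (c : R) : (fun n => c * b n) @ \oo --> 0.
  rewrite -[X in _ --> X](mulr0 c); apply: cvgM; first exact: cvg_cst.
  exact: cvg_harmonic.
have [u cu] : exists u, l2cv F u.
  apply: (@l2cv_complete _ _ _ leb D mD F (fun n => (C * 2) * b n)) => //.
    by move=> n; exact: test_l2.
  move=> n p; rewrite -(@ler_pXn2r _ 2)// ?nnegrE ?n2_ge0 ?addr_ge0 ?mulr_ge0 ?(ltW (b0 _)) ?(ltW C0)//.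
  apply: le_trans (_ : C ^+ 2 * T (fun x => F n x + -1 * F p x) (fun x => F n x + -1 * F p x) <= _).
    apply: le_trans (CP _ _ (test_H10 oD bD D0 (testD (-1) (tF n) (tF p)))).
    rewrite le_eqVlt; apply/orP; left; apply/eqP; congr (_ ^+ 2).
    by apply: eq_n2 => x _; rewrite mulN1r.
  by rewrite -mulrDr -mulrA exprMn ler_wpM2l ?sqr_ge0.
have [g cg] : {g : 'I_N -> E -> R & forall i, l2cv (fun n => partial i (F n)) (g i)}.
  apply: (@choice _ _ (fun i f => l2cv (fun n => partial i (F n)) f)) => i.
  apply: (@l2cv_complete _ _ _ leb D mD _ (fun n => 2 * b n)) => //.
    by move=> n; apply: test_l2 => //; exact: test_fun_partial.
  move=> n p; rewrite -(@ler_pXn2r _ 2)// ?nnegrE ?n2_ge0 ?addr_ge0 ?mulr_ge0 ?(ltW (b0 _)) ?(ltW C0)//.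
  by rewrite -mulrDr; apply: le_trans (TF n p); exact: Td.
have ug : H10_gradient D u (fun x => \row_i g i x).
  apply/(H10_gradientP oD bD D0); exists F; split=> // i.
  by rewrite (_ : (fun x => _) = g i)//; apply/funext => x; rewrite mxE.
exists u; split; first by exists (fun x => \row_i g i x).
split=> // phi tp; have lp := test_l2 oD bD tp.
pose G := \sum_i Int (fun x => g i x * partial i phi x).
have lpi i := test_l2 oD bD (test_fun_partial i tp).
have c1 : (fun n => T (F n) phi) @ \oo --> G.
  rewrite (_ : (fun n => _) = fun n => \sum_i Int (fun x => partial i (F n) x * partial i phi x)).
    by apply: cvg_sumr => i; exact: (l2cv_mul mD (cg i) (l2cv_cst mD (lpi i))).
  apply/funext => n; rewrite -Int_sum//.
    by apply: eq_Int => x _; apply: eq_bigr => i _; rewrite !mxE.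
  by move=> i; apply: l2_mul => //; apply: test_l2 => //; exact: test_fun_partial.
have aux (j l q a t : R) : l <= j + a + t -> j < l + q -> 0 <= q + a + t by lra.
have key (c : R) : 0 <= 2 * c * (G + L phi) + c ^+ 2 * T phi phi.
  have c2 : (fun n => b n * b n + 2 * c * (T (F n) phi + L phi) + c ^+ 2 * T phi phi) @ \oo
      --> 0 * 0 + 2 * c * (G + L phi) + c ^+ 2 * T phi phi.
    apply: cvgD; last exact: cvg_cst.
    apply: cvgD; first by apply: cvgM; exact: cvg_harmonic.
    apply: cvgM; first exact: cvg_cst.
    by apply: cvgD => //; exact: cvg_cst.
  rewrite mul0r add0r in c2; rewrite -(cvg_lim _ c2)//; apply: limr_ge; first exact: cvgP c2.
  apply: nearW => n; have := Jm _ (testD c (tF n) tp).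
  rewrite JD// -expr2 => h2; have [_ h1] := FP n; exact: aux h2 h1.
(* A nonnegative quadratic polynomial in [c] without constant term has no linear term. The value
   [- q / (t + 1)] avoids a division by [t], which may be 0. *)
have GL : G + L phi = 0.
  have T0 : 0 <= T phi phi by apply: Int_ge0 => x _; exact: dotg_ge0.
  move: key T0; set q := G + _; set t := T _ _ => key t0.
  apply/eqP/negPn/negP => q0; have := key (- q / (t + 1)).
  have t1 : 0 < t + 1 by lra.
  rewrite (_ : _ + _ = - (q ^+ 2 * (t + 2)) / (t + 1) ^+ 2); last by field; rewrite gt_eqF.
  rewrite pmulr_lge0 ?invr_gt0 ?exprn_gt0// oppr_ge0 leNgt => /negP; apply.
  by rewrite mulr_gt0 ?exprn_even_gt0//; lra.
have [_ [_ wg] _] := ug.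
have -> : \int[leb]_(x in D) (f x * phi x) = - G.
  by apply/eqP; rewrite eq_sym eqr_oppLR -addr_eq0; apply/eqP.
have i1 i : intg (fun x => u x * partial i (partial i phi) x).
  by apply: l2_mul => //; [case: cu|apply: test_l2 => //; do 2!apply: test_fun_partial].
transitivity (\sum_i Int (fun x => u x * partial i (partial i phi) x)).
  by rewrite -Int_sum//; apply: eq_Int => x _; rewrite mulr_sumr.
rewrite /G -sumrN; apply: eq_bigr => i _.
apply: etrans (wg _ (test_fun_partial i tp) i) _; congr (- _).
by apply: eq_Int => x _; rewrite mxE.
Qed.

(** The equation tested with [u] itself says that the Dirichlet integral of [u] is [- Int (f u)],
    and Poincare's inequality closes the estimate. *)
Lemma dirichlet_bound : exists2 C : R, 0 < C & forall u g f, H10_gradient D u g ->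
  weak_laplacian D u f -> n2 u <= C * n2 f /\ forall i, n2 (fun x => g x 0 i) <= C * n2 f.
Proof.
have [C C0 CP] := poincare; exists (C + C ^+ 2).
  by rewrite addr_gt0// exprn_gt0.
move=> u g f ug lap; have [lf _] := lap; have lu := H10_l2 ug.
have [ni n0] := weak_laplacian_H10 oD bD D0 ug ug lap.
have i1 : intg (fun x => f x * u x) by exact: l2_mul.
have e : Int (fun x => f x * u x) + Int (dotg g g) = 0.
  by rewrite -IntD//; exact: (intg_dot ug ug).
have := n2_CS mD lf lu; rewrite ler_norml => /andP[h1 _].
have h2 := CP _ _ ug; have u0 := n2_ge0 leb D u; have f0 := n2_ge0 leb D f.
have g0 : 0 <= Int (dotg g g) by apply: Int_ge0 => x _; exact: dotg_ge0.
have hu : n2 u <= C ^+ 2 * n2 f.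
  have : n2 u * n2 u <= (C ^+ 2 * n2 f) * n2 u.
    have : C ^+ 2 * Int (dotg g g) <= C ^+ 2 * (n2 f * n2 u).
      by apply: ler_wpM2l; [exact: sqr_ge0|lra].
    by rewrite -expr2; lra.
  have [->|un0] := eqVneq (n2 u) 0; first by move=> _; rewrite mulr_ge0 ?sqr_ge0.
  by rewrite ler_pM2r// lt_def un0.
split; first by apply: le_trans hu _; rewrite ler_wpM2r// lerDr ltW.
move=> i; rewrite -(@ler_pXn2r _ 2)// ?nnegrE ?n2_ge0 ?mulr_ge0 ?addr_ge0 ?sqr_ge0 ?(ltW C0)//.
apply: le_trans (n2_grad_le i ug) _.
apply: (@le_trans _ _ ((C * n2 f) ^+ 2)); first by nra.
by rewrite ler_sqr ?nnegrE ?mulr_ge0 ?addr_ge0 ?sqr_ge0 ?(ltW C0)// ler_wpM2r// lerDl sqr_ge0.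
Qed.

End dirichlet_problem.

(** * The phase space *)

Section state_module.
Context {R : realType} {N : nat}.
Local Notation state := (@state R N).

Let scaleA (a b : R) (U : state) : scale_state a (scale_state b U) = scale_state (a * b) U.
Proof. by congr pair; apply/funext => x /=; rewrite mulrA. Qed.

Let scale1 (U : state) : scale_state 1 U = U.
Proof. by case: U => u v; congr pair; apply/funext => x /=; rewrite mul1r. Qed.

Let scaleDr (a : R) (U W : state) :
  scale_state a (U + W) = scale_state a U + scale_state a W.
Proof. by congr pair; apply/funext => x /=; rewrite mulrDr. Qed.

Let scaleDl (U : state) (a b : R) :
  scale_state (a + b) U = scale_state a U + scale_state b U.
Proof. by congr pair; apply/funext => x /=; rewrite mulrDl. Qed.

HB.instance Definition _ :=
  GRing.Zmodule_isLmodule.Build R state scaleA scale1 scaleDr scaleDl.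

End state_module.

Lemma ler_add3M (R : realFieldType) (r s t a b d a' b' d' k : R) :
  r <= a + k * a' -> s <= b + k * b' -> t <= d + k * d' ->
  r + s + t <= a + b + d + k * (a' + b' + d').
Proof. by lra. Qed.

(** * The seminorm of the phase space, completeness, and a bound for the inverse of the wave
    operator *)

Section phase_space_theory.
Context {R : realType} {N : nat}.
Local Notation E := 'rV[R]_N.
Local Notation leb := (@lebesgue_rV R N).
Local Notation state := (@state R N).
Variable D : set E.
Hypotheses (oD : open D) (bD : bounded_set D) (D0 : ~ closure D 0).
Hypothesis N2 : (2 <= N)%N.
Implicit Types (u w f : E -> R) (U W Y Z : state) (x : E).

Local Notation Int := (Int leb D).
Local Notation intg := (intg leb D).
Local Notation l2 := (l2 leb D).
Local Notation n2 := (n2 leb D).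
Local Notation l2cv := (l2cv leb D).
Local Notation bmf := (bmf D).
Local Notation P := (phase_space D).

Let mD : measurable D := open_measurable_rV oD.
Local Hint Resolve mD : core.

Lemma stateE1 U (c : R) W : (U + c *: W).1 = (fun x => U.1 x + c * W.1 x).
Proof. by []. Qed.

Lemma stateE2 U (c : R) W : (U + c *: W).2 = (fun x => U.2 x + c * W.2 x).
Proof. by []. Qed.

Lemma phaseD U (c : R) W : P U -> P W -> P (U + c *: W).
Proof.
move=> [hU lU] [hW lW]; split; first exact: (H10D oD bD D0).
by rewrite stateE2; apply: l2D => //; exact: l2Z.
Qed.

Lemma phase_0 (v : E -> R) : l2 v -> P (0, v).
Proof.
move=> lv; split=> //; exists (gradient (fun=> 0)).
by apply: test_H10 => //; exact: test0.
Qed.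

Lemma phase0 : P 0.
Proof. by apply: phase_0; exact: l2_0. Qed.

Lemma phaseZ (c : R) W : P W -> P (c *: W).
Proof. by move=> PW; rewrite -[_ *: _]add0r; apply: phaseD => //; exact: phase0. Qed.

Lemma phaseDD U W : P U -> P W -> P (U + W).
Proof. by move=> PU PW; rewrite -[W]scale1r; exact: phaseD. Qed.

Lemma phaseB U W : P U -> P W -> P (U - W).
Proof. by move=> PU PW; rewrite -scaleN1r; exact: phaseD. Qed.

Lemma nabla_l2 u i : H10 D u -> l2 (fun x => nabla D u x 0 i).
Proof. by move=> hu; exact: H10_grad_l2 (nablaP hu). Qed.

Lemma H10_l2' u : H10 D u -> l2 u.
Proof. by move=> hu; exact: H10_l2 (nablaP hu). Qed.

(** Equivalent to the square root of [phase_sq] by [phase_sq_le] and [nrm_le], but a sum of L^2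
    seminorms, so that the triangle inequality holds term by term. Equality of states is
    [nrm (U - W) = 0]. *)
Definition nrm U : R :=
  n2 U.1 + \sum_i n2 (fun x => nabla D U.1 x 0 i) + n2 U.2.

Lemma nrm_ge0 U : 0 <= nrm U.
Proof. by rewrite !addr_ge0 ?n2_ge0// sumr_ge0// => i _; exact: n2_ge0. Qed.

Lemma n2_null f w : l2 f -> l2 w -> n2 (fun x => f x - w x) = 0 -> n2 f = n2 w.
Proof.
have h f' w' : l2 f' -> l2 w' -> n2 (fun x => f' x - w' x) = 0 -> n2 f' <= n2 w'.
  move=> lf lw e; rewrite (@eq_n2 _ _ _ leb D f' (fun x => (f' x - w' x) + w' x)).
    by rewrite -[leRHS]add0r -e; apply: n2D => //; exact: l2B.
  by move=> x _; ring.
move=> lf lw e; apply/eqP; rewrite eq_le h//= h//.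
by rewrite -e -n2N; apply: eq_n2 => x _; ring.
Qed.

Lemma nablaD_n2 u w (c : R) i : H10 D u -> H10 D w ->
  n2 (fun x => nabla D (fun x => u x + c * w x) x 0 i) =
  n2 (fun x => nabla D u x 0 i + c * nabla D w x 0 i).
Proof.
move=> hu hw; have lu := nabla_l2 i hu; have lw := nabla_l2 i hw.
apply: n2_null; first by apply: nabla_l2; exact: (H10D oD bD D0).
  exact: (l2D mD lu (l2Z mD c lw)).
exact: (nablaD oD bD D0).
Qed.

Lemma nrmD U (c : R) W : P U -> P W -> nrm (U + c *: W) <= nrm U + `|c| * nrm W.
Proof.
move=> [hU lU] [hW lW]; rewrite /nrm stateE1 stateE2.
have h f w : l2 f -> l2 w -> n2 (fun x => f x + c * w x) <= n2 f + `|c| * n2 w.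
  by move=> lf lw; rewrite -n2Z//; apply: n2D => //; exact: l2Z.
have h1 := h _ _ (H10_l2' hU) (H10_l2' hW); have h2 := h _ _ lU lW.
have h3 : \sum_i n2 (fun x => nabla D (fun x => U.1 x + c * W.1 x) x 0 i) <=
    \sum_i n2 (fun x => nabla D U.1 x 0 i) + `|c| * \sum_i n2 (fun x => nabla D W.1 x 0 i).
  rewrite mulr_sumr -big_split/=; apply: ler_sum => i _; rewrite nablaD_n2//.
  by apply: h; exact: nabla_l2.
exact: ler_add3M h1 h3 h2.
Qed.

Lemma nrm0 : nrm 0 = 0.
Proof.
have p0 := phase0; apply/eqP; rewrite eq_le nrm_ge0 andbT.
have := nrmD (-1) p0 p0; rewrite scaleN1r subrr normrN normr1 mul1r.
have z : n2 (0 : state).1 = 0.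
  rewrite /n2 (_ : Int _ = 0) ?sqrtr0//.
  by rewrite -[RHS](Int0 leb mD); apply: eq_Int => x _; rewrite expr0n.
have H0 : H10_gradient D (fun=> 0) (gradient (fun=> 0)) := test_H10 oD bD D0 (test0 D).
have n0 i : n2 (fun x => nabla D (fun=> 0) x 0 i) = 0.
  apply: etrans (H10_gradient_uniq oD bD D0 i (nablaP (ex_intro _ _ H0)) H0).
  apply: eq_n2 => x _; rewrite mxE /partial derive_cst subr0//.
have -> : nrm 0 = n2 (0 : state).1 + \sum_i n2 (fun x => nabla D (fun=> 0) x 0 i) + n2 (0 : state).1 by [].
by rewrite z big1// !addr0.
Qed.

Lemma phase_sqE U : P U -> phase_sq D U =
  (n2 U.1 ^+ 2 + \sum_i n2 (fun x => nabla D U.1 x 0 i) ^+ 2 + n2 U.2 ^+ 2)%:E.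
Proof.
move=> [hU lU]; have l1 := H10_l2' hU; have lg i := nabla_l2 i hU.
have is_ := intg_sum mD (index_enum 'I_N) (fun i => l2_sqr (lg i)).
rewrite /phase_sq EFinD; congr (_ + _)%E; last first.
  by rewrite sqr_n2 Int_EFin//; exact: l2_sqr.
rewrite !sqr_n2; under eq_bigr do rewrite sqr_n2.
rewrite -Int_sum; [|exact: mD|by move=> i; exact: l2_sqr].
rewrite -IntD//; last exact: l2_sqr.
rewrite Int_EFin; last by apply: intgD => //; exact: l2_sqr.
  by apply: eq_integral => x _; rewrite sqr_enorm.
exact: mD.
Qed.

Lemma phase_sq_le U : P U -> (phase_sq D U <= (nrm U ^+ 2)%:E)%E.
Proof.
move=> PU; rewrite phase_sqE// lee_fin /nrm.
set s := \sum_i _; set t := \sum_i _.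
have st : s <= t ^+ 2.
  rewrite expr2 mulr_suml; apply: ler_sum => i _; rewrite expr2 ler_wpM2l ?n2_ge0//.
  by rewrite /t (bigD1 i)//= lerDl sumr_ge0// => j _; exact: n2_ge0.
have t0 : 0 <= t by apply: sumr_ge0 => i _; exact: n2_ge0.
have := n2_ge0 leb D U.1; have := n2_ge0 leb D U.2; clear -st t0.
by move: s t (n2 _) (n2 _) st t0 => s t a b st t0 a0 b0; nra.
Qed.

(** The seminorm has [N + 2] terms, each at most the square root of the sum of the squares. *)
Lemma nrm_le U : P U -> ((nrm U ^+ 2)%:E <= (N.+2%:R ^+ 2)%:E * phase_sq D U)%E.
Proof.
move=> PU; rewrite phase_sqE// -EFinM lee_fin.
set q := (X in _ <= _ * X).
have q0 : 0 <= q.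
  by rewrite /q !addr_ge0 ?sqr_ge0// sumr_ge0// => i _; exact: sqr_ge0.
have h (a : R) : 0 <= a -> a ^+ 2 <= q -> a <= Num.sqrt q.
  by move=> a0 aq; rewrite -(ger0_norm a0) -sqrtr_sqr ler_sqrt.
have s0 : 0 <= \sum_i n2 (fun x => nabla D U.1 x 0 i) ^+ 2.
  by apply: sumr_ge0 => i _; exact: sqr_ge0.
rewrite -[q in leRHS]sqr_sqrtr// -exprMn ler_sqr ?nnegrE ?nrm_ge0 ?mulr_ge0 ?sqrtr_ge0//.
rewrite /nrm -addn2 natrD mulrDl.
have h1 : n2 U.1 <= Num.sqrt q.
  apply: h; first exact: n2_ge0.
  by rewrite /q -addrA lerDl addr_ge0 ?sqr_ge0.
have h2 : n2 U.2 <= Num.sqrt q.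
  apply: h; first exact: n2_ge0.
  by rewrite /q lerDr addr_ge0 ?sqr_ge0.
have h3 : \sum_i n2 (fun x => nabla D U.1 x 0 i) <= N%:R * Num.sqrt q.
  rewrite -[N in leRHS]card_ord -sum1_card natr_sum mulr_suml.
  apply: ler_sum => i _; rewrite mul1r; apply: h; first exact: n2_ge0.
  rewrite /q -addrA addrCA (bigD1 i)//= -addrA lerDl !addr_ge0 ?sqr_ge0//.
  by apply: sumr_ge0 => j _; exact: sqr_ge0.
have aux (a b d t n : R) : a <= t -> b <= t -> d <= n * t -> a + d + b <= n * t + 2 * t by lra.
exact: aux h1 h2 h3.
Qed.

Lemma phase_eqP U W : P U -> P W -> phase_eq D U W <-> nrm (U - W) = 0.
Proof.
move=> PU PW; have PUW := phaseB PU PW; rewrite /phase_eq; split=> e.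
  apply/eqP; rewrite -sqrf_eq0 eq_le sqr_ge0 andbT -lee_fin.
  by have := nrm_le PUW; rewrite e mule0.
apply/eqP; rewrite eq_le; apply/andP; split.
  by have := phase_sq_le PUW; rewrite e expr0n.
rewrite phase_sqE// lee_fin !addr_ge0 ?sqr_ge0// sumr_ge0// => i _; exact: sqr_ge0.
Qed.

Lemma phase_complete (F : nat -> state) (b : nat -> R) :
  (forall n, P (F n)) -> b @ \oo --> 0 ->
  (forall n m, nrm (F n - F m) <= b n + b m) ->
  exists2 U, P U & (fun n => nrm (F n - U)) @ \oo --> 0.
Proof.
move=> PF b0 FC.
have part n m : [/\ n2 (fun x => (F n).1 x - (F m).1 x) <= b n + b m,
    forall i, n2 (fun x => nabla D (F n).1 x 0 i - nabla D (F m).1 x 0 i) <= b n + b m &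
    n2 (fun x => (F n).2 x - (F m).2 x) <= b n + b m].
  have [hn ln] := PF n; have [hm lm] := PF m.
  have := FC n m; rewrite -scaleN1r /nrm stateE1 stateE2 => h.
  have e1 (a c : E -> R) : n2 (fun x => a x - c x) = n2 (fun x => a x + -1 * c x).
    by apply: eq_n2 => x _; rewrite mulN1r.
  have s0 : 0 <= \sum_i n2 (fun x => nabla D (fun x => (F n).1 x + -1 * (F m).1 x) x 0 i).
    by apply: sumr_ge0 => i _; exact: n2_ge0.
  split; rewrite ?e1.
  - by apply: le_trans h; rewrite -addrA lerDl addr_ge0 ?n2_ge0.
  - move=> i; rewrite e1 -(nablaD_n2 (-1) i hn hm); apply: le_trans h.
    rewrite (bigD1 i)//= addrAC addrCA lerDl !addr_ge0 ?n2_ge0//.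
    by apply: sumr_ge0 => j _; exact: n2_ge0.
  - by apply: le_trans h; rewrite lerDr addr_ge0 ?n2_ge0.
have [u [hu cu cg]] := H10_complete oD bD D0 (fun n => (PF n).1) b0
  (fun n m => let: And3 h _ _ := part n m in h)
  (fun i n m => let: And3 _ h _ := part n m in h i).
have [v cv] := l2cv_complete mD (fun n => (PF n).2) b0
  (fun n m => let: And3 _ _ h := part n m in h).
have Puv : P (u, v) by split=> //; case: cv.
exists (u, v) => //.
have c : (fun n => n2 (fun x => (F n).1 x - u x) +
    \sum_i n2 (fun x => nabla D (F n).1 x 0 i - nabla D u x 0 i) +
    n2 (fun x => (F n).2 x - v x)) @ \oo --> 0 + \sum_(i < N) 0 + 0.
  apply: cvgD; last by case: cv.
  by apply: cvgD; [case: cu|apply: cvg_sumr => i; case: (cg i)].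
rewrite big1// !addr0 in c.
rewrite (_ : (fun n => nrm _) = (fun n => n2 (fun x => (F n).1 x - u x) +
    \sum_i n2 (fun x => nabla D (F n).1 x 0 i - nabla D u x 0 i) +
    n2 (fun x => (F n).2 x - v x))); first exact: c.
apply/funext => n.
rewrite -scaleN1r /nrm stateE1 stateE2; have [hn _] := PF n.
congr (_ + _ + _); try by apply: eq_n2 => x _; rewrite mulN1r.
apply: eq_bigr => i _; rewrite nablaD_n2//.
by apply: eq_n2 => x _; rewrite mulN1r.
Qed.

Lemma bmf_damping (V0 : R) : bmf (fun x => V0 / enorm x).
Proof.
have := bmfM (bmf_cst D V0) (bmf_pw oD bD D0 (-1) (lexx (0 : R)) ltr01).
by congr (bmf _); apply/funext => x; rewrite /pw add0r mul1r powR_inv1// enorm_ge0.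
Qed.

Variable V0 : R.
Local Notation A := (wave_operator D V0).

Lemma wave_operator_phase K U : A K U -> P K.
Proof. by move=> [h1 h2 _]; split=> //; exact: H10_l2'. Qed.

Lemma weak_laplacianD u w f k (c : R) : H10 D u -> H10 D w ->
  weak_laplacian D u f -> weak_laplacian D w k ->
  weak_laplacian D (fun x => u x + c * w x) (fun x => f x + c * k x).
Proof.
move=> hu hw [lf uf] [lk wk]; split; first by apply: l2D => //; exact: l2Z.
move=> phi tp; have lp := test_l2 oD bD tp.
have ll : l2 (laplacian phi).
  by apply: l2_sum => // i; apply: test_l2 => //; do 2!apply: test_fun_partial.
have lin f' k' psi : l2 f' -> l2 k' -> l2 psi ->
    Int (fun x => (f' x + c * k' x) * psi x) =
    Int (fun x => f' x * psi x) + c * Int (fun x => k' x * psi x).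
  move=> l1 l2' l3; have i1 := l2_mul mD l1 l3; have i2 := l2_mul mD l2' l3.
  rewrite -(IntZ mD _ i2) -(IntD mD i1 (intgZ mD c i2)).
  by apply: eq_Int => x _; ring.
have e1 := lin _ _ _ (H10_l2' hu) (H10_l2' hw) ll.
have e2 := lin _ _ _ lf lk lp.
apply: etrans e1 _; apply: etrans _ (esym e2).
by congr (_ + _ * _); [exact: uf|exact: wk].
Qed.

Lemma eq_l2_lap f k U : P U -> H10 D k -> l2 f ->
  phase_eq D U (k, fun x => f x - V0 / enorm x * k x) ->
  n2 f <= n2 U.2 + n2 (fun x => V0 / enorm x * k x).
Proof.
move=> PU hk lf e; have lk := H10_l2' hk.
have lV := l2_bmf mD (bmf_damping V0) lk.
have PW : P (k, fun x => f x - V0 / enorm x * k x) by split=> //; exact: l2B.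
have := (phase_eqP PU PW).1 e => e0.
have z : n2 (fun x => U.2 x - (f x - V0 / enorm x * k x)) <= 0.
  rewrite -e0 /nrm lerDr addr_ge0 ?n2_ge0// sumr_ge0// => i _; exact: n2_ge0.
have lU : l2 U.2 by case: PU.
rewrite (@eq_n2 _ _ _ leb D f (fun x => (-1 * (U.2 x - (f x - V0 / enorm x * k x)) + U.2 x)
    + V0 / enorm x * k x)); last by move=> x _; ring.
have l3 : l2 (fun x => U.2 x - (f x - V0 / enorm x * k x)) by do 2!apply: l2B => //.
apply: le_trans (n2D mD (l2D mD (l2Z mD _ l3) lU) lV) _; rewrite lerD2r.
apply: le_trans (n2D mD (l2Z mD _ l3) lU) _; rewrite n2Z// normrN normr1 mul1r.
by rewrite -[leRHS]add0r lerD2r.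
Qed.

(** If [A K = U], then up to null functions [K.2] is [U.1], and [K.1] solves the Dirichlet problem
    with right-hand side [U.2 + V0 U.1 / |x|]. *)
Lemma wave_operator_inv_bound : exists2 C : R, 0 < C & forall K U, P U -> A K U ->
  nrm K <= C * nrm U.
Proof.
have [C C0 CP] := dirichlet_bound oD bD D0 N2.
have [mV [B BP]] := bmf_damping V0.
have BP' x : D x -> `|V0 / enorm x| <= `|B|.
  by move=> Dx; apply: le_trans (BP _ Dx) (ler_norm _).
exists (C * (1 + `|B|) * N.+1%:R + 1).
  by rewrite ltr_wpDl// mulr_ge0// mulr_ge0 ?addr_ge0// ltW.
move=> K U PU [h1 h2 [f lap e]]; have lf := lap.1.
have l2K := H10_l2' h2.
have lV := l2_bmf mD (bmf_damping V0) l2K.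
have PW : P (K.2, fun x => f x - V0 / enorm x * K.2 x) by split=> //; exact: l2B.
have e0 := (phase_eqP PU PW).1 e.
have nU1 : n2 U.1 = n2 K.2.
  apply: n2_null => //; first by apply: H10_l2'; case: PU.
  apply/eqP; rewrite eq_le n2_ge0 andbT -e0 /nrm -addrA lerDl addr_ge0 ?n2_ge0//.
  by apply: sumr_ge0 => i _; exact: n2_ge0.
have hf : n2 f <= (1 + `|B|) * nrm U.
  apply: le_trans (eq_l2_lap PU h2 lf e) _.
  rewrite mulrDl mul1r lerD//.
    rewrite /nrm lerDr addr_ge0 ?n2_ge0// sumr_ge0// => i _; exact: n2_ge0.
  apply: le_trans (n2_le_bmf mD BP' mV (normr_ge0 _) l2K) _.
  rewrite ler_wpM2l// -nU1 /nrm -addrA lerDl addr_ge0 ?n2_ge0//.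
  by apply: sumr_ge0 => i _; exact: n2_ge0.
have [c1 c2] := CP _ _ _ (nablaP h1) lap.
have hC : C * n2 f <= C * ((1 + `|B|) * nrm U) by rewrite ler_wpM2l// ltW.
rewrite /nrm mulrDl mul1r -!nU1; apply: lerD.
  rewrite -natr1 [C * _ * _]mulrDr mulr1 [in leRHS]mulrDl addrC; apply: lerD.
    rewrite mulrAC; set q := C * _ * _.
    rewrite (_ : q * N%:R = \sum_(i < N) q); last by rewrite sumr_const card_ord mulr_natr.
    apply: ler_sum => i _; rewrite /q -mulrA; exact: le_trans (c2 i) hC.
  by rewrite -mulrA; exact: le_trans c1 hC.
rewrite /nrm -addrA lerDl addr_ge0 ?n2_ge0// sumr_ge0// => i _; exact: n2_ge0.
Qed.

End phase_space_theory.

Ltac nneg := repeat first [exact: sqr_ge0|assumption|exact: ler0n|apply: addr_ge0|apply: mulr_ge0|apply: ltW; assumption].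

(** * Dini inequalities for perturbed semigroups *)

Section real_dini.
Context {R : realType}.
Implicit Types (s r e h c eta : R).

(** Continuous induction. The supremum of the [s] up to which the bound holds has the property
    itself, by the left condition; if it were below [h], the right condition would push it
    further. *)
Lemma dini_le (f : R -> R) (h c : R) : 0 <= h ->
  (forall s, 0 <= s -> s < h -> exists2 eta, 0 < eta & forall r, 0 < r -> r < eta ->
     s + r <= h -> f (s + r) <= f s + c * r) ->
  (forall s e, 0 < s -> s <= h -> 0 < e -> exists2 eta, 0 < eta & forall r,
     0 <= r -> s - eta < r -> r < s -> f s <= f r + e) ->
  f h <= f 0 + c * h.
Proof.
move=> h0 right left.
pose A := [set s | 0 <= s <= h /\ forall r, 0 <= r <= s -> f r <= f 0 + c * r].
have A0 : A 0.
  split; first by rewrite lexx.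
  move=> r /andP[r0 r1]; have -> : r = 0 by apply/eqP; rewrite eq_le r0 r1.
  by rewrite mulr0 addr0.
have supA : has_sup A by split; [exists 0|exists h => s [/andP[]]].
set b := sup A.
have b0 : 0 <= b by apply: ub_le_sup => //; case: supA.
have bh : b <= h by apply: ge_sup => //; [exists 0|move=> s [/andP[]]].
have below r : 0 <= r -> r < b -> f r <= f 0 + c * r.
  move=> r0 rb; have br0 : 0 < b - r by rewrite subr_gt0.
  have [s [_ sP]] := sup_adherent br0 supA; rewrite -/b opprB addrC subrK => rs.
  by apply: sP; rewrite r0 ltW.
have atb : f b <= f 0 + c * b.
  have [b00|bn0] := eqVneq b 0; first by rewrite b00 mulr0 addr0.
  have bp : 0 < b by rewrite lt_def bn0.
  apply/ler_addgt0Pr => e e0.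
  have e2 : 0 < e / 2 by rewrite divr_gt0.
  have [eta eta0 etaP] := left b _ bp bh e2.
  pose c1 := `|c| + 1; have c10 : 0 < c1 by rewrite ltr_wpDl.
  (* The step [k] keeps [b - k] within reach of the left condition and nonnegative, and makes
     [|c| k] at most [e / 2]. *)
  pose k := Num.min (eta / 2) (Num.min (b / 2) (e / 2 / c1)).
  have k0 : 0 < k by rewrite !lt_min !divr_gt0.
  have k1 : k < eta by rewrite gt_min ltr_pdivrMr// ltr_pMr// ltr1n.
  have k2 : k < b by rewrite !gt_min [b / 2 < b]ltr_pdivrMr// ltr_pMr// ltr1n orbT.
  have k3 : k * c1 <= e / 2 by rewrite -ler_pdivlMr// !ge_min lexx !orbT.
  have kb0 : 0 <= b - k by rewrite subr_ge0 ltW.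
  have := etaP (b - k) kb0; rewrite ltrD2l ltrN2 => /(_ k1).
  have kb : b - k < b by rewrite ltrBlDr ltrDl.
  move=> /(_ kb) h1; have h2 := below _ kb0 kb.
  have h3 : - c * k <= `|c| * k by rewrite ler_pM2r// -normrN ler_norm.
  have h4 : `|c| * k <= k * c1 by rewrite mulrC ler_pM2l// /c1 lerDl.
  move: h1 h2 h3 h4 k3; clear; move: (f b) (f (b - k)) (f 0) `|c| => fb fk f0 ac; lra.
have Ab : A b.
  split; first by rewrite b0 bh.
  move=> r /andP[r0]; rewrite le_eqVlt => /predU1P[->//|]; exact: below.
have [<-//|bneh] := eqVneq b h.
have blt : b < h by rewrite lt_neqAle bneh.
have [eta eta0 etaP] := right b b0 blt.
pose k := Num.min (eta / 2) (h - b).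
have k0 : 0 < k by rewrite lt_min divr_gt0// subr_gt0.
have keta : k < eta by rewrite gt_min ltr_pdivrMr// ltr_pMr// ltr1n.
have kh : b + k <= h by rewrite addrC -lerBrDr ge_min lexx orbT.
have : A (b + k).
  split; first by rewrite addr_ge0 ?(ltW k0).
  move=> r /andP[r0 rk]; have [rb|br] := leP r b; first by apply: Ab.2; rewrite r0.
  have rb0 : 0 < r - b by rewrite subr_gt0.
  have := etaP (r - b) rb0; rewrite [b + _]addrC subrK => h1.
  have /h1 : r - b < eta by rewrite (le_lt_trans _ keta)// lerBlDl.
  move=> /(_ (le_trans rk kh)) h2; move: h2 atb; clear; lra.
move=> /(ub_le_sup supA.2); rewrite -/b; rewrite gerDl leNgt k0//.
Qed.

End real_dini.

Lemma gliding_contra (R : realFieldType) (p q r s u : R) : p < 1 -> q <= r + p ->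
  4^-1 * s <= q -> 1 + u / 3 <= s -> 12 * (r + 1) < u -> False.
Proof. by lra. Qed.

Lemma form_step_arith (R : realFieldType)
    (x a b c a' b' c' s k1 bY k2 k3 k4 k5 k6 e : R) :
  x - (a + 2 * s * b + s ^+ 2 * c) - s * (a' + 2 * s * b' + s ^+ 2 * c') <= k6 ->
  s * b <= s * (bY + k1) -> s ^+ 2 * c <= s * k2 -> s * (2 * s * b') <= s * k3 ->
  s * (s ^+ 2 * c') <= s * k4 -> k6 <= s * k5 ->
  s * (2 * k1 + k2 + k3 + k4 + k5) <= s * e -> x <= a + s * (a' + 2 * bY + e).
Proof. by lra. Qed.

(** * Strongly continuous semigroups on a complete seminormed space *)

Section abstract_semigroup.
Context {R : realType} {V : lmodType R}.
Implicit Types (s t h r c e eta : R) (U W Y Z : V).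
Variables (P : V -> Prop) (nrm : V -> R).
Hypothesis P0 : P 0.
Hypothesis PD : forall U (c : R) W, P U -> P W -> P (U + c *: W).
Hypothesis nrm_ge0 : forall U, 0 <= nrm U.
Hypothesis nrm0 : nrm 0 = 0.
Hypothesis nrmD : forall U (c : R) W, P U -> P W -> nrm (U + c *: W) <= nrm U + `|c| * nrm W.
Hypothesis nrm_complete : forall (F : nat -> V) (b : nat -> R),
  (forall n, P (F n)) -> b @ \oo --> 0 ->
  (forall n m, nrm (F n - F m) <= b n + b m) ->
  exists2 U, P U & (fun n => nrm (F n - U)) @ \oo --> 0.

Lemma PZ (c : R) U : P U -> P (c *: U).
Proof. by move=> PU; rewrite -[_ *: _]add0r; exact: PD. Qed.

Lemma PA U W : P U -> P W -> P (U + W).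
Proof. by move=> PU PW; rewrite -[W]scale1r; exact: PD. Qed.

Lemma PB U W : P U -> P W -> P (U - W).
Proof. by move=> PU PW; rewrite -scaleN1r; exact: PD. Qed.

Lemma nrmA U W : P U -> P W -> nrm (U + W) <= nrm U + nrm W.
Proof. by move=> PU PW; have := nrmD 1 PU PW; rewrite scale1r normr1 mul1r. Qed.

Lemma nrm_scale (c : R) U : P U -> nrm (c *: U) = `|c| * nrm U.
Proof.
move=> PU.
have h (a : R) Y : P Y -> nrm (a *: Y) <= `|a| * nrm Y.
  by move=> PY; have := nrmD a P0 PY; rewrite add0r nrm0 add0r.
apply/eqP; rewrite eq_le h//=; have [->|c0] := eqVneq c 0.
  by rewrite normr0 mul0r nrm_ge0.
have := h c^-1 _ (PZ c PU); rewrite scalerA mulVf// scale1r normfV.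
by rewrite mulrC ler_pdivlMr ?normr_gt0// mulrC.
Qed.

Lemma nrm_opp U : P U -> nrm (- U) = nrm U.
Proof. by move=> PU; rewrite -scaleN1r nrm_scale// normrN normr1 mul1r. Qed.

Lemma nrm_sym U W : P U -> P W -> nrm (U - W) = nrm (W - U).
Proof. by move=> PU PW; rewrite -opprB nrm_opp//; exact: PB. Qed.

Lemma nrm_tri W U Y : P U -> P W -> P Y -> nrm (U - Y) <= nrm (U - W) + nrm (W - Y).
Proof.
move=> PU PW PY; have -> : U - Y = (U - W) + (W - Y) by rewrite addrA subrK.
by apply: nrmA; exact: PB.
Qed.

Lemma nrm_subl U W : P U -> P W -> nrm U <= nrm W + nrm (U - W).
Proof.
move=> PU PW; have -> : nrm U = nrm (W + (U - W)) by rewrite addrC subrK.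
by apply: nrmA => //; exact: PB.
Qed.

Lemma nrm_eq0l U W Y : P U -> P W -> P Y -> nrm (U - W) = 0 -> nrm (U - Y) = nrm (W - Y).
Proof.
move=> PU PW PY e; apply/eqP; rewrite eq_le.
have h1 := nrm_tri PU PW PY; have h2 := nrm_tri PW PU PY.
by move: h1 h2; rewrite (nrm_sym PW PU) e !add0r => -> ->.
Qed.

Lemma nrm_eq0 U W : P U -> P W -> nrm (U - W) = 0 -> nrm U = nrm W.
Proof. by move=> PU PW /(nrm_eq0l PU PW P0); rewrite !subr0. Qed.

Variable S : R -> V -> V.
Hypothesis SP : forall t U, 0 <= t -> P U -> P (S t U).
Hypothesis Slin : forall t U (c : R) W, 0 <= t -> P U -> P W ->
  nrm (S t (U + c *: W) - (S t U + c *: S t W)) = 0.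
Hypothesis Sbd : forall t, 0 <= t -> exists C : R, forall U, P U -> nrm (S t U) <= C * nrm U.
Hypothesis S0 : forall U, P U -> nrm (S 0 U - U) = 0.
Hypothesis Sadd : forall s t U, 0 <= s -> 0 <= t -> P U -> nrm (S (s + t) U - S s (S t U)) = 0.
Hypothesis Scont : forall U, P U -> forall e : R, 0 < e -> exists2 eta : R, 0 < eta &
  forall t, 0 < t -> t < eta -> nrm (S t U - U) < e.

Lemma nrm_S0 t : 0 <= t -> nrm (S t 0) = 0.
Proof.
move=> t0; have [C CP] := Sbd t0; apply/eqP; rewrite eq_le nrm_ge0 andbT.
by have := CP _ P0; rewrite nrm0 mulr0.
Qed.

Lemma nrm_SD t U (c : R) W : 0 <= t -> P U -> P W ->
  nrm (S t (U + c *: W)) <= nrm (S t U) + `|c| * nrm (S t W).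
Proof.
move=> t0 PU PW; rewrite (nrm_eq0 _ _ (Slin c t0 PU PW)); [|by apply: SP => //; exact: PD|].
  by apply: nrmD; exact: SP.
by apply: PD; exact: SP.
Qed.

Lemma nrm_SZ t (c : R) U : 0 <= t -> P U -> nrm (S t (c *: U)) = `|c| * nrm (S t U).
Proof.
move=> t0 PU.
have h (a : R) Y : P Y -> nrm (S t (a *: Y)) <= `|a| * nrm (S t Y).
  by move=> PY; have := nrm_SD a t0 P0 PY; rewrite add0r nrm_S0// add0r.
apply/eqP; rewrite eq_le h//=; have [->|c0] := eqVneq c 0.
  by rewrite normr0 mul0r nrm_ge0.
have := h c^-1 _ (PZ c PU); rewrite scalerA mulVf// scale1r normfV.
by rewrite mulrC ler_pdivlMr ?normr_gt0// mulrC.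
Qed.

Lemma nrm_SB t U W : 0 <= t -> P U -> P W -> nrm (S t U - S t W) = nrm (S t (U - W)).
Proof.
move=> t0 PU PW; apply/esym; rewrite -scaleN1r -[- S t W]scaleN1r.
apply: nrm_eq0; [by apply: SP => //; exact: PD|by apply: PD; exact: SP|exact: Slin].
Qed.

Lemma Scont0 U : P U -> forall e : R, 0 < e -> exists2 eta : R, 0 < eta &
  forall t, 0 <= t -> t < eta -> nrm (S t U - U) < e.
Proof.
move=> PU e e0; have [eta eta0 etaP] := Scont PU e0; exists eta => // t.
by rewrite le_eqVlt => /predU1P[<- _|]; [rewrite S0|exact: etaP].
Qed.

(** [C] is the operator seminorm of [S t], and [z] attains three quarters of it; [Y] only witnesses
    that [C] is at least [c]. *)
Lemma op_norm t (c : R) Y : 0 <= t -> 0 < c -> P Y -> c * nrm Y < nrm (S t Y) ->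
  exists C z, [/\ c <= C, P z, nrm z <= 1, 3 / 4 * C <= nrm (S t z) &
    forall U, P U -> nrm (S t U) <= C * nrm U].
Proof.
move=> t0 c0 PY Yc; have [C0 C0P] := Sbd t0.
pose A := [set nrm (S t z) | z in [set z | P z /\ nrm z <= 1]].
have supA : has_sup A.
  split; first by exists (nrm (S t 0)), 0 => //; rewrite /= nrm0.
  exists `|C0| => _ [z [Pz z1] <-]; apply: le_trans (C0P _ Pz) _.
  rewrite -[leRHS]mulr1; apply: le_trans (_ : `|C0| * nrm z <= _); last exact: ler_wpM2l.
  by apply: ler_wpM2r => //; exact: ler_norm.
have bd U : P U -> nrm (S t U) <= sup A * nrm U.
  move=> PU; have [U0|Un0] := eqVneq (nrm U) 0.
    by have := C0P _ PU; rewrite U0 !mulr0.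
  have Up : 0 < nrm U by rewrite lt_def Un0 nrm_ge0.
  rewrite -ler_pdivrMr// mulrC; apply: (ub_le_sup supA.2).
  exists ((nrm U)^-1 *: U); last by rewrite nrm_SZ// ger0_norm// invr_ge0.
  split; first exact: PZ.
  by rewrite nrm_scale// ger0_norm ?invr_ge0// mulVf.
have cC : c <= sup A.
  have := bd _ PY; have [Y0|Yn0] := eqVneq (nrm Y) 0.
    by move: Yc; rewrite Y0 !mulr0 => h1 h2; have := lt_le_trans h1 h2; rewrite ltxx.
  have Yp : 0 < nrm Y by rewrite lt_def Yn0 nrm_ge0.
  by move=> h; have := lt_le_trans Yc h; rewrite ltr_pM2r// => /ltW.
have sp : 0 < sup A / 4 by rewrite divr_gt0// (lt_le_trans c0).
have [_ [z [Pz z1] <-] zP] := sup_adherent sp supA.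
exists (sup A), z; split=> //; apply: le_trans (ltW zP).
by move: (sup A) sp => s sp; lra.
Qed.

(** One of [s = c] and [s = - c] works: if both failed, the triangle inequality for
    [2 c z = (x + c z) - (x - c z)] would be violated. *)
Lemma gliding t (c : R) x z : 0 <= t -> 0 <= c -> P x -> P z ->
  exists s, `|s| = c /\ c * nrm (S t z) <= nrm (S t (x + s *: z)).
Proof.
move=> t0 c0 Px Pz.
have [h|h1] := leP (c * nrm (S t z)) (nrm (S t (x + c *: z))).
  by exists c; rewrite ger0_norm.
have [h|h2] := leP (c * nrm (S t z)) (nrm (S t (x + (- c) *: z))).
  by exists (- c); rewrite normrN ger0_norm.
have := nrm_SD (-1) t0 (PD c Px Pz) (PD (- c) Px Pz).
have -> : x + c *: z + -1 *: (x + - c *: z) = (2 * c) *: z.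
  by rewrite scaleN1r opprD addrACA subrr add0r scaleNr opprK -scalerDl mulr2n mulrDl mul1r.
rewrite nrm_SZ// normrN normr1 mul1r ger0_norm ?mulr_ge0//.
move: h1 h2; move: (nrm (S t _)) (nrm (S t _)) (nrm (S t _)) => p q r h1 h2 h3.
by exfalso; lra.
Qed.

(* Uniform boundedness near time 0, by Sokal's gliding hump argument. *)
Lemma local_bound : exists M h0 : R, [/\ 1 <= M, 0 < h0 &
  forall h U, 0 <= h -> h <= h0 -> P U -> nrm (S h U) <= M * nrm U].
Proof.
apply: contrapT => H.
have /choice [g gP] : forall n : nat, exists q : R * R * V,
    [/\ 0 <= q.1.1, q.1.1 <= n.+1%:R^-1, 4 ^+ n <= q.1.2 /\ P q.2, nrm q.2 <= 1 /\
      3 / 4 * q.1.2 <= nrm (S q.1.1 q.2) &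
      forall U, P U -> nrm (S q.1.1 U) <= q.1.2 * nrm U].
  move=> n; have [h [h0 hn [Y PY Yn]]] : exists h, [/\ 0 <= h, h <= n.+1%:R^-1 &
      exists2 Y, P Y & 4 ^+ n * nrm Y < nrm (S h Y)].
    apply: contrapT => H2; apply: H; exists (4 ^+ n), n.+1%:R^-1; split.
    - by rewrite exprn_ege1// ler1n.
    - by rewrite invr_gt0.
    - move=> h U h0 hn PU; rewrite leNgt; apply/negP => lt.
      by apply: H2; exists h; split=> //; exists U.
  have [C [z [cC Pz z1 zC CP]]] := op_norm h0 (exprn_gt0 n (ltr0n R 4)) PY Yn.
  by exists (h, C, z).
pose h n := (g n).1.1; pose C n := (g n).1.2; pose z n := (g n).2.
pose e (n : nat) : R := 3^-1 ^+ n.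
have e0 n : 0 < e n by rewrite exprn_gt0// invr_gt0.
have h0 n : 0 <= h n by have [] := gP n.
have hn n : h n <= n.+1%:R^-1 by have [] := gP n.
have CPn n : 4 ^+ n <= C n by have [_ _ []] := gP n.
have Pz n : P (z n) by have [_ _ []] := gP n.
have z1 n : nrm (z n) <= 1 by have [_ _ _ []] := gP n.
have zC n : 3 / 4 * C n <= nrm (S (h n) (z n)) by have [_ _ _ []] := gP n.
have CU n U : P U -> nrm (S (h n) U) <= C n * nrm U by have [_ _ _ _] := gP n; apply.
have /choice [sg sgP] : forall q : nat * V, exists s : R, P q.2 ->
    `|s| = e q.1 /\ e q.1 * nrm (S (h q.1) (z q.1)) <= nrm (S (h q.1) (q.2 + s *: z q.1)).
  move=> [n x] /=; have [Px|] := pselect (P x); last by exists 0.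
  by have [s sP] := gliding (h0 n) (ltW (e0 n)) Px (Pz n); exists s.
pose x := fix x n := if n is k.+1 then x k + sg (k, x k) *: z k else 0.
have Px n : P (x n) by elim: n => [//|n IH]; exact: PD.
have xS n : nrm (x n.+1 - x n) <= e n.
  rewrite /= addrC addKr nrm_scale//; have [-> _] := sgP (n, x n) (Px n).
  by rewrite -[leRHS]mulr1 ler_pM2l.
have eS n : e n.+1 = e n / 3 by rewrite /e exprSr.
have xk n k : nrm (x (n + k)%N - x n) <= 3 / 2 * (e n - e (n + k)%N).
  elim: k => [|k IH]; first by rewrite addn0 !subrr nrm0 mulr0.
  rewrite addnS; apply: le_trans (nrm_tri (Px _) (Px (n + k)%N) (Px n)) _.
  have := xS (n + k)%N; rewrite eS; move: IH (e0 n); move: (nrm _) (nrm _) => p q; lra.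
pose b n := 3 / 2 * e n.
have b0 : b @ \oo --> 0.
  rewrite -[X in _ --> X](mulr0 (3 / 2)); apply: cvgM; first exact: cvg_cst.
  by apply: cvg_expr; rewrite ger0_norm ?invr_ge0// invf_lt1// ltr1n.
have xd n m : (n <= m)%N -> nrm (x m - x n) <= b n.
  move=> nm; have := xk n (m - n)%N; rewrite subnKC// => h1; apply: le_trans h1 _.
  by rewrite ler_pM2l ?divr_gt0// gerBl ltW.
have b0' n : 0 <= b n by rewrite mulr_ge0 ?divr_ge0 ?(ltW (e0 n)).
have [y Py xy] : exists2 U, P U & (fun n => nrm (x n - U)) @ \oo --> 0.
  apply: nrm_complete b0 _ => // n m; have [nm|/ltnW mn] := leqP n m.
    by rewrite nrm_sym//; apply: le_trans (xd _ _ nm) _; rewrite lerDl.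
  by apply: le_trans (xd _ _ mn) _; rewrite lerDr.
have yd n : nrm (y - x n) <= b n.
  apply/ler_addgt0Pr => d d0; have /cvgrPdist_le /(_ _ d0) [k _ kP] := xy.
  have := kP (maxn n k) (leq_maxr _ _); rewrite /= sub0r normrN ger0_norm// => h1.
  apply: le_trans (nrm_tri Py (Px (maxn n k)) (Px n)) _; rewrite addrC lerD//.
    by apply: xd; exact: leq_maxl.
  by rewrite nrm_sym.
(* The hump of step [n] contributes [3/4 e_n C_n]. Later steps move the limit by at most [e_n / 2],
   which [S (h n)] magnifies by at most [C_n], so a quarter of [e_n C_n >= (4/3)^n] remains. *)
have big n : 4^-1 * (4 / 3) ^+ n <= nrm (S (h n) y).
  have h1 := CU n _ (PB (Px n.+1) Py); rewrite -nrm_SB// in h1.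
  have h2 := nrm_subl (SP (h0 n) (Px n.+1)) (SP (h0 n) Py).
  have [_ /= h3] := sgP (n, x n) (Px n); rewrite -/(x n.+1) in h3.
  have h4 := yd n.+1; rewrite nrm_sym// /b eS in h4.
  have h5 := zC n; have h6 := CPn n.
  have -> : (4 / 3) ^+ n = e n * 4 ^+ n by rewrite /e expr_div_n exprVn mulrC.
  have c0 : 0 < C n by rewrite (lt_le_trans _ h6)// exprn_gt0.
  have h7 : e n * (3 / 4 * C n) <= e n * nrm (S (h n) (z n)) by rewrite ler_pM2l.
  have h8 : C n * nrm (x n.+1 - y) <= C n * (3 / 2 * (e n / 3)) by rewrite ler_pM2l.
  have h9 : e n * 4 ^+ n <= e n * C n by rewrite ler_pM2l.
  move: h1 h2 h3 h7 h8 h9; clear; move: (nrm _) (nrm _) (nrm _) (nrm _) (nrm _) => p q r s t.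
  by move: (e n) (C n) (4 ^+ n) => a c d; lra.
have [eta eta0 etaP] := Scont0 Py (ltr01 : 0 < 1 :> R).
(* For [n > K] the time [h n] is below [eta], so strong continuity bounds [S (h n) y] by
   [nrm y + 1]; the factor 12 is what [(1 + n / 3) / 4] needs in order to exceed this. *)
pose K := Num.max eta^-1 (12 * (nrm y + 1)).
have K0 : 0 <= K by rewrite le_max invr_ge0 ltW.
pose n := Num.Def.archi_bound K; have nK : K < n%:R by exact: archi_boundP.
have hneta : h n < eta.
  apply: le_lt_trans (hn n) _; rewrite invf_plt ?posrE//.
  apply: le_lt_trans (_ : eta^-1 <= K) _; first by rewrite le_max lexx.
  by apply: lt_trans nK _; rewrite ltr_nat.
have h1 := etaP _ (h0 n) hneta; have h2 := nrm_subl (SP (h0 n) Py) Py; have h3 := big n.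
have bern k : 1 + k%:R / 3 <= (4 / 3) ^+ k :> R.
  elim: k => [|k IH]; first by rewrite mul0r addr0 expr0.
  rewrite exprS -natr1; have k0 : 0 <= k%:R :> R by [].
  by move: (_ ^+ k) (k%:R) IH k0 => p q IH k0; lra.
have h4 := bern n.
have h5 : 12 * (nrm y + 1) < n%:R by apply: le_lt_trans nK; rewrite le_max lexx orbT.
exact: gliding_contra h1 h2 h3 h4 h5.
Qed.

(** Equality in the quotient of [P] by the states of zero seminorm, the only sense in which the
    semigroup laws and the linearity of [S] hold. *)
Definition eqv U W := [/\ P U, P W & nrm (U - W) = 0].

Lemma eqv_refl U : P U -> eqv U U.
Proof. by move=> PU; split=> //; rewrite subrr nrm0. Qed.

Lemma eqv_sym U W : eqv U W -> eqv W U.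
Proof. by move=> [PU PW e]; split=> //; rewrite nrm_sym. Qed.

Lemma eqv_trans W U Y : eqv U W -> eqv W Y -> eqv U Y.
Proof. by move=> [PU PW e] [_ PY e']; split=> //; rewrite (nrm_eq0l PU PW PY e). Qed.

Lemma eqv_nrm U W : eqv U W -> nrm U = nrm W.
Proof. by move=> [PU PW e]; exact: nrm_eq0. Qed.

Lemma eqvD U U' c W W' : eqv U U' -> eqv W W' -> eqv (U + c *: W) (U' + c *: W').
Proof.
move=> [PU PU' e] [PW PW' e']; split; [exact: PD|exact: PD|].
have -> : U + c *: W - (U' + c *: W') = (U - U') + c *: (W - W').
  by rewrite opprD addrACA scalerBr.
apply/eqP; rewrite eq_le nrm_ge0 andbT.
by apply: le_trans (nrmD c (PB PU PU') (PB PW PW')) _; rewrite e e' mulr0 addr0.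
Qed.

Lemma eqvZ c W W' : eqv W W' -> eqv (c *: W) (c *: W').
Proof. by move=> h; have := eqvD c (eqv_refl P0) h; rewrite !add0r. Qed.

Lemma eqvS t U W : 0 <= t -> eqv U W -> eqv (S t U) (S t W).
Proof.
move=> t0 [PU PW e]; split; [exact: SP|exact: SP|rewrite nrm_SB//].
have [C CP] := Sbd t0; apply/eqP; rewrite eq_le nrm_ge0 andbT.
by have := CP _ (PB PU PW); rewrite e mulr0.
Qed.

Lemma eqvSD t U c W : 0 <= t -> P U -> P W -> eqv (S t (U + c *: W)) (S t U + c *: S t W).
Proof.
move=> t0 PU PW; split; [by apply: SP => //; exact: PD|by apply: PD; exact: SP|exact: Slin].
Qed.

Lemma eqvS0 t : 0 <= t -> eqv (S t 0) 0.
Proof. by move=> t0; split=> //; [exact: SP|rewrite subr0 nrm_S0]. Qed.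

Lemma eqvSZ t c W : 0 <= t -> P W -> eqv (S t (c *: W)) (c *: S t W).
Proof.
move=> t0 PW; have := eqvSD c t0 P0 PW; rewrite add0r => /eqv_trans; apply.
have := eqvD c (eqvS0 t0) (eqv_refl (SP t0 PW)); rewrite add0r; apply.
Qed.

Lemma eqvS_add s t U : 0 <= s -> 0 <= t -> P U -> eqv (S (s + t) U) (S s (S t U)).
Proof.
move=> s0 t0 PU; split; [by apply: SP => //; exact: addr_ge0| |exact: Sadd].
by apply: SP => //; exact: SP.
Qed.

Lemma eqvS_comm s t U : 0 <= s -> 0 <= t -> P U -> eqv (S s (S t U)) (S t (S s U)).
Proof.
move=> s0 t0 PU; apply: eqv_trans (eqvS_add t0 s0 PU); rewrite addrC.
exact/eqv_sym/eqvS_add.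
Qed.

Lemma P_sum n (a : nat -> R) (F : nat -> V) : (forall i, (i < n)%N -> P (F i)) ->
  P (\sum_(i < n) a i *: F i).
Proof.
elim: n => [|n IH] PF; first by rewrite big_ord0.
by rewrite big_ord_recr/=; apply: PD; [apply: IH => i /ltnW; exact: PF|exact: PF].
Qed.

Lemma eqvS_sum t n (a : nat -> R) (F F' : nat -> V) : 0 <= t ->
  (forall i, (i < n)%N -> P (F i) /\ eqv (S t (F i)) (F' i)) ->
  eqv (S t (\sum_(i < n) a i *: F i)) (\sum_(i < n) a i *: F' i).
Proof.
move=> t0; elim: n => [|n IH] PF; first by rewrite !big_ord0; exact: eqvS0.
rewrite !big_ord_recr/=; have [PFn en] := PF n (ltnSn n).
have PF' i : (i < n)%N -> P (F i) /\ eqv (S t (F i)) (F' i) by move=> /ltnW; exact: PF.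
have PS : P (\sum_(i < n) a i *: F i) by apply: P_sum => i /PF' [].
apply: eqv_trans (eqvSD _ t0 PS PFn) _.
by apply: eqvD => //; exact: IH.
Qed.

Lemma nrm_sum n (a : nat -> R) (F : nat -> V) Y (q : R) :
  (forall i, (i < n)%N -> [/\ 0 <= a i, P (F i) & nrm (F i - Y) <= q]) -> P Y ->
  nrm (\sum_(i < n) a i *: F i - (\sum_(i < n) a i) *: Y) <= (\sum_(i < n) a i) * q.
Proof.
move=> H PY; elim: n H => [|n IH] H; first by rewrite !big_ord0 scale0r subrr nrm0 mul0r.
rewrite !big_ord_recr/=; have [an PFn qn] := H n (ltnSn n).
have H' i : (i < n)%N -> [/\ 0 <= a i, P (F i) & nrm (F i - Y) <= q].
  by move=> /ltnW; exact: H.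
rewrite scalerDl opprD addrACA -scalerBr mulrDl.
apply: le_trans (nrmD _ _ _) _; [|exact: PB|].
  by apply: PB; [apply: P_sum => i /H' []|exact: PZ].
by rewrite lerD ?IH// ger0_norm// ler_wpM2l.
Qed.

Definition dq h U : V := h^-1 *: (S h U + -1 *: U).

Definition gen U Z := forall e, 0 < e -> exists2 eta, 0 < eta & forall h, 0 < h -> h < eta ->
  nrm (dq h U + -1 *: Z) < e.

Lemma P_dq h U : 0 <= h -> P U -> P (dq h U).
Proof. by move=> h0 PU; apply: PZ; apply: PD => //; exact: SP. Qed.

Lemma dqS h t U : 0 <= h -> 0 <= t -> P U -> eqv (dq h (S t U)) (S t (dq h U)).
Proof.
move=> h0 t0 PU; have PS := SP h0 PU; have PSt := SP t0 PU.
apply/eqv_sym; apply: eqv_trans (eqvSZ _ t0 (PD _ PS PU)) _; apply: eqvZ.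
apply: eqv_trans (eqvSD _ t0 PS PU) _; apply: eqvD; last exact: eqv_refl.
exact: eqvS_comm.
Qed.

(** [S t] is bounded and commutes with difference quotients, so it preserves the domain of the
    generator and commutes with it. *)
Lemma genS t U Z : 0 <= t -> P U -> P Z -> gen U Z -> gen (S t U) (S t Z).
Proof.
move=> t0 PU PZ gU e e0; have [C CP] := Sbd t0.
have C1 : 0 < `|C| + 1 by rewrite ltr_wpDl.
have [eta eta0 etaP] := gU (e / (`|C| + 1)) (divr_gt0 e0 C1).
exists eta => // h h0 heta; have Pq := P_dq (ltW h0) PU.
have PQ : P (dq h U + -1 *: Z) by exact: PD.
have -> : nrm (dq h (S t U) + -1 *: S t Z) = nrm (S t (dq h U + -1 *: Z)).
  apply: eqv_nrm; apply: eqv_trans (eqv_sym (eqvSD _ t0 Pq PZ)).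
  by apply: eqvD; [apply: dqS => //; exact: ltW|apply: eqv_refl; exact: SP].
apply: le_lt_trans (CP _ PQ) _; apply: (@le_lt_trans _ _ ((`|C| + 1) * nrm (dq h U + -1 *: Z))).
  by rewrite ler_wpM2r// (le_trans (ler_norm C))// lerDl.
by rewrite mulrC -ltr_pdivlMr//; exact: etaP.
Qed.

Lemma genD U Z c W Y : P U -> P Z -> P W -> P Y -> gen U Z -> gen W Y ->
  gen (U + c *: W) (Z + c *: Y).
Proof.
move=> PU PZ PW PY gU gW e e0; have c1 : 0 < `|c| + 1 by rewrite ltr_wpDl.
have e2 : 0 < e / 2 by rewrite divr_gt0.
have [a a0 aP] := gU _ e2; have [b b0 bP] := gW _ (divr_gt0 e2 c1).
exists (Num.min a b); first by rewrite lt_min a0.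
move=> h h0; rewrite lt_min => /andP[ha hb].
have h1 := aP h h0 ha; have h2 := bP h h0 hb; have h0' := ltW h0.
have P1 := P_dq h0' PU; have P2 := P_dq h0' PW.
have -> : nrm (dq h (U + c *: W) + -1 *: (Z + c *: Y)) =
    nrm ((dq h U + -1 *: Z) + c *: (dq h W + -1 *: Y)).
  apply: eqv_nrm; have -> : dq h U + -1 *: Z + c *: (dq h W + -1 *: Y) =
      (h^-1 *: ((S h U + c *: S h W) + -1 *: (U + c *: W))) + -1 *: (Z + c *: Y).
    rewrite /dq !scaleN1r !opprD !scalerDr !scalerN !scalerA ![c * _]mulrC -!addrA.
    congr (_ + _); rewrite [RHS]addrCA; congr (_ + _).
    by rewrite [X in _ = _ + X]addrCA [RHS]addrCA.
  apply: eqvD; last by apply: eqv_refl; exact: PD.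
  apply: eqvZ; apply: eqvD; last by apply: eqv_refl; exact: PD.
  exact: eqvSD.
apply: le_lt_trans (nrmD _ (PD _ P1 PZ) (PD _ P2 PY)) _.
rewrite [ltRHS]splitr; apply: ltr_leD => //.
apply: (@le_trans _ _ ((`|c| + 1) * nrm (dq h W + -1 *: Y))); first by rewrite ler_wpM2r// lerDl.
by rewrite mulrC -ler_pdivlMr// ltW.
Qed.

Lemma gen0 : gen 0 0.
Proof.
move=> e e0; exists 1 => // h h0 _; rewrite scaler0 addr0.
by rewrite /dq scaler0 addr0 (eqv_nrm (eqvZ _ (eqvS0 (ltW h0)))) scaler0 nrm0.
Qed.

Hypothesis gen_onto : forall U, P U -> exists K, P K /\ gen K U.

(* [U] is the limit of the difference quotients at 0 of the orbit of [K],
   where [K] is mapped to [U] by the generator, and these lie in its domain. *)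
Lemma gen_dense U e : P U -> 0 < e -> exists W Y, [/\ P W, P Y, gen W Y & nrm (W - U) < e].
Proof.
move=> PU e0; have [K [PK gK]] := gen_onto PU; have [eta eta0 etaP] := gK _ e0.
pose h := eta / 2; have h0 : 0 < h by rewrite divr_gt0.
have h1 : h < eta by rewrite ltr_pdivrMr// ltr_pMr// ltr1n.
have PS := SP (ltW h0) PK; have PSU := SP (ltW h0) PU.
exists (dq h K), (dq h U); split; [exact: P_dq (ltW h0) PK|exact: P_dq (ltW h0) PU| |].
  have g1 := genD (-1) PS PSU PK PU (genS (ltW h0) PK PU gK) gK.
  have := genD h^-1 P0 P0 (PD _ PS PK) (PD _ PSU PU) gen0 g1.
  by rewrite !add0r.
by have := etaP h h0 h1; rewrite scaleN1r.
Qed.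

Variable T : R.

Definition form_family (B : R -> V -> V -> R) := exists C : R,
  [/\ 0 <= C, forall t U c U' W, 0 <= t -> t <= T -> P U -> P U' -> P W ->
        B t (U + c *: U') W = B t U W + c * B t U' W,
      forall t U W, 0 <= t -> t <= T -> P U -> P W -> B t U W = B t W U,
      forall t U W, 0 <= t -> t <= T -> P U -> P W -> `|B t U W| <= C * (nrm U * nrm W) &
      forall s t U W, 0 <= s -> s <= T -> 0 <= t -> t <= T -> P U -> P W ->
        `|B s U W - B t U W| <= C * `|s - t| * (nrm U * nrm W)].

Definition form_derivative (B B' : R -> V -> V -> R) := exists2 C : R, 0 <= C &
  forall t h U, 0 <= t -> 0 <= h -> t + h <= T -> P U ->
    `|B (t + h) U U - B t U U - h * B' t U U| <= C * h ^+ 2 * nrm U ^+ 2.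

(** Joint continuity in time and both arguments. Imposing [r <= 1] bounds [nrm W'] by [nrm W + 1]
    before the errors are estimated. *)
Lemma form_near B t U W e : form_family B -> 0 <= t -> t <= T -> P U -> P W -> 0 < e ->
  exists2 r, 0 < r & forall s U' W', 0 <= s -> s <= T -> `|s - t| < r -> P U' -> P W' ->
    nrm (U' - U) < r -> nrm (W' - W) < r -> `|B s U' W' - B t U W| < e.
Proof.
move=> [C [C0 lin sym bd lip]] t0 tT PU PW e0.
pose K := C * (nrm W + 1 + nrm U + nrm U * nrm W) + 1.
have q0 : 0 <= nrm W + 1 + nrm U + nrm U * nrm W by rewrite !addr_ge0 ?mulr_ge0.
have K0 : 0 < K by rewrite ltr_wpDl// mulr_ge0.
pose r := Num.min 1 (e / K); have r0 : 0 < r by rewrite lt_min ltr01 divr_gt0.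
exists r => // s U' W' s0 sT sr PU' PW' Ur Wr.
have -> : B s U' W' - B t U W = B s (U' - U) W' + B s U (W' - W) + (B s U W - B t U W).
  rewrite -[U' - U]/(U' + - U) -scaleN1r lin// [B s U (W' - W)]sym//; last exact: PB.
  rewrite -scaleN1r lin// ![B s _ U]sym//; ring.
have r1 : r <= 1 by rewrite ge_min lexx.
have nW' : nrm W' <= nrm W + 1.
  by apply: le_trans (nrm_subl PW' PW) _; rewrite lerD2l (le_trans (ltW Wr)).
have b1 : `|B s (U' - U) W'| <= C * (r * (nrm W + 1)).
  apply: le_trans (bd _ _ _ s0 sT (PB PU' PU) PW') _; apply: ler_wpM2l => //.
  by apply: ler_pM => //; exact: ltW.
have b2 : `|B s U (W' - W)| <= C * (nrm U * r).
  apply: le_trans (bd _ _ _ s0 sT PU (PB PW' PW)) _; apply: ler_wpM2l => //.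
  by apply: ler_wpM2l => //; exact: ltW.
have b3 : `|B s U W - B t U W| <= C * r * (nrm U * nrm W).
  apply: le_trans (lip _ _ _ _ s0 sT t0 tT PU PW) _; apply: ler_wpM2r.
    by rewrite mulr_ge0.
  by apply: ler_wpM2l => //; exact: ltW.
apply: le_lt_trans (ler_normD _ _) _.
apply: le_lt_trans (lerD (le_trans (ler_normD _ _) (lerD b1 b2)) b3) _.
have -> : C * (r * (nrm W + 1)) + C * (nrm U * r) + C * r * (nrm U * nrm W) =
  r * (C * (nrm W + 1 + nrm U + nrm U * nrm W)) by ring.
apply: (@lt_le_trans _ _ (r * K)); first by rewrite ltr_pM2l// ltrDl.
by rewrite -ler_pdivlMr// ge_min lexx orbT.
Qed.

Lemma form_eqv B t U U' W W' : form_family B -> 0 <= t -> t <= T ->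
  eqv U U' -> eqv W W' -> B t U W = B t U' W'.
Proof.
move=> fB t0 tT [PU PU' eU] [PW PW' eW]; apply/eqP; rewrite -subr_eq0 -normr_le0.
apply/ler_addgt0Pr => e e0; rewrite add0r.
have [r r0 rP] := form_near fB t0 tT PU' PW' e0.
by apply/ltW/rP => //; rewrite ?subrr ?normr0 ?eU ?eW.
Qed.

(** First-order expansion along a step whose slope [D] is only close to [Y]. The number [q] collects
    the coefficients of all error terms, and [r <= e / (C q + 1)] makes their sum at most [e]. *)
Lemma form_step B B' t W Y e : form_family B -> form_family B' -> form_derivative B B' ->
  0 <= t -> t <= T -> P W -> P Y -> 0 < e ->
  exists2 r, 0 < r & forall s D W', 0 < s -> s < r -> t + s <= T -> P D ->
    nrm (D - Y) < r -> eqv W' (W + s *: D) ->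
    B (t + s) W' W' <= B t W W + s * (B' t W W + 2 * B t W Y + e).
Proof.
move=> fB fB' [C3 C30 der] t0 tT PW PY e0.
have [C1 [C10 lin sym bd _]] := fB; have [C2 [C20 lin' sym' bd' _]] := fB'.
pose n := nrm W; pose y := nrm Y + 1; pose C := C1 + C2 + C3.
have n0 : 0 <= n by exact: nrm_ge0.
have y0 : 0 <= y by rewrite addr_ge0.
have C0 : 0 <= C by rewrite !addr_ge0.
pose q := 2 * n + y ^+ 2 + 2 * n * y + y ^+ 2 + (n + y) ^+ 2.
have q0 : 0 <= q by rewrite /q; nneg.
have K0 : 0 < C * q + 1 by rewrite ltr_wpDl// mulr_ge0.
pose r := Num.min 1 (e / (C * q + 1)); have r0 : 0 < r by rewrite lt_min ltr01 divr_gt0.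
have r1 : r <= 1 by rewrite ge_min lexx.
exists r => // s D W' s0 sr tsT PD_ Dr eW; have s0' := ltW s0.
have s1 : s <= 1 by rewrite (le_trans (ltW sr)).
have nD : nrm D <= y.
  by apply: le_trans (nrm_subl PD_ PY) _; rewrite lerD2l (le_trans (ltW Dr)).
have [PW' _ _] := eW.
have nW' : nrm W' <= n + y.
  rewrite (eqv_nrm eW); apply: le_trans (nrmD s PW PD_) _; rewrite lerD2l ger0_norm//.
  by rewrite -[leRHS]mul1r ler_pM.
have expand B0 : (forall U c U' Z, P U -> P U' -> P Z ->
      B0 (U + c *: U') Z = B0 U Z + c * B0 U' Z) ->
    (forall U Z, P U -> P Z -> B0 U Z = B0 Z U) ->
    B0 (W + s *: D) (W + s *: D) = B0 W W + 2 * s * B0 W D + s ^+ 2 * B0 D D.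
  move=> l sy; have PWD := PD s PW PD_.
  rewrite l// [B0 W _]sy// [B0 D _]sy// !l// [B0 D W]sy//; ring.
have eB : B t W' W' = B t W W + 2 * s * B t W D + s ^+ 2 * B t D D.
  rewrite (form_eqv fB t0 tT eW eW); apply: expand => *; [exact: lin|exact: sym].
have eB' : B' t W' W' = B' t W W + 2 * s * B' t W D + s ^+ 2 * B' t D D.
  rewrite (form_eqv fB' t0 tT eW eW); apply: expand => *; [exact: lin'|exact: sym'].
have := der t s W' t0 s0' tsT PW'; rewrite ler_norml => /andP[_ h1].
have h2 : nrm W' ^+ 2 <= (n + y) ^+ 2 by rewrite ler_sqr ?nnegrE ?addr_ge0.
have h3 : B t W D <= B t W Y + C1 * (n * r).
  have -> : B t W D = B t W Y + B t W (D - Y).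
    rewrite ![B t W _]sym//; [|exact: PB]; rewrite -scaleN1r lin//; ring.
  rewrite lerD2l; apply: le_trans (ler_norm _) _.
  apply: le_trans (bd _ _ _ t0 tT PW (PB PD_ PY)) _.
  by apply: ler_wpM2l => //; apply: ler_wpM2l => //; exact: ltW.
have nDD : nrm D * nrm D <= y ^+ 2 by rewrite expr2 ler_pM.
have h4 : B t D D <= C1 * y ^+ 2.
  by apply: le_trans (ler_norm _) _; apply: le_trans (bd _ _ _ t0 tT PD_ PD_) _; exact: ler_wpM2l.
have h5 : B' t D D <= C2 * y ^+ 2.
  by apply: le_trans (ler_norm _) _; apply: le_trans (bd' _ _ _ t0 tT PD_ PD_) _; exact: ler_wpM2l.
have h6 : B' t W D <= C2 * (n * y).
  apply: le_trans (ler_norm _) _; apply: le_trans (bd' _ _ _ t0 tT PW PD_) _.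
  by apply: ler_wpM2l => //; exact: ler_wpM2l.
have H1 : s * B t W D <= s * (B t W Y + C1 * (n * r)) by rewrite ler_wpM2l.
have H2 : s ^+ 2 * B t D D <= s * (r * (C1 * y ^+ 2)).
  rewrite expr2 -mulrA ler_wpM2l//; apply: (@le_trans _ _ (s * (C1 * y ^+ 2))).
    by rewrite ler_wpM2l.
  by rewrite ler_wpM2r ?mulr_ge0 ?sqr_ge0// ltW.
have H3 : s * (2 * s * B' t W D) <= s * (r * (2 * (C2 * (n * y)))).
  rewrite ler_wpM2l//; apply: (@le_trans _ _ (s * (2 * (C2 * (n * y))))).
    by rewrite [2 * s]mulrC -mulrA ler_wpM2l// ler_wpM2l.
  by rewrite ler_wpM2r ?mulr_ge0// ltW.
have H4 : s * (s ^+ 2 * B' t D D) <= s * (r * (C2 * y ^+ 2)).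
  rewrite ler_wpM2l//; apply: (@le_trans _ _ (s * (C2 * y ^+ 2))); last first.
    by rewrite ler_wpM2r ?mulr_ge0 ?sqr_ge0// ltW.
  apply: (@le_trans _ _ (s ^+ 2 * (C2 * y ^+ 2))); first by rewrite ler_wpM2l ?sqr_ge0.
  by rewrite ler_wpM2r ?mulr_ge0 ?sqr_ge0// expr2 ler_piMl.
have H5 : C3 * s ^+ 2 * nrm W' ^+ 2 <= s * (r * (C3 * (n + y) ^+ 2)).
  apply: (@le_trans _ _ (C3 * s ^+ 2 * (n + y) ^+ 2)).
    by rewrite ler_wpM2l ?mulr_ge0 ?sqr_ge0.
  have -> : C3 * s ^+ 2 * (n + y) ^+ 2 = s * (s * (C3 * (n + y) ^+ 2)) by ring.
  apply: ler_wpM2l => //; apply: ler_wpM2r; last exact: ltW.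
  by nneg.
have H6 : 2 * (C1 * (n * r)) + r * (C1 * y ^+ 2) + r * (2 * (C2 * (n * y))) +
    r * (C2 * y ^+ 2) + r * (C3 * (n + y) ^+ 2) <= e.
  rewrite (_ : 2 * (C1 * (n * r)) = r * (2 * (C1 * n))); last by ring.
  apply: (@le_trans _ _ (r * (C * q + 1))); last by rewrite -ler_pdivlMr// ge_min lexx orbT.
  have -> : r * (C * q + 1) = r * (2 * (C1 * n)) + r * (C1 * y ^+ 2) +
      r * (2 * (C2 * (n * y))) + r * (C2 * y ^+ 2) + r * (C3 * (n + y) ^+ 2) +
      r * (C1 * (2 * n * y + y ^+ 2 + (n + y) ^+ 2) +
      C2 * (2 * n + y ^+ 2 + (n + y) ^+ 2) + C3 * (2 * n + y ^+ 2 + 2 * n * y + y ^+ 2) + 1).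
    by rewrite /C /q; ring.
  by rewrite lerDl; nneg.
have H7 := ler_wpM2l s0' H6.
move: h1; rewrite eB' eB => h1; exact: form_step_arith h1 H1 H2 H3 H4 H5 H7.
Qed.

(** * Dissipation of a form along the free flow *)

Variables B B' d : R -> V -> V -> R.
Hypotheses (fB : form_family B) (fB' : form_family B') (fd : form_family d).
Hypothesis derB : form_derivative B B'.
Hypothesis diss : forall t U Z, 0 <= t -> t <= T -> P U -> P Z -> gen U Z ->
  B' t U U + 2 * B t U Z <= - d t U U.

(** In the domain of the generator the right derivative of the form along the orbit is at most
    [- d <= - c], and [dini_le] integrates this. The local bound [M] gives the left continuity of
    the orbit: up to a null state [S s U - S q U] is [S q] applied to [S (s - q) U - U]. *)
Lemma flow_domain M h0 t h U Z c : 1 <= M -> 0 < h0 ->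
  (forall r W, 0 <= r -> r <= h0 -> P W -> nrm (S r W) <= M * nrm W) ->
  0 <= t -> 0 <= h -> t + h <= T -> P U -> P Z -> gen U Z ->
  (forall s, 0 <= s -> s <= h -> c <= d (t + s) (S s U) (S s U)) ->
  h <= h0 -> B (t + h) (S h U) (S h U) <= B t U U - h * c.
Proof.
move=> M1 h00 MP t0 hh0 thT PU PZ gU cd hh.
have M0 : 0 < M by rewrite (lt_le_trans ltr01).
have tsT s : s <= h -> t + s <= T by move=> sh; apply: le_trans thT; rewrite lerD2l.
apply/ler_addgt0Pr => e0 e00.
have h1 : 0 < h + 1 by rewrite ltr_wpDl.
pose e := e0 / (h + 1); have ep : 0 < e by rewrite divr_gt0.
have eh : e * h <= e0.
  by rewrite /e mulrAC ler_pdivrMr// ler_wpM2l ?(ltW e00)// lerDl.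
pose f s := B (t + s) (S s U) (S s U).
have f0 : f 0 = B t U U.
  have tT : t <= T by have := tsT 0 hh0; rewrite addr0.
  by rewrite /f addr0; apply: form_eqv => //; split=> //; [exact: SP|exact: S0|exact: SP|exact: S0].
suff hf : f h <= f 0 + (- c + e) * h.
  apply: le_trans hf _; rewrite f0 mulrDl addrA lerD// mulNr mulrC lexx//.
apply: dini_le => // [s s0 sh|s e1 s0 sh e10].
  have PSs := SP s0 PU; have PZs := SP s0 PZ.
  have ts0 : 0 <= t + s by rewrite addr_ge0.
  have tsT' := tsT _ (ltW sh).
  have [r r0 rP] := form_step fB fB' derB ts0 tsT' PSs PZs ep.
  have [eta eta0 etaP] := genS s0 PU PZ gU r0.
  exists (Num.min r eta); first by rewrite lt_min r0.
  move=> q q0; rewrite lt_min => /andP[qr qeta] sqh; have q0' := ltW q0.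
  have := rP q (dq q (S s U)) (S (s + q) U) q0 qr.
  rewrite -addrA => /(_ (tsT _ sqh)) /(_ (P_dq q0' PSs)).
  rewrite -scaleN1r => /(_ (etaP q q0 qeta)).
  have -> : S s U + q *: dq q (S s U) = S q (S s U).
    by rewrite /dq scalerA divff ?gt_eqF// scale1r scaleN1r addrC subrK.
  have ee := eqvS_add q0' s0 PU; rewrite (addrC q s) in ee.
  move=> /(_ ee) h2; rewrite /f; apply: le_trans h2 _.
  rewrite lerD2l mulrC ler_wpM2r// lerD2r.
  apply: le_trans (diss ts0 tsT' PSs PZs (genS s0 PU PZ gU)) _.
  by rewrite lerN2; apply: cd => //; exact: ltW.
have PSs := SP (ltW s0) PU.
have ts0 : 0 <= t + s by rewrite addr_ge0// ltW.
have [r r0 rP] := form_near fB ts0 (tsT _ sh) PSs PSs e10.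
have [eta eta0 etaP] := Scont0 PU (divr_gt0 r0 M0).
exists (Num.min r eta); first by rewrite lt_min r0.
move=> q q0; rewrite ltrBlDr -ltrBlDl lt_min => /andP[qr qeta] qs.
have sq0 : 0 <= s - q by rewrite subr_ge0 ltW.
have qh : q <= h0 by rewrite (le_trans (ltW qs))// (le_trans sh).
have near : nrm (S q U - S s U) < r.
  have e1' : eqv (S s U) (S q (S (s - q) U)).
    by have := eqvS_add q0 sq0 PU; rewrite addrC subrK.
  have PSsq := SP sq0 PU.
  have [_ PSq _] := e1'.
  rewrite nrm_sym//; last exact: SP.
  rewrite (nrm_eq0l _ _ _ (let: And3 _ _ h := e1' in h))//; last exact: SP.
  rewrite nrm_SB//; apply: le_lt_trans (MP _ _ q0 qh (PB PSsq PU)) _.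
  by rewrite mulrC -ltr_pdivlMr//; exact: etaP.
have tqT := tsT _ (le_trans (ltW qs) sh).
have := rP (t + q) (S q U) (S q U) (addr_ge0 t0 q0) tqT _ (SP q0 PU) (SP q0 PU) near near.
have -> : t + q - (t + s) = q - s by rewrite opprD addrACA subrr add0r.
rewrite distrC ger0_norm// => /(_ qr); rewrite ltr_norml => /andP[h3 _].
by move: h3; rewrite -/(f q) -/(f s); lra.
Qed.

(** The orbit of a general [U] cannot be differentiated, so [U] is approximated by [W] in the domain
    of the generator at fixed [h]. The loss [e] pays for the variation of [d] along the orbit. *)
Lemma flow_step t U e : 0 <= t -> t < T -> P U -> 0 < e ->
  exists2 eta, 0 < eta & forall h, 0 < h -> h < eta -> t + h <= T ->
    B (t + h) (S h U) (S h U) <= B t U U - h * (d t U U - e).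
Proof.
move=> t0 tT PU e0; have [M [h0 [M1 h00 MP]]] := local_bound.
have M0 : 0 < M by rewrite (lt_le_trans ltr01).
have tT' := ltW tT.
have [r r0 rP] := form_near fd t0 tT' PU PU e0.
have r2 : 0 < r / 2 by rewrite divr_gt0.
have [eta1 eta10 eta1P] := Scont0 PU r2.
exists (Num.min h0 (Num.min r eta1)); first by rewrite !lt_min h00 r0.
move=> h hp; rewrite !lt_min => /and3P[hh0 hr heta] thT.
have hp' := ltW hp; have th0 : 0 <= t + h by rewrite addr_ge0.
apply/ler_addgt0Pr => k k0; have k2 : 0 < k / 2 by rewrite divr_gt0.
have PSh := SP hp' PU.
have [r1 r10 r1P] := form_near fB t0 tT' PU PU k2.
have [r3 r30 r3P] := form_near fB th0 thT PSh PSh k2.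
(* The closeness of [W] to [U] may depend on [h] and [k]; the range of [h] was fixed beforehand
   through [r] and [eta1], which depend on [t], [U] and [e] alone. *)
pose q := Num.min r1 (Num.min r3 (r / 2) / M).
have q0 : 0 < q by rewrite lt_min r10 divr_gt0// lt_min r30.
have [W [Y [PW PY gW WU]]] := gen_dense PU q0.
have WUr1 : nrm (W - U) < r1 by rewrite (lt_le_trans WU)// ge_min lexx.
have WUM s : 0 <= s -> s <= h -> nrm (S s W - S s U) < Num.min r3 (r / 2).
  move=> s0 sh; rewrite nrm_SB//.
  apply: le_lt_trans (MP _ _ s0 (le_trans sh (ltW hh0)) (PB PW PU)) _.
  by rewrite mulrC -ltr_pdivlMr// (lt_le_trans WU)// ge_min lexx orbT.
have dW s : 0 <= s -> s <= h -> d t U U - e <= d (t + s) (S s W) (S s W).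
  move=> s0 sh; have tsT : t + s <= T by apply: le_trans thT; rewrite lerD2l.
  have nW : nrm (S s W - U) < r.
    apply: le_lt_trans (nrm_tri (SP s0 PW) (SP s0 PU) PU) _.
    rewrite [ltRHS]splitr; apply: ltrD; last by apply: eta1P => //; exact: le_lt_trans heta.
    by have := WUM s s0 sh; rewrite lt_min => /andP[].
  have PSW := SP s0 PW.
  have := rP (t + s) (S s W) (S s W) (addr_ge0 t0 s0) tsT _ PSW PSW nW nW.
  rewrite addrAC subrr add0r ger0_norm// => /(_ (le_lt_trans sh hr)).
  by rewrite ltr_norml => /andP[h1 _]; move: h1; lra.
have H := flow_domain M1 h00 MP t0 hp' thT PW PY gW dW (ltW hh0).
have W3 : nrm (S h W - S h U) < r3.
  by have := WUM h hp' (lexx h); rewrite lt_min => /andP[].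
have PSW := SP hp' PW.
have := r3P (t + h) (S h W) (S h W) th0 thT _ PSW PSW W3 W3.
rewrite subrr normr0 => /(_ r30); rewrite ltr_norml => /andP[h1 _].
have := r1P t W W t0 tT' _ PW PW WUr1 WUr1.
rewrite subrr normr0 => /(_ r10); rewrite ltr_norml => /andP[_ h2].
by move: H h1 h2; lra.
Qed.

(** * Duhamel's formula and the Dini inequality for mild solutions *)

Variables (G I U : R -> V) (U0 : V).
Hypothesis PG : forall s, 0 <= s -> s <= T -> P (G s).
Hypothesis Gcont : forall s e, 0 <= s -> s <= T -> 0 < e -> exists2 eta, 0 < eta &
  forall r, 0 <= r -> r <= T -> `|r - s| < eta -> nrm (G r - G s) < e.
Hypothesis PI : forall t, 0 <= t -> t <= T -> P (I t).
Hypothesis IP : forall t, 0 <= t -> t <= T -> forall e, 0 < e -> exists2 eta, 0 < eta &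
  forall n (p c : nat -> R), p 0%N = 0 -> p n = t ->
    (forall i, (i < n)%N -> p i <= c i <= p i.+1 /\ p i.+1 - p i < eta) ->
    nrm (\sum_(i < n) (p i.+1 - p i) *: S (t - c i) (G (c i)) - I t) < e.
Hypothesis PU0 : P U0.
Hypothesis UP : forall t, 0 <= t -> t <= T -> eqv (U t) (S t U0 + I t).

(** The integral is known only through Riemann sums, so the splitting of [I (t + h)] at time [t] is
    read on the sums: [S h] carries a sum for [I t] to the part over [[0, t]], and the part over
    [[t, t + h]] is within [e h] of [h G t], because [G] and the semigroup are continuous. *)
Lemma duhamel_step t e : 0 <= t -> t < T -> 0 < e -> exists2 eta, 0 < eta &
  forall h, 0 < h -> h < eta -> t + h <= T ->
    nrm (I (t + h) - (S h (I t) + h *: G t)) <= e * h.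
Proof.
move=> t0 tT e0; have [M [h0 [M1 h00 MP]]] := local_bound.
have M0 : 0 < M by rewrite (lt_le_trans ltr01).
have tT' := ltW tT; have PGt := PG t0 tT'.
have e2 : 0 < e / 2 by rewrite divr_gt0.
have [a a0 aP] := Gcont t0 tT' (divr_gt0 e2 M0).
have [b b0 bP] := Scont0 PGt e2.
exists (Num.min h0 (Num.min a b)); first by rewrite !lt_min h00 a0.
move=> h hp; rewrite !lt_min => /and3P[hh0 ha hb] thT; have hp' := ltW hp.
have SG s r : 0 <= s -> s <= h -> 0 <= r -> r <= h -> nrm (S s (G (t + r)) - G t) <= e.
  move=> s0 sh r0 rh; have trT : t + r <= T by apply: le_trans thT; rewrite lerD2l.
  have PGr := PG (addr_ge0 t0 r0) trT.
  apply: le_trans (nrm_tri (SP s0 PGr) (SP s0 PGt) PGt) _.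
  rewrite [leRHS]splitr; apply: lerD; last by apply/ltW/bP => //; exact: le_lt_trans hb.
  rewrite nrm_SB//; apply: le_trans (MP _ _ s0 (le_trans sh (ltW hh0)) (PB PGr PGt)) _.
  rewrite mulrC -ler_pdivlMr//; apply/ltW/aP => //; first exact: addr_ge0.
  by rewrite addrAC subrr add0r ger0_norm// (le_lt_trans rh).
apply/ler_addgt0Pr => k k0.
have k3 : 0 < k / (M + 1) by rewrite divr_gt0// ltr_wpDl// ltW.
set k' := k / (M + 1) in k3.
have kM : k' + M * k' = k.
  by rewrite /k' -{1}[k / _]mul1r -mulrDl addrC mulrCA divff ?mulr1// gt_eqF// ltr_wpDl// ltW.
have th0 : 0 <= t + h by rewrite addr_ge0.
have [m1 m10 m1P] := IP th0 thT k3; have [m2 m20 m2P] := IP t0 tT' k3.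
pose m := Num.min m1 m2; have m0 : 0 < m by rewrite lt_min m10.
pose n := (Num.Def.archi_bound ((t + h) / m)).+1.
have n0 : 0 < n%:R :> R by rewrite ltr0n.
have nth : (t + h) / n%:R < m.
  rewrite ltr_pdivrMr// mulrC -ltr_pdivrMr//; apply: lt_trans (_ : _ < n.-1%:R) _.
    by apply: archi_boundP; rewrite divr_ge0// ltW.
  by rewrite ltr_nat.
have tn : t / n%:R < m.
  by apply: le_lt_trans nth; rewrite ler_wpM2r ?invr_ge0 ?ltW// ltrDl.
have hn : h / n%:R < m.
  by apply: le_lt_trans nth; rewrite ler_wpM2r ?invr_ge0 ?(ltW n0) ?lerDr.
(* The nodes are [n] steps of length [t / n] followed by [n] steps of length [h / n], and every tag
   is the left end of its piece. *)
pose c0 i := t / n%:R * i%:R.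
pose p i : R := if (i <= n)%N then c0 i else t + h / n%:R * (i - n)%:R.
have c0n : c0 n = t by rewrite /c0 divfK// gt_eqF.
have pl i : (i <= n)%N -> p i = c0 i by rewrite /p => ->.
have pr i : p (n + i)%N = t + h / n%:R * i%:R.
  rewrite /p; case: i => [|i]; first by rewrite addn0 leqnn c0n mulr0 addr0.
  by rewrite ifF ?addKn//; apply/negbTE; rewrite -ltnNge -addSnnS leq_addr.
have c0S i : c0 i.+1 - c0 i = t / n%:R by rewrite /c0 -mulrBr -natr1 addrAC subrr add0r mulr1.
have tn0 : 0 <= t / n%:R by rewrite divr_ge0// ltW.
have hn0 : 0 <= h / n%:R by rewrite divr_ge0// ltW.
have c0_0 : c0 0%N = 0 by rewrite /c0 mulr0.
have c0ge i : 0 <= c0 i by rewrite mulr_ge0.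
have c0le i : (i <= n)%N -> c0 i <= t.
  by move=> hin; rewrite -[leRHS]c0n ler_wpM2l// ler_nat.
have s1 : nrm (\sum_(i < n) (t / n%:R) *: S (t - c0 i) (G (c0 i)) - I t) < k'.
  have := m2P n c0 c0 c0_0 c0n; rewrite (eq_bigr (fun i : 'I_n =>
    (t / n%:R) *: S (t - c0 i) (G (c0 i)))); last by move=> i _; rewrite c0S.
  apply=> i _; rewrite c0S lexx/=; split; last by rewrite (lt_le_trans tn)// ge_min lexx orbT.
  by rewrite -subr_ge0 c0S.
have rle i : (i < n)%N -> h / n%:R * i%:R <= h.
  by move=> hin; rewrite mulrAC ler_pdivrMr// ler_wpM2l// ler_nat ltnW.
pose F1 i := S (t + h - c0 i) (G (c0 i)).
pose F2 i := S (h - h / n%:R * i%:R) (G (t + h / n%:R * i%:R)).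
have s2 : nrm (\sum_(i < n) (t / n%:R) *: F1 i + \sum_(i < n) (h / n%:R) *: F2 i - I (t + h)) < k'.
  have pn : p (n + n)%N = t + h by rewrite pr divfK// gt_eqF.
  have p0 : p 0%N = 0 by rewrite pl.
  have pS i : p (n + i).+1 - p (n + i)%N = h / n%:R.
    by rewrite -addnS !pr opprD addrACA subrr add0r -mulrBr -natr1 addrAC subrr add0r mulr1.
  have := m1P (n + n)%N p p p0 pn; rewrite big_split_ord/=.
  rewrite [X in X + _ - _](eq_bigr (fun i : 'I_n => (t / n%:R) *: F1 i)); last first.
    by move=> i _; rewrite !pl ?c0S// ltnW.
  rewrite [X in _ + X - _](eq_bigr (fun i : 'I_n => (h / n%:R) *: F2 i)); last first.
    by move=> i _; rewrite pS pr opprD addrACA subrr add0r.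
  apply=> i hi; rewrite lexx/=; have [hin|ni] := ltnP i n.
    rewrite !pl ?(ltnW hin)// c0S; split; first by rewrite -subr_ge0 c0S.
    by rewrite (lt_le_trans tn)// ge_min lexx.
  rewrite -(subnKC ni) pS; split; first by rewrite -subr_ge0 pS.
  by rewrite (lt_le_trans hn)// ge_min lexx.
have PF1 i : (i < n)%N -> P (F1 i).
  move=> hin; apply: SP; last by apply: PG => //; exact: le_trans (c0le _ (ltnW hin)) tT'.
  by rewrite subr_ge0 (le_trans (c0le _ (ltnW hin)))// lerDl.
have PF2 i : (i < n)%N -> P (F2 i).
  move=> hin; have hr := rle _ hin; apply: SP; first by rewrite subr_ge0.
  by apply: PG; [rewrite addr_ge0// mulr_ge0|apply: le_trans thT; rewrite lerD2l].
have PF0 i : (i < n)%N -> P (S (t - c0 i) (G (c0 i))).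
  move=> hin; apply: SP; last by apply: PG => //; exact: le_trans (c0le _ (ltnW hin)) tT'.
  by rewrite subr_ge0 c0le// ltnW.
set A1 := \sum_(i < n) _ in s1; set A2 := (X in nrm (X + _ - _)) in s2.
set A3 := (X in nrm (_ + X - _)) in s2.
have PA1 : P A1 by apply: (P_sum (fun=> _) (F := fun i => S (t - c0 i) (G (c0 i)))).
have PA2 : P A2 by apply: (P_sum (fun=> _)).
have PA3 : P A3 by apply: (P_sum (fun=> _)).
have eA : eqv (S h A1) A2.
  apply: (eqvS_sum (fun=> _) (F := fun i => S (t - c0 i) (G (c0 i)))) => // i hin.
  split; first exact: PF0.
  have ct : 0 <= t - c0 i by rewrite subr_ge0 c0le// ltnW.
  have PGi : P (G (c0 i)) by apply: PG => //; exact: le_trans (c0le _ (ltnW hin)) tT'.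
  have := eqv_sym (eqvS_add hp' ct PGi).
  by rewrite (_ : h + (t - c0 i) = t + h - c0 i)//; ring.
have s3 : nrm (A3 - h *: G t) <= e * h.
  have := @nrm_sum n (fun=> h / n%:R) F2 (G t) e.
  have -> : \sum_(i < n) h / n%:R = h.
    by rewrite sumr_const card_ord -[LHS]mulr_natr divfK// gt_eqF.
  rewrite [h * e]mulrC; apply=> // i hin.
  have hr := rle _ hin; split => //; first exact: PF2.
  apply: SG => //; [by rewrite subr_ge0|by rewrite gerBl mulr_ge0|by rewrite mulr_ge0].
have PIt := PI t0 tT'; have PIth := PI th0 thT.
have s4 : nrm (A2 - S h (I t)) <= M * k'.
  have [_ _ e1] := eqv_sym eA.
  rewrite (nrm_eq0l PA2 (SP hp' PA1) (SP hp' PIt) e1) nrm_SB//.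
  apply: le_trans (MP _ _ hp' (ltW hh0) (PB PA1 PIt)) _.
  by rewrite ler_pM2l// ltW.
have PhG := PZ h PGt; have PS := SP hp' PIt.
apply: le_trans (nrm_tri PIth (PA PA2 PA3) (PA PS PhG)) _.
rewrite nrm_sym//; last exact: PA.
have -> : A2 + A3 - (S h (I t) + h *: G t) = (A2 - S h (I t)) + (A3 - h *: G t).
  by rewrite opprD addrACA.
have := nrmA (PB PA2 PS) (PB PA3 PhG).
by move: s2 s3 s4; rewrite -kM; move: (nrm _) (nrm _) (nrm _) (nrm _) => ? ? ? ?; lra.
Qed.

(** The quotient [D = (U (t + h) - S h (U t)) / h] tends to [G t] by [duhamel_step]. Expanding the
    form at [S h (U t) + h D] adds [2 B (U t) (G t)] to the rate of the free flow, and the square of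
    [D] costs only a factor [h^2]. *)
Lemma mild_dini t e : 0 <= t -> t < T -> 0 < e -> exists2 eta, 0 < eta &
  forall h, 0 < h -> h < eta -> t + h <= T ->
    B (t + h) (U (t + h)) (U (t + h)) <=
    B t (U t) (U t) + h * (- d t (U t) (U t) + 2 * B t (U t) (G t) + e).
Proof.
move=> t0 tT e0; have tT' := ltW tT; have e4 : 0 < e / 4 by rewrite divr_gt0.
have [PUt _ _] := UP t0 tT'; have PGt := PG t0 tT'.
have [a a0 aP] := flow_step t0 tT PUt e4.
have [r r0 rP] := form_near fB t0 tT' PUt PGt e4.
have [C [C0 lin sym bd _]] := fB.
have r2 : 0 < r / 2 by rewrite divr_gt0.
have [b b0 bP] := duhamel_step t0 tT r2.
have [c c0 cP] := Scont0 PUt r0.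
pose y := nrm (G t) + r; have y0 : 0 <= y by rewrite addr_ge0// ltW.
have K0 : 0 < C * (y * y) + 1 by rewrite ltr_wpDl// !mulr_ge0.
exists (Num.min (Num.min a b) (Num.min c (Num.min r (e / 4 / (C * (y * y) + 1))))).
  by rewrite !lt_min a0 b0 c0 r0 divr_gt0.
move=> h hp; rewrite !lt_min => /andP[/andP[ha hb] /and3P[hc hr hK]] thT.
have hp' := ltW hp; have th0 : 0 <= t + h by rewrite addr_ge0.
have [PUth _ _] := UP th0 thT; have PS := SP hp' PUt.
pose D := h^-1 *: (U (t + h) + -1 *: S h (U t)).
have PDD : P D by apply: PZ; exact: PD.
have hD : h *: D = U (t + h) - S h (U t).
  by rewrite /D scalerA divff ?gt_eqF// scale1r scaleN1r.
have PhG := PZ h PGt; have PIt := PI t0 tT'; have PIth := PI th0 thT.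
have PSt := SP t0 PU0; have PSth := SP th0 PU0.
have nD : nrm (D - G t) < r.
  have : nrm (h *: (D - G t)) <= r / 2 * h.
    apply: le_trans (bP h hp hb thT).
    have -> : h *: (D - G t) = (U (t + h) + -1 *: S h (U t)) + -1 *: (h *: G t).
      by rewrite scalerBr hD !scaleN1r.
    have q1 : eqv (S h (U t)) (S h (S t U0) + S h (I t)).
      apply: eqv_trans (eqvS hp' (UP t0 tT')) _.
      by have := eqvSD 1 hp' PSt PIt; rewrite !scale1r.
    have q2 : eqv (U (t + h)) (S h (S t U0) + I (t + h)).
      apply: eqv_trans (UP th0 thT) _; have := eqvS_add hp' t0 PU0; rewrite addrC => q3.
      by have := eqvD 1 q3 (eqv_refl PIth); rewrite !scale1r.
    rewrite (eqv_nrm (eqvD (-1) (eqvD (-1) q2 q1) (eqv_refl PhG))) !scaleN1r.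
    by rewrite opprD addrACA subrr add0r opprD addrA.
  rewrite nrm_scale; last exact: PB.
  rewrite gtr0_norm// mulrC ler_pM2r// => /le_lt_trans; apply.
  by rewrite ltr_pdivrMr// ltr_pMr// ltr1n.
have nDy : nrm D <= y.
  by apply: le_trans (nrm_subl PDD PGt) _; rewrite lerD2l ltW.
have H1 := aP h hp ha thT.
have := rP (t + h) (S h (U t)) D th0 thT _ PS PDD (cP h hp' hc) nD.
rewrite addrAC subrr add0r gtr0_norm// => /(_ hr); rewrite ltr_norml => /andP[_ H2].
have H3 : B (t + h) D D <= C * (y * y).
  apply: le_trans (ler_norm _) _; apply: le_trans (bd _ _ _ th0 thT PDD PDD) _.
  by apply: ler_wpM2l => //; apply: ler_pM.
have eU : U (t + h) = S h (U t) + h *: D by rewrite hD [RHS]addrC subrK.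
have PhD : P (S h (U t) + h *: D) by exact: PD.
have eB : B (t + h) (U (t + h)) (U (t + h)) = B (t + h) (S h (U t)) (S h (U t)) +
    2 * h * B (t + h) (S h (U t)) D + h * (h * B (t + h) D D).
  rewrite eU lin// [B _ (S h (U t)) (_ + _)]sym// [B _ D (_ + _)]sym// !lin//.
  rewrite [B _ D (S h (U t))]sym//; ring.
have H4 : h * B (t + h) D D <= e / 4.
  apply: (@le_trans _ _ (h * (C * (y * y) + 1))).
    by rewrite ler_wpM2l// (le_trans H3)// lerDl.
  by rewrite -ler_pdivlMr// ltW.
have H5 : h * (h * B (t + h) D D) <= h * (e / 4) by rewrite ler_wpM2l.
have H6 : h * B (t + h) (S h (U t)) D <= h * (e / 4 + B t (U t) (G t)).
  by rewrite ler_wpM2l// -lerBlDr ltW.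
rewrite eB; move: H1 H5 H6; lra.
Qed.

End abstract_semigroup.

(** * Weighted quadratic forms *)

Section quadratic_forms.
Context {R : realFieldType}.
Implicit Types (V n lam mu kap eta p X Y G w : R).

(** The coefficient of [w^2] in [damp]: the time derivative of the zero order weight [rho], plus the
    divergence of the current chosen in [Sform_dual]. *)
Definition damp_u V n lam mu kap p : R :=
  p * ((n - 1) * (V * lam ^+ 2 * (mu / 2 - kap)) + V ^+ 2 * lam * mu / 2) +
  (mu - 1) * (V * lam ^+ 3 * (mu / 2 - kap) - V * lam * mu / 2 - lam ^+ 2 * (mu + 1) * kap).

(** The density of the derivative of [S(mu, kap)] along the free flow, divided by [Psi^mu], in the
    variables [X = v], [Y = u_r], [w = u / Psi], [G = |grad u|^2] and [p = Psi / |x|]. *)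
Definition damp V n lam mu kap p X Y w G : R :=
  (mu + 1 - V * lam) * G + (mu + 1 + V * lam - 2 * V * p) * X ^+ 2
  - 2 * lam * (mu + 1) * (X * Y) - 2 * V * lam ^+ 2 * kap * (w * Y)
  - 2 * lam ^+ 2 * (mu + 1) * kap * (w * X) + damp_u V n lam mu kap p * w ^+ 2.

(** An exact sum of squares in [X + Y + z], [Y + z], [Y + 2 z] and [X], with [z = lam kap w]. The
    first square swallows the product [X Y]; what it takes from [Y^2] is repaid because
    [lam (V - (mu + 1))] is at least [4 V], which is where [mu + 1 < V] and a large [lam] enter. *)
Lemma damp_core V n lam mu kap p X Y w G eta : 0 <= mu + 1 -> mu + 1 < V ->
  eta = (V - (mu + 1)) / 2 -> 1 <= lam -> 4 * V <= lam * (V - (mu + 1)) -> lam <= p ->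
  Y ^+ 2 <= G ->
  damp V n lam mu kap p X Y w G <= - eta * (G + p * X ^+ 2) +
    (V * lam ^+ 3 * kap ^+ 2 + 2 * (mu + 1 + eta) * lam ^+ 2 * kap ^+ 2
     + damp_u V n lam mu kap p) * w ^+ 2.
Proof.
rewrite /damp; set k := mu + 1; set U := damp_u _ _ _ _ _ _ => k0 kV eE l1 lV lp YG.
rewrite -subr_ge0; set z := lam * kap * w.
rewrite (_ : _ - _ = (V * lam - k - eta) * (G - Y ^+ 2) + lam * k * (X + Y + z) ^+ 2
  + (lam * (V - k) - 2 * (k + eta)) * (Y + z) ^+ 2 + (k + eta) * (Y + 2 * z) ^+ 2
  + (lam * (V - k - eta) - k + (2 * V - eta) * (p - lam)) * X ^+ 2); last first.
  by rewrite /z; ring.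
have lV2 : 4 * V <= lam * V - lam * k by rewrite -mulrBr.
have lk : 0 <= lam * k by rewrite mulr_ge0//; lra.
have hp : 0 <= (2 * V - eta) * (p - lam) by rewrite eE; apply: mulr_ge0; lra.
have le : lam * eta = lam * (V - k) / 2 by rewrite eE; field.
have c1 : 0 <= V * lam - k - eta by rewrite eE; lra.
have c2 : 0 <= lam * (V - k) - 2 * (k + eta) by rewrite eE; lra.
have c3 : 0 <= k + eta by rewrite eE; lra.
have c4 : 0 <= lam * (V - k - eta) - k + (2 * V - eta) * (p - lam).
  by apply: addr_ge0 => //; rewrite mulrBr le; lra.
have hG : 0 <= G - Y ^+ 2 by rewrite subr_ge0.
by rewrite !addr_ge0// mulr_ge0// sqr_ge0.
Qed.

(** At [p = lam] the coefficient of [lam^3] is [V mu (mu + 2 - n) / 2], negative for [mu < n - 2],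
    and it wins for large [lam]. For larger [p] the expression decreases as soon as
    [lam (n - 1) >= V]. *)
Lemma damp_u_pos V n mu eta : 0 < V -> 0 < mu -> mu < n - 2 -> 0 <= eta ->
  exists l0, forall lam p, l0 <= lam -> 1 <= lam -> lam <= p ->
    V * lam ^+ 3 * mu ^+ 2 + 2 * (mu + 1 + eta) * lam ^+ 2 * mu ^+ 2
     + damp_u V n lam mu mu p <= 0.
Proof.
move=> hV m0 mn e0.
pose c1 := 2 * (mu + 1 + eta) * mu + V ^+ 2 / 2 - (mu - 1) * (mu + 1).
have d0 : 0 < V * (n - 2 - mu) by rewrite mulr_gt0//; lra.
exists (Num.max (V / (n - 1)) (2 * (`|c1| + V / 2) / (V * (n - 2 - mu)))) => lam p.
rewrite ge_max => /andP[h1 h2] l1 lp; have l0 : 0 < lam by lra.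
have n1 : 0 < n - 1 by lra.
have h1' : V <= lam * (n - 1) by rewrite -ler_pdivrMr.
have h2' : 2 * (`|c1| + V / 2) <= lam * (V * (n - 2 - mu)) by rewrite -ler_pdivrMr.
have hc := ler_norm c1.
have e1 : 0 <= (p - lam) * (lam * V * mu / 2 * (lam * (n - 1) - V)).
  by apply: mulr_ge0; [lra|apply: mulr_ge0; [rewrite divr_ge0// !mulr_ge0 ?ltW//|lra]].
have e2 : 0 <= lam ^+ 2 * mu / 2 * (lam * (V * (n - 2 - mu)) - 2 * (c1 + V / 2)).
  by apply: mulr_ge0; [rewrite divr_ge0// mulr_ge0 ?sqr_ge0 ?ltW|lra].
have e3 : 0 <= lam * mu * V / 2 * (lam - 1 + mu).
  by apply: mulr_ge0; [rewrite divr_ge0// !mulr_ge0 ?ltW|lra].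
rewrite -oppr_ge0 (_ : - _ = (p - lam) * (lam * V * mu / 2 * (lam * (n - 1) - V))
  + lam ^+ 2 * mu / 2 * (lam * (V * (n - 2 - mu)) - 2 * (c1 + V / 2))
  + lam * mu * V / 2 * (lam - 1 + mu)); first by rewrite !addr_ge0.
by rewrite /damp_u /c1; field.
Qed.

(** With [kap = 0] the coefficient of [lam^3] at [p = lam] is [V mu (n - 2 + mu) / 2], nonpositive
    for [2 - n <= mu <= 0]; all other terms have the right sign. *)
Lemma damp_u_neg V n mu lam p : 0 < V -> mu <= 0 -> 2 - n <= mu -> 1 <= n -> 1 <= lam -> lam <= p ->
  damp_u V n lam mu 0 p <= 0.
Proof.
move=> hV m0 nm n1 l1 lp; have l0 : 0 < lam by lra.
have m0' : 0 <= - mu by lra.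
have e1 : 0 <= (p - lam) * (lam ^+ 2 * V * - mu / 2 * (n - 1)).
  by apply: mulr_ge0; [lra|rewrite !mulr_ge0 ?invr_ge0 ?sqr_ge0 ?(ltW hV)//; lra].
have e2 : 0 <= lam ^+ 3 * V / 2 * (- mu * (n - 2 + mu)).
  by rewrite !mulr_ge0 ?invr_ge0 ?exprn_ge0 ?(ltW hV)//; lra.
have e3 : 0 <= p * (V ^+ 2 * lam * - mu / 2).
  by rewrite !mulr_ge0 ?invr_ge0 ?sqr_ge0//; lra.
have e4 : 0 <= (1 - mu) * (- mu) * V * lam / 2.
  by rewrite !mulr_ge0 ?invr_ge0 ?(ltW hV)//; lra.
rewrite -oppr_ge0 (_ : - _ = (p - lam) * (lam ^+ 2 * V * - mu / 2 * (n - 1)) +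
  lam ^+ 3 * V / 2 * (- mu * (n - 2 + mu)) + p * (V ^+ 2 * lam * - mu / 2)
  + (1 - mu) * (- mu) * V * lam / 2); first by rewrite !addr_ge0.
by rewrite /damp_u; field.
Qed.

(** Without a condition on [mu] the error is merely linear in [p]. Multiplied by [Psi^mu w^2], the
    bound [C p] is the term [C Psi^(mu - 1) u^2 / |x|], which has to be absorbed elsewhere. *)
Lemma damp_u_any V n mu lam : exists2 C, 0 < C & forall p, 1 <= p -> damp_u V n lam mu 0 p <= C * p.
Proof.
pose a := (n - 1) * (V * lam ^+ 2 * (mu / 2 - 0)) + V ^+ 2 * lam * mu / 2.
pose c := (mu - 1) * (V * lam ^+ 3 * (mu / 2 - 0) - V * lam * mu / 2 - lam ^+ 2 * (mu + 1) * 0).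
exists (`|a| + `|c| + 1); first by rewrite ltr_wpDl// addr_ge0.
move=> p p1; rewrite /damp_u -/a -/c.
have ha : p * a <= p * `|a| by rewrite ler_wpM2l ?ler_norm//; lra.
have hc : `|c| * 1 <= `|c| * p by rewrite ler_wpM2l.
have := ler_norm c; lra.
Qed.

(** The coefficient of [w^2] in the energy density divided by [Psi^(mu + 1)], once the divergence of
    [kap lam Psi^mu u^2 x / |x|] has been added; as in [damp], [w = u / Psi] and [p = Psi / |x|]. *)
Definition energy_u V n lam mu kap p : R :=
  V ^+ 2 * lam * p / 2 - V * lam * mu / 2 - lam ^+ 2 * (mu + 1) * kap
  + kap * lam * (lam * mu + (n - 1) * p).

(** With [z = lam w] the cross terms cost [(V^2 / 4 + kap^2) z^2]. The spare [V^2 / 8] buys the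
    constant [c] on the left, determined by [c (V^2 / 2 + 2 kap^2) = V^2 / 8]. *)
Lemma energy_core V n lam mu kap p X Y w G : 0 < V -> Y ^+ 2 <= G ->
  (V ^+ 2 / 8 + V ^+ 2 / 4 + kap ^+ 2) * lam ^+ 2 <= energy_u V n lam mu kap p ->
  V ^+ 2 / (4 * V ^+ 2 + 16 * kap ^+ 2) * (G + X ^+ 2) <=
  G + X ^+ 2 + V * lam * (w * X) + 2 * kap * lam * (w * Y) + energy_u V n lam mu kap p * w ^+ 2.
Proof.
move=> hV YG; set e := energy_u _ _ _ _ _ _ => he.
set d := 4 * V ^+ 2 + 16 * kap ^+ 2.
have V2 : 0 < V ^+ 2 by rewrite exprn_gt0.
have k2 := sqr_ge0 kap.
have d0 : 0 < d by rewrite /d; lra.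
set c := V ^+ 2 / d; have c0 : 0 <= c by rewrite divr_ge0 ?ltW.
have c4 : c <= 1 / 4 by rewrite /c ler_pdivrMr// /d; lra.
have cw : c * (V ^+ 2 / 2 + 2 * kap ^+ 2) = V ^+ 2 / 8.
  by rewrite /c /d; field; rewrite gt_eqF.
set z := lam * w; have hz : e * w ^+ 2 >= (V ^+ 2 / 8 + V ^+ 2 / 4 + kap ^+ 2) * z ^+ 2.
  by rewrite /z exprMn mulrA ler_wpM2r ?sqr_ge0.
have h1 : 0 <= (1 - c) * (G - Y ^+ 2) by apply: mulr_ge0; lra.
have h2 : 0 <= (1 - 2 * c) * (X + V / 2 * z) ^+ 2 by apply: mulr_ge0; rewrite ?sqr_ge0//; lra.
have h3 : 0 <= (1 - 2 * c) * (Y + kap * z) ^+ 2 by apply: mulr_ge0; rewrite ?sqr_ge0//; lra.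
have h4 : 0 <= c * (X + V * z) ^+ 2 by rewrite mulr_ge0 ?sqr_ge0.
have h5 : 0 <= c * (Y + 2 * kap * z) ^+ 2 by rewrite mulr_ge0 ?sqr_ge0.
have cz : c * (V ^+ 2 / 2 + 2 * kap ^+ 2) * z ^+ 2 = V ^+ 2 / 8 * z ^+ 2 by rewrite cw.
rewrite -subr_ge0; apply: (@le_trans _ _ ((1 - c) * (G - Y ^+ 2) + (1 - 2 * c) * (X + V / 2 * z) ^+ 2 +
  (1 - 2 * c) * (Y + kap * z) ^+ 2 + c * (X + V * z) ^+ 2 + c * (Y + 2 * kap * z) ^+ 2)).
  by rewrite !addr_ge0.
have -> : V * lam * (w * X) = V * (z * X) by rewrite /z; ring.
have -> : 2 * kap * lam * (w * Y) = 2 * kap * (z * Y) by rewrite /z; ring.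
move: hz cz; clear; move: (e * w ^+ 2) => E hz cz; lra.
Qed.

(** At [p = lam] the difference of the two sides is [V^2 lam^2 / 8 - V lam mu / 2 + lam^2 mu (n - 2
    - mu)]; the choice [lam >= 4 mu / V] settles the first two terms. *)
Lemma energy_u_pos V n mu : 0 < V -> 0 < mu -> mu < n - 2 ->
  exists l0, forall lam p, l0 <= lam -> 1 <= lam -> lam <= p ->
    (V ^+ 2 / 8 + V ^+ 2 / 4 + mu ^+ 2) * lam ^+ 2 <= energy_u V n lam mu mu p.
Proof.
move=> hV m0 mn; have V2 : 0 < V ^+ 2 by rewrite exprn_gt0.
exists (4 * mu / V) => lam p h l1 lp; have l0 : 0 < lam by lra.
have h' : 4 * mu <= lam * V by rewrite -ler_pdivrMr.
have e1 : 0 <= (p - lam) * (V ^+ 2 * lam / 2 + mu * lam * (n - 1)).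
  apply: mulr_ge0; first by lra.
  by rewrite addr_ge0 ?divr_ge0 ?mulr_ge0 ?(ltW m0) ?(ltW V2) ?(ltW l0)//; lra.
have e2 : 0 <= lam * V / 8 * (lam * V - 4 * mu).
  by rewrite mulr_ge0 ?divr_ge0 ?mulr_ge0 ?(ltW l0) ?(ltW hV)//; lra.
have e3 : 0 <= lam ^+ 2 * mu * (n - 2 - mu) by rewrite !mulr_ge0 ?sqr_ge0 ?(ltW m0)//; lra.
rewrite -subr_ge0 (_ : _ - _ = (p - lam) * (V ^+ 2 * lam / 2 + mu * lam * (n - 1)) +
  lam * V / 8 * (lam * V - 4 * mu) + lam ^+ 2 * mu * (n - 2 - mu)); first by rewrite !addr_ge0.
by rewrite /energy_u; field.
Qed.

Lemma energy_u_zero V n mu : 0 < V ->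
  exists l0, forall lam p, l0 <= lam -> 1 <= lam -> lam <= p ->
    (V ^+ 2 / 8 + V ^+ 2 / 4 + 0 ^+ 2) * lam ^+ 2 <= energy_u V n lam mu 0 p.
Proof.
move=> hV; have V2 : 0 < V ^+ 2 by rewrite exprn_gt0.
exists (4 * mu / V) => lam p h l1 lp; have l0 : 0 < lam by lra.
have h' : 4 * mu <= lam * V by rewrite -ler_pdivrMr.
have e1 : 0 <= (p - lam) * (V ^+ 2 * lam / 2).
  by rewrite mulr_ge0 ?divr_ge0 ?mulr_ge0 ?(ltW V2) ?(ltW l0)//; lra.
have e2 : 0 <= lam * V / 8 * (lam * V - 4 * mu).
  by rewrite mulr_ge0 ?divr_ge0 ?mulr_ge0 ?(ltW l0) ?(ltW hV)//; lra.
rewrite -subr_ge0 (_ : _ - _ = (p - lam) * (V ^+ 2 * lam / 2) +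
  lam * V / 8 * (lam * V - 4 * mu)); first by rewrite !addr_ge0.
by rewrite /energy_u; field.
Qed.

(** One constant for a whole family of binary forms, with [be] bounded and the discriminant bounded
    away from 0; in [elliptic] both coefficients vary with the point. *)
Lemma quad_coercive (d b : R) : 0 < d -> exists2 c, 0 < c & forall be ga Y w : R,
  `|be| <= b -> d <= ga - be ^+ 2 / 4 ->
  c * (Y ^+ 2 + w ^+ 2) <= Y ^+ 2 + be * (Y * w) + ga * w ^+ 2.
Proof.
move=> d0; pose C := 2 + (b ^+ 2 / 2 + 1) / d.
have b2 := sqr_ge0 b.
have C0 : 0 < C by rewrite ltr_wpDr// divr_ge0 ?ltW//; lra.
exists C^-1; first by rewrite invr_gt0.
move=> be ga Y w beb hd; rewrite mulrC ler_pdivrMr//.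
have bb : be ^+ 2 <= b ^+ 2.
  by rewrite -(real_normK (num_real be)) ler_sqr ?nnegrE// (le_trans _ beb).
have h1 : Y ^+ 2 + be * (Y * w) + ga * w ^+ 2 >= (Y + be / 2 * w) ^+ 2 + d * w ^+ 2.
  rewrite -subr_ge0 (_ : _ - _ = (ga - be ^+ 2 / 4 - d) * w ^+ 2); last by field.
  by rewrite mulr_ge0 ?sqr_ge0//; lra.
apply: (@le_trans _ _ (((Y + be / 2 * w) ^+ 2 + d * w ^+ 2) * C)); last by rewrite ler_pM2r.
have dC : d * C = 2 * d + (b ^+ 2 / 2 + 1) by rewrite /C; field; rewrite gt_eqF.
have C2 : 2 <= C by rewrite /C lerDl divr_ge0 ?ltW//; lra.
rewrite mulrDl [d * _ * C]mulrAC dC.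
have h2 : (Y + be / 2 * w) ^+ 2 * 2 <= (Y + be / 2 * w) ^+ 2 * C by rewrite ler_wpM2l ?sqr_ge0.
have h3 := sqr_ge0 (Y + be * w).
have h4 : be ^+ 2 * w ^+ 2 <= b ^+ 2 * w ^+ 2 by rewrite ler_wpM2r ?sqr_ge0.
have h5 : 0 <= d * w ^+ 2 by rewrite mulr_ge0 ?sqr_ge0 ?ltW.
by move: h2 h3 h4 h5; clear -R; move: C (b ^+ 2) => C b2; lra.
Qed.

End quadratic_forms.

(** * Weights that depend on time *)

Section time_weights.
Context {R : realType} {N : nat}.
Local Notation E := 'rV[R]_N.
Local Notation leb := (@lebesgue_rV R N).
Variable D : set E.
Hypotheses (oD : open D) (bD : bounded_set D) (D0 : ~ closure D 0).
Implicit Types (w v : R -> E -> R) (x : E) (t h b lam : R).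

Local Notation bmf := (bmf D).

Let mD : measurable D := open_measurable_rV oD.
Local Hint Resolve mD : core.

(** The mean value theorem, twice. The base stays in [[1, Z]], so every power of it is at most
    [1 + Z^a], whatever the sign of the exponent [a]. *)
Lemma powR_taylor b (Z y h : R) : 1 <= y -> 0 <= h -> y + h <= Z ->
  `|(y + h) `^ b - y `^ b - h * (b * y `^ (b - 1))| <=
  `|b * (b - 1)| * (1 + Z `^ (b - 2)) * h ^+ 2.
Proof.
move=> y1 h0 yZ; have yh : y <= y + h by rewrite lerDl.
have pos z : y <= z -> 0 < z by move=> yz; rewrite (lt_le_trans _ yz)// (lt_le_trans ltr01).
have mvt a z : y <= z -> exists2 c, y <= c <= z & z `^ a - y `^ a = a * c `^ (a - 1) * (z - y).
  move=> yz.
  have dv c : c \in `]y, z[%R -> is_derive c 1 (fun z => z `^ a) (a * c `^ (a - 1)).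
    by rewrite in_itv/= => /andP[yc _]; apply: is_derive1_powR; apply: pos; exact: ltW.
  have cv : {within `[y, z]%classic, continuous (fun z => z `^ a)}.
    apply: derivable_within_continuous => q; rewrite in_itv/= => /andP[yq _].
    by apply: derivable_powR; rewrite in_itv/= andbT; exact: pos.
  by have [c] := MVT_segment yz dv cv; rewrite in_itv/= => ? ?; exists c.
have [c /andP[yc cz] ->] := mvt b _ yh.
have [c' /andP[yc' cz'] e] := mvt (b - 1) _ yc.
rewrite addrAC subrr add0r.
have -> : b * c `^ (b - 1) * h - h * (b * y `^ (b - 1)) =
    b * (b - 1) * c' `^ (b - 2) * ((c - y) * h).
  have -> : c `^ (b - 1) = y `^ (b - 1) + (b - 1) * c' `^ (b - 1 - 1) * (c - y).
    by rewrite -e [RHS]addrC subrK.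
  rewrite (_ : b - 1 - 1 = b - 2); last by ring.
  by ring.
rewrite !normrM -mulrA -[leRHS]mulrA; apply: ler_wpM2l; first by rewrite mulr_ge0.
rewrite ger0_norm ?powR_ge0// !ger0_norm ?subr_ge0//.
apply: ler_pM; rewrite ?powR_ge0 ?mulr_ge0 ?subr_ge0//.
  have := @powR_le_ends R 1 Z c' (b - 2) ltr01; rewrite powR1; apply.
  by rewrite (le_trans y1 yc') (le_trans cz')// (le_trans cz).
by rewrite expr2 ler_wpM2r// lerBlDl.
Qed.

(** A syntactic class of weights paired with their time derivatives. It is closed under
    differentiation ([tder_next]), so the derivative of a form is again Lipschitz in time. The value
    [lam = 0] yields the pure time factors [(1 + t)^b]. *)
Inductive tder : (R -> E -> R) -> (R -> E -> R) -> Prop :=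
| tder_cst c : bmf c -> tder (fun=> c) (fun _ _ => 0)
| tder_pw lam b : 0 <= lam -> tder (fun t => pw (1 + t) lam b) (fun t x => b * pw (1 + t) lam (b - 1) x)
| tder_add w w' v v' : tder w w' -> tder v v' ->
    tder (fun t x => w t x + v t x) (fun t x => w' t x + v' t x)
| tder_mul w w' v v' : tder w w' -> tder v v' ->
    tder (fun t x => w t x * v t x) (fun t x => w' t x * v t x + w t x * v' t x).

Lemma tder_const (c : R) : tder (fun _ _ => c) (fun _ _ => 0).
Proof. by apply: (tder_cst (c := fun=> c)); exact: bmf_cst. Qed.

Lemma tder_scale (c : R) w w' : tder w w' ->
  tder (fun t x => c * w t x) (fun t x => c * w' t x).
Proof.
move=> dw; rewrite (_ : (fun t x => c * w' t x) = (fun t x => 0 * w t x + c * w' t x)).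
  exact: (tder_mul (tder_const c)).
by apply/funext => t; apply/funext => x; rewrite mul0r add0r.
Qed.

Lemma tder_next w w' : tder w w' -> exists w'', tder w' w''.
Proof.
elim=> {w w'} [c bc|lam b l0|w w' v v' dw [w2 dw2] dv [v2 dv2]|w w' v v' dw [w2 dw2] dv [v2 dv2]].
- by eexists; exact: tder_const 0.
- by eexists; apply: tder_scale; exact: tder_pw.
- by eexists; apply: tder_add; [exact: dw2|exact: dv2].
- by eexists; apply: tder_add; [exact: tder_mul dw2 dv|exact: tder_mul dw dv2].
Qed.

Variable T : R.
Hypothesis T0 : 0 < T.

Definition time_weight w w' := exists2 C : R, 0 <= C & forall t, 0 <= t -> t <= T ->
  [/\ measurable_fun D (w t), measurable_fun D (w' t),
      forall x, D x -> `|w t x| <= C, forall x, D x -> `|w' t x| <= C &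
      forall h x, 0 <= h -> t + h <= T -> D x ->
        `|w (t + h) x - w t x - h * w' t x| <= C * h ^+ 2].

Lemma bmf_pw_time t lam b : 0 <= t -> 0 <= lam -> bmf (pw (1 + t) lam b).
Proof.
move=> t0; rewrite le_eqVlt => /predU1P[<-|l0].
  rewrite (_ : pw _ _ _ = fun=> (1 + t) `^ b); first exact: bmf_cst.
  by apply/funext => x; rewrite /pw mul0r addr0.
by apply: bmf_pw => //; rewrite addr_ge0.
Qed.

Lemma tder_weight w w' : tder w w' -> time_weight w w'.
Proof.
elim=> {w w'} [c [mc [C cC]]|lam b l0|w w' v v' _ [C C0 CP] _ [K K0 KP]
  |w w' v v' _ [C C0 CP] _ [K K0 KP]].
- exists `|C| => // t t0 tT; split=> //.
  + by move=> x Dx; exact: le_trans (cC _ Dx) (ler_norm _).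
  + by move=> x Dx; rewrite normr0.
  + by move=> h x *; rewrite subrr mulr0 subr0 normr0 mulr_ge0 ?sqr_ge0.
- have [r0 [R0 [r00 R00 rP]]] := domain_bounds bD D0.
  pose Z := 1 + T + lam * R0.
  have base t x : 0 <= t -> t <= T -> D x -> 1 <= 1 + t + lam * enorm x <= Z.
    move=> t0 tT Dx; have [_ xR] := rP _ Dx.
    rewrite -addrA lerDl addr_ge0 ?mulr_ge0 ?enorm_ge0//= /Z addrA.
    by rewrite lerD// ?lerD2l// ler_wpM2l.
  have Z1 a : 0 <= 1 + Z `^ a by rewrite addr_ge0 ?powR_ge0.
  have bnd t x a : 0 <= t -> t <= T -> D x -> `|pw (1 + t) lam a x| <= 1 + Z `^ a.
    move=> t0 tT Dx; rewrite ger0_norm ?powR_ge0//.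
    by have := @powR_le_ends R 1 Z _ a ltr01 (base _ _ t0 tT Dx); rewrite powR1.
  exists ((1 + Z `^ b) + `|b| * (1 + Z `^ (b - 1)) + `|b * (b - 1)| * (1 + Z `^ (b - 2))).
    by apply: addr_ge0; [apply: addr_ge0 => //; exact: mulr_ge0|exact: mulr_ge0].
  move=> t t0 tT; split.
  + by have [] := bmf_pw_time b t0 l0.
  + by apply: measurable_funM => //; have [] := bmf_pw_time (b - 1) t0 l0.
  + by move=> x Dx; apply: le_trans (bnd t x b t0 tT Dx) _; rewrite -addrA lerDl addr_ge0// mulr_ge0.
  + move=> x Dx; rewrite normrM addrAC; apply: le_trans (_ : `|b| * (1 + Z `^ (b - 1)) <= _).
      by rewrite ler_wpM2l// bnd.
    by rewrite lerDr addr_ge0// mulr_ge0.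
  + move=> h x h0 thT Dx; have th0 : 0 <= t + h by rewrite addr_ge0.
    have /andP[y1 _] := base _ _ t0 tT Dx; have /andP[_ yZ] := base _ _ th0 thT Dx.
    rewrite /pw (_ : 1 + (t + h) + lam * enorm x = 1 + t + lam * enorm x + h) in yZ *; last by ring.
    apply: le_trans (powR_taylor b y1 h0 yZ) _; rewrite ler_wpM2r ?sqr_ge0//.
    by rewrite lerDr addr_ge0// mulr_ge0.
- exists (C + K); first by rewrite addr_ge0.
  move=> t t0 tT; have [mw mw' bw bw' dw] := CP t t0 tT; have [mv mv' bv bv' dv] := KP t t0 tT.
  split; [exact: measurable_funD|exact: measurable_funD| | |].
  + by move=> x Dx; apply: le_trans (ler_normD _ _) _; apply: lerD; [exact: bw|exact: bv].
  + by move=> x Dx; apply: le_trans (ler_normD _ _) _; apply: lerD; [exact: bw'|exact: bv'].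
  + move=> h x h0 thT Dx.
    rewrite (_ : _ - _ - _ = (w (t + h) x - w t x - h * w' t x) + (v (t + h) x - v t x - h * v' t x)).
      by apply: le_trans (ler_normD _ _) _; rewrite mulrDl; apply: lerD; [exact: dw|exact: dv].
    by ring.
- exists (C * K + (C * K + C * K) + (C * K + C * K + C * (K + K * T))).
    by nneg.
  move=> t t0 tT; have [mw mw' bw bw' dw] := CP t t0 tT; have [mv mv' bv bv' dv] := KP t t0 tT.
  have CK : 0 <= C * K by rewrite mulr_ge0.
  have CT : 0 <= C * (K + K * T) by nneg.
  split.
  + exact: measurable_funM.
  + by apply: measurable_funD; exact: measurable_funM.
  + move=> x Dx; rewrite normrM; apply: le_trans (_ : C * K <= _).
      by apply: ler_pM => //; [exact: bw|exact: bv].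
    by rewrite -addrA lerDl !addr_ge0.
  + move=> x Dx; apply: le_trans (ler_normD _ _) _; rewrite !normrM.
    apply: le_trans (_ : C * K + C * K <= _).
      by apply: lerD; apply: ler_pM => //; [exact: bw'|exact: bv|exact: bw|exact: bv'].
    by rewrite addrAC lerDr !addr_ge0.
  + move=> h x h0 thT Dx; have th0 : 0 <= t + h by rewrite addr_ge0.
    have [_ _ bv2 _ _] := KP _ th0 thT.
    rewrite (_ : _ - _ - _ = (w (t + h) x - w t x - h * w' t x) * v (t + h) x
        + w t x * (v (t + h) x - v t x - h * v' t x)
        + h * w' t x * (v (t + h) x - v t x)); last by ring.
    have hT : h <= T by rewrite (le_trans _ thT)// lerDr.
    have vl : `|v (t + h) x - v t x| <= (K + K * T) * h.
      rewrite (_ : v (t + h) x - v t x = (v (t + h) x - v t x - h * v' t x) + h * v' t x); last by ring.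
      apply: le_trans (ler_normD _ _) _; rewrite mulrDl addrC; apply: lerD.
        by rewrite normrM ger0_norm// mulrC ler_wpM2r// bv'.
      apply: le_trans (dv _ _ h0 thT Dx) _; rewrite expr2 mulrA ler_wpM2r//.
      by rewrite ler_wpM2l.
    apply: (@le_trans _ _ ((C * K + C * K + C * (K + K * T)) * h ^+ 2)); last first.
      by rewrite ler_wpM2r ?sqr_ge0// lerDr !addr_ge0.
    rewrite [leRHS]mulrDl [X in _ <= X + _]mulrDl; apply: le_trans (ler_normD _ _) _; apply: lerD.
      apply: le_trans (ler_normD _ _) _; apply: lerD; rewrite normrM.
        rewrite mulrAC; apply: ler_pM => //; [exact: dw|exact: bv2].
      rewrite -mulrA; apply: ler_pM => //; [exact: bw|exact: dv].
    rewrite (_ : C * (K + K * T) * h ^+ 2 = C * (h * ((K + K * T) * h))); last by ring.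
    rewrite (_ : h * w' t x * (v (t + h) x - v t x) = w' t x * (h * (v (t + h) x - v t x))); last by ring.
    rewrite normrM; apply: ler_pM => //; first exact: bw'.
    by rewrite normrM (ger0_norm h0); exact: ler_wpM2l.
Qed.

(** On [[0, T]] the Taylor remainder [C h^2] is at most [C T h], whence [C + C T]. *)
Lemma time_weight_lip w w' : time_weight w w' -> exists2 C : R, 0 <= C &
  forall s t x, 0 <= s -> s <= T -> 0 <= t -> t <= T -> D x ->
    `|w s x - w t x| <= C * `|s - t|.
Proof.
move=> [C C0 CP]; exists (C + C * T); first by nneg.
have key t h x : 0 <= t -> 0 <= h -> t + h <= T -> D x -> `|w (t + h) x - w t x| <= (C + C * T) * h.
  move=> t0 h0 thT Dx; have tT : t <= T by rewrite (le_trans _ thT)// lerDl.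
  have hT : h <= T by rewrite (le_trans _ thT)// lerDr.
  have [_ _ _ bw' dw] := CP t t0 tT.
  rewrite (_ : w (t + h) x - w t x = (w (t + h) x - w t x - h * w' t x) + h * w' t x); last by ring.
  apply: le_trans (ler_normD _ _) _; rewrite mulrDl addrC; apply: lerD.
    by rewrite normrM ger0_norm// mulrC ler_wpM2r// bw'.
  apply: le_trans (dw _ _ h0 thT Dx) _; rewrite expr2 mulrA ler_wpM2r//.
  by rewrite ler_wpM2l.
move=> s t x s0 sT t0 tT Dx; have [ts|/ltW st] := leP t s.
  have h0 : 0 <= s - t by rewrite subr_ge0.
  have e : t + (s - t) = s by rewrite addrC subrK.
  by have := key t (s - t) x t0 h0; rewrite e (ger0_norm h0); apply.
have h0 : 0 <= t - s by rewrite subr_ge0.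
have e : s + (t - s) = t by rewrite addrC subrK.
by have := key s (t - s) x s0 h0; rewrite e distrC [`|s - t|]distrC (ger0_norm h0); apply.
Qed.

End time_weights.

(** * Bilinear forms built from weights *)

Section weighted_forms.
Context {R : realType} {N : nat}.
Local Notation E := 'rV[R]_N.
Local Notation leb := (@lebesgue_rV R N).
Local Notation state := (@state R N).
Variable D : set E.
Hypotheses (oD : open D) (bD : bounded_set D) (D0 : ~ closure D 0).
Hypothesis N2 : (2 <= N)%N.
Variable T : R.
Hypothesis T0 : 0 < T.
Implicit Types (u f g : E -> R) (U W Y Z : state) (x : E) (w : R -> E -> R) (s t h c : R).
Implicit Types (B : R -> state -> state -> R).

Local Notation Int := (Int leb D).
Local Notation intg := (intg leb D).
Local Notation l2 := (l2 leb D).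
Local Notation n2 := (n2 leb D).
Local Notation bmf := (bmf D).
Local Notation P := (phase_space D).
Local Notation nrm := (nrm D).
Local Notation form_family := (form_family P nrm T).
Local Notation form_derivative := (form_derivative P nrm T).
Local Notation time_weight := (time_weight D T).

Let mD : measurable D := open_measurable_rV oD.
Local Hint Resolve mD : core.

(** The components [u], [v] and the partial derivatives of [u], treated alike. Linearity is asked
    only up to an L^2-null function, because [nabla] is a choice. *)
Definition coordinate (q : state -> E -> R) : Prop :=
  [/\ forall U, P U -> l2 (q U),
      forall U c W, P U -> P W -> n2 (fun x => q (U + c *: W) x - (q U x + c * q W x)) = 0 &
      forall U, P U -> n2 (q U) <= nrm U].

Lemma n2_refl0 f : n2 (fun x => f x - f x) = 0.
Proof.
rewrite /n2 (_ : Int _ = 0) ?sqrtr0//.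
by rewrite -[RHS](Int0 leb mD); apply: eq_Int => x _; rewrite subrr expr0n.
Qed.

Lemma sum_n2_ge0 u : 0 <= \sum_i n2 (fun x => nabla D u x 0 i).
Proof. by apply: sumr_ge0 => i _; exact: n2_ge0. Qed.

Lemma coord_fst : coordinate fst.
Proof.
split=> [U [hU _]|U c W _ _|U _]; first exact: H10_l2'.
  exact: n2_refl0.
by rewrite /nrm -addrA lerDl addr_ge0 ?n2_ge0// sum_n2_ge0.
Qed.

Lemma coord_snd : coordinate snd.
Proof.
split=> [U [_ lU]//|U c W _ _|U _]; first exact: n2_refl0.
by rewrite /nrm lerDr addr_ge0 ?n2_ge0// sum_n2_ge0.
Qed.

Lemma coord_nabla i : coordinate (fun U x => nabla D U.1 x 0 i).
Proof.
split=> [U [hU _]|U c W [hU _] [hW _]|U _]; first exact: nabla_l2.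
  exact: (nablaD oD bD D0).
rewrite /nrm (bigD1 i)//= addrAC addrCA lerDl !addr_ge0 ?n2_ge0// sumr_ge0// => j _.
exact: n2_ge0.
Qed.

(** A form together with its time derivative, without symmetry: the cross term of [wform] is a sum
    of two pieces, neither of which is symmetric. Symmetry is restored in [fam_form]. *)
Definition fam B B' := exists2 C : R, 0 <= C &
  forall t, 0 <= t -> t <= T -> forall U W, P U -> P W ->
  [/\ forall c U', P U' -> B t (U + c *: U') W = B t U W + c * B t U' W,
      `|B t U W| <= C * (nrm U * nrm W),
      forall s, 0 <= s -> s <= T -> `|B s U W - B t U W| <= C * `|s - t| * (nrm U * nrm W) &
      forall h, 0 <= h -> t + h <= T ->
        `|B (t + h) U W - B t U W - h * B' t U W| <= C * h ^+ 2 * (nrm U * nrm W)].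

Lemma famD B B' A A' : fam B B' -> fam A A' ->
  fam (fun t U W => B t U W + A t U W) (fun t U W => B' t U W + A' t U W).
Proof.
move=> [C C0 CP] [K K0 KP]; exists (C + K); first exact: addr_ge0.
move=> t t0 tT U W PU PW.
have [l1 b1 p1 d1] := CP t t0 tT U W PU PW; have [l2' b2 p2 d2] := KP t t0 tT U W PU PW.
split.
- by move=> c U' PU'; rewrite l1// l2'//; ring.
- by apply: le_trans (ler_normD _ _) _; rewrite mulrDl lerD.
- move=> s s0 sT; rewrite opprD addrACA; apply: le_trans (ler_normD _ _) _.
  by rewrite (mulrDl C K) mulrDl lerD ?p1 ?p2.
- move=> h h0 hT; rewrite (_ : _ - _ - _ = (B (t + h) U W - B t U W - h * B' t U W) +
    (A (t + h) U W - A t U W - h * A' t U W)); last by ring.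
  by apply: le_trans (ler_normD _ _) _; rewrite (mulrDl C K) mulrDl lerD ?d1 ?d2.
Qed.

Lemma fam0 : fam (fun _ _ _ => 0) (fun _ _ _ => 0).
Proof.
exists 0 => // t t0 tT U W _ _; split.
- by move=> *; rewrite mulr0 addr0.
- by rewrite normr0 mul0r.
- by move=> *; rewrite subrr normr0 !mul0r.
- by move=> *; rewrite mulr0 !subr0 normr0 !mul0r.
Qed.

Lemma fam_sum (r : seq 'I_N) (B B' : 'I_N -> R -> state -> state -> R) :
  (forall i, fam (B i) (B' i)) ->
  fam (fun t U W => \sum_(i <- r) B i t U W) (fun t U W => \sum_(i <- r) B' i t U W).
Proof.
move=> fB; elim: r => [|i r IH].
  have := fam0; congr fam; do 3!apply/funext => ?; by rewrite big_nil.
have := famD (fB i) IH; congr fam; do 3!apply/funext => ?; by rewrite big_cons.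
Qed.

(** Cauchy-Schwarz transfers each bound on the weight, Taylor remainder included, to the form. *)
Lemma fam_elem w w' (p q : state -> E -> R) : time_weight w w' -> coordinate p -> coordinate q ->
  fam (fun t U W => Int (fun x => w t x * (p U x * q W x)))
      (fun t U W => Int (fun x => w' t x * (p U x * q W x))).
Proof.
move=> tw [lp dp bp] [lq _ bq]; have [C C0 CP] := tw; have [K K0 KP] := time_weight_lip T0 tw.
have CK : 0 <= C + K by rewrite addr_ge0.
exists (C + K) => // t t0 tT U W PU PW; have [mw mw' bw bw' dw] := CP t t0 tT.
have lpU := lp _ PU; have lqW := lq _ PW.
have bmw : bmf (w t) by split=> //; exists C.
have bmw' : bmf (w' t) by split=> //; exists C.
have i0 := intg_bmf2 mD bmw lpU lqW.
have main (v : E -> R) (a : R) : measurable_fun D v -> 0 <= a -> (forall x, D x -> `|v x| <= a) ->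
    `|Int (fun x => v x * (p U x * q W x))| <= a * (nrm U * nrm W).
  move=> mv a0 va; apply: le_trans (n2_bmf3 mD va mv a0 lpU lqW) _.
  by rewrite ler_wpM2l// ler_pM ?n2_ge0// ?bp ?bq.
split.
- move=> c U' PU'; have PUU' := phaseD oD bD D0 c PU PU'.
  have lpU' := lp _ PU'; have lpUU := lp _ PUU'.
  have i1 := intg_bmf2 mD bmw lpU' lqW; have i2 := intg_bmf2 mD bmw lpUU lqW.
  have i01 := intgD mD i0 (intgZ mD c i1).
  apply/eqP; rewrite -subr_eq0 -normr_le0; rewrite -(IntZ mD _ i1) -(IntD mD i0 (intgZ mD c i1)) -(IntB mD i2 i01).
  have ld : l2 (fun x => p (U + c *: U') x - (p U x + c * p U' x)).
    exact: (l2B mD lpUU (l2D mD lpU (l2Z mD c lpU'))).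
  rewrite (@eq_Int _ _ _ _ _ _ (fun x => w t x * ((p (U + c *: U') x - (p U x + c * p U' x)) * q W x))).
    by apply: le_trans (n2_bmf3 mD bw mw C0 ld lqW) _; rewrite dp// mul0r mulr0.
  by move=> x _; ring.
- by apply: main => // x Dx; apply: le_trans (bw _ Dx) _; rewrite lerDl.
- move=> s s0 sT; have [mws _ bws _ _] := CP s s0 sT.
  have bms : bmf (w s) by split=> //; exists C.
  have is_ := intg_bmf2 mD bms lpU lqW.
  rewrite -(IntB mD is_ i0) (@eq_Int _ _ _ _ _ _ (fun x => (w s x - w t x) * (p U x * q W x))).
    apply: main; [exact: measurable_funB|by rewrite mulr_ge0|].
    move=> x Dx; apply: le_trans (KP _ _ _ s0 sT t0 tT Dx) _.
    by rewrite ler_wpM2r// lerDr.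
  by move=> x _; ring.
- move=> h h0 thT; have th0 : 0 <= t + h by rewrite addr_ge0.
  have [mws _ bws _ _] := CP _ th0 thT.
  have bms : bmf (w (t + h)) by split=> //; exists C.
  have is_ := intg_bmf2 mD bms lpU lqW; have i' := intg_bmf2 mD bmw' lpU lqW.
  rewrite -(IntB mD is_ i0) -(IntZ mD _ i') -(IntB mD (intgB mD is_ i0) (intgZ mD h i')).
  rewrite (@eq_Int _ _ _ _ _ _ (fun x => (w (t + h) x - w t x - h * w' t x) * (p U x * q W x))).
    apply: main; last 2 first.
    + by rewrite mulr_ge0 ?sqr_ge0.
    + by move=> x Dx; apply: le_trans (dw _ _ h0 thT Dx) _; rewrite ler_wpM2r ?sqr_ge0// lerDl.
    by apply: measurable_funB; [exact: measurable_funB|exact: measurable_funM].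
  by move=> x _; ring.
Qed.

Definition wform (w1 w2 w3 w4 : R -> E -> R) t U Y : R :=
  Int (fun x => w1 t x * dotg (nabla D U.1) (nabla D Y.1) x + w2 t x * (U.2 x * Y.2 x)
    + w3 t x * (U.1 x * Y.2 x + U.2 x * Y.1 x) + w4 t x * (U.1 x * Y.1 x)).

Lemma wform_intg (a1 a2 a3 a4 : E -> R) U Y : bmf a1 -> bmf a2 -> bmf a3 -> bmf a4 -> P U -> P Y ->
  intg (fun x => a1 x * dotg (nabla D U.1) (nabla D Y.1) x + a2 x * (U.2 x * Y.2 x)
    + a3 x * (U.1 x * Y.2 x + U.2 x * Y.1 x) + a4 x * (U.1 x * Y.1 x)).
Proof.
move=> b1 b2 b3 b4 [hU lU] [hY lY]; have lU1 := H10_l2' hU; have lY1 := H10_l2' hY.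
apply: intgD => //; last exact: intg_bmf2.
apply: intgD => //; last by apply: intg_bmf => //; apply: intgD => //; exact: l2_mul.
apply: intgD => //; last exact: intg_bmf2.
by apply: (intg_dotg oD b1 (nablaP hU) (nablaP hY)).
Qed.

Lemma wformE w1 w2 w3 w4 t U Y : bmf (w1 t) -> bmf (w2 t) -> bmf (w3 t) -> bmf (w4 t) ->
  P U -> P Y -> wform w1 w2 w3 w4 t U Y =
  \sum_i Int (fun x => w1 t x * (nabla D U.1 x 0 i * nabla D Y.1 x 0 i))
  + Int (fun x => w2 t x * (U.2 x * Y.2 x)) + Int (fun x => w3 t x * (U.1 x * Y.2 x))
  + Int (fun x => w3 t x * (U.2 x * Y.1 x)) + Int (fun x => w4 t x * (U.1 x * Y.1 x)).
Proof.
move=> b1 b2 b3 b4 [hU lU] [hY lY]; have lU1 := H10_l2' hU; have lY1 := H10_l2' hY.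
have i1 i := intg_bmf2 mD b1 (nabla_l2 i hU) (nabla_l2 i hY).
have i2 := intg_bmf2 mD b2 lU lY; have i3 := intg_bmf2 mD b3 lU1 lY.
have i4 := intg_bmf2 mD b3 lU lY1; have i5 := intg_bmf2 mD b4 lU1 lY1.
have is_ := intg_sum mD (index_enum 'I_N) i1.
rewrite -Int_sum// -(IntD mD is_ i2) -(IntD mD (intgD mD is_ i2) i3).
rewrite -(IntD mD (intgD mD (intgD mD is_ i2) i3) i4).
rewrite -(IntD mD (intgD mD (intgD mD (intgD mD is_ i2) i3) i4) i5).
apply: eq_Int => x _; rewrite /dotg mulr_sumr; ring.
Qed.

Lemma fam_ext B B' A A' : (forall t, 0 <= t -> t <= T -> forall U W, P U -> P W ->
  B t U W = A t U W /\ B' t U W = A' t U W) -> fam B B' -> fam A A'.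
Proof.
move=> e [C C0 CP]; exists C => // t t0 tT U W PU PW.
have [l b p d] := CP t t0 tT U W PU PW; have [e1 e2] := e t t0 tT U W PU PW; split.
- move=> c U' PU'; have PUU' := phaseD oD bD D0 c PU PU'.
  by rewrite -e1 -(e t t0 tT U' W PU' PW).1 -(e t t0 tT _ W PUU' PW).1 l.
- by rewrite -e1.
- by move=> s s0 sT; rewrite -e1 -(e s s0 sT U W PU PW).1 p.
- move=> h h0 thT; have th0 : 0 <= t + h by rewrite addr_ge0.
  by rewrite -e1 -e2 -(e _ th0 thT U W PU PW).1 d.
Qed.

Lemma wform_fam w1 w1' w2 w2' w3 w3' w4 w4' : time_weight w1 w1' -> time_weight w2 w2' ->
  time_weight w3 w3' -> time_weight w4 w4' ->
  fam (wform w1 w2 w3 w4) (wform w1' w2' w3' w4').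
Proof.
move=> t1 t2 t3 t4.
have bb (v v' : R -> E -> R) t : time_weight v v' -> 0 <= t -> t <= T -> bmf (v t) /\ bmf (v' t).
  by move=> [C _ CP] t0 tT; have [? ? ? ? _] := CP t t0 tT; split; split=> //; exists C.
have f1 := fam_sum (index_enum 'I_N) (fun i => fam_elem t1 (coord_nabla i) (coord_nabla i)).
have := famD (famD (famD (famD f1 (fam_elem t2 coord_snd coord_snd))
  (fam_elem t3 coord_fst coord_snd)) (fam_elem t3 coord_snd coord_fst))
  (fam_elem t4 coord_fst coord_fst).
apply: fam_ext => t tge tT U W PU PW.
have [? ?] := bb _ _ _ t1 tge tT; have [? ?] := bb _ _ _ t2 tge tT.
have [? ?] := bb _ _ _ t3 tge tT; have [? ?] := bb _ _ _ t4 tge tT.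
by rewrite !wformE.
Qed.

Lemma wform_sym w1 w2 w3 w4 t U Y : wform w1 w2 w3 w4 t U Y = wform w1 w2 w3 w4 t Y U.
Proof.
apply: eq_Int => x _; rewrite (_ : dotg _ _ x = dotg (nabla D Y.1) (nabla D U.1) x); first by ring.
by apply: eq_bigr => i _; rewrite mulrC.
Qed.

Lemma fam_form B B' : fam B B' -> (forall t U Y, B t U Y = B t Y U) -> form_family B.
Proof.
move=> [C C0 CP] sy; exists C; split=> //.
- by move=> t U c U' W t0 tT PU PU' PW; have [l _ _ _] := CP t t0 tT U W PU PW; exact: l.
- by move=> t U W t0 tT PU PW; have [] := CP t t0 tT U W PU PW.
- by move=> s t U W s0 sT t0 tT PU PW; have [_ _ p _] := CP t t0 tT U W PU PW; exact: p.
Qed.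

Lemma fam_der B B' : fam B B' -> form_derivative B B'.
Proof.
move=> [C C0 CP]; exists C => // t h U t0 h0 thT PU.
have tT : t <= T by rewrite (le_trans _ thT)// lerDl.
by have [_ _ _ d] := CP t t0 tT U U PU PU; rewrite [nrm U ^+ 2]expr2 d.
Qed.

Lemma tder_wform w1 w1' w2 w2' w3 w3' w4 w4' : tder D w1 w1' -> tder D w2 w2' ->
  tder D w3 w3' -> tder D w4 w4' ->
  [/\ form_family (wform w1 w2 w3 w4), form_family (wform w1' w2' w3' w4') &
      form_derivative (wform w1 w2 w3 w4) (wform w1' w2' w3' w4')].
Proof.
move=> d1 d2 d3 d4; have tw v v' := @tder_weight R N D oD bD D0 T T0 v v'.
have f := wform_fam (tw _ _ d1) (tw _ _ d2) (tw _ _ d3) (tw _ _ d4).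
have [v1 e1] := tder_next d1; have [v2 e2] := tder_next d2.
have [v3 e3] := tder_next d3; have [v4 e4] := tder_next d4.
have f' := wform_fam (tw _ _ e1) (tw _ _ e2) (tw _ _ e3) (tw _ _ e4).
split; [apply: fam_form f _|apply: fam_form f' _|exact: fam_der] => *; exact: wform_sym.
Qed.

Lemma form_familyD B A (M : R) : form_family B -> form_family A ->
  form_family (fun t U W => B t U W + M * A t U W).
Proof.
move=> [C [C0 l s b p]] [K [K0 l' s' b' p']]; exists (C + `|M| * K); split.
- by rewrite addr_ge0// mulr_ge0.
- by move=> t U c U' W t0 tT PU PU' PW; rewrite l// l'//; ring.
- by move=> t U W t0 tT PU PW; rewrite s// s'.
- move=> t U W t0 tT PU PW; apply: le_trans (ler_normD _ _) _.
  by rewrite mulrDl lerD ?b// normrM -mulrA ler_wpM2l// b'.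
- move=> r t U W r0 rT t0 tT PU PW.
  rewrite (_ : _ - _ = (B r U W - B t U W) + M * (A r U W - A t U W)); last by ring.
  apply: le_trans (ler_normD _ _) _; rewrite (mulrDl C) mulrDl lerD ?p// normrM.
  rewrite (_ : `|M| * K * `|r - t| * (nrm U * nrm W) = `|M| * (K * `|r - t| * (nrm U * nrm W))); last by ring.
  by rewrite ler_wpM2l// p'.
Qed.

Lemma form_derivativeD B B' A A' (M : R) : form_derivative B B' -> form_derivative A A' ->
  form_derivative (fun t U W => B t U W + M * A t U W) (fun t U W => B' t U W + M * A' t U W).
Proof.
move=> [C C0 CP] [K K0 KP]; exists (C + `|M| * K); first by rewrite addr_ge0// mulr_ge0.
move=> t h U t0 h0 thT PU.
rewrite (_ : _ - _ - _ = (B (t + h) U U - B t U U - h * B' t U U) +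
  M * (A (t + h) U U - A t U U - h * A' t U U)); last by ring.
apply: le_trans (ler_normD _ _) _; rewrite (mulrDl C) mulrDl; apply: lerD; first exact: CP.
rewrite normrM (_ : `|M| * K * h ^+ 2 * nrm U ^+ 2 = `|M| * (K * h ^+ 2 * nrm U ^+ 2)); last by ring.
by apply: ler_wpM2l => //; exact: KP.
Qed.

Variable L : state -> state.
Hypothesis PL : forall U, P U -> P (L U).
Hypothesis Llin : forall U c W, P U -> P W -> nrm (L (U + c *: W) - (L U + c *: L W)) = 0.
Hypothesis Lbd : exists2 C : R, 0 <= C & forall U, P U -> nrm (L U) <= C * nrm U.

Let P0 : P 0 := phase0 oD bD D0.
Let PD_ U c W : P U -> P W -> P (U + c *: W) := @phaseD R N D oD bD D0 U c W.
Let nD U c W : P U -> P W -> nrm (U + c *: W) <= nrm U + `|c| * nrm W :=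
  @nrmD R N D oD bD D0 U c W.

(** Turns a form evaluated at [A^-1 U] into a form in [U]; linearity of [L] up to null states is
    enough, since bounded forms do not see those. *)
Lemma form_family_comp B : form_family B -> form_family (fun t U W => B t (L U) (L W)).
Proof.
move=> fB; have [C [C0 l s b p]] := fB; have [K K0 KP] := Lbd.
have KK U W : P U -> P W -> nrm (L U) * nrm (L W) <= K ^+ 2 * (nrm U * nrm W).
  move=> PU PW; rewrite expr2 mulrACA; apply: ler_pM; rewrite ?nrm_ge0 ?KP//; exact: nrm_ge0.
exists (C * K ^+ 2); split.
- by rewrite mulr_ge0 ?sqr_ge0.
- move=> t U c U' W t0 tT PU PU' PW.
  have e1 : eqv P nrm (L (U + c *: U')) (L U + c *: L U').
    split; [exact/PL/PD_|by apply: PD_; exact: PL|exact: Llin].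
  have e2 : eqv P nrm (L W) (L W).
    by split; [exact: PL|exact: PL|rewrite subrr (nrm0 oD bD D0)].
  rewrite -l//; try exact: PL.
  exact: (form_eqv PD_ (@nrm_ge0 R N D) nD fB).
- by move=> t U W t0 tT PU PW; apply: s => //; exact: PL.
- move=> t U W t0 tT PU PW; apply: le_trans (b _ _ _ t0 tT (PL PU) (PL PW)) _.
  by rewrite -mulrA ler_wpM2l// KK.
- move=> r t U W r0 rT t0 tT PU PW; apply: le_trans (p _ _ _ _ r0 rT t0 tT (PL PU) (PL PW)) _.
  rewrite (_ : C * K ^+ 2 * `|r - t| * (nrm U * nrm W) = C * `|r - t| * (K ^+ 2 * (nrm U * nrm W))); last by ring.
  by apply: ler_wpM2l; [exact: mulr_ge0|exact: KK].
Qed.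

Lemma form_derivative_comp B B' : form_derivative B B' ->
  form_derivative (fun t U W => B t (L U) (L W)) (fun t U W => B' t (L U) (L W)).
Proof.
move=> [C C0 CP]; have [K K0 KP] := Lbd; exists (C * K ^+ 2).
  by rewrite mulr_ge0 ?sqr_ge0.
move=> t h U t0 h0 thT PU; apply: le_trans (CP _ _ _ t0 h0 thT (PL PU)) _.
rewrite (_ : C * K ^+ 2 * h ^+ 2 * nrm U ^+ 2 = C * h ^+ 2 * (K * nrm U) ^+ 2); last by ring.
apply: ler_wpM2l; first by rewrite mulr_ge0 ?sqr_ge0.
rewrite ler_sqr ?nnegrE ?KP ?nrm_ge0//; first by rewrite mulr_ge0// nrm_ge0.
Qed.

End weighted_forms.

(** * Energy estimates *)

Section energy_estimates.
Context {R : realType} {N : nat}.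
Local Notation E := 'rV[R]_N.
Local Notation leb := (@lebesgue_rV R N).
Local Notation state := (@state R N).
Variable D : set E.
Hypotheses (oD : open D) (bD : bounded_set D) (D0 : ~ closure D 0).
Variable V : R.
Implicit Types (u v f h : E -> R) (U Y Z : state) (x : E) (s c mu kap : R).

Local Notation Int := (Int leb D).
Local Notation intg := (intg leb D).
Local Notation l2 := (l2 leb D).
Local Notation bmf := (bmf D).
Local Notation P := (phase_space D).
Local Notation n := (N%:R : R).

Let mD : measurable D := open_measurable_rV oD.
Local Hint Resolve mD : core.

Definition gsq U x : R := dotg (nabla D U.1) (nabla D U.1) x.
Definition rad U x : R := drad (nabla D U.1) x.

Lemma gsq_ge0 U x : 0 <= gsq U x.
Proof. by apply: sumr_ge0 => i _; rewrite -expr2 sqr_ge0. Qed.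

Lemma rad_le U x : D x -> rad U x ^+ 2 <= gsq U x.
Proof. by move=> /(domain_n0 D0); exact: drad_sqr_le. Qed.

Lemma enorm_D x : D x -> 0 < enorm x.
Proof. by move=> /(domain_n0 D0); exact: enorm_gt0. Qed.

Definition rinv x : R := pw 0 1 (-1) x.

Lemma rinvE x : rinv x = (enorm x)^-1.
Proof. by rewrite /rinv /pw add0r mul1r powR_inv1// enorm_ge0. Qed.

Lemma rw_rinv : radial_weight D rinv (fun x => -1 * 1 * pw 0 1 (-1 - 1) x).
Proof. exact: rw_pw. Qed.

Lemma bmf_rinv : bmf rinv.
Proof. by case: rw_rinv. Qed.

Lemma rinv_derE x : x != 0 -> -1 * 1 * pw 0 1 (-1 - 1) x = - rinv x ^+ 2.
Proof.
move=> x0; rewrite /pw add0r mul1r powRD; last by apply/implyP => _; rewrite gt_eqF// enorm_gt0.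
by rewrite powR_inv1 ?enorm_ge0// -rinvE; ring.
Qed.

(** Green's formula with the multipliers [w1 v] and [w3 u] removes the Laplacian [h]. The current of
    [a] has integral zero and remains free, to trade [u u_r] for [u^2]. *)
Lemma dual_form (w1 w1' w3 w3' w4 a a' h : E -> R) U : radial_weight D w1 w1' ->
  radial_weight D w3 w3' -> radial_weight D a a' -> bmf w4 ->
  H10 D U.1 -> H10 D U.2 -> weak_laplacian D U.1 h ->
  2 * Int (fun x => w1 x * dotg (nabla D U.1) (nabla D U.2) x
     + w1 x * (U.2 x * (h x - V / enorm x * U.2 x))
     + w3 x * (U.1 x * (h x - V / enorm x * U.2 x) + U.2 x * U.2 x) + w4 x * (U.1 x * U.2 x)) =
  Int (fun x => - 2 * w3 x * gsq U x + (2 * w3 x - 2 * V * w1 x * rinv x) * U.2 x ^+ 2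
     - 2 * w1' x * (rad U x * U.2 x) + (2 * a x - 2 * w3' x) * (U.1 x * rad U x)
     + (a' x + (n - 1) * (a x * rinv x)) * U.1 x ^+ 2
     + (2 * w4 x - 2 * V * w3 x * rinv x) * (U.1 x * U.2 x)).
Proof.
move=> r1 r3 ra b4 h1 h2 lap; have [lh _] := lap.
have l1 := H10_l2' h1; have l2' := H10_l2' h2.
have [_ _ b1 _] := r1; have [_ _ b3 _] := r3.
have ly : l2 (fun x => h x - V / enorm x * U.2 x).
  apply: l2B => //; apply: l2_bmf => //; exact: bmf_damping.
have PK : P U by split.
have PY : P (U.2, fun x => h x - V / enorm x * U.2 x) by split.
have i0 := wform_intg oD b1 b1 b3 b4 PK PY.
have n1 := radial_laplacian oD bD D0 r1 (nablaP h1) (nablaP h2) lap.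
have n3 := radial_laplacian oD bD D0 r3 (nablaP h1) (nablaP h1) lap.
have n4 := radial_current oD bD D0 ra (nablaP h1).
have nn := nullD oD (nullD oD (nullZ oD (-2) n1) (nullZ oD (-2) n3)) n4.
rewrite -(IntZ mD _ i0) (Int_null oD (intgZ mD 2 i0) nn).
apply: eq_Int => x Dx; rewrite /= /gsq /rad rinvE; ring.
Qed.

Variables (t lam : R).
Hypotheses (t0 : 0 <= t) (lam1 : 1 <= lam).
Local Notation Pw c := (pw (1 + t) lam c).
Definition Psl x : R := 1 + t + lam * enorm x.

Let t1 : 0 <= 1 + t. Proof. by rewrite addr_ge0. Qed.
Let lam0 : 0 < lam. Proof. exact: lt_le_trans ltr01 lam1. Qed.

Lemma Psl_gt0 x : 0 < Psl x.
Proof. by rewrite /Psl ltr_wpDr ?mulr_ge0 ?enorm_ge0 ?(ltW lam0)// ltr_wpDr. Qed.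

Lemma Pw_gt0 c x : 0 < Pw c x.
Proof. by rewrite powR_gt0// Psl_gt0. Qed.

Lemma PwS c x : Pw (c + 1) x = Pw c x * Psl x.
Proof.
by rewrite /pw powRD ?powRr1 ?(ltW (Psl_gt0 x))//; apply/implyP => _; rewrite gt_eqF// Psl_gt0.
Qed.

Lemma PwB c x : Pw (c - 1) x = Pw c x / Psl x.
Proof.
have := PwS (c - 1) x; rewrite subrK => ->.
by rewrite mulfK// gt_eqF// Psl_gt0.
Qed.

Lemma bmf_Pw c : bmf (Pw c).
Proof. exact: bmf_pw. Qed.

Lemma p_ge x : D x -> lam <= Psl x / enorm x.
Proof. by move=> /enorm_D r0; rewrite ler_pdivlMr// /Psl lerDr. Qed.

Lemma intg_gsq w U : bmf w -> P U -> intg (fun x => w x * gsq U x).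
Proof. by move=> bw [hU _]; apply: (intg_dotg oD bw (nablaP hU) (nablaP hU)). Qed.

Lemma intg_sqr w f : bmf w -> l2 f -> intg (fun x => w x * f x ^+ 2).
Proof. by move=> bw lf; apply: intg_bmf => //; exact: l2_sqr. Qed.

Lemma l2_rad U : P U -> l2 (rad U).
Proof. by move=> [hU _]; exact: (l2_drad oD D0 (nablaP hU)). Qed.

(* With the current [- al Psl^s x/|x|^2], the difference of the two sides
   becomes a positive definite form in [u_r] and [u/|x|]. *)
Lemma hardy s al U : P U -> 0 < al -> (s < 0 -> 2 * al <= n - 2 + s) -> 2 * al <= n - 2 ->
  al ^+ 2 * Int (fun x => Pw s x * (U.1 x * rinv x) ^+ 2) <= Int (fun x => Pw s x * gsq U x).
Proof.
move=> PU al0 als aln; have [hU _] := PU; have lu := H10_l2' hU.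
have rwa := rwZ al (rwM (rw_pw oD bD D0 s t1 lam0) rw_rinv).
have [ni n0] := radial_current oD bD D0 rwa (nablaP hU).
have lur : l2 (fun x => U.1 x * rinv x).
  by under eq_fun do rewrite mulrC; apply: l2_bmf => //; exact: bmf_rinv.
have i1 := intg_sqr (bmf_Pw s) lur; have i2 := intg_gsq (bmf_Pw s) PU.
rewrite -subr_ge0 -(IntZ mD _ i1) -(IntB mD i2 (intgZ mD _ i1)).
rewrite (Int_null oD (intgB mD i2 (intgZ mD _ i1)) (conj ni n0)).
apply: Int_ge0 => x Dx; have r0 := enorm_D Dx; have y0 := Psl_gt0 x.
rewrite (rinv_derE (domain_n0 D0 Dx)) PwB rinvE -/(rad U x).
set y := Psl x in y0 *; set r := enorm x in r0 *; set q := Pw s x.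
have q0 : 0 < q := Pw_gt0 s x.
set z := lam * r / y; have z0 : 0 <= z by rewrite divr_ge0 ?mulr_ge0 ?ltW.
have z1 : z <= 1 by rewrite ler_pdivrMr// mul1r /y /Psl -/r lerDr.
rewrite [X in 0 <= X](_ : _ = q * (gsq U x - rad U x ^+ 2 + (rad U x + al * (U.1 x / r)) ^+ 2
   + al * (n - 2 + s * z - 2 * al) * (U.1 x / r) ^+ 2)); last first.
  by rewrite /z; field; rewrite !gt_eqF.
apply: mulr_ge0; first exact: ltW.
have GY : 0 <= gsq U x - rad U x ^+ 2 by rewrite subr_ge0 rad_le.
apply: addr_ge0; first by apply: addr_ge0 => //; exact: sqr_ge0.
apply: mulr_ge0; rewrite ?sqr_ge0//; apply: mulr_ge0; first exact: ltW.
have [s0|s0] := ltP s 0; last by have := mulr_ge0 s0 z0; lra.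
have : s * 1 <= s * z by rewrite ler_nM2l.
by have := als s0; lra.
Qed.

(** Green's formula with the multiplier [Psi^s u], plus the current
    [(n - 2) / 2 Psi^s u^2 x / |x|^2], leaves a form in [u_r] and [u / |x|] with [ga - be^2 / 4]
    equal to [((n - 2)^2 - (s z)^2) / 4], where [z = lam |x| / Psi] lies in [[0, 1]]. This is where
    [s < n - 2] is needed. The square of [h |x| + c u / |x|] absorbs the product [h u]. *)
Lemma elliptic s d b c U h : 0 <= s -> s + d <= n - 2 -> 0 < d -> b = 2 * (n - 2) -> 0 < c -> c <= 1 ->
  (forall be ga X w : R, `|be| <= b -> d ^+ 2 / 4 <= ga - be ^+ 2 / 4 ->
    c * (X ^+ 2 + w ^+ 2) <= X ^+ 2 + be * (X * w) + ga * w ^+ 2) ->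
  P U -> weak_laplacian D U.1 h ->
  c ^+ 2 * Int (fun x => Pw s x * (gsq U x + (U.1 x * rinv x) ^+ 2)) <=
  Int (fun x => Pw s x * (h x * enorm x) ^+ 2).
Proof.
move=> s0 sn d0 bE c0 c1 Hc PU lap; have [hU _] := PU; have lu := H10_l2' hU.
have [lh _] := lap.
have rwP := rw_pw oD bD D0 s t1 lam0.
have al0 : 0 <= (n - 2) / 2 by lra.
have n1 := radial_laplacian oD bD D0 rwP (nablaP hU) (nablaP hU) lap.
have n2 := radial_current oD bD D0 (rwZ ((n - 2) / 2) (rwM rwP rw_rinv)) (nablaP hU).
have nn := nullZ oD (2 * c) (nullD oD n1 n2).
have lur : l2 (fun x => U.1 x * rinv x).
  by under eq_fun do rewrite mulrC; apply: l2_bmf => //; exact: bmf_rinv.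
have lhr : l2 (fun x => h x * enorm x).
  under eq_fun do rewrite mulrC; apply: l2_bmf => //.
  rewrite (_ : @enorm R N = pw 0 1 1); first exact: bmf_pw.
  by apply/funext => x; rewrite /pw add0r mul1r powRr1 ?enorm_ge0.
have i1 := intg_gsq (bmf_Pw s) PU; have i2 := intg_sqr (bmf_Pw s) lur.
have i3 := intg_sqr (bmf_Pw s) lhr.
have i12 : intg (fun x => Pw s x * (gsq U x + (U.1 x * rinv x) ^+ 2)).
  by apply: intg_eq (intgD mD i1 i2) => // x _; rewrite mulrDr.
have i4 := intgB mD i3 (intgZ mD (c ^+ 2) i12).
rewrite -subr_ge0 -(IntZ mD _ i12) -(IntB mD i3 (intgZ mD _ i12)).
have [ni n0] := nn.
have -> : Int (fun x => Pw s x * (h x * enorm x) ^+ 2 -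
    c ^+ 2 * (Pw s x * (gsq U x + (U.1 x * rinv x) ^+ 2))) = _ := Int_null oD i4 nn.
apply: Int_ge0 => x Dx; have r0 := enorm_D Dx; have y0 := Psl_gt0 x.
rewrite (rinv_derE (domain_n0 D0 Dx)) PwB rinvE -/(rad U x) -/(gsq U x).
have GY := rad_le U Dx.
set y := Psl x in y0 *; set r := enorm x in r0 *; set q := Pw s x.
have q0 : 0 < q := Pw_gt0 s x.
set z := lam * r / y; have z0 : 0 <= z by rewrite divr_ge0 ?mulr_ge0 ?ltW.
have z1 : z <= 1 by rewrite ler_pdivrMr// mul1r /y /Psl -/r lerDr.
have sz : s * z <= s by rewrite -[leRHS]mulr1 ler_wpM2l.
have sz0 : 0 <= s * z by rewrite mulr_ge0.
have := Hc (s * z + (n - 2)) ((n - 2) / 2 * (n - 2 + s * z)) (rad U x) (U.1 x / r).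
have b3 : (n - 2) / 2 * (n - 2 + s * z) - (s * z + (n - 2)) ^+ 2 / 4 = ((n - 2) ^+ 2 - (s * z) ^+ 2) / 4.
  by field.
rewrite b3.
have b1 : `|s * z + (n - 2)| <= b by rewrite ger0_norm ?bE; lra.
have b2 : d ^+ 2 / 4 <= ((n - 2) ^+ 2 - (s * z) ^+ 2) / 4.
  rewrite ler_pM2r// lerBrDr.
  have h1 : d <= n - 2 - s * z by lra.
  have h2 : 0 <= (n - 2 - s * z - d) * (n - 2 + s * z) by apply: mulr_ge0; lra.
  have h3 : 0 <= d * (n - 2 + s * z - d) by apply: mulr_ge0; lra.
  by move: h2 h3; lra.
move=> /(_ b1 b2) HH.
set w := U.1 x / r in HH *.
rewrite [X in 0 <= X](_ : _ = q * ((h x * r + c * w) ^+ 2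
   + 2 * c * (rad U x ^+ 2 + (s * z + (n - 2)) * (rad U x * w)
       + (n - 2) / 2 * (n - 2 + s * z) * w ^+ 2 - c * (rad U x ^+ 2 + w ^+ 2))
   + c * (2 - c) * (gsq U x - rad U x ^+ 2) + c ^+ 2 * rad U x ^+ 2)); last first.
  by rewrite /z /w; field; rewrite !gt_eqF.
apply: mulr_ge0; first exact: ltW.
apply: addr_ge0; last by rewrite mulr_ge0 ?sqr_ge0.
apply: addr_ge0; last first.
  by apply: mulr_ge0; [apply: mulr_ge0; [exact: ltW|lra]|rewrite subr_ge0].
apply: addr_ge0; first exact: sqr_ge0.
by apply: mulr_ge0; [rewrite mulr_ge0// ltW|rewrite subr_ge0].
Qed.

(** * The forms S(mu, kap) *)

Variables mu kap : R.
(* The cross term [2 fb Psi^mu u v] contributes [2 fb Psi^mu (v^2 - |grad u|^2)]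
   to the derivative; since [lam |x| <= Psi] and the damping contributes
   [- 2 V Psi^(mu+1) v^2 / |x|], this value of [fb] leaves at most
   [- V lam Psi^mu] in front of both [|grad u|^2] and [v^2]. *)
Definition fb : R := V * lam / 2.
(** This value lets the product [u v] complete the square of [X + Y + z] in [damp_core], where
    [z = lam kap w]. *)
Definition fc : R := lam ^+ 2 * (mu + 1) * kap.
Definition sw1 r x : R := pw (1 + r) lam (mu + 1) x.
Definition sw1' r x : R := (mu + 1) * pw (1 + r) lam mu x.
Definition sw3 r x : R := fb * pw (1 + r) lam mu x.
Definition sw3' r x : R := fb * (mu * pw (1 + r) lam (mu - 1) x).
(** The first term cancels the product of the damping with the cross term, [- 2 V w3 u v / |x|], and
    [fb mu] cancels the time derivative of the cross weight; in front of [u v] only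
    [- 2 fc Psi^(mu - 1)] remains. *)
Definition sw4 r x : R := V * fb * (pw (1 + r) lam mu x * rinv x) - (fb * mu + fc) * pw (1 + r) lam (mu - 1) x.
Definition sw4' r x : R := V * fb * (mu * pw (1 + r) lam (mu - 1) x * rinv x)
  - (fb * mu + fc) * ((mu - 1) * pw (1 + r) lam (mu - 1 - 1) x).
Definition Sform := wform D sw1 sw1 sw3 sw4.
Definition Sform' := wform D sw1' sw1' sw3' sw4'.

Lemma tder_eq (w w' v v' : R -> E -> R) : tder D w w' -> (forall r x, v r x = w r x) ->
  (forall r x, v' r x = w' r x) -> tder D v v'.
Proof.
move=> h e e'; rewrite (_ : v = w); last by apply/funext => r; apply/funext => x; exact: e.
by rewrite (_ : v' = w')//; apply/funext => r; apply/funext => x; exact: e'.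
Qed.

Lemma tder_sw1 : tder D sw1 sw1'.
Proof.
apply: tder_eq (tder_pw D (mu + 1) (ltW lam0)) _ _ => r x //.
by rewrite /sw1' addrK.
Qed.

Lemma tder_sw3 : tder D sw3 sw3'.
Proof. exact: (tder_scale _ (tder_pw D mu (ltW lam0))). Qed.

Lemma tder_sw4 : tder D sw4 sw4'.
Proof.
have d1 := tder_scale (V * fb) (tder_mul (tder_pw D mu (ltW lam0)) (tder_cst bmf_rinv)).
have d2 := tder_scale (- (fb * mu + fc)) (tder_pw D (mu - 1) (ltW lam0)).
apply: tder_eq (tder_add d1 d2) _ _ => r x; rewrite /sw4 /sw4'; ring.
Qed.

Lemma rw_Pw c : radial_weight D (Pw c) (fun x => c * lam * Pw (c - 1) x).
Proof. exact: rw_pw. Qed.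

Lemma bmf_sw1 : bmf (sw1 t). Proof. exact: bmf_Pw. Qed.

Lemma bmf_sw3 : bmf (sw3 t).
Proof. by apply: bmfM; [exact: bmf_cst|exact: bmf_Pw]. Qed.

Lemma bmf_sw4 : bmf (sw4 t).
Proof.
apply: bmfD => //.
  by apply: bmfM; [exact: bmf_cst|apply: bmfM; [exact: bmf_Pw|exact: bmf_rinv]].
have := bmfM (bmf_cst D (- (fb * mu + fc))) (bmf_Pw (mu - 1)).
by congr (bmf _); apply/funext => x; rewrite mulNr.
Qed.

(** The choice of the weights makes the density depend on [x] only through [damp], the common factor
    [Psi^mu] aside. *)
Lemma Sform_dual U h : H10 D U.1 -> H10 D U.2 -> weak_laplacian D U.1 h ->
  Sform' t U U + 2 * Sform t U (U.2, fun x => h x - V / enorm x * U.2 x) =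
  Int (fun x => Pw mu x * damp V n lam mu kap (Psl x / enorm x) (U.2 x) (rad U x)
    (U.1 x / Psl x) (gsq U x)).
Proof.
move=> h1 h2 lap; have l1 := H10_l2' h1; have l2' := H10_l2' h2.
have PK : P U by split.
have b1' : bmf (sw1' t) by apply: bmfM; [exact: bmf_cst|exact: bmf_Pw].
have b3' : bmf (sw3' t).
  by apply: bmfM; [exact: bmf_cst|apply: bmfM; [exact: bmf_cst|exact: bmf_Pw]].
have b4' : bmf (sw4' t).
  apply: bmfD => //.
    apply: bmfM; first exact: bmf_cst.
    by apply: bmfM; [apply: bmfM; [exact: bmf_cst|exact: bmf_Pw]|exact: bmf_rinv].
  have := bmfM (bmf_cst D (- (fb * mu + fc))) (bmfM (bmf_cst D (mu - 1)) (bmf_Pw (mu - 1 - 1))).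
  by congr (bmf _); apply/funext => x; rewrite mulNr.
have i1 := wform_intg oD b1' b1' b3' b4' PK PK.
have r1 : radial_weight D (sw1 t) (fun x => (mu + 1) * lam * Pw (mu + 1 - 1) x) := rw_Pw (mu + 1).
have r3 : radial_weight D (sw3 t) (fun x => fb * (mu * lam * Pw (mu - 1) x)) := rwZ fb (rw_Pw mu).
(* This current reduces the coefficient of [u u_r], otherwise [- V lam^2 mu Psi^(mu - 1)], to
   [- 2 V lam^2 kap Psi^(mu - 1)]. *)
have ra := rwZ (V * lam ^+ 2 * (mu / 2 - kap)) (rw_Pw (mu - 1)).
have := dual_form r1 r3 ra bmf_sw4 h1 h2 lap.
rewrite -/(Sform t U (U.2, fun x => h x - V / enorm x * U.2 x)) => e.
have -> : 2 * Sform t U (U.2, fun x => h x - V / enorm x * U.2 x) = _ := e.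
rewrite /Sform' /wform -IntD//; last first.
  have br := bmf_rinv; have bP := bmf_Pw; have lr := l2_rad PK.
  have bc (q : R) := bmf_cst D q; have b4 := bmf_sw4; have b3 := bmf_sw3; have b1 := bmf_sw1.
  have lvr := l2_mul mD lr l2'; have lur := l2_mul mD l1 lr; have luv := l2_mul mD l1 l2'.
  have bma : bmf (fun x => V * lam ^+ 2 * (mu / 2 - kap) * Pw (mu - 1) x) by exact: bmfM.
  repeat apply: intgD => //.
  - by apply: intg_gsq => //; apply: bmfM.
  - apply: intg_sqr => //; apply: bmfD => //; first exact: bmfM.
    have := bmfM (bc (-1)) (bmfM (bmfM (bc (2 * V)) b1) br).
    by congr (bmf _); apply/funext => x; rewrite mulN1r.
  - have hh := intg_bmf mD (bmfM (bc (-1)) (bmfM (bc 2) (bmfM (bc ((mu + 1) * lam)) (bP (mu + 1 - 1))))) lvr.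
    by apply: intg_eq hh => // x _; ring.
  - apply: intg_bmf => //; apply: bmfD => //; first exact: bmfM.
    have := bmfM (bc (-1)) (bmfM (bc 2) (bmfM (bc fb) (bmfM (bc (mu * lam)) (bP (mu - 1))))).
    by congr (bmf _); apply/funext => x; rewrite mulN1r.
  - apply: intg_sqr => //; apply: bmfD => //; first by do 2!apply: bmfM => //.
    by apply: bmfM => //; exact: bmfM.
  - apply: intg_bmf => //; apply: bmfD => //; first exact: bmfM.
    have := bmfM (bc (-1)) (bmfM (bmfM (bc (2 * V)) b3) br).
    by congr (bmf _); apply/funext => x; rewrite mulN1r.
apply: eq_Int => x Dx; have r0 := enorm_D Dx; have y0 := Psl_gt0 x.
rewrite /sw1' /sw1 /sw3' /sw3 /sw4' /sw4 /fb /fc -/(gsq U x) addrK !PwB PwS rinvE /damp /damp_u.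
field; rewrite !gt_eqF//.
Qed.

Lemma Sform_damp (eta Cu : R) U h : 0 <= mu + 1 -> mu + 1 < V -> eta = (V - (mu + 1)) / 2 ->
  4 * V <= lam * (V - (mu + 1)) ->
  (forall p, lam <= p -> V * lam ^+ 3 * kap ^+ 2 + 2 * (mu + 1 + eta) * lam ^+ 2 * kap ^+ 2
     + damp_u V n lam mu kap p <= Cu * p) ->
  H10 D U.1 -> H10 D U.2 -> weak_laplacian D U.1 h ->
  Sform' t U U + 2 * Sform t U (U.2, fun x => h x - V / enorm x * U.2 x) <=
  - Int (fun x => eta * Pw mu x * gsq U x + eta * (Pw (mu + 1) x * rinv x) * U.2 x ^+ 2
          - Cu * (Pw (mu - 1) x * rinv x) * U.1 x ^+ 2).
Proof.
move=> m0 mV eE lV HC h1 h2 lap; have l1 := H10_l2' h1; have l2' := H10_l2' h2.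
have PK : P U by split.
rewrite (Sform_dual h1 h2 lap).
have bc (q : R) := bmf_cst D q; have bP := bmf_Pw; have br := bmf_rinv; have lr := l2_rad PK.
have j1 : intg (fun x => eta * Pw mu x * gsq U x) by apply: intg_gsq => //; exact: bmfM.
have j2 : intg (fun x => eta * (Pw (mu + 1) x * rinv x) * U.2 x ^+ 2).
  by apply: intg_sqr => //; do 2!apply: bmfM => //.
have j3 : intg (fun x => Cu * (Pw (mu - 1) x * rinv x) * U.1 x ^+ 2).
  by apply: intg_sqr => //; do 2!apply: bmfM => //.
have j := intgB mD (intgD mD j1 j2) j3.
rewrite -[leRHS]mulN1r -(IntZ mD _ j); apply: le_Int => //; last 2 first.
- exact: intgZ.
- move=> x Dx; have r0 := enorm_D Dx; have y0 := Psl_gt0 x; have q0 := Pw_gt0 mu x.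
  have hp := p_ge Dx.
  have H := damp_core (V := V) n kap (U.2 x) (U.1 x / Psl x) m0 mV eE lam1 lV hp (rad_le U Dx).
  apply: le_trans (ler_wpM2l (ltW q0) H) _.
  have H2 : Pw mu x * ((V * lam ^+ 3 * kap ^+ 2 + 2 * (mu + 1 + eta) * lam ^+ 2 * kap ^+ 2
     + damp_u V n lam mu kap (Psl x / enorm x)) * (U.1 x / Psl x) ^+ 2) <=
     Pw mu x * (Cu * (Psl x / enorm x) * (U.1 x / Psl x) ^+ 2).
    by apply: ler_wpM2l; [exact: ltW|apply: ler_wpM2r; [exact: sqr_ge0|exact: HC]].
  rewrite mulrDr; apply: le_trans (lerD (lexx _) H2) _.
  rewrite PwB PwS rinvE le_eqVlt; apply/orP; left; apply/eqP; field.
  by rewrite !gt_eqF.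
- have i1 := intg_gsq (bmfM (bc (mu + 1 - V * lam)) (bP mu)) PK.
  have i2 := intg_sqr (bmfD (bmfM (bc (mu + 1 + V * lam)) (bP mu))
    (bmfM (bc (- 2 * V)) (bmfM (bP (mu + 1)) br))) l2'.
  have i3 := intg_bmf mD (bmfM (bc (- 2 * lam * (mu + 1))) (bP mu)) (l2_mul mD l2' lr).
  have i4 := intg_bmf mD (bmfM (bc (- 2 * V * lam ^+ 2 * kap)) (bP (mu - 1))) (l2_mul mD l1 lr).
  have i5 := intg_bmf mD (bmfM (bc (- 2 * lam ^+ 2 * (mu + 1) * kap)) (bP (mu - 1))) (l2_mul mD l1 l2').
  have i6 := intg_sqr (bmfD (bmfM (bc ((n - 1) * (V * lam ^+ 2 * (mu / 2 - kap)) + V ^+ 2 * lam * mu / 2))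
      (bmfM (bP (mu - 1)) br))
    (bmfM (bc ((mu - 1) * (V * lam ^+ 3 * (mu / 2 - kap) - V * lam * mu / 2 - lam ^+ 2 * (mu + 1) * kap)))
      (bP (mu - 1 - 1)))) l1.
  have hh := intgD mD (intgD mD (intgD mD (intgD mD (intgD mD i1 i2) i3) i4) i5) i6.
  apply: intg_eq hh => // x Dx; have r0 := enorm_D Dx; have y0 := Psl_gt0 x.
  by rewrite !PwB PwS rinvE /damp /damp_u; field; rewrite !gt_eqF.
Qed.

(** The current [kap lam Psi^mu u^2 x / |x|] is added to the energy; its divergence provides the
    [u^2] that [fc] takes away, at the price of a product [u u_r]. *)
Lemma Sform_lower U : 0 < V ->
  (forall p, lam <= p -> (V ^+ 2 / 8 + V ^+ 2 / 4 + kap ^+ 2) * lam ^+ 2 <= energy_u V n lam mu kap p) ->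
  P U ->
  V ^+ 2 / (4 * V ^+ 2 + 16 * kap ^+ 2) * Int (fun x => Pw (mu + 1) x * (gsq U x + U.2 x ^+ 2)) <=
  Sform t U U.
Proof.
move=> V0 HC PU; have [hU lU2] := PU; have lU1 := H10_l2' hU.
have bP := bmf_Pw.
have nn := radial_current oD bD D0 (rwZ (kap * lam) (rw_Pw mu)) (nablaP hU).
have i1 : intg (fun x => Pw (mu + 1) x * (gsq U x + U.2 x ^+ 2)).
  apply: intg_eq (intgD mD (intg_gsq (bP (mu + 1)) PU) (intg_sqr (bP (mu + 1)) lU2)) => // x _.
  by rewrite mulrDr.
have i2 := wform_intg oD bmf_sw1 bmf_sw1 bmf_sw3 bmf_sw4 PU PU.
rewrite -(IntZ mD _ i1) [leRHS](Int_null oD i2 nn).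
apply: le_Int; [exact: mD|exact: intgZ|by apply: intgD => //; case: nn|].
move=> x Dx; have r0 := enorm_D Dx; have y0 := Psl_gt0 x; have q0 := Pw_gt0 (mu + 1) x.
have := energy_core (U.2 x) (U.1 x / Psl x) V0 (rad_le U Dx) (HC _ (p_ge Dx)).
move=> /(ler_wpM2l (ltW q0)); rewrite mulrCA => /le_trans; apply.
rewrite /sw1 /sw3 /sw4 /fb /fc -/(gsq U x) -/(rad U x) !PwB PwS rinvE /energy_u.
rewrite le_eqVlt; apply/orP; left; apply/eqP; field.
by rewrite !gt_eqF.
Qed.

Definition fA : R := fb + V * fb + `|fb * mu + fc|.

Lemma rPsl x : D x -> enorm x <= Psl x.
Proof.
by move=> Dx; rewrite /Psl ler_wpDl// -[leLHS]mul1r ler_wpM2r ?enorm_ge0.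
Qed.

(** Since [|x| <= Psi], the cross and zero order terms are at most [fA Psi^(mu + 1) (u / |x|)^2]
    plus a multiple of the energy density, and Hardy's inequality bounds the first. *)
Lemma Sform_upper al U : 0 < V -> 0 < al -> 2 * al <= n - 2 -> 0 <= mu + 1 -> P U ->
  Sform t U U <= (1 + fb + fA / al ^+ 2) * Int (fun x => Pw (mu + 1) x * (gsq U x + U.2 x ^+ 2)).
Proof.
move=> V0 al0 aln m0 PU; have [hU lU2] := PU; have lU1 := H10_l2' hU.
have bP := bmf_Pw; have fb0 : 0 < fb by rewrite divr_gt0 ?mulr_gt0.
have fA0 : 0 <= fA by have fb0' := ltW fb0; rewrite /fA; nneg.
have lur : l2 (fun x => U.1 x * rinv x).
  by under eq_fun do rewrite mulrC; apply: l2_bmf => //; exact: bmf_rinv.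
have ig := intg_gsq (bP (mu + 1)) PU; have iv := intg_sqr (bP (mu + 1)) lU2.
have iu := intg_sqr (bP (mu + 1)) lur.
have i1 : intg (fun x => Pw (mu + 1) x * (gsq U x + U.2 x ^+ 2)).
  by apply: intg_eq (intgD mD ig iv) => // x _; rewrite mulrDr.
have i2 := wform_intg oD bmf_sw1 bmf_sw1 bmf_sw3 bmf_sw4 PU PU.
have H : Int (fun x => Pw (mu + 1) x * (U.1 x * rinv x) ^+ 2) <=
    (al ^+ 2)^-1 * Int (fun x => Pw (mu + 1) x * (gsq U x + U.2 x ^+ 2)).
  rewrite mulrC ler_pdivlMr ?exprn_gt0// mulrC.
  have := @hardy (mu + 1) al U PU al0 _ aln; rewrite ltNge m0 => /(_ _)/le_trans; apply => //.
  apply: le_Int => // x Dx; apply: ler_wpM2l; first exact/ltW/Pw_gt0.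
  by rewrite lerDl sqr_ge0.
have i3 := intgD mD (intgZ mD (1 + fb) i1) (intgZ mD fA iu).
apply: (@le_trans _ _ ((1 + fb) * Int (fun x => Pw (mu + 1) x * (gsq U x + U.2 x ^+ 2)) +
    fA * Int (fun x => Pw (mu + 1) x * (U.1 x * rinv x) ^+ 2))); last first.
  by rewrite [leRHS]mulrDl lerD2l -mulrA ler_wpM2l.
rewrite -(IntZ mD _ i1) -(IntZ mD _ iu) -(IntD mD (intgZ mD _ i1) (intgZ mD _ iu)).
apply: le_Int => // x Dx; have r0 := enorm_D Dx; have y0 := Psl_gt0 x; have q0 := Pw_gt0 (mu + 1) x.
have ry := rPsl Dx; have g0 := gsq_ge0 U x.
rewrite /sw1 /sw3 /sw4 -/(gsq U x) PwB (_ : Pw mu x = Pw (mu + 1) x / Psl x); last first.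
  by rewrite PwS mulfK// gt_eqF.
move: q0 y0 r0 ry; rewrite rinvE; set q := Pw (mu + 1) x; set y := Psl x; set r := enorm x.
move=> q0 y0 r0 ry.
set X := U.2 x; set u := U.1 x; set G := gsq U x.
set a := u / y; set b := u / r; have ab : a = (r / y) * b by rewrite /a /b; field; rewrite !gt_eqF.
set k := r / y in ab; have k0 : 0 < k by rewrite divr_gt0.
have k1 : k <= 1 by rewrite ler_pdivrMr// mul1r.
have a2 : a ^+ 2 <= b ^+ 2.
  by rewrite ab exprMn -[leRHS]mul1r ler_wpM2r ?sqr_ge0// expr_le1// ltW.
have k2 : k * b ^+ 2 <= b ^+ 2 by rewrite -[leRHS]mul1r ler_wpM2r ?sqr_ge0.
rewrite [leLHS](_ : _ = q * (G + X ^+ 2 + 2 * fb * (a * X) + V * fb * (k * b ^+ 2) - (fb * mu + fc) * a ^+ 2)); last first.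
  by rewrite /a /b /k; field; rewrite !gt_eqF.
rewrite [leRHS](_ : _ = q * ((1 + fb) * (G + X ^+ 2) + fA * b ^+ 2)); last by ring.
apply: ler_wpM2l; first exact: ltW.
have e1 : - (fb * mu + fc) * a ^+ 2 <= `|fb * mu + fc| * b ^+ 2.
  apply: (@le_trans _ _ (`|fb * mu + fc| * a ^+ 2)); last by rewrite ler_wpM2l.
  by rewrite ler_wpM2r ?sqr_ge0// -normrN ler_norm.
have e2 : V * fb * (k * b ^+ 2) <= V * fb * b ^+ 2 by rewrite ler_wpM2l// mulr_ge0 ?ltW.
have e3 : 0 <= fb * (a - X) ^+ 2 by rewrite mulr_ge0 ?sqr_ge0 ?ltW.
have e4 : fb * a ^+ 2 <= fb * b ^+ 2 by rewrite ler_wpM2l// ltW.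
have e5 : 0 <= fb * G by rewrite mulr_ge0// ltW.
by move: e1 e2 e3 e4 e5; rewrite /fA; move: (`|_|) => M e1 e2 e3 e4 e5; lra.
Qed.

Lemma phase0r f : l2 f -> P ((0 : E -> R), f).
Proof. exact: phase_0. Qed.

(** The gradient that [nabla] picks for the zero function vanishes only almost everywhere, hence an
    identity between integrals. *)
Lemma dotg_zero w U Y : bmf w -> P U -> P Y -> Y.1 = 0 ->
  null D (fun x => w x * dotg (nabla D U.1) (nabla D Y.1) x).
Proof.
move=> bw [hU _] [hY lY] Y0.
have z i : null D (fun x => w x * (nabla D U.1 x 0 i * nabla D Y.1 x 0 i)).
  have l1 := nabla_l2 i hU; have l2' := nabla_l2 i hY.
  split; first exact: (intg_bmf2 mD bw l1 l2').
  have [mw [C wC]] := bw.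
  have wC' x : D x -> `|w x| <= `|C| by move=> Dx; rewrite (le_trans (wC _ Dx))// ler_norm.
  apply/eqP; rewrite -normr_le0.
  apply: le_trans (n2_bmf3 mD wC' mw (normr_ge0 _) l1 l2') _.
  rewrite (_ : n2 leb D (fun x => nabla D Y.1 x 0 i) = 0) ?mulr0//.
  apply/eqP; rewrite eq_le n2_ge0 andbT.
  rewrite -[leRHS](nrm0 oD bD D0) Y0.
  have [_ _ h] := coord_nabla oD bD D0 i.
  exact: (h 0 (phase0 oD bD D0)).
apply: (eq_null oD _ (null_sum oD (index_enum 'I_N) z)) => x _.
by rewrite /dotg mulr_sumr.
Qed.

Lemma young (al c X Y : R) : 0 < al -> 2 * c * (X * Y) <= al * X ^+ 2 + c ^+ 2 / al * Y ^+ 2.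
Proof.
move=> al0; rewrite -subr_ge0 (_ : _ - _ = al * (X - c / al * Y) ^+ 2).
  by rewrite mulr_ge0 ?sqr_ge0 ?ltW.
by field; rewrite gt_eqF.
Qed.

Lemma dotg_young (al c : R) (g k : E -> E) x : 0 < al ->
  2 * c * dotg g k x <= al * dotg g g x + c ^+ 2 / al * dotg k k x.
Proof.
move=> al0; rewrite /dotg !mulr_sumr -big_split/=; apply: ler_sum => i _.
by rewrite -!expr2 young.
Qed.

Lemma bmf_enorm : bmf (@enorm R N).
Proof.
rewrite (_ : @enorm R N = pw 0 1 1); first exact: bmf_pw.
by apply/funext => x; rewrite /pw add0r mul1r powRr1 ?enorm_ge0.
Qed.

(** The damping controls [v^2] with the weight [Psi^(mu + 1) / |x|], so Young's inequality measures
    the force with the dual weight [Psi^(mu + 1) |x|]: this is the origin of the factor [|x|] in the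
    theorem. *)
Lemma Sform_kick (eps : R) U f : P U -> l2 f -> 0 < eps ->
  2 * Sform t U ((0 : E -> R), f) <=
  eps * Int (fun x => Pw (mu + 1) x * rinv x * U.2 x ^+ 2) +
  eps * Int (fun x => Pw (mu - 1) x * rinv x * U.1 x ^+ 2) +
  (1 + fb ^+ 2) / eps * Int (fun x => Pw (mu + 1) x * enorm x * f x ^+ 2).
Proof.
move=> PU lf e0; have [hU lU2] := PU; have lU1 := H10_l2' hU.
have PY := phase0r lf; have bP := bmf_Pw; have br := bmf_rinv.
have i0 := wform_intg oD bmf_sw1 bmf_sw1 bmf_sw3 bmf_sw4 PU PY.
have nn := nullZ oD (-1) (dotg_zero bmf_sw1 PU PY erefl).
have i1 := intg_sqr (bmfM (bP (mu + 1)) br) lU2.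
have i2 := intg_sqr (bmfM (bP (mu - 1)) br) lU1.
have i3 := intg_sqr (bmfM (bP (mu + 1)) bmf_enorm) lf.
rewrite [Sform _ _ _](Int_null oD i0 nn) -(IntZ mD _ (intgD mD i0 nn.1)).
rewrite -(IntZ mD _ i1) -(IntZ mD _ i2) -(IntZ mD _ i3).
rewrite -(IntD mD (intgZ mD _ i1) (intgZ mD _ i2)).
rewrite -(IntD mD (intgD mD (intgZ mD _ i1) (intgZ mD _ i2)) (intgZ mD _ i3)).
apply: le_Int => //.
- by apply: intgZ => //; apply: intgD => //; case: nn.
- by apply: intgD => //; [apply: intgD => //; exact: intgZ|exact: intgZ].
move=> x Dx /=; have r0 := enorm_D Dx; have y0 := Psl_gt0 x; have q0 := Pw_gt0 mu x.
rewrite /sw1 /sw3 /sw4 (_ : (0 : E -> R) x = 0)// PwB PwS rinvE.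
move: q0 y0 r0; set q := Pw mu x; set y := Psl x; set r := enorm x => q0 y0 r0.
rewrite [leLHS](_ : _ = 2 * (q * y) * (U.2 x * f x) + 2 * (fb * q) * (U.1 x * f x)); last by ring.
have a1 : 0 < eps * (q * y / r) by rewrite mulr_gt0// divr_gt0// mulr_gt0.
have a2 : 0 < eps * (q / y / r) by rewrite mulr_gt0// !divr_gt0.
have := lerD (young (q * y) (U.2 x) (f x) a1) (young (fb * q) (U.1 x) (f x) a2).
move=> /le_trans; apply; rewrite le_eqVlt; apply/orP; left; apply/eqP; field.
by rewrite !gt_eqF.
Qed.

(** * Forms with a separate power of 1 + t *)

Variable e : R.
Hypothesis e_ge0 : 0 <= e.

Lemma Pw_split c d x : Pw c x = Pw (c - d) x * Pw d x.
Proof. by rewrite /pw -powRD ?subrK//; apply/implyP => _; rewrite gt_eqF// Psl_gt0. Qed.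

Lemma tau_le x : (1 + t) `^ e <= Pw e x.
Proof.
apply: ge0_ler_powR => //; rewrite ?nnegrE//; first exact/ltW/Psl_gt0.
by rewrite lerDl mulr_ge0 ?enorm_ge0 ?ltW.
Qed.

Let tau0 : 0 < 1 + t. Proof. by rewrite ltr_wpDr. Qed.

Lemma tau_inv : (1 + t) `^ (e - 1) * (1 + t) `^ (1 - e) = 1.
Proof.
rewrite -powRD; last by apply/implyP => _; rewrite gt_eqF.
by rewrite (_ : e - 1 + (1 - e) = 0) ?powRr0//; ring.
Qed.

Definition fA4 : R := V * fb + `|fb * mu + fc|.

(** Young's inequality with the weights [(1 + t)^(e - 1) Psi^(mu + 1 - e)] and
    [(1 + t)^(1 - e) Psi^(mu + 1 + e)], whose product is the square of [Psi^(mu + 1)]. The first is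
    the weight that [Eform] dissipates; the dissipation of [Sform], of order [Psi^mu] on gradients,
    would be too weak. The term with [e3] is carried along because [Eform] also feels the force. *)
Lemma Sform_kick2 (eps e3 : R) U Y : 0 < V -> P U -> P Y -> Y.2 = (fun=> 0) -> 0 < eps -> 0 <= e3 ->
  2 * (Sform t U Y - e3 * Int (fun x => (1 + t) `^ e * Pw (mu + 1 - e) x * dotg (nabla D U.1) (nabla D Y.1) x)) <=
  eps * (1 + t) `^ (e - 1) * Int (fun x => Pw (mu + 1 - e) x * (gsq U x + U.2 x ^+ 2 + (U.1 x * rinv x) ^+ 2)) +
  ((1 + e3) ^+ 2 + fb ^+ 2 + fA4 ^+ 2) / eps * (1 + t) `^ (1 - e) *
    Int (fun x => Pw (mu + 1 + e) x * (gsq Y x + (Y.1 x * rinv x) ^+ 2)).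
Proof.
move=> V0 PU PY Y2 eps0 e30; have [hU lU2] := PU; have lU1 := H10_l2' hU.
have [hY lY2] := PY; have lY1 := H10_l2' hY.
have bP := bmf_Pw; have br := bmf_rinv; have fb0 : 0 <= fb by rewrite divr_ge0 ?mulr_ge0 ?ltW.
have lur f : l2 f -> l2 (fun x => f x * rinv x).
  by move=> lf; under eq_fun do rewrite mulrC; exact: l2_bmf.
have i0 := wform_intg oD bmf_sw1 bmf_sw1 bmf_sw3 bmf_sw4 PU PY.
have i1 := intg_dotg oD (bmfM (bmf_cst D ((1 + t) `^ e)) (bP (mu + 1 - e))) (nablaP hU) (nablaP hY).
have i2 : intg (fun x => Pw (mu + 1 - e) x * (gsq U x + U.2 x ^+ 2 + (U.1 x * rinv x) ^+ 2)).
  have := intgD mD (intgD mD (intg_gsq (bP (mu + 1 - e)) PU) (intg_sqr (bP (mu + 1 - e)) lU2))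
    (intg_sqr (bP (mu + 1 - e)) (lur _ lU1)) => h.
  by apply: intg_eq h => // x _; ring.
have i3 : intg (fun x => Pw (mu + 1 + e) x * (gsq Y x + (Y.1 x * rinv x) ^+ 2)).
  have h := intgD mD (intg_gsq (bP (mu + 1 + e)) PY) (intg_sqr (bP (mu + 1 + e)) (lur _ lY1)).
  by apply: intg_eq h => // x _; ring.
have i1' := intgZ mD e3 i1.
rewrite -(IntZ mD _ i1) -(IntB mD i0 i1') -(IntZ mD _ (intgB mD i0 i1')).
rewrite -(IntZ mD _ i2) -(IntZ mD _ i3) -(IntD mD (intgZ mD _ i2) (intgZ mD _ i3)).
apply: le_Int => //.
- by apply: intgZ => //; exact: intgB.
- by apply: intgD => //; exact: intgZ.
move=> x Dx; have r0 := enorm_D Dx; have y0 := Psl_gt0 x.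
have q0 := Pw_gt0 (mu + 1) x; have q1 := Pw_gt0 (mu + 1 - e) x; have q2 := Pw_gt0 (mu + 1 + e) x.
have qq : Pw (mu + 1 - e) x * Pw (mu + 1 + e) x = Pw (mu + 1) x ^+ 2.
  by rewrite (Pw_split (mu + 1 + e) e) addrK mulrCA -(Pw_split (mu + 1) e) expr2.
have qt : (1 + t) `^ e * Pw (mu + 1 - e) x <= Pw (mu + 1) x.
  by rewrite (Pw_split (mu + 1) e) mulrC ler_pM2l ?tau_le.
have te0 : 0 <= (1 + t) `^ e * Pw (mu + 1 - e) x by rewrite mulr_ge0 ?powR_ge0 ?ltW.
have tt := tau_inv.
have p1 : 0 < (1 + t) `^ (e - 1) by rewrite powR_gt0.
have p2 : 0 < (1 + t) `^ (1 - e) by rewrite powR_gt0.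
have ry := rPsl Dx.
rewrite /sw1 /sw3 /sw4 Y2 PwB (_ : Pw mu x = Pw (mu + 1) x / Psl x); last first.
  by rewrite PwS mulfK// gt_eqF.
rewrite rinvE; move: q0 q1 q2 qq qt te0 tt p1 p2 y0 r0 ry.
set q := Pw (mu + 1) x; set Q1 := Pw (mu + 1 - e) x; set Q2 := Pw (mu + 1 + e) x.
set te := (1 + t) `^ e * Q1; set s1 := (1 + t) `^ (e - 1); set s2 := (1 + t) `^ (1 - e).
set y := Psl x; set r := enorm x; set M := dotg _ _ x.
move=> q0 q1 q2 qq qt te0 tt p1 p2 y0 r0 ry.
pose al := eps * s1 * Q1; have al0 : 0 < al by rewrite !mulr_gt0.
pose be := s2 * Q2 / eps; have be0 : 0 <= be by rewrite divr_ge0 ?mulr_ge0 ?ltW.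
have alb : al * be = q ^+ 2.
  rewrite /al /be -qq -[RHS]mul1r -tt; field; rewrite gt_eqF//.
have qab : q ^+ 2 / al = be by rewrite -alb; field; rewrite gt_eqF.
pose k := r / y; have k0 : 0 < k by rewrite divr_gt0.
have k1 : k <= 1 by rewrite ler_pdivrMr// mul1r.
pose th := Y.1 x / r; pose z := U.1 x / r.
pose c4 := q * (V * fb * k - (fb * mu + fc) * k ^+ 2).
have GY0 := gsq_ge0 Y x; have GU0 := gsq_ge0 U x.
rewrite [leLHS](_ : _ = 2 * (q - e3 * te) * M + 2 * (fb * q * k) * (U.2 x * th) + 2 * c4 * (z * th)); last first.
  by rewrite /c4 /z /th /k; field; rewrite !gt_eqF.
rewrite [leRHS](_ : _ = al * (gsq U x + U.2 x ^+ 2 + z ^+ 2) +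
  ((1 + e3) ^+ 2 + fb ^+ 2 + fA4 ^+ 2) * be * (gsq Y x + th ^+ 2)); last first.
  by rewrite /al /be /z /th; field; rewrite !gt_eqF.
have Y1 := dotg_young (q - e3 * te) (nabla D U.1) (nabla D Y.1) x al0.
have Yb := young (fb * q * k) (U.2 x) th al0; have Yc := young c4 z th al0.
rewrite -/M -/(gsq U x) -/(gsq Y x) in Y1.
have sq (c B : R) : 0 <= B -> `|c| <= B * q -> c ^+ 2 / al <= B ^+ 2 * be.
  move=> B0 cB; rewrite -qab mulrA ler_pM2r ?invr_gt0// -exprMn.
  by rewrite -(real_normK (num_real c)) ler_sqr ?nnegrE ?mulr_ge0 ?(ltW q0).
have b1 : (q - e3 * te) ^+ 2 / al <= (1 + e3) ^+ 2 * be.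
  apply: sq; first by rewrite addr_ge0.
  have h1 : 0 <= e3 * te by rewrite mulr_ge0.
  have h2 : e3 * te <= e3 * q by rewrite ler_wpM2l.
  rewrite mulrDl mul1r; apply: le_trans (ler_normB _ _) _.
  by rewrite gtr0_norm// ger0_norm// lerD2l.
have b2 : (fb * q * k) ^+ 2 / al <= fb ^+ 2 * be.
  have fq : 0 <= fb * q by rewrite mulr_ge0// ltW.
  apply: sq => //; rewrite (ger0_norm (mulr_ge0 fq (ltW k0))).
  by rewrite ler_piMr.
have b3 : c4 ^+ 2 / al <= fA4 ^+ 2 * be.
  have VF : 0 <= V * fb by rewrite mulr_ge0// ltW.
  apply: sq; first by rewrite addr_ge0.
  rewrite /c4 normrM gtr0_norm// mulrC ler_pM2r//; apply: le_trans (ler_normB _ _) _.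
  apply: lerD.
    by rewrite (ger0_norm (mulr_ge0 VF (ltW k0))) ler_piMr.
  by rewrite normrM ler_piMr// ger0_norm ?sqr_ge0// expr_le1// ltW.
have h1 : (q - e3 * te) ^+ 2 / al * gsq Y x <= (1 + e3) ^+ 2 * be * gsq Y x by rewrite ler_wpM2r.
have h2 : (fb * q * k) ^+ 2 / al * th ^+ 2 <= fb ^+ 2 * be * th ^+ 2 by rewrite ler_wpM2r ?sqr_ge0.
have h3 : c4 ^+ 2 / al * th ^+ 2 <= fA4 ^+ 2 * be * th ^+ 2 by rewrite ler_wpM2r ?sqr_ge0.
have h4 : 0 <= (1 + e3) ^+ 2 * be * th ^+ 2 by nneg.
have h5 : 0 <= (fb ^+ 2 + fA4 ^+ 2) * be * gsq Y x by nneg.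
move: Y1 Yb Yc h1 h2 h3 h4 h5.
move: (_ ^+ 2 / al) (_ ^+ 2 / al) (_ ^+ 2 / al) (gsq U x) (gsq Y x) (U.2 x) => d1 d2 d3 G H X.
move: (2 * (q - e3 * te) * M) (2 * (fb * q * k) * (X * th)) (2 * c4 * (z * th)) ((1 + e3) ^+ 2) (fb ^+ 2) (fA4 ^+ 2) => m1 m2 m3 n1 n2 n3.
by move: (th) (z) (al) (be); clear -R; move=> *; lra.
Qed.

Definition ew r x : R := pw (1 + r) 0 e x * pw (1 + r) lam (mu + 1 - e) x.
Definition ew' r x : R := e * pw (1 + r) 0 (e - 1) x * pw (1 + r) lam (mu + 1 - e) x
  + pw (1 + r) 0 e x * ((mu + 1 - e) * pw (1 + r) lam (mu + 1 - e - 1) x).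
Definition Eform := wform D ew ew (fun _ _ => 0) (fun _ _ => 0).
Definition Eform' := wform D ew' ew' (fun _ _ => 0) (fun _ _ => 0).

Lemma tder_ew : tder D ew ew'.
Proof. exact: (tder_mul (tder_pw D e (lexx 0)) (tder_pw D (mu + 1 - e) (ltW lam0))). Qed.

Lemma pw_time c x : pw (1 + t) 0 c x = (1 + t) `^ c.
Proof. by rewrite /pw mul0r addr0. Qed.

Lemma bmf_ew : bmf (ew t).
Proof. by apply: bmfM; [exact: bmf_pw_time|exact: bmf_Pw]. Qed.

(** The derivative of the factor [(1 + t)^e] makes this energy grow; with a minus sign it is a
    dissipation. All other terms are dominated by what [Sform] dissipates, since [(1 + t)^e Psi^(mu
    + 1 - e) <= Psi^(mu + 1)]. *)
Lemma Eform_damp U h : 0 < V -> H10 D U.1 -> H10 D U.2 -> weak_laplacian D U.1 h ->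
  - (Eform' t U U + 2 * Eform t U (U.2, fun x => h x - V / enorm x * U.2 x)) <=
  - (e * (1 + t) `^ (e - 1)) * Int (fun x => Pw (mu + 1 - e) x * (gsq U x + U.2 x ^+ 2)) +
  (`|mu + 1 - e| * (1 + lam) + 2 * V) *
    Int (fun x => Pw mu x * gsq U x + Pw (mu + 1) x * rinv x * U.2 x ^+ 2).
Proof.
move=> V0 h1 h2 lap; have l1 := H10_l2' h1; have l2' := H10_l2' h2.
have PK : P U by split.
have bP := bmf_Pw; have br := bmf_rinv; have b0 := bmf_cst D (0 : R).
have bt c : bmf (pw (1 + t) 0 c) by exact: bmf_pw_time.
have bc (q : R) := bmf_cst D q.
have r1 : radial_weight D (ew t) (fun x => (1 + t) `^ e * ((mu + 1 - e) * lam * Pw (mu + 1 - e - 1) x)).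
  rewrite (_ : ew t = fun x => (1 + t) `^ e * Pw (mu + 1 - e) x).
    exact: rwZ (rw_Pw _).
  by apply/funext => x; rewrite /ew pw_time.
have r3 := rw_cst D (0 : R).
have ee := dual_form r1 r3 r3 b0 h1 h2 lap.
have -> : 2 * Eform t U (U.2, fun x => h x - V / enorm x * U.2 x) = _ := ee.
have b1' : bmf (ew' t).
  by apply: bmfD; apply: bmfM => //; apply: bmfM.
have i1 := wform_intg oD b1' b1' b0 b0 PK PK.
have lr := l2_rad PK.
have i2 : intg (fun x => - 2 * 0 * gsq U x + (2 * 0 - 2 * V * ew t x * rinv x) * U.2 x ^+ 2
     - 2 * ((1 + t) `^ e * ((mu + 1 - e) * lam * Pw (mu + 1 - e - 1) x)) * (rad U x * U.2 x)
     + (2 * 0 - 2 * 0) * (U.1 x * rad U x)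
     + (0 + (n - 1) * (0 * rinv x)) * U.1 x ^+ 2
     + (2 * 0 - 2 * V * 0 * rinv x) * (U.1 x * U.2 x)).
  have j1 := intg_sqr (bmfM (bc (- 2 * V)) (bmfM bmf_ew br)) l2'.
  have j2 := intg_bmf mD (bmfM (bc (- 2 * (1 + t) `^ e * ((mu + 1 - e) * lam))) (bP (mu + 1 - e - 1)))
    (l2_mul mD lr l2').
  by apply: intg_eq (intgD mD j1 j2) => // x _; ring.
have i3 : intg (fun x => Pw (mu + 1 - e) x * (gsq U x + U.2 x ^+ 2)).
  by apply: intg_eq (intgD mD (intg_gsq (bP (mu + 1 - e)) PK) (intg_sqr (bP (mu + 1 - e)) l2')) => // x _; rewrite mulrDr.
have i4 := intgD mD (intg_gsq (bP mu) PK) (intg_sqr (bmfM (bP (mu + 1)) br) l2').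
rewrite -(IntD mD i1 i2) -[leLHS]mulN1r -(IntZ mD _ (intgD mD i1 i2)).
rewrite -(IntZ mD _ i3) -(IntZ mD _ i4) -(IntD mD (intgZ mD _ i3) (intgZ mD _ i4)).
apply: le_Int => //.
- by apply: intgZ => //; exact: intgD.
- by apply: intgD => //; exact: intgZ.
move=> x Dx; have r0 := enorm_D Dx; have y0 := Psl_gt0 x.
have GY := rad_le U Dx; have G0 := gsq_ge0 U x.
have q1 := Pw_gt0 (mu + 1 - e) x.
have qt : (1 + t) `^ e * Pw (mu + 1 - e) x <= Pw (mu + 1) x.
  by rewrite (Pw_split (mu + 1) e) mulrC ler_pM2l ?tau_le.
have te0 : 0 <= (1 + t) `^ e * Pw (mu + 1 - e) x by rewrite mulr_ge0 ?powR_ge0 ?ltW.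
have ry := rPsl Dx.
rewrite /ew /ew' !pw_time PwB rinvE -/(gsq U x) (_ : Pw mu x = Pw (mu + 1) x / Psl x); last first.
  by rewrite PwS mulfK// gt_eqF.
move: q1 qt te0 ry y0 r0 GY G0; set Q1 := Pw (mu + 1 - e) x; set q := Pw (mu + 1) x.
set y := Psl x; set r := enorm x; set k := mu + 1 - e; set X := U.2 x; set G := gsq U x; set Y := rad U x.
move=> q1 qt te0 ry y0 r0 GY G0.
set te := (1 + t) `^ e * Q1 in qt te0.
have [b b0'] : {b | b = te / y} by exists (te / y).
have tb : te = b * y by rewrite b0' divfK// gt_eqF.
have bq : b <= q / y by rewrite b0' ler_pM2r ?invr_gt0.
have bge : 0 <= b by rewrite b0' divr_ge0// ltW.
rewrite [leLHS](_ : _ = - (e * (1 + t) `^ (e - 1)) * (Q1 * (G + X ^+ 2)) + (- k * b * (G + X ^+ 2)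
   + 2 * V * (te / r) * X ^+ 2 + 2 * lam * k * b * (Y * X))); last first.
  rewrite b0' /te; field; rewrite !gt_eqF//.
rewrite lerD2l.
have s1 : - k * b * (G + X ^+ 2) <= `|k| * b * (G + X ^+ 2).
  rewrite ler_wpM2r ?addr_ge0 ?sqr_ge0// ler_wpM2r//.
  by rewrite -normrN ler_norm.
have s2 : 2 * lam * k * b * (Y * X) <= lam * (`|k| * b) * (G + X ^+ 2).
  have h3 : 2 * (k * (Y * X)) <= `|k| * (Y ^+ 2 + X ^+ 2).
    apply: le_trans (ler_norm _) _; rewrite !normrM ger0_norm//.
    rewrite mulrCA; apply: ler_wpM2l => //.
    rewrite -(real_normK (num_real Y)) -(real_normK (num_real X)).
    by have := sqr_ge0 (`|Y| - `|X|); lra.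
  have h4 : `|k| * (Y ^+ 2 + X ^+ 2) <= `|k| * (G + X ^+ 2) by rewrite ler_wpM2l// lerD2r.
  have lb : 0 <= lam * b by rewrite mulr_ge0// ltW.
  have := ler_wpM2l lb (le_trans h3 h4).
  by move: (`|k|) => ak; lra.
have s3 : 2 * V * (te / r) * X ^+ 2 <= 2 * V * (q / r) * X ^+ 2.
  rewrite ler_wpM2r ?sqr_ge0// ler_wpM2l ?mulr_ge0 ?(ltW V0)//.
  by rewrite ler_pM2r ?invr_gt0.
have s4 : b * G <= q / y * G by rewrite ler_wpM2r.
have s5 : b * X ^+ 2 <= q / r * X ^+ 2.
  rewrite ler_wpM2r ?sqr_ge0// (le_trans bq)//.
  have q0 : 0 <= q by exact/ltW/Pw_gt0.
  by apply: ler_wpM2l => //; rewrite lef_pV2 ?posrE.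
have c0 : 0 <= `|k| * (1 + lam) by rewrite mulr_ge0// addr_ge0 ?ltW.
have s6 := ler_wpM2l c0 (lerD s4 s5).
have s7 : 0 <= 2 * V * (q / y * G).
  by rewrite !mulr_ge0 ?invr_ge0 ?(ltW V0) ?(ltW y0)//; exact/ltW/Pw_gt0.
rewrite [leRHS](_ : _ = (`|k| * (1 + lam) + 2 * V) * (q / y * G + q / r * X ^+ 2)); last by ring.
move: s1 s2 s3 s6 s7; move: (`|k|) (q / y) (q / r) (te / r) => ak g1 g2 g3; clear -R; lra.
Qed.

End energy_estimates.

(** * Lyapunov functionals *)

Section lyapunov_pieces.
Context {R : realType} {N : nat}.
Local Notation E := 'rV[R]_N.
Local Notation leb := (@lebesgue_rV R N).
Local Notation state := (@state R N).
Variable D : set E.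
Hypotheses (oD : open D) (bD : bounded_set D) (D0 : ~ closure D 0).
Hypothesis N3 : (3 <= N)%N.
Variable V : R.
Hypothesis V0 : 0 < V.
Implicit Types (u v f h : E -> R) (U Y Z : state) (x : E) (s c mu kap : R).

Local Notation Int := (Int leb D).
Local Notation intg := (intg leb D).
Local Notation l2 := (l2 leb D).
Local Notation bmf := (bmf D).
Local Notation P := (phase_space D).
Local Notation nrm := (nrm D).
Local Notation n := (N%:R : R).
Local Notation A := (wave_operator D V).
Local Notation eqv := (eqv P nrm).

Let mD : measurable D := open_measurable_rV oD.
Local Hint Resolve mD : core.
Let N2 : (2 <= N)%N := ltnW N3.
Let P0 : P 0 := phase0 oD bD D0.

Lemma n_ge3 : 3 <= n. Proof. by rewrite ler_nat. Qed.

Lemma wave_eqv K U : P U -> A K U -> exists2 h, weak_laplacian D K.1 h &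
  eqv U (K.2, fun x => h x - V / enorm x * K.2 x).
Proof.
move=> PU [h1 h2 [h lap e]]; exists h => //.
have PW : P (K.2, fun x => h x - V / enorm x * K.2 x).
  split=> //; apply: (l2B mD lap.1); apply: l2_bmf => //; first exact: bmf_damping.
  exact: H10_l2'.
by split=> //; apply/(phase_eqP oD bD D0 PU PW).
Qed.

Lemma wave_operatorD K U c K' U' : P U -> P U' -> A K U -> A K' U' ->
  A (K + c *: K') (U + c *: U').
Proof.
move=> PU PU' a a'; have [h lap e] := wave_eqv PU a; have [h' lap' e'] := wave_eqv PU' a'.
have [k1 k2 _] := a; have [k1' k2' _] := a'.
split; [exact: (H10D oD bD D0 c k1 k1')|exact: (H10D oD bD D0 c k2 k2')|].
exists (fun x => h x + c * h' x); first exact: (weak_laplacianD oD bD c k1 k1' lap lap').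
have [p1 p2 e0] := eqvD (@phaseD R N D oD bD D0) (@nrm_ge0 R N D) (@nrmD R N D oD bD D0) c e e'.
apply/(phase_eqP oD bD D0).
- exact: p1.
- move: p2; congr (P _); congr pair; apply/funext => x /=.
  rewrite (_ : (K.2 + _) x = K.2 x + c * K'.2 x)// (_ : (_ + _) x = h x - V / enorm x * K.2 x +
    c * (h' x - V / enorm x * K'.2 x))//; ring.
- rewrite -e0; congr (nrm (_ - _)); congr pair; apply/funext => x /=.
  rewrite (_ : (K.2 + _) x = K.2 x + c * K'.2 x)// (_ : (_ + _) x = h x - V / enorm x * K.2 x +
    c * (h' x - V / enorm x * K'.2 x))//; ring.
Qed.

Lemma wave_uniq K K' U : P U -> A K U -> A K' U -> nrm (K - K') = 0.
Proof.
move=> PU a a'; have [C C0 CP] := wave_operator_inv_bound oD bD D0 N2 V.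
have z := wave_operatorD (-1) PU PU a a'; rewrite !scaleN1r subrr in z.
apply/eqP; rewrite eq_le nrm_ge0 andbT.
by have := CP _ _ P0 z; rewrite (nrm0 oD bD D0) mulr0.
Qed.

(** Among the preimages of [U], which agree up to null states, one is picked with [K.2 = U.1] as
    functions; [wave_operator] alone gives this only almost everywhere. *)
Definition wave_inv U : state :=
  xget 0 [set K | [/\ A K U, K.2 = U.1 &
    weak_laplacian D K.1 (fun x => U.2 x + V / enorm x * U.1 x)]].

Lemma wave_invP U : P U -> [/\ A (wave_inv U) U, (wave_inv U).2 = U.1 &
    weak_laplacian D (wave_inv U).1 (fun x => U.2 x + V / enorm x * U.1 x)].
Proof.
move=> PU; rewrite /wave_inv; apply: (@xgetPex _ 0 [set K | [/\ A K U, K.2 = U.1 &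
    weak_laplacian D K.1 (fun x => U.2 x + V / enorm x * U.1 x)]]).
have [hU lU] := PU; have lV : l2 (fun x => V / enorm x * U.1 x).
  by apply: l2_bmf => //; [exact: bmf_damping|exact: H10_l2'].
have [u [hu lap]] := dirichlet_exists oD bD D0 N2 (l2D mD lU lV).
exists (u, U.1); split=> //; split=> //; exists (fun x => U.2 x + V / enorm x * U.1 x) => //.
apply/(phase_eqP oD bD D0) => //.
  by split=> //=; apply: l2B => //; apply: l2D.
rewrite /= (_ : (_, _) = U) ?subrr ?(nrm0 oD bD D0)//.
by case: (U) => u1 u2 /=; congr pair; apply/funext => x; rewrite addrK.
Qed.

Lemma wave_inv_phase U : P U -> P (wave_inv U).
Proof. by move=> /wave_invP[/wave_operator_phase]. Qed.

Lemma wave_inv_lin U c W : P U -> P W ->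
  nrm (wave_inv (U + c *: W) - (wave_inv U + c *: wave_inv W)) = 0.
Proof.
move=> PU PW; have [a _ _] := wave_invP PU; have [a' _ _] := wave_invP PW.
have PUW := phaseD oD bD D0 c PU PW; have [a'' _ _] := wave_invP PUW.
exact: (wave_uniq PUW a'' (wave_operatorD c PU PW a a')).
Qed.

Lemma wave_inv_bound : exists2 C : R, 0 <= C & forall U, P U -> nrm (wave_inv U) <= C * nrm U.
Proof.
have [C C0 CP] := wave_operator_inv_bound oD bD D0 N2 V; exists C; first exact: ltW.
by move=> U PU; apply: CP => //; have [] := wave_invP PU.
Qed.

Lemma wave_inv_gen U Z : P U -> P Z -> A U Z -> eqv (wave_inv Z) U.
Proof.
move=> PU PZ a; split=> //; first exact: wave_inv_phase.
by have [a' _ _] := wave_invP PZ; exact: (wave_uniq PZ a' a).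
Qed.

Variables (t lam : R).
Hypotheses (t0 : 0 <= t) (lam1 : 1 <= lam).
Local Notation Pw c := (pw (1 + t) lam c).
Let lam0 : 0 < lam. Proof. exact: lt_le_trans ltr01 lam1. Qed.
Let bP c : bmf (Pw c) := bmf_Pw oD bD D0 t0 lam1 c.
Let br : bmf rinv := bmf_rinv oD bD D0.
Let be : bmf (@enorm R N) := bmf_enorm oD bD D0.

Definition Ig s U := Int (fun x => Pw s x * gsq D U x).
Definition Iv s f := Int (fun x => Pw s x * f x ^+ 2).
Definition Ir s f := Int (fun x => Pw s x * rinv x * f x ^+ 2).
Definition Ih s f := Int (fun x => Pw s x * (f x * rinv x) ^+ 2).
Definition Ie s f := Int (fun x => Pw s x * enorm x * f x ^+ 2).

Lemma ig_g s U : P U -> intg (fun x => Pw s x * gsq D U x).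
Proof. by apply: intg_gsq => //; exact: bP. Qed.

Lemma ig_v s f : l2 f -> intg (fun x => Pw s x * f x ^+ 2).
Proof. by apply: intg_sqr => //; exact: bP. Qed.

Lemma ig_r s f : l2 f -> intg (fun x => Pw s x * rinv x * f x ^+ 2).
Proof. by apply: intg_sqr => //; exact: bmfM. Qed.

Lemma ig_e s f : l2 f -> intg (fun x => Pw s x * enorm x * f x ^+ 2).
Proof. by apply: intg_sqr => //; exact: bmfM. Qed.

Lemma l2_rinv f : l2 f -> l2 (fun x => f x * rinv x).
Proof. by move=> lf; under eq_fun do rewrite mulrC; exact: l2_bmf. Qed.

Lemma ig_h s f : l2 f -> intg (fun x => Pw s x * (f x * rinv x) ^+ 2).
Proof. by move=> lf; apply: ig_v; exact: l2_rinv. Qed.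

Lemma Ig_ge0 s U : 0 <= Ig s U.
Proof. by apply: Int_ge0 => x _; rewrite mulr_ge0 ?gsq_ge0// powR_ge0. Qed.

Lemma Iv_ge0 s f : 0 <= Iv s f.
Proof. by apply: Int_ge0 => x _; rewrite mulr_ge0 ?sqr_ge0// powR_ge0. Qed.

Lemma Ir_ge0 s f : 0 <= Ir s f.
Proof.
apply: Int_ge0 => x _; have r0 : 0 <= rinv x := powR_ge0 _ _; have p0 : 0 <= Pw s x := powR_ge0 _ _.
nneg.
Qed.

Lemma Ie_ge0 s f : 0 <= Ie s f.
Proof.
apply: Int_ge0 => x _; have r0 := enorm_ge0 x; have p0 : 0 <= Pw s x := powR_ge0 _ _.
nneg.
Qed.

Lemma Psl_rinv x : D x -> 1 <= Psl t lam x * rinv x.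
Proof. by move=> Dx; rewrite rinvE (le_trans lam1)// (p_ge D0). Qed.

Lemma Ir_le_Ih s f : l2 f -> Ir (s - 1) f <= Ih s f.
Proof.
move=> lf; apply: le_Int; [exact: mD|exact: ig_r|exact: ig_h|].
move=> x Dx; have := Psl_rinv Dx; have p0 := Psl_gt0 t0 lam1 x; have q0 := Pw_gt0 t0 lam1 (s - 1) x.
have := PwS t0 lam1 (s - 1) x; rewrite subrK => -> h.
have r0 : 0 <= rinv x by exact: powR_ge0.
rewrite [leRHS](_ : _ = Pw (s - 1) x * rinv x * (Psl t lam x * rinv x) * f x ^+ 2); last by ring.
by rewrite ler_wpM2r ?sqr_ge0// ler_peMr// mulr_ge0// ltW.
Qed.

Lemma Iv_le_Ir s f : l2 f -> Iv s f <= Ir (s + 1) f.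
Proof.
move=> lf; apply: le_Int; [exact: mD|exact: ig_v|exact: ig_r|].
move=> x Dx; rewrite (PwS t0 lam1) -[_ * _ * rinv x]mulrA ler_wpM2r ?sqr_ge0//.
by rewrite ler_peMr ?Psl_rinv// ltW// (Pw_gt0 t0 lam1).
Qed.

Lemma Iv_le_Ih s f : l2 f -> Iv s f <= Ih (s + 1 + 1) f.
Proof.
by move=> lf; apply: le_trans (Iv_le_Ir _ lf) _; have := Ir_le_Ih (s + 1 + 1) lf; rewrite addrK.
Qed.

(** Hardy's inequality with [al = 1/4], whence [16 = al^-2]: for [N >= 3] and [s >= -1/2] one has
    [2 al <= N - 2 + s]. *)
Lemma Ih_le_Ig s U : P U -> - 2^-1 <= s -> Ih s U.1 <= 16 * Ig s U.
Proof.
move=> PU s1; have n3 := n_ge3; have a0 : 0 < 4^-1 :> R by rewrite invr_gt0.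
have := @hardy R N D oD bD D0 t lam t0 lam1 s 4^-1 U PU a0.
rewrite -/(Ih s U.1) -/(Ig s U) => H.
have /H : s < 0 -> 2 * 4^-1 <= n - 2 + s by move=> _; lra.
have -> : (2 * 4^-1 <= n - 2) by lra.
by move=> /(_ isT); lra.
Qed.

Lemma Ie_mass s f : l2 f -> Int (fun x => Pw s x * (f x * enorm x) ^+ 2) <= Ie (s + 1) f.
Proof.
move=> lf; have lfe : l2 (fun x => f x * enorm x).
  by under eq_fun do rewrite mulrC; exact: l2_bmf.
apply: le_Int; [exact: mD|exact: ig_v|exact: ig_e|].
move=> x Dx; rewrite (PwS t0 lam1) exprMn.
have ry := rPsl t0 lam1 Dx; have q0 := Pw_gt0 t0 lam1 s x; have r0 := enorm_ge0 x.
rewrite [leLHS](_ : _ = Pw s x * enorm x * f x ^+ 2 * enorm x); last by ring.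
rewrite [leRHS](_ : _ = Pw s x * enorm x * f x ^+ 2 * Psl t lam x); last by ring.
by apply: ler_wpM2l => //; nneg.
Qed.

End lyapunov_pieces.

Lemma kick_arith (R : realFieldType) (s g r v c i eta Cu : R) :
  2 * s <= eta / 32 * v + eta / 32 * r + c * i -> eta / 32 * r <= eta / 32 * (16 * g) ->
  0 <= eta * v ->
  - (eta * g + eta * v - Cu * r) + 2 * s <= - (eta / 2) * (g + v) + Cu * r + c * i.
Proof. by lra. Qed.

Lemma sqrD_le (R : realDomainType) (a b : R) : (a + b) ^+ 2 <= 2 * a ^+ 2 + 2 * b ^+ 2.
Proof. by have := sqr_ge0 (a - b); lra. Qed.

Lemma elliptic_kick_arith (R : realFieldType) (a1 a2 a3 a4 a5 a6 e3 e g1 g2 : R) :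
  2 * (a1 - e3 * a2) <= e3 * e / 17 * a6 * (a3 + a4 + a5) + g2 -> g2 <= g1 ->
  e3 * e / 17 * a6 * a5 <= e3 * e / 17 * a6 * (16 * a3) -> 0 <= e3 * e / 17 * a6 * a4 ->
  - (e3 * (e * a6 * (a3 + a4))) + 2 * (a1 - e3 * a2) <= g1.
Proof. by lra. Qed.

Lemma elliptic_energy_arith (R : realFieldType) (a1 a2 a3 a4 v : R) : a3 <= a2 -> v ^+ 2 * a1 <= v ^+ 2 * (16 * a4) ->
  2 * a3 + 2 * v ^+ 2 * a1 <= 2 * a2 + 32 * v ^+ 2 * a4.
Proof. by lra. Qed.

(** * Dissipation and effect of the force, form by form *)

Section lyapunov_estimates.
Context {R : realType} {N : nat}.
Local Notation E := 'rV[R]_N.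
Local Notation leb := (@lebesgue_rV R N).
Local Notation state := (@state R N).
Variable D : set E.
Hypotheses (oD : open D) (bD : bounded_set D) (D0 : ~ closure D 0).
Hypothesis N3 : (3 <= N)%N.
Variable V : R.
Hypothesis V0 : 0 < V.
Variable lam : R.
Hypothesis lam1 : 1 <= lam.
Implicit Types (u v f h : E -> R) (U Y Z K : state) (x : E) (s c mu kap eta Cu e t T : R).

Local Notation Int := (Int leb D).
Local Notation intg := (intg leb D).
Local Notation l2 := (l2 leb D).
Local Notation bmf := (bmf D).
Local Notation P := (phase_space D).
Local Notation nrm := (nrm D).
Local Notation n := (N%:R : R).
Local Notation A := (wave_operator D V).
Local Notation eqv := (eqv P nrm).
Local Notation pr c := (fun r x => pw (1 + r) lam c x).

Let mD : measurable D := open_measurable_rV oD.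
Local Hint Resolve mD : core.
Let lam0 : 0 < lam. Proof. exact: lt_le_trans ltr01 lam1. Qed.
Let bP t (t0 : 0 <= t) c : bmf (pw (1 + t) lam c) := bmf_Pw oD bD D0 t0 lam1 c.
Let br : bmf rinv := bmf_rinv oD bD D0.
Let bc c : bmf (fun=> c) := bmf_cst D c.

Local Notation Sform := (Sform D V lam).
Local Notation Sform' := (Sform' D V lam).
Local Notation Eform := (Eform D lam).
Local Notation Eform' := (Eform' D lam).
Local Notation Ig := (Ig D).
Local Notation Ir := (Ir D).
Local Notation Iv := (Iv D).
Local Notation Ih := (Ih D).
Local Notation Ie := (Ie D).

Definition Dform mu eta Cu : R -> state -> state -> R :=
  wform D (fun r x => eta * pw (1 + r) lam mu x) (fun r x => eta * (pw (1 + r) lam (mu + 1) x * rinv x))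
    (fun _ _ => 0) (fun r x => - Cu * (pw (1 + r) lam (mu - 1) x * rinv x)).

(** The part of the derivative of [Eform] that comes from the factor [(1 + t)^e], and so the
    dissipation gained by subtracting [Eform]. *)
Definition Rform mu e : R -> state -> state -> R :=
  wform D (fun r x => e * (pw (1 + r) 0 (e - 1) x * pw (1 + r) lam (mu + 1 - e) x))
    (fun r x => e * (pw (1 + r) 0 (e - 1) x * pw (1 + r) lam (mu + 1 - e) x))
    (fun _ _ => 0) (fun _ _ => 0).

Lemma Dform_family mu eta Cu T : 0 < T -> form_family P nrm T (Dform mu eta Cu).
Proof.
move=> T0; have p c := tder_pw D c (ltW lam0).
have [f _ _] := tder_wform oD bD D0 T0 (tder_scale eta (p mu))
  (tder_scale eta (tder_mul (p (mu + 1)) (tder_cst br))) (tder_const D 0)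
  (tder_scale (- Cu) (tder_mul (p (mu - 1)) (tder_cst br))).
exact: f.
Qed.

Lemma Rform_family mu e T : 0 < T -> form_family P nrm T (Rform mu e).
Proof.
move=> T0.
have p := tder_scale e (tder_mul (tder_pw D (e - 1) (lexx (0 : R))) (tder_pw D (mu + 1 - e) (ltW lam0))).
by have [f _ _] := tder_wform oD bD D0 T0 p p (tder_const D 0) (tder_const D 0).
Qed.

Lemma Sform_family mu kap T : 0 < T -> [/\ form_family P nrm T (Sform mu kap),
  form_family P nrm T (Sform' mu kap) & form_derivative P nrm T (Sform mu kap) (Sform' mu kap)].
Proof.
move=> T0; have d1 := tder_sw1 D lam1 mu; have d3 := tder_sw3 D V lam1 mu.
exact: (tder_wform oD bD D0 T0 d1 d1 d3 (tder_sw4 oD bD D0 V lam1 mu kap)).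
Qed.

Lemma Eform_family mu e T : 0 < T -> [/\ form_family P nrm T (Eform mu e),
  form_family P nrm T (Eform' mu e) & form_derivative P nrm T (Eform mu e) (Eform' mu e)].
Proof.
move=> T0; have d1 := tder_ew D lam1 mu e; have z := tder_const D 0.
exact: (tder_wform oD bD D0 T0 d1 d1 z z).
Qed.

Section fixed_time.
Variable t : R.
Hypothesis t0 : 0 <= t.

Lemma DformE mu eta Cu U : P U -> Dform mu eta Cu t U U =
  eta * Ig t lam mu U + eta * Ir t lam (mu + 1) U.2 - Cu * Ir t lam (mu - 1) U.1.
Proof.
move=> PU; have [hU lU] := PU; have lU1 := H10_l2' hU.
have i1 := ig_g oD bD D0 t0 lam1 mu PU; have i2 := ig_r oD bD D0 t0 lam1 (mu + 1) lU.
have i3 := ig_r oD bD D0 t0 lam1 (mu - 1) lU1.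
rewrite -(IntZ mD _ i1) -(IntZ mD _ i2) -(IntZ mD _ i3).
rewrite -(IntD mD (intgZ mD _ i1) (intgZ mD _ i2)).
rewrite -(IntB mD (intgD mD (intgZ mD _ i1) (intgZ mD _ i2)) (intgZ mD _ i3)).
by apply: eq_Int => x _; rewrite /gsq; ring.
Qed.

Lemma RformE mu e U : P U -> Rform mu e t U U =
  e * (1 + t) `^ (e - 1) * (Ig t lam (mu + 1 - e) U + Iv t lam (mu + 1 - e) U.2).
Proof.
move=> PU; have [hU lU] := PU.
have i1 := ig_g oD bD D0 t0 lam1 (mu + 1 - e) PU; have i2 := ig_v oD bD D0 t0 lam1 (mu + 1 - e) lU.
rewrite -(IntD mD i1 i2) -(IntZ mD _ (intgD mD i1 i2)).
by apply: eq_Int => x _; rewrite /gsq pw_time; ring.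
Qed.

Lemma EformE mu e U Y : P U -> P Y -> Y.2 = (fun=> 0) -> Eform mu e t U Y =
  Int (fun x => (1 + t) `^ e * pw (1 + t) lam (mu + 1 - e) x * dotg (nabla D U.1) (nabla D Y.1) x).
Proof. by move=> PU PY Y2; apply: eq_Int => x _; rewrite Y2 /ew pw_time; ring. Qed.

Lemma Eform_diag mu e U : P U -> Eform mu e t U U =
  (1 + t) `^ e * (Ig t lam (mu + 1 - e) U + Iv t lam (mu + 1 - e) U.2).
Proof.
move=> PU; have [hU lU] := PU.
have i1 := ig_g oD bD D0 t0 lam1 (mu + 1 - e) PU; have i2 := ig_v oD bD D0 t0 lam1 (mu + 1 - e) lU.
rewrite -(IntD mD i1 i2) -(IntZ mD _ (intgD mD i1 i2)).
by apply: eq_Int => x _; rewrite /ew pw_time /gsq; ring.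
Qed.

Lemma time_Iv e s f : 0 <= e -> l2 f -> (1 + t) `^ e * Iv t lam (s - e) f <= Iv t lam s f.
Proof.
move=> e0 lf; have i := ig_v oD bD D0 t0 lam1 (s - e) lf.
rewrite -(IntZ mD _ i); apply: le_Int; [exact: mD|exact: intgZ|exact: ig_v|].
move=> x _; rewrite mulrA ler_wpM2r ?sqr_ge0// (Pw_split t0 lam1 s e) mulrC.
by rewrite ler_pM2l ?tau_le// (Pw_gt0 t0 lam1).
Qed.

Lemma time_Ig e s U : 0 <= e -> P U -> (1 + t) `^ e * Ig t lam (s - e) U <= Ig t lam s U.
Proof.
move=> e0 PU; have i := ig_g oD bD D0 t0 lam1 (s - e) PU.
rewrite -(IntZ mD _ i); apply: le_Int; [exact: mD|exact: intgZ|exact: ig_g|].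
move=> x _; rewrite mulrA ler_wpM2r ?gsq_ge0// (Pw_split t0 lam1 s e) mulrC.
by rewrite ler_pM2l ?tau_le// (Pw_gt0 t0 lam1).
Qed.

Lemma Eform_bounds mu e U : 0 <= e -> P U ->
  0 <= Eform mu e t U U <= Ig t lam (mu + 1) U + Iv t lam (mu + 1) U.2.
Proof.
move=> e0 PU; have [_ lU] := PU; rewrite Eform_diag// mulr_ge0 ?powR_ge0 ?addr_ge0 ?Ig_ge0 ?Iv_ge0//=.
by rewrite mulrDr lerD ?time_Ig ?time_Iv.
Qed.

Lemma form_gen B U Z h : form_family P nrm (t + 1) B -> P U ->
  eqv Z (U.2, fun x => h x - V / enorm x * U.2 x) ->
  B t U Z = B t U (U.2, fun x => h x - V / enorm x * U.2 x).
Proof.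
move=> fB PU eZ; have e1 : eqv U U by split=> //; rewrite subrr (nrm0 oD bD D0).
apply: (form_eqv (@phaseD R N D oD bD D0) (@nrm_ge0 R N D) (@nrmD R N D oD bD D0) fB) => //.
by rewrite lerDl.
Qed.

(** [Cu] measures the error left in front of [Psi^(mu - 1) u^2 / |x|]. It is 0 in [ex_damped_pos]
    and [ex_damped_neg], and positive in [ex_damped_any]. *)
Definition damped mu kap eta Cu :=
  [/\ 0 <= mu + 1, mu + 1 < V, eta = (V - (mu + 1)) / 2, 4 * V <= lam * (V - (mu + 1)) &
  forall p, lam <= p -> V * lam ^+ 3 * kap ^+ 2 + 2 * (mu + 1 + eta) * lam ^+ 2 * kap ^+ 2
     + damp_u V n lam mu kap p <= Cu * p].

Definition coercive mu kap := forall p, lam <= p ->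
  (V ^+ 2 / 8 + V ^+ 2 / 4 + kap ^+ 2) * lam ^+ 2 <= energy_u V n lam mu kap p.

Lemma Sform_diss mu kap eta Cu U Z : damped mu kap eta Cu -> P U -> P Z -> A U Z ->
  Sform' mu kap t U U + 2 * Sform mu kap t U Z <= - Dform mu eta Cu t U U.
Proof.
move=> [m0 mV eE lV HC] PU PZ a; have [h lap e] := wave_eqv oD bD D0 PZ a.
(* Form families are indexed by a time horizon; [t + 1] is just one that contains [t]. *)
have T0 : 0 < t + 1 by rewrite ltr_wpDl.
have [f _ _] := Sform_family mu kap T0.
rewrite (form_gen f PU e).
have [h1 h2 _] := a.
apply: le_trans (Sform_damp oD bD D0 t0 lam1 m0 mV eE lV HC h1 h2 lap) _.
rewrite le_eqVlt; apply/orP; left; apply/eqP; congr (- _).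
by apply: eq_Int => x _; rewrite /gsq; ring.
Qed.

Lemma Eform_diss mu e U Z : 0 <= e -> P U -> P Z -> A U Z ->
  - (Eform' mu e t U U + 2 * Eform mu e t U Z) <= - Rform mu e t U U +
    (`|mu + 1 - e| * (1 + lam) + 2 * V) * (Ig t lam mu U + Ir t lam (mu + 1) U.2).
Proof.
move=> e0 PU PZ a; have [h lap ez] := wave_eqv oD bD D0 PZ a.
have T0 : 0 < t + 1 by rewrite ltr_wpDl.
have [f _ _] := Eform_family mu e T0.
rewrite (form_gen f PU ez); have [h1 h2 _] := a; have [_ lU] := PU.
apply: le_trans (Eform_damp oD bD D0 t0 lam1 mu e0 V0 h1 h2 lap) _.
have i1 := ig_g oD bD D0 t0 lam1 (mu + 1 - e) PU; have i2 := ig_v oD bD D0 t0 lam1 (mu + 1 - e) lU.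
have i3 := ig_g oD bD D0 t0 lam1 mu PU; have i4 := ig_r oD bD D0 t0 lam1 (mu + 1) lU.
rewrite RformE// -(IntD mD i1 i2) -(IntD mD i3 i4) mulNr le_eqVlt; apply/orP; left; apply/eqP.
by congr (- (_ * _) + _ * _); apply: eq_Int => x _; rewrite ?mulrDr.
Qed.

Lemma IntgD_energy s U : P U -> Int (fun x => pw (1 + t) lam s x * (gsq D U x + U.2 x ^+ 2)) =
  Ig t lam s U + Iv t lam s U.2.
Proof.
move=> PU; have [_ lU] := PU.
have i1 := ig_g oD bD D0 t0 lam1 s PU; have i2 := ig_v oD bD D0 t0 lam1 s lU.
by rewrite -(IntD mD i1 i2); apply: eq_Int => x _; rewrite mulrDr.
Qed.

Lemma Sform_kick_diss mu kap eta Cu U f : 0 < eta -> 0 <= mu -> P U -> l2 f ->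
  - Dform mu eta Cu t U U + 2 * Sform mu kap t U ((0 : E -> R), f) <=
  - (eta / 2) * (Ig t lam mu U + Ir t lam (mu + 1) U.2) + Cu * Ir t lam (mu - 1) U.1
  + (1 + fb V lam ^+ 2) / (eta / 32) * Ie t lam (mu + 1) f.
Proof.
move=> eta0 m0 PU lf; have [hU lU] := PU; have lU1 := H10_l2' hU.
(* The factor is [1 / (2 * 16)]: with the constant 16 of [Ih_le_Ig] the term in [u^2] takes half of
   [eta Ig]. *)
have ep : 0 < eta / 32 by rewrite divr_gt0.
have H1 := Sform_kick oD bD D0 V t0 lam1 mu kap PU lf ep.
rewrite -/(Ir t lam (mu + 1) U.2) -/(Ir t lam (mu - 1) U.1) -/(Ie t lam (mu + 1) f) in H1.
have m1 : - 2^-1 <= mu by lra.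
have H2 := le_trans (Ir_le_Ih oD bD D0 t0 lam1 mu lU1) (Ih_le_Ig oD bD D0 N3 t0 lam1 PU m1).
have H3 := ler_wpM2l (ltW ep) H2.
have H4 : 0 <= eta * Ir t lam (mu + 1) U.2 by rewrite mulr_ge0 ?Ir_ge0// ltW.
rewrite DformE//.
exact: kick_arith H1 H3 H4.
Qed.

Section elliptic_gain.
Variables (d c : R).
Hypotheses (d0 : 0 < d) (c0 : 0 < c) (c1 : c <= 1).
Hypothesis coer : forall be ga X w : R, `|be| <= 2 * (n - 2) -> d ^+ 2 / 4 <= ga - be ^+ 2 / 4 ->
    c * (X ^+ 2 + w ^+ 2) <= X ^+ 2 + be * (X * w) + ga * w ^+ 2.

(** Besides [Sform_kick2] and [elliptic], this is a count of weights: [(1 + t)^(1 - e) Psi^(mu + 1 +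
    e) |x|^2 <= Psi^(mu + 2) |x|^2 <= Psi^(mu + 3) |x|], which for [mu = m - 2] is the weight
    [Psi^(m + 1) |x|] of the theorem. *)
Lemma elliptic_kick mu kap e e3 K Y f : 0 < e -> e <= 2^-1 -> 0 < e3 -> 0 <= mu + 1 ->
  mu + 1 + e + d <= n - 2 -> P K -> l2 f -> P Y -> Y.2 = (fun=> 0) ->
  weak_laplacian D Y.1 f ->
  - (e3 * Rform mu e t K K) + 2 * (Sform mu kap t K Y - e3 * Eform mu e t K Y) <=
  ((1 + e3) ^+ 2 + fb V lam ^+ 2 + fA4 V lam mu kap ^+ 2) / (e3 * e / 17) / c ^+ 2 * Ie t lam (mu + 1 + 1 + 1) f.
Proof.
move=> e0 e2 e30 m0 md PK lf PY Y2 lap; have [hK lK] := PK; have lK1 := H10_l2' hK.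
have [hY _] := PY; have lY1 := H10_l2' hY.
(* [17 = 1 + 16]: the gradient itself and, by Hardy's inequality, [u / |x|]. *)
have ep : 0 < e3 * e / 17 by rewrite divr_gt0// mulr_gt0.
have H1 := Sform_kick2 oD bD D0 t0 lam1 mu kap (ltW e0) V0 PK PY Y2 ep (ltW e30).
rewrite -EformE// in H1.
have i1 := ig_g oD bD D0 t0 lam1 (mu + 1 - e) PK; have i2 := ig_v oD bD D0 t0 lam1 (mu + 1 - e) lK.
have i3 := ig_h oD bD D0 t0 lam1 (mu + 1 - e) lK1.
have H2 : Int (fun x => pw (1 + t) lam (mu + 1 - e) x * (gsq D K x + K.2 x ^+ 2 + (K.1 x * rinv x) ^+ 2)) =
    Ig t lam (mu + 1 - e) K + Iv t lam (mu + 1 - e) K.2 + Ih t lam (mu + 1 - e) K.1.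
  by rewrite -(IntD mD i1 i2) -(IntD mD (intgD mD i1 i2) i3); apply: eq_Int => x _; ring.
have s1 : - 2^-1 <= mu + 1 - e by lra.
have H3 := Ih_le_Ig oD bD D0 N3 t0 lam1 PK s1.
have s2 : 0 <= mu + 1 + e by lra.
have H4 := elliptic oD bD D0 t0 lam1 s2 md d0 (erefl _) c0 c1 coer PY lap.
have H5 : (1 + t) `^ (1 - e) * Int (fun x => pw (1 + t) lam (mu + 1 + e) x * (f x * enorm x) ^+ 2) <=
    Ie t lam (mu + 1 + 1 + 1) f.
  apply: le_trans (Ie_mass oD bD D0 t0 lam1 (mu + 1 + 1) lf).
  have lfe : l2 (fun x => f x * enorm x).
    by under eq_fun do rewrite mulrC; apply: l2_bmf => //; exact: bmf_enorm.
  have e1 : 0 <= 1 - e by lra.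
  have := time_Iv (mu + 1 + 1) e1 lfe.
  by rewrite (_ : mu + 1 + 1 - (1 - e) = mu + 1 + e)//; ring.
rewrite H2 in H1; rewrite RformE//.
set X := Int (fun x => _ * (gsq D Y x + _)) in H1 H4.
set M := Int (fun x => _ * (f x * _) ^+ 2) in H4 H5.
set C := (_ + _ ^+ 2) in H1 *.
have C0 : 0 <= C by rewrite /C !addr_ge0 ?sqr_ge0.
have cc : 0 < c ^+ 2 by rewrite exprn_gt0.
have H6 : C / (e3 * e / 17) * (1 + t) `^ (1 - e) * X <= C / (e3 * e / 17) / c ^+ 2 * Ie t lam (mu + 1 + 1 + 1) f.
  rewrite -[leLHS]mulrA -[leRHS]mulrA; apply: ler_wpM2l; first by rewrite divr_ge0// ltW.
  rewrite [c ^- 2 * _]mulrC ler_pdivlMr//; apply: le_trans H5; rewrite -mulrA ler_wpM2l ?powR_ge0//.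
  by rewrite mulrC.
have q0 : 0 <= e3 * e / 17 * (1 + t) `^ (e - 1) by rewrite mulr_ge0 ?powR_ge0// ltW.
have H7 := ler_wpM2l q0 H3.
have q1 : 0 <= e3 * e / 17 * (1 + t) `^ (e - 1) * Iv t lam (mu + 1 - e) K.2 by rewrite mulr_ge0 ?Iv_ge0.
exact: elliptic_kick_arith H1 H6 H7 q1.
Qed.

(** [K.1] has the Laplacian [v + V u / |x|], and [elliptic] charges a factor [|x|^2 <= Psi^2] for
    it; this explains the two extra powers of the weight on the side of [U]. *)
Lemma elliptic_energy mu K U : 0 <= mu + 1 -> mu + 1 + d <= n - 2 -> P K -> P U -> K.2 = U.1 ->
  weak_laplacian D K.1 (fun x => U.2 x + V / enorm x * U.1 x) ->
  Ig t lam (mu + 1) K + Iv t lam (mu + 1) K.2 <=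
  (16 + 2 * (1 + 16 * V ^+ 2) / c ^+ 2) * (Ig t lam (mu + 1 + 1 + 1) U + Iv t lam (mu + 1 + 1 + 1) U.2).
Proof.
move=> m0 md PK PU K2 lap; have [hU lU] := PU; have lU1 := H10_l2' hU.
have [hK _] := PK; have lK1 := H10_l2' hK.
have H1 := elliptic oD bD D0 t0 lam1 m0 md d0 (erefl _) c0 c1 coer PK lap.
have i1 := ig_g oD bD D0 t0 lam1 (mu + 1) PK; have i2 := ig_h oD bD D0 t0 lam1 (mu + 1) lK1.
have H2 : Ig t lam (mu + 1) K <= Int (fun x => pw (1 + t) lam (mu + 1) x * (gsq D K x + (K.1 x * rinv x) ^+ 2)).
  apply: le_Int => //.
    by apply: intg_eq (intgD mD i1 i2) => // x _; rewrite mulrDr.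
  by move=> x _; rewrite ler_wpM2l ?powR_ge0// lerDl sqr_ge0.
set m2 := mu + 1 + 1 + 1; have m20 : - 2^-1 <= m2 by rewrite /m2; lra.
have H3 := Ih_le_Ig oD bD D0 N3 t0 lam1 PU m20.
have H4 := Iv_le_Ih oD bD D0 t0 lam1 (mu + 1) lU1; rewrite -/m2 in H4.
have lUe : l2 (fun x => U.2 x * enorm x).
  by under eq_fun do rewrite mulrC; apply: l2_bmf => //; exact: bmf_enorm.
have H5 : Iv t lam (mu + 1) (fun x => U.2 x * enorm x) <= Iv t lam m2 U.2.
  apply: le_Int; [exact: mD|exact: ig_v|exact: ig_v|].
  move=> x Dx; rewrite /m2 !(PwS t0 lam1) exprMn.
  have ry := rPsl t0 lam1 Dx; have r0 := enorm_ge0 x; have q0 := Pw_gt0 t0 lam1 mu x; have y0 := Psl_gt0 t0 lam1 x.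
  rewrite [leLHS](_ : _ = pw (1 + t) lam mu x * Psl t lam x * U.2 x ^+ 2 * enorm x ^+ 2); last by ring.
  rewrite [leRHS](_ : _ = pw (1 + t) lam mu x * Psl t lam x * U.2 x ^+ 2 * Psl t lam x ^+ 2); last by ring.
  by apply: ler_wpM2l; [nneg|rewrite ler_sqr// nnegrE// ltW].
have H6 : Int (fun x => pw (1 + t) lam (mu + 1) x * ((U.2 x + V / enorm x * U.1 x) * enorm x) ^+ 2) <=
    2 * Iv t lam (mu + 1) (fun x => U.2 x * enorm x) + 2 * V ^+ 2 * Iv t lam (mu + 1) U.1.
  have j1 := ig_v oD bD D0 t0 lam1 (mu + 1) lUe; have j2 := ig_v oD bD D0 t0 lam1 (mu + 1) lU1.
  rewrite -(IntZ mD _ j1) -(IntZ mD _ j2) -(IntD mD (intgZ mD _ j1) (intgZ mD _ j2)).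
  have r0 x : D x -> enorm x != 0 by move=> Dx; rewrite gt_eqF// (enorm_D D0).
  have e1 x : D x -> (U.2 x + V / enorm x * U.1 x) * enorm x = U.2 x * enorm x + V * U.1 x.
    by move=> Dx; field; exact: r0.
  apply: le_Int => //; last 2 first.
  - by apply: intgD => //; exact: intgZ.
  - move=> x Dx; rewrite e1//.
    rewrite [leRHS](_ : _ = pw (1 + t) lam (mu + 1) x * (2 * (U.2 x * enorm x) ^+ 2 + 2 * (V * U.1 x) ^+ 2)); last by ring.
    rewrite ler_wpM2l ?powR_ge0//.
    exact: sqrD_le.
  - have := ig_v oD bD D0 t0 lam1 (mu + 1) (l2D mD lUe (l2Z mD V lU1)) => j.
    by apply: intg_eq j => // x Dx; rewrite e1.
rewrite K2; have cc : 0 < c ^+ 2 by rewrite exprn_gt0.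
have H7 : Ig t lam (mu + 1) K <= (2 * Iv t lam m2 U.2 + 32 * V ^+ 2 * Ig t lam m2 U) / c ^+ 2.
  rewrite ler_pdivlMr// mulrC; apply: (@le_trans _ _ (c ^+ 2 * Int (fun x => pw (1 + t) lam (mu + 1) x * (gsq D K x + (K.1 x * rinv x) ^+ 2)))).
    by rewrite ler_pM2l.
  apply: le_trans H1 _; apply: le_trans H6 _.
  exact: elliptic_energy_arith H5 (ler_wpM2l (sqr_ge0 V) (le_trans H4 H3)).
have g0 := Ig_ge0 D t lam m2 U; have v0 := Iv_ge0 D t lam m2 U.2.
apply: le_trans (lerD H7 (le_trans H4 H3)) _.
rewrite [leRHS](_ : _ = (2 * Iv t lam m2 U.2 + 32 * V ^+ 2 * Ig t lam m2 U) / c ^+ 2 + 16 * Ig t lam m2 U +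
  ((2 * Ig t lam m2 U + 32 * V ^+ 2 * Iv t lam m2 U.2) / c ^+ 2 + 16 * Iv t lam m2 U.2)); last by field; rewrite gt_eqF.
by rewrite lerDl; apply: addr_ge0; [apply: divr_ge0|]; nneg.
Qed.

End elliptic_gain.
End fixed_time.
End lyapunov_estimates.

Lemma kform_diss_arith (R : realFieldType) (a b c d e3 r q eta g i j : R) :
  a + 2 * b <= - (eta * g + eta * i - 0 * j) -> e3 * - (c + 2 * d) <= e3 * (- r + q * (g + i)) ->
  e3 * q * (g + i) <= eta / 2 * (g + i) ->
  a + - e3 * c + 2 * (b + - e3 * d) <= - (eta / 2 * g + eta / 2 * i - 0 * j + e3 * r).
Proof. by lra. Qed.

Lemma kform_kick_arith (R : realFieldType) (r e3 s x eta g i j k : R) :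
  - (e3 * r) + 2 * (s - e3 * x) <= k -> 0 <= eta * g ->
  - (eta / 2 * g + eta / 2 * i - 0 * j + e3 * r) + 2 * (s + - e3 * x) <= - (eta / 2) * i + k.
Proof. by lra. Qed.

Lemma lyapunov_arith (R : realFieldType) (a b c d e f M : R) : a + 2 * b <= - e ->
  M * (c + 2 * d) <= M * - f -> a + M * c + 2 * (b + M * d) <= - (e + M * f).
Proof. by lra. Qed.

Lemma lyapunov_upper_arith (R : realFieldType) (a b M r q : R) : 0 <= r * q ->
  a * q + M * (b * q) <= (a + M * b + r) * q.
Proof. by lra. Qed.

Lemma lyapunov_kick_arith (R : realFieldType) (d s M k q eta eta2 g i u Cu Ck kk ie cc v : R) :
  - d + 2 * s <= - (eta / 2) * (g + i) + Cu * u + Ck * ie ->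
  M * (- k + 2 * q) <= M * (- (eta2 / 2) * u + kk * ie) -> 0 <= cc * ie ->
  M * (eta2 / 2) = Cu -> eta / 2 * (g + v) <= eta / 2 * (g + i) ->
  - (d + M * k) + 2 * (s + M * q) <= - (eta / 2) * (g + v) + (cc + (Ck + M * kk)) * ie.
Proof. by move=> h1 h2 h3 h4; move: h1; rewrite -h4 => h1 h5; lra. Qed.

(** * Construction of the Lyapunov functional and choice of the constants *)

Section lyapunov.
Context {R : realType} {N : nat}.
Local Notation E := 'rV[R]_N.
Local Notation leb := (@lebesgue_rV R N).
Local Notation state := (@state R N).
Local Notation n := (N%:R : R).
Implicit Types (D : set E) (U Y Z K : state) (f : E -> R).

(* The last clause is the effect of the force, which kicks the state in the
   direction [(0, f)]. *)
Definition lyapunov D (T V lam m c C delta : R) : Prop :=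
  exists B B' d : R -> state -> state -> R,
  let P := phase_space D in
  [/\ [/\ form_family P (nrm D) T B, form_family P (nrm D) T B', form_family P (nrm D) T d &
        form_derivative P (nrm D) T B B'],
    forall t U Z, 0 <= t -> t <= T -> P U -> P Z -> wave_operator D V U Z ->
      B' t U U + 2 * B t U Z <= - d t U U,
    forall t U, 0 <= t -> t <= T -> P U ->
      c * (Ig D t lam (m + 1) U + Iv D t lam (m + 1) U.2) <= B t U U <=
      C * (Ig D t lam (m + 1) U + Iv D t lam (m + 1) U.2) &
    forall t U f, 0 <= t -> t <= T -> P U -> l2 leb D f ->
      - d t U U + 2 * B t U ((0 : E -> R), f) <=
      - delta * (Ig D t lam m U + Iv D t lam m U.2) + C * Ie D t lam (m + 1) f].

Hypothesis N3 : (3 <= N)%N.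
Variable V : R.
Hypothesis V0 : 0 < V.
Local Notation damped := (@damped R N V).
Local Notation coercive := (@coercive R N V).

Let n3 : 3 <= n := n_ge3 N3.

Lemma ex_damped_pos (mu : R) : 0 < mu -> mu < n - 2 -> mu + 1 < V -> exists l0, forall lam, l0 <= lam -> 1 <= lam ->
  damped lam mu mu ((V - (mu + 1)) / 2) 0 /\ coercive lam mu mu.
Proof.
move=> m0 mn mV; set eta := (V - (mu + 1)) / 2; have eta0 : 0 <= eta by rewrite divr_ge0// subr_ge0 ltW.
have [l1 h1] := damp_u_pos V0 m0 mn eta0; have [l2 h2] := energy_u_pos V0 m0 mn.
have dV : 0 < V - (mu + 1) by rewrite subr_gt0.
exists (Num.max (4 * V / (V - (mu + 1))) (Num.max l1 l2)) => lam; rewrite !ge_max => /and3P[a b c] l.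
split; last by move=> p; exact: h2.
split => //; [by rewrite addr_ge0// ltW|by rewrite -ler_pdivrMr|].
by move=> p pl; rewrite mul0r; exact: h1.
Qed.

Lemma ex_damped_neg (mu : R) : mu <= 0 -> 2 - n <= mu -> 0 <= mu + 1 -> mu + 1 < V -> exists l0, forall lam, l0 <= lam -> 1 <= lam ->
  damped lam mu 0 ((V - (mu + 1)) / 2) 0 /\ coercive lam mu 0.
Proof.
move=> m0 mn m1 mV; have [l2 h2] := energy_u_zero n mu V0.
have dV : 0 < V - (mu + 1) by rewrite subr_gt0.
exists (Num.max (4 * V / (V - (mu + 1))) l2) => lam; rewrite !ge_max => /andP[a b] l.
split; last by move=> p; exact: h2.
split => //; first by rewrite -ler_pdivrMr.
move=> p pl; rewrite mul0r expr0n/= !mulr0 !add0r.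
by apply: damp_u_neg => //; move: n3; lra.
Qed.

Lemma ex_damped_any (mu : R) : 0 <= mu + 1 -> mu + 1 < V -> exists l0, forall lam, l0 <= lam -> 1 <= lam ->
  exists2 Cu, 0 < Cu & damped lam mu 0 ((V - (mu + 1)) / 2) Cu /\ coercive lam mu 0.
Proof.
move=> m1 mV; have [l2 h2] := energy_u_zero n mu V0.
have dV : 0 < V - (mu + 1) by rewrite subr_gt0.
exists (Num.max (4 * V / (V - (mu + 1))) l2) => lam; rewrite !ge_max => /andP[a b] l.
have [Cu Cu0 hC] := damp_u_any V n mu lam; exists Cu => //.
split; last by move=> p; exact: h2.
split => //; first by rewrite -ler_pdivrMr.
move=> p pl; rewrite expr0n/= !mulr0 !add0r; apply: hC; exact: le_trans pl.
Qed.

Definition clow (kap : R) : R := V ^+ 2 / (4 * V ^+ 2 + 16 * kap ^+ 2).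
Definition cup (lam mu kap : R) : R := 1 + fb V lam + fA V lam mu kap / 4^-1 ^+ 2.

Lemma clow_gt0 kap : 0 < clow kap.
Proof. by rewrite divr_gt0 ?exprn_gt0// ltr_pwDl ?mulr_gt0 ?exprn_gt0// mulr_ge0// sqr_ge0. Qed.

Section fixed_weight.
Variable lam : R.
Hypothesis lam1 : 1 <= lam.
Let lam0 : 0 < lam. Proof. exact: lt_le_trans ltr01 lam1. Qed.

Lemma fb_ge0 : 0 <= fb V lam.
Proof. by rewrite /fb; apply: divr_ge0 => //; apply: mulr_ge0; exact: ltW. Qed.

Lemma cup_gt0 mu kap : 0 < cup lam mu kap.
Proof.
rewrite /cup /fA; have f0 := fb_ge0; have V0' := ltW V0.
have a0 := normr_ge0 (fb V lam * mu + fc lam mu kap).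
by apply: ltr_wpDr; [apply: divr_ge0; nneg|apply: ltr_wpDr].
Qed.

Lemma Sform_bounds D t mu kap U : open D -> bounded_set D -> ~ closure D 0 -> 0 <= t ->
  0 <= mu + 1 -> coercive lam mu kap -> phase_space D U ->
  clow kap * (Ig D t lam (mu + 1) U + Iv D t lam (mu + 1) U.2) <= Sform D V lam mu kap t U U <=
  cup lam mu kap * (Ig D t lam (mu + 1) U + Iv D t lam (mu + 1) U.2).
Proof.
move=> oD bD D0 t0 m0 hc PU; rewrite -(IntgD_energy oD bD D0 lam1 t0)//.
rewrite (Sform_lower oD bD D0 t0 lam1 V0 hc PU)/=.
have a0 : 0 < 4^-1 :> R by rewrite invr_gt0.
have an : 2 * 4^-1 <= n - 2 by move: n3; lra.
exact: (Sform_upper oD bD D0 t0 lam1 kap V0 a0 an m0 PU).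
Qed.

Lemma energy_le_Ir D t s U : open D -> bounded_set D -> ~ closure D 0 -> 0 <= t -> phase_space D U ->
  Ig D t lam s U + Iv D t lam s U.2 <= Ig D t lam s U + Ir D t lam (s + 1) U.2.
Proof. by move=> oD bD D0 t0 [_ lU]; rewrite lerD2l; apply: Iv_le_Ir. Qed.

(** With [Cu = 0] the form [S(m, kap)] suffices by itself. A single [C] serves the upper bound and
    the force, hence the sum in its choice. *)
Lemma lyapunov_low m kap eta : 0 < m -> 0 < eta -> damped lam m kap eta 0 -> coercive lam m kap ->
  exists c C delta, [/\ 0 < c, 0 < C, 0 < delta & forall D T, open D -> bounded_set D -> ~ closure D 0 -> 0 < T ->
    lyapunov D T V lam m c C delta].
Proof.
move=> m0 eta0 hd hc; have m0' := ltW m0; have m1 : 0 <= m + 1 by rewrite addr_ge0.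
pose Ck := (1 + fb V lam ^+ 2) / (eta / 32).
have Ck0 : 0 < Ck by rewrite divr_gt0 ?divr_gt0// ltr_wpDr// sqr_ge0.
exists (clow kap), (cup lam m kap + Ck), (eta / 2); split.
- exact: clow_gt0.
- by rewrite addr_gt0// cup_gt0.
- by rewrite divr_gt0.
move=> D T oD bD D0 T0; have [f1 f2 f3] := Sform_family oD bD D0 V lam1 m kap T0.
exists (Sform D V lam m kap), (Sform' D V lam m kap), (Dform D lam m eta 0); split.
- by split=> //; exact: Dform_family.
- by move=> t U Z t0 _; exact: (Sform_diss oD bD D0 lam1 t0 hd).
- move=> t U t0 _ PU; have /andP[-> h] := Sform_bounds oD bD D0 t0 m1 hc PU.
  by apply: le_trans h _; rewrite ler_wpM2r ?addr_ge0 ?Ig_ge0 ?Iv_ge0// lerDl ltW.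
- move=> t U f t0 _ PU lf.
  apply: le_trans (Sform_kick_diss oD bD D0 N3 V lam1 t0 kap 0 eta0 m0' PU lf) _.
  rewrite mul0r addr0 -/Ck; apply: lerD.
    rewrite !mulNr lerN2 ler_wpM2l ?divr_ge0 ?(ltW eta0)//; exact: energy_le_Ir.
  by rewrite ler_wpM2r ?Ie_ge0// lerDr ltW// cup_gt0.
Qed.

Section high.
Variables (m mu kap eta eta2 Cu e e3 d c : R).
Hypotheses (mE : m = mu + 1 + 1) (m1 : 1 <= m) (eta0 : 0 < eta) (eta20 : 0 < eta2) (Cu0 : 0 < Cu).
Hypotheses (hd : damped lam m 0 eta Cu) (hc : coercive lam m 0).
Hypotheses (hd2 : damped lam mu kap eta2 0) (hc2 : coercive lam mu kap).
Hypotheses (e0 : 0 < e) (e2 : e <= 2^-1) (d0 : 0 < d) (md : mu + 1 + e + d <= n - 2).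
Hypotheses (c0 : 0 < c) (c1 : c <= 1).
Hypothesis coer : forall be ga X w : R, `|be| <= 2 * (n - 2) -> d ^+ 2 / 4 <= ga - be ^+ 2 / 4 ->
    c * (X ^+ 2 + w ^+ 2) <= X ^+ 2 + be * (X * w) + ga * w ^+ 2.
Hypotheses (e30 : 0 < e3) (e3c : e3 <= clow kap).
Hypothesis e3d : e3 * (`|mu + 1 - e| * (1 + lam) + 2 * V) <= eta2 / 2.

(** Times this factor, the dissipation [eta2 / 2] of the form at [A^-1 U] equals the error [Cu]. *)
Let M := 2 * Cu / eta2.
Let M0 : 0 < M. Proof. by rewrite divr_gt0// mulr_gt0. Qed.
Let mu1 : 0 <= mu + 1. Proof. by move: m1; rewrite mE; lra. Qed.

Section domain.
Variable D : set E.
Hypotheses (oD : open D) (bD : bounded_set D) (D0 : ~ closure D 0).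
Local Notation P := (phase_space D).
Local Notation L := (wave_inv D V).

(** Two conditions keep [e3] small: [e3 <= clow kap] preserves nonnegativity, and [e3d] sacrifices
    only half of the dissipation [eta2] of [Sform]. *)
Definition kform t K Y := Sform D V lam mu kap t K Y + - e3 * Eform D lam mu e t K Y.
Definition kform' t K Y := Sform' D V lam mu kap t K Y + - e3 * Eform' D lam mu e t K Y.
Definition kdiss t K Y := Dform D lam mu (eta2 / 2) 0 t K Y + e3 * Rform D lam mu e t K Y.

Lemma kform_family T : 0 < T -> [/\ form_family P (nrm D) T kform, form_family P (nrm D) T kform',
  form_family P (nrm D) T kdiss & form_derivative P (nrm D) T kform kform'].
Proof.
move=> T0; have [f1 f2 f3] := Sform_family oD bD D0 V lam1 mu kap T0.
have [g1 g2 g3] := Eform_family oD bD D0 lam1 mu e T0.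
split; [exact: form_familyD|exact: form_familyD| |exact: form_derivativeD].
by apply: form_familyD; [exact: Dform_family|exact: Rform_family].
Qed.

(** If [U] moves with velocity [Z = A U], then [K = A^-1 U] moves with velocity [A^-1 Z = U = A K]:
    [K] follows the same flow, and the dissipation estimates apply to it. *)
Lemma kform_diss t U Z : 0 <= t -> P U -> P Z -> wave_operator D V U Z ->
  kform' t (L U) (L U) + 2 * kform t (L U) (L Z) <= - kdiss t (L U) (L U).
Proof.
move=> t0 PU PZ a; have PK := wave_inv_phase oD bD D0 N3 V PU.
have [aK _ _] := wave_invP oD bD D0 N3 V PU; have [_ lK] := PK.
have T0 : 0 < t + 1 by rewrite ltr_wpDl.
have [f1 _ _ _] := kform_family T0.
have -> : kform t (L U) (L Z) = kform t (L U) U.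
  have tT : t <= t + 1 by rewrite lerDl.
  have q1 : eqv P (nrm D) (L U) (L U) by split=> //; rewrite subrr (nrm0 oD bD D0).
  have q2 : eqv P (nrm D) (L Z) U by exact: wave_inv_gen.
  exact: (@form_eqv _ _ P (nrm D) (@phaseD R N D oD bD D0) (@nrm_ge0 R N D) (@nrmD R N D oD bD D0)
    (t + 1) kform t (L U) (L U) (L Z) U f1 t0 tT q1 q2).
have H1 := Sform_diss oD bD D0 lam1 t0 hd2 PK PU aK.
have H2 := ler_wpM2l (ltW e30) (Eform_diss oD bD D0 V0 lam1 t0 mu (ltW e0) PK PU aK).
have gi : 0 <= Ig D t lam mu (L U) + Ir D t lam (mu + 1) (L U).2 by rewrite addr_ge0 ?Ig_ge0 ?Ir_ge0.
have H3 := ler_wpM2r gi e3d.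
rewrite /kform' /kform /kdiss; rewrite !(DformE oD bD D0 lam1 t0)// in H1 *.
exact: kform_diss_arith H1 H2 H3.
Qed.

(** Nonnegativity is enough from below, since the form at [U] is coercive already; from above,
    [elliptic_energy] returns to the energy of [U] with weight [Psi^(m + 1)]. *)
Lemma kform_bounds t U : 0 <= t -> P U ->
  0 <= kform t (L U) (L U) <= cup lam mu kap * (16 + 2 * (1 + 16 * V ^+ 2) / c ^+ 2) *
    (Ig D t lam (m + 1) U + Iv D t lam (m + 1) U.2).
Proof.
move=> t0 PU; have PK := wave_inv_phase oD bD D0 N3 V PU.
have [_ K2 lap] := wave_invP oD bD D0 N3 V PU.
have /andP[h1 h2] := Sform_bounds oD bD D0 t0 mu1 hc2 PK.
have /andP[h3 h4] := Eform_bounds oD bD D0 lam1 t0 mu (ltW e0) PK.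
have md' : mu + 1 + d <= n - 2 by move: md e0; lra.
have := elliptic_energy oD bD D0 N3 lam1 t0 d0 c0 c1 coer mu1 md' PK PU K2 lap; rewrite -mE => h5.
rewrite /kform mulNr; apply/andP; split.
  rewrite subr_ge0; apply: le_trans h1.
  apply: le_trans (ler_wpM2l (ltW e30) h4) _.
  by apply: ler_wpM2r e3c; rewrite addr_ge0 ?Ig_ge0 ?Iv_ge0.
apply: (@le_trans _ _ (Sform D V lam mu kap t (L U) (L U))).
  by rewrite lerBlDr lerDl mulr_ge0// ltW.
apply: le_trans h2 _; rewrite -mulrA ler_wpM2l//; exact/ltW/cup_gt0.
Qed.

Definition kkick : R := ((1 + e3) ^+ 2 + fb V lam ^+ 2 + fA4 V lam mu kap ^+ 2) / (e3 * e / 17) / c ^+ 2.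

Lemma kform_kick t U f : 0 <= t -> P U -> l2 leb D f ->
  - kdiss t (L U) (L U) + 2 * kform t (L U) (L ((0 : E -> R), f)) <=
  - (eta2 / 2) * Ir D t lam (m - 1) U.1 + kkick * Ie D t lam (m + 1) f.
Proof.
move=> t0 PU lf; have PK := wave_inv_phase oD bD D0 N3 V PU.
have [_ K2 _] := wave_invP oD bD D0 N3 V PU.
have Pf : P ((0 : E -> R), f) := phase0r oD bD D0 lf.
have PY := wave_inv_phase oD bD D0 N3 V Pf.
have [_ Y2 lap] := wave_invP oD bD D0 N3 V Pf.
have lap' : weak_laplacian D (L ((0 : E -> R), f)).1 f.
  move: lap; congr (weak_laplacian D _ _); apply/funext => x /=.
  by rewrite (_ : (0 : E -> R) x = 0)// mulr0 addr0.
have := elliptic_kick oD bD D0 N3 V0 lam1 t0 d0 c0 c1 coer kap e0 e2 e30 mu1 md PK lf PY Y2 lap'.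
rewrite -/kkick -mE /kform /kdiss (DformE oD bD D0 lam1 t0)// K2 => H.
have g0 := Ig_ge0 D t lam mu (L U).
rewrite (_ : m - 1 = mu + 1); last by rewrite mE addrK.
exact: kform_kick_arith H (mulr_ge0 (ltW eta20) g0).
Qed.

End domain.

Lemma lyapunov_high : exists c C delta, [/\ 0 < c, 0 < C, 0 < delta & forall D T, open D -> bounded_set D -> ~ closure D 0 -> 0 < T ->
    lyapunov D T V lam m c C delta].
Proof.
pose Ck := (1 + fb V lam ^+ 2) / (eta / 32).
have Ck0 : 0 < Ck by rewrite divr_gt0 ?divr_gt0// ltr_wpDr// sqr_ge0.
pose Cl := 16 + 2 * (1 + 16 * V ^+ 2) / c ^+ 2.
have Cl0 : 0 <= Cl.
  by rewrite /Cl; apply: addr_ge0 => //; apply: divr_ge0; nneg.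
have kk0 : 0 <= kkick.
  rewrite /kkick; apply: divr_ge0; last exact: sqr_ge0.
  by apply: divr_ge0; [rewrite !addr_ge0 ?sqr_ge0|rewrite divr_ge0// mulr_ge0// ltW].
have cu0 := cup_gt0 m 0; have cu1 := cup_gt0 mu kap.
have m0 : 0 <= m by rewrite (le_trans ler01).
have mm : 0 <= m + 1 by rewrite addr_ge0.
exists (clow 0), (cup lam m 0 + M * (cup lam mu kap * Cl) + (Ck + M * kkick)), (eta / 2); split.
- exact: clow_gt0.
- have M0' := ltW M0; have Ck0' := ltW Ck0; have cu1' := ltW cu1.
  by apply: ltr_wpDr; [nneg|apply: ltr_wpDr; [nneg|]].
- by rewrite divr_gt0.
move=> D T oD bD D0 T0; have [f1 f2 f3] := Sform_family oD bD D0 V lam1 m 0 T0.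
have [g1 g2 g3 g4] := kform_family oD bD D0 T0.
have PL := @wave_inv_phase R N D oD bD D0 N3 V.
have Ll := @wave_inv_lin R N D oD bD D0 N3 V; have Lb := wave_inv_bound oD bD D0 N3 V.
exists (fun t U W => Sform D V lam m 0 t U W + M * kform D t (wave_inv D V U) (wave_inv D V W)),
  (fun t U W => Sform' D V lam m 0 t U W + M * kform' D t (wave_inv D V U) (wave_inv D V W)),
  (fun t U W => Dform D lam m eta Cu t U W + M * kdiss D t (wave_inv D V U) (wave_inv D V W)); split.
- split.
  + by apply: form_familyD => //; exact: (form_family_comp oD bD D0 PL Ll Lb).
  + by apply: form_familyD => //; exact: (form_family_comp oD bD D0 PL Ll Lb).
  + apply: form_familyD; first exact: Dform_family.
    exact: (form_family_comp oD bD D0 PL Ll Lb).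
  + by apply: form_derivativeD => //; exact: (form_derivative_comp PL Lb).
- move=> t U Z t0 _ PU PZ a.
  have H1 := Sform_diss oD bD D0 lam1 t0 hd PU PZ a.
  have H2 := ler_wpM2l (ltW M0) (kform_diss oD bD D0 t0 PU PZ a).
  exact: lyapunov_arith H1 H2.
- move=> t U t0 _ PU; have /andP[h1 h2] := Sform_bounds oD bD D0 t0 mm hc PU.
  have /andP[h3 h4] := kform_bounds oD bD D0 t0 PU; rewrite -/Cl in h4.
  have q0 : 0 <= Ig D t lam (m + 1) U + Iv D t lam (m + 1) U.2 by rewrite addr_ge0 ?Ig_ge0 ?Iv_ge0.
  apply/andP; split; first by apply: le_trans h1 _; rewrite lerDl mulr_ge0// ltW.
  apply: le_trans (lerD h2 (ler_wpM2l (ltW M0) h4)) _.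
  have M0' := ltW M0; have Ck0' := ltW Ck0.
  apply: lyapunov_upper_arith; nneg.
- move=> t U f t0 _ PU lf.
  have H1 := Sform_kick_diss oD bD D0 N3 V lam1 t0 0 Cu eta0 m0 PU lf.
  have H2 := ler_wpM2l (ltW M0) (kform_kick oD bD D0 t0 PU lf).
  have ie := Ie_ge0 D t lam (m + 1) f.
  have H3 : 0 <= (cup lam m 0 + M * (cup lam mu kap * Cl)) * Ie D t lam (m + 1) f.
    by have M0' := ltW M0; nneg.
  have H4 : M * (eta2 / 2) = Cu by rewrite /M; field; rewrite gt_eqF.
  have H5 := ler_wpM2l (ltW (divr_gt0 eta0 (ltr0n _ 2))) (energy_le_Ir m oD bD D0 t0 PU).
  rewrite -/Ck in H1; exact: lyapunov_kick_arith H1 H2 H3 H4 H5.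
Qed.

End high.
End fixed_weight.

Lemma ex_lyapunov m : 0 < m -> m < n - 1 -> m + 1 < V -> exists lam c C delta,
  [/\ 1 <= lam, 0 < c, 0 < C, 0 < delta & forall D T, open D -> bounded_set D -> ~ closure D 0 -> 0 < T ->
    lyapunov D T V lam m c C delta].
Proof.
move=> m0 mn mV; have eta0 : 0 < (V - (m + 1)) / 2 by rewrite divr_gt0// subr_gt0.
have [mn2|mn2] := ltP m (n - 2).
  have [l0 h] := ex_damped_pos m0 mn2 mV.
  have l1 : 1 <= Num.max 1 l0 by rewrite le_max lexx.
  have l2 : l0 <= Num.max 1 l0 by rewrite le_max lexx orbT.
  have [hd hc] := h _ l2 l1; have [c [C [de [a b d H]]]] := lyapunov_low l1 m0 eta0 hd hc.
  by exists (Num.max 1 l0), c, C, de.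
have m1 : 1 <= m by move: n3 mn2; lra.
(* Here [N - 4 <= mu < N - 3]. Depending on [N], this may have either sign; a positive [mu] is
   handled with [kap = mu], the others with [kap = 0], and [mu >= 2 - N] holds because [N >= 3]. *)
pose mu := m - 2; have mE : m = mu + 1 + 1 by rewrite /mu; ring.
pose eta2 := (V - (mu + 1)) / 2.
have eta20 : 0 < eta2 by rewrite divr_gt0// subr_gt0 /mu; move: mV; lra.
have [kap [l2 h2]] : exists kap l0, forall lam, l0 <= lam -> 1 <= lam ->
    damped lam mu kap eta2 0 /\ coercive lam mu kap.
  have mu0 : 0 <= mu + 1 by rewrite /mu; lra.
  have muV : mu + 1 < V by rewrite /mu; move: mV; lra.
  have [mup|mun] := ltP 0 mu.
    by exists mu; apply: ex_damped_pos => //; rewrite /mu; move: mn; lra.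
  by exists 0; apply: ex_damped_neg => //; rewrite /mu; move: n3 m1; lra.
have m1' : 0 <= m + 1 by rewrite addr_ge0// ltW.
have [l1 h1] := ex_damped_any m1' mV.
pose lam := Num.max 1 (Num.max l1 l2).
have lam1 : 1 <= lam by rewrite le_max lexx.
have lam2 : l1 <= lam by rewrite !le_max lexx orbT.
have lam3 : l2 <= lam by rewrite !le_max lexx !orbT.
have [Cu Cu0 [hd hc]] := h1 _ lam2 lam1; have [hd2 hc2] := h2 _ lam3 lam1.
(* The room [N - 1 - m] is split evenly: one half is the gap [d] in the elliptic estimate, the other
   bounds the exponent [e]. The further bound [e <= 1/2] keeps [mu + 1 - e] in the range of
   [Ih_le_Ig]. *)
pose d := (n - 1 - m) / 2; have d0 : 0 < d by rewrite divr_gt0// subr_gt0.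
pose e := Num.min 2^-1 d; have e0 : 0 < e by rewrite lt_min invr_gt0 ltr0n.
have e2 : e <= 2^-1 by rewrite ge_min lexx.
have ed : e <= d by rewrite ge_min lexx orbT.
have md : mu + 1 + e + d <= n - 2 by move: ed; rewrite /mu /d; lra.
(* This constant depends on [N] and [m] only; it is then lowered to at most 1, as [elliptic]
   requires. *)
have [c' c'0 coer'] := quad_coercive (2 * (n - 2)) (divr_gt0 (exprn_gt0 2 d0) (ltr0n R 4)).
pose c := Num.min 1 c'; have c0 : 0 < c by rewrite lt_min ltr01.
have c1 : c <= 1 by rewrite ge_min lexx.
have cc : c <= c' by rewrite ge_min lexx orbT.
have coer (be ga X w : R) : `|be| <= 2 * (n - 2) -> d ^+ 2 / 4 <= ga - be ^+ 2 / 4 ->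
    c * (X ^+ 2 + w ^+ 2) <= X ^+ 2 + be * (X * w) + ga * w ^+ 2.
  move=> b1 b2; apply: le_trans (coer' be ga X w b1 b2).
  by apply: ler_wpM2r => //; rewrite addr_ge0 ?sqr_ge0.
pose k := `|mu + 1 - e| * (1 + lam) + 2 * V.
have k0 : 0 < k.
  by rewrite ltr_wpDl ?mulr_gt0// mulr_ge0// addr_ge0// (le_trans ler01).
pose e3 := Num.min (clow kap) (eta2 / 2 / k).
have e30 : 0 < e3 by rewrite lt_min clow_gt0; apply: divr_gt0 => //; exact: divr_gt0.
have e3c : e3 <= clow kap by rewrite ge_min lexx.
have e3d : e3 * k <= eta2 / 2 by rewrite -ler_pdivlMr// ge_min lexx orbT.
have [c2 [C [de [a b f H]]]] := lyapunov_high lam1 mE m1 eta0 eta20 Cu0 hd hc hd2 hc2 e0 e2 d0 md c0 c1 coer e30 e3c e3d.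
by exists lam, c2, C, de.
Qed.

End lyapunov.

(** * Mild solutions *)

Section time_integral.
Context {R : realType}.
Local Notation leb := (@lebesgue_measure R).
Implicit Types (g J : R -> R) (s t r e T : R).

Definition continuous_upto T g := forall s e, 0 <= s -> s <= T -> 0 < e -> exists2 eta, 0 < eta &
  forall r, 0 <= r -> r <= T -> `|r - s| < eta -> `|g r - g s| < e.

Lemma continuous_uptoD T g J (c : R) : continuous_upto T g -> continuous_upto T J ->
  continuous_upto T (fun s => g s + c * J s).
Proof.
move=> cg cJ s e s0 sT e0; have e2 : 0 < e / 2 by rewrite divr_gt0.
have c1 : 0 < `|c| + 1 by rewrite ltr_wpDl.
have [a a0 aP] := cg s _ s0 sT e2; have [b b0 bP] := cJ s _ s0 sT (divr_gt0 e2 c1).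
exists (Num.min a b); first by rewrite lt_min a0.
move=> r r0 rT; rewrite lt_min => /andP[ra rb].
have h1 := aP r r0 rT ra; have h2 := bP r r0 rT rb.
rewrite (_ : _ - _ = (g r - g s) + c * (J r - J s)); last by ring.
apply: le_lt_trans (ler_normD _ _) _; rewrite normrM.
have h3 : `|c| * `|J r - J s| <= e / 2.
  apply: (@le_trans _ _ ((`|c| + 1) * `|J r - J s|)); first by rewrite ler_wpM2r// lerDl.
  by rewrite mulrC -ler_pdivlMr// ltW.
by move: h1 h3; lra.
Qed.

Lemma clip_dist T x y : 0 <= T ->
  `|Num.max 0 (Num.min x T) - Num.max 0 (Num.min y T)| <= `|x - y|.
Proof.
move=> T0; case: (leP x T) => hx; case: (leP y T) => hy; rewrite ?(max_r T0);
  case: (leP 0 x) => x0; case: (leP 0 y) => y0; rewrite ler_norml;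
  have := ler_norm (x - y); have := ler_norm (y - x); rewrite [`|y - x|]distrC => q1 q2;
  apply/andP; split; lra.
Qed.

(** Composition with the clipping of the line to [[0, T]], which is 1-Lipschitz. *)
Lemma continuous_upto_extend T g : 0 <= T -> continuous_upto T g ->
  exists2 f, continuous f & forall s, 0 <= s -> s <= T -> f s = g s.
Proof.
move=> T0 cg; pose cl s : R := Num.max 0 (Num.min s T).
have cl0 s : 0 <= cl s by rewrite le_max lexx.
have clT s : cl s <= T by rewrite ge_max T0 ge_min lexx orbT.
exists (g \o cl) => [x|s s0 sT]; last by rewrite /= /cl min_l// max_r.
apply/cvgrPdist_lt => e e0; have [eta eta0 etaP] := cg _ e (cl0 x) (clT x) e0.
near=> y; rewrite /= distrC; apply: etaP => //.
apply: le_lt_trans (clip_dist y x T0) _; rewrite distrC; near: y.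
exact: (nbhsx_ballx x eta eta0).
Unshelve. all: by end_near. Qed.

Lemma continuous_upto_integrable T g t : continuous_upto T g -> 0 <= t -> t <= T ->
  leb.-integrable `[0, t] (EFin \o g).
Proof.
move=> cg t0 tT; have [f cf fE] := continuous_upto_extend (le_trans t0 tT) cg.
have := continuous_compact_integrable (@segment_compact _ 0 t) (continuous_subspaceT cf).
apply: eq_integrable => // x /set_mem /=; rewrite in_itv/= => /andP[x0 xt].
by rewrite fE// (le_trans xt).
Qed.

Lemma continuous_upto_bounded T g : 0 <= T -> continuous_upto T g ->
  exists2 C : R, 0 <= C & forall x, 0 <= x -> x <= T -> `|g x| <= C.
Proof.
move=> T0 cg; have [f cf fE] := continuous_upto_extend T0 cg.
have cn : continuous (fun x => `|f x|).
  by move=> x; apply: cvg_norm; exact: cf.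
have [c _ cP] := EVT_max T0 (continuous_subspaceT cn).
exists `|f c| => // x x0 xT; rewrite -fE//; apply: cP.
by rewrite in_itv/= x0.
Qed.

(** Apply [dini_le] to [J] plus the primitive of [g]: the increments of the two compensate up to
    [e h], by the hypothesis on [J] and the continuity of [g]. Then [e] goes to 0. *)
Lemma dini_integral J g T t : continuous_upto T J -> continuous_upto T g ->
  (forall s e, 0 <= s -> s < T -> 0 < e -> exists2 eta, 0 < eta & forall h, 0 < h -> h < eta ->
     s + h <= T -> J (s + h) <= J s + h * (- g s + e)) ->
  0 <= t -> t <= T -> J t + \int[leb]_(s in `[0, t]) g s <= J 0.
Proof.
move=> cJ cg dJ t0 tT; have T0 : 0 <= T := le_trans t0 tT.
have ig s : 0 <= s -> s <= T -> leb.-integrable `[0, s] (EFin \o g) := continuous_upto_integrable cg.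
pose G s := \int[leb]_(x in `[0, s]) g x.
have step s r : 0 <= s -> 0 < r -> s + r <= T -> G (s + r) - G s = \int[leb]_(x in `]s, (s + r)]) g x.
  move=> s0 r0 rT; apply: Rintegral_itvB; rewrite ?bnd_simp//.
    by apply: ig => //; rewrite addr_ge0// ltW.
  by rewrite lerDl ltW.
have iS s r : 0 <= s -> 0 < r -> s + r <= T -> leb.-integrable `]s, (s + r)] (EFin \o g).
  move=> s0 r0 rT; have sr : 0 <= s + r by rewrite addr_ge0// ltW.
  apply: integrableS (ig _ sr rT) => //; apply: subset_itvr; rewrite bnd_simp//.
have bnd s r M : 0 <= s -> 0 < r -> s + r <= T -> (forall x, s < x -> x <= s + r -> g x <= M) ->
    G (s + r) - G s <= M * r.
  move=> s0 r0 rT gM; rewrite step//.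
  have -> : M * r = \int[leb]_(x in `]s, (s + r)]) M.
    rewrite Rintegral_cst//; congr (_ * _).
    have e : leb `]s, (s + r)] = r%:E.
      have := lebesgue_measure_itv `]s, (s + r)]; rewrite /= lte_fin ltrDl r0 => ->.
      by rewrite -EFinB addrAC subrr add0r.
    exact: (esym (congr1 fine e)).
  apply: le_Rintegral => //; first exact: iS.
    have cM : continuous ((fun=> M) : R -> R) by move=> x; exact: cvg_cst.
    have iM := continuous_compact_integrable (@segment_compact _ s (s + r)) (continuous_subspaceT cM).
    by apply: integrableS iM => //; apply: subset_itvr; rewrite bnd_simp.
  by move=> x /=; rewrite in_itv/= => /andP[]; exact: gM.
have [C C0 CP] := continuous_upto_bounded T0 cg.
have H e : 0 < e -> J t + G t <= J 0 + e * t.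
  move=> e0; have G0 : G 0 = 0 by rewrite /G set_itv1 Rintegral_set1.
  have := @dini_le R (fun s => J s + G s) t e t0; rewrite G0 addr0; apply => [s s0 st|s q s0 st q0].
    have e2 : 0 < e / 2 by rewrite divr_gt0.
    have sT : s < T := lt_le_trans st tT.
    have [a a0 aP] := dJ s _ s0 sT e2; have [b b0 bP] := cg s _ s0 (ltW sT) e2.
    exists (Num.min a b); first by rewrite lt_min a0.
    move=> r r0; rewrite lt_min => /andP[ra rb] rt; have rT := le_trans rt tT.
    have h1 := aP r r0 ra rT.
    have h2 : G (s + r) - G s <= (g s + e / 2) * r.
      apply: bnd => // x sx xr; have : `|g x - g s| < e / 2.
        apply: bP; rewrite ?(le_trans xr)//; first by rewrite (le_trans s0)// ltW.
        rewrite gtr0_norm ?subr_gt0//; apply: le_lt_trans rb.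
        by rewrite lerBlDl.
      by rewrite ltr_norml => /andP[_]; lra.
    by move: h1 h2; clear; move: (J (s + r)) (J s) (G (s + r)) (G s) (g s) => *; lra.
  have q2 : 0 < q / 2 by rewrite divr_gt0.
  have sT := le_trans st tT.
  have [a a0 aP] := cJ s _ (ltW s0) sT q2.
  have C1 : 0 < C + 1 by rewrite ltr_wpDl.
  exists (Num.min a (q / 2 / (C + 1))); first by rewrite lt_min a0 !divr_gt0.
  move=> r r0 sr rs.
  have sra : s - r < a by apply: lt_le_trans (_ : _ < Num.min a (q / 2 / (C + 1))) _; [move: sr; lra|rewrite ge_min lexx].
  have srq : s - r < q / 2 / (C + 1) by apply: lt_le_trans (_ : _ < Num.min a (q / 2 / (C + 1))) _; [move: sr; lra|rewrite ge_min lexx orbT].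
  have rT : r <= T by rewrite (le_trans (ltW rs)).
  have := aP r r0 rT; rewrite distrC gtr0_norm ?subr_gt0// => /(_ sra).
  rewrite ltr_norml => /andP[h1 _].
  have h2 : G s - G r <= C * (s - r).
    rewrite -[in G s](subrKC r s); apply: bnd => //; rewrite ?subr_gt0// ?subrKC// => x xr xs.
    apply: le_trans (ler_norm _) _; apply: CP; first by rewrite (le_trans r0)// ltW.
    by rewrite (le_trans xs).
  have h3 : C * (s - r) <= q / 2.
    apply: (@le_trans _ _ ((C + 1) * (s - r))); first by rewrite ler_wpM2r ?lerDl// subr_ge0 ltW.
    by rewrite mulrC -ler_pdivlMr// ltW.
  by move: h1 h2 h3; clear; move: (J s) (J r) (G s) (G r) (C * (s - r)) => *; lra.
apply/ler_addgt0Pr => e e0; have t1 : 0 < t + 1 by rewrite ltr_wpDl.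
apply: le_trans (H _ (divr_gt0 e0 t1)) _; rewrite lerD2l -mulrA ger_pMr// mulrC ler_pdivrMr// mul1r.
by rewrite lerDl.
Qed.

End time_integral.

(** * From limits of squared norms to the seminorm *)

Section ereal_limits.
Context {R : realType}.

Lemma cvg_ereal0 {T : Type} (F : set_system T) {FF : Filter F} (h : T -> \bar R) :
  (forall x, (0 <= h x)%E) ->
  h @ F --> 0%E <-> forall e : R, 0 < e -> \forall x \near F, (h x < e%:E)%E.
Proof.
move=> h0; split=> [cv e e0|H A].
  apply: (cv [set y | (y < e%:E)%E]); rewrite /nbhs/= /ereal_nbhs/=.
  near=> r; rewrite lte_fin; apply: le_lt_trans (ler_norm r) _.
  by rewrite -[r]subr0 distrC; near: r; exact: (nbhsx_ballx (0 : R) e e0).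
rewrite /nbhs/= /ereal_nbhs/= => /nbhs_ballP[e /= e0 eA].
have := H e e0; apply: filterS => x hx.
have : (0 <= h x)%E := h0 x; rewrite /preimage/=; move: hx; case: (h x) => [r| |]//=; rewrite lte_fin lee_fin => re r0.
by apply: eA; rewrite /ball/= sub0r normrN ger0_norm.
Unshelve. all: by end_near. Qed.

Lemma near_right0 (Q : R -> Prop) : (\forall t \near 0^'+, Q t) <->
  exists2 eta : R, 0 < eta & forall t, 0 < t -> t < eta -> Q t.
Proof.
split=> [|[eta eta0 H]].
  rewrite /at_right /within /= => /nbhs_ballP[eta /= eta0 H]; exists eta => // t t0 te.
  by apply: H => //; rewrite /ball/= sub0r normrN gtr0_norm.
rewrite /at_right /within /=; apply/nbhs_ballP; exists eta => //= t; rewrite /ball/= sub0r normrN => te t0.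
by apply: H => //; rewrite (le_lt_trans _ te)// ler_norm.
Qed.

Lemma near_within (T s : R) (Q : R -> Prop) : (\forall r \near within `[0, T]%classic (nbhs s), Q r) ->
  exists2 eta : R, 0 < eta & forall r, 0 <= r -> r <= T -> `|r - s| < eta -> Q r.
Proof.
rewrite /within /= => /nbhs_ballP[eta /= eta0 H]; exists eta => // r r0 rT re.
by apply: H; rewrite /ball/= ?in_itv/= ?r0// distrC.
Qed.

End ereal_limits.

Section phase_limits.
Context {R : realType} {N : nat}.
Local Notation E := 'rV[R]_N.
Local Notation leb := (@lebesgue_rV R N).
Local Notation state := (@state R N).
Variable D : set E.
Hypotheses (oD : open D) (bD : bounded_set D) (D0 : ~ closure D 0).
Implicit Types (U Z W : state) (f : E -> R).
Local Notation P := (phase_space D).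
Local Notation nrm := (nrm D).
Local Notation n2 := (n2 leb D).
Local Notation l2 := (l2 leb D).
Let mD : measurable D := open_measurable_rV oD.

Lemma phase_sq_ge0 U : (0 <= phase_sq D U)%E.
Proof.
apply: adde_ge0; apply: integral_ge0 => x _; rewrite lee_fin ?addr_ge0 ?sqr_ge0//.
Qed.

(** The factor [N + 2] undoes the constant of [nrm_le]. *)
Lemma phase_lt_nrm U e : P U -> 0 < e -> (phase_sq D U < ((e / N.+2%:R) ^+ 2)%:E)%E -> nrm U < e.
Proof.
move=> PU e0 h; have k0 : 0 < N.+2%:R :> R by rewrite ltr0n.
have h1 : nrm U ^+ 2 < e ^+ 2.
  rewrite -lte_fin; apply: le_lt_trans (nrm_le oD PU) _.
  rewrite (_ : (e ^+ 2)%:E = (N.+2%:R ^+ 2)%:E * ((e / N.+2%:R) ^+ 2)%:E)%E; last first.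
    by rewrite -EFinM; congr EFin; field; rewrite gt_eqF.
  by rewrite lte_pmul2l// lte_fin exprn_gt0.
by move: h1; rewrite ltr_sqr// nnegrE ?nrm_ge0// ltW.
Qed.

Lemma nrm_lt_phase U e : P U -> 0 < e -> nrm U < Num.sqrt e -> (phase_sq D U < e%:E)%E.
Proof.
move=> PU e0 h; apply: le_lt_trans (phase_sq_le oD PU) _; rewrite lte_fin.
by rewrite -[ltRHS]sqr_sqrtr ?(ltW e0)// ltr_sqr// nnegrE ?nrm_ge0// sqrtr_ge0.
Qed.

Lemma cvg_phase (T : Type) (F : set_system T) {FF : Filter F} (f : T -> state) :
  (\forall x \near F, P (f x)) -> phase_sq D (f x) @[x --> F] --> 0%E <->
  forall e, 0 < e -> \forall x \near F, nrm (f x) < e.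
Proof.
move=> Pf; split=> [cv e e0|H].
  have e1 : 0 < (e / N.+2%:R) ^+ 2 by rewrite exprn_gt0// divr_gt0.
  have := (@cvg_ereal0 R T F FF _ (fun x => phase_sq_ge0 (f x))).1 cv _ e1.
  by apply: filterS2 Pf => x Px; exact: phase_lt_nrm.
apply/(@cvg_ereal0 R T F FF _ (fun x => phase_sq_ge0 (f x))) => e e0.
have s0 : 0 < Num.sqrt e by rewrite sqrtr_gt0.
by have := H _ s0; apply: filterS2 Pf => x Px; exact: nrm_lt_phase.
Qed.

Lemma cvg_phase_right (f : R -> state) : (forall t, 0 < t -> P (f t)) ->
  phase_sq D (f t) @[t --> 0^'+] --> 0%E <->
  forall e, 0 < e -> exists2 eta, 0 < eta & forall t, 0 < t -> t < eta -> nrm (f t) < e.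
Proof.
move=> Pf; have Pn : \forall x \near 0^'+, P (f x).
  by apply/near_right0; exists 1 => // t t0 _; exact: Pf.
split=> [cv e e0|H]; first by apply/near_right0; exact: (cvg_phase Pn).1 cv e e0.
by apply/(cvg_phase Pn) => e e0; apply/near_right0; exact: H.
Qed.

Lemma continuous_phase T (f : R -> state) : (forall s, 0 <= s -> s <= T -> P (f s)) ->
  (forall s, 0 <= s -> s <= T ->
     phase_sq D (f r - f s) @[r --> within `[0, T]%classic (nbhs s)] --> 0%E) ->
  forall s e, 0 <= s -> s <= T -> 0 < e -> exists2 eta, 0 < eta &
  forall r, 0 <= r -> r <= T -> `|r - s| < eta -> nrm (f r - f s) < e.
Proof.
move=> Pf cv s e s0 sT e0; have e1 : 0 < (e / N.+2%:R) ^+ 2 by rewrite exprn_gt0// divr_gt0.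
have FF : Filter (within `[0, T]%classic (nbhs s)) by exact: _.
have cvs := (@cvg_ereal0 R _ _ FF _ (fun r => phase_sq_ge0 (f r - f s))).1 (cv s s0 sT) _ e1.
have [eta eta0 H] := near_within cvs; exists eta => // r r0 rT rs.
apply: phase_lt_nrm => //; last exact: H.
by apply: (phaseB oD bD D0); exact: Pf.
Qed.

Lemma H1_sq0 : H1_sq D (0 : E -> R) = 0%E.
Proof.
have := phase_sq_le oD (phase0 oD bD D0); rewrite (nrm0 oD bD D0) expr0n/= => h.
apply/eqP; rewrite eq_le; apply/andP; split; last first.
  by apply: integral_ge0 => x _; rewrite lee_fin ?addr_ge0 ?sqr_ge0.
apply: le_trans h; rewrite /phase_sq leeDl//; apply: integral_ge0 => x _.
by rewrite lee_fin sqr_ge0.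
Qed.

End phase_limits.

(** * Mild solutions as perturbed orbits of the semigroup *)

Section mild_solutions.
Context {R : realType} {N : nat}.
Local Notation E := 'rV[R]_N.
Local Notation leb := (@lebesgue_rV R N).
Local Notation state := (@state R N).
Variable D : set E.
Hypotheses (oD : open D) (bD : bounded_set D) (D0 : ~ closure D 0).
Hypothesis N3 : (3 <= N)%N.
Implicit Types (U Z W : state) (f : E -> R).
Local Notation P := (phase_space D).
Local Notation nrm := (nrm D).
Local Notation n2 := (n2 leb D).
Local Notation l2 := (l2 leb D).
Let mD : measurable D := open_measurable_rV oD.
Let P0 := phase0 oD bD D0.
Let PD := @phaseD R N D oD bD D0.
Let PB U W := @phaseB R N D oD bD D0 U W.
Let nD := @nrmD R N D oD bD D0.

Variables (V : R) (S : R -> state -> state).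
Hypotheses (HS : C0_semigroup D S) (HG : generated_by_wave_operator D V S).

Lemma semigroup_phase t U : 0 <= t -> P U -> P (S t U).
Proof. by have [H _ _ _] := HS; move=> t0; have [h _ _] := H t t0; exact: h. Qed.

Lemma semigroup_lin t U c W : 0 <= t -> P U -> P W ->
  nrm (S t (U + c *: W) - (S t U + c *: S t W)) = 0.
Proof.
move=> t0 PU PW; have [H _ _ _] := HS; have [h1 h2 _] := H t t0.
have := h2 c W U PW PU; rewrite [_ + U]addrC [_ + S t U]addrC => e.
apply/(phase_eqP oD bD D0) => //; first by apply/h1/PD.
by apply: PD; exact: h1.
Qed.

Lemma semigroup_bound t : 0 <= t -> exists C : R, forall U, P U -> nrm (S t U) <= C * nrm U.
Proof.
move=> t0; have [H _ _ _] := HS; have [h1 _ [C HC]] := H t t0.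
exists (N.+2%:R * Num.sqrt `|C|) => U PU.
have q : nrm (S t U) ^+ 2 <= (N.+2%:R * Num.sqrt `|C| * nrm U) ^+ 2.
  rewrite -lee_fin; apply: le_trans (nrm_le oD (h1 _ PU)) _.
  apply: le_trans (lee_wpmul2l _ (HC U PU)) _; first by rewrite lee_fin sqr_ge0.
  apply: (@le_trans _ _ ((N.+2%:R ^+ 2)%:E * (`|C|%:E * (nrm U ^+ 2)%:E))%E).
    apply: lee_wpmul2l; first by rewrite lee_fin sqr_ge0.
    have hC : (C%:E <= `|C|%:E)%E by rewrite lee_fin ler_norm.
    apply: le_trans (lee_wpmul2r (phase_sq_ge0 D U) hC) _.
    by apply: lee_wpmul2l; [rewrite lee_fin|exact: phase_sq_le].
  by rewrite -!EFinM lee_fin !exprMn sqr_sqrtr// mulrA.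
by move: q; rewrite ler_sqr// nnegrE ?mulr_ge0 ?nrm_ge0 ?sqrtr_ge0.
Qed.

Lemma semigroup0 U : P U -> nrm (S 0 U - U) = 0.
Proof.
move=> PU; have [_ h _ _] := HS; apply/(phase_eqP oD bD D0) => //; last exact: h.
exact: semigroup_phase.
Qed.

Lemma semigroup_add s t U : 0 <= s -> 0 <= t -> P U -> nrm (S (s + t) U - S s (S t U)) = 0.
Proof.
move=> s0 t0 PU; have [_ _ h _] := HS; apply/(phase_eqP oD bD D0); last exact: h.
  by apply: semigroup_phase => //; exact: addr_ge0.
by do 2!apply: semigroup_phase => //.
Qed.

Lemma semigroup_cont U : P U -> forall e : R, 0 < e -> exists2 eta : R, 0 < eta &
  forall t, 0 < t -> t < eta -> nrm (S t U - U) < e.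
Proof.
move=> PU; have [_ _ _ h] := HS; apply/(cvg_phase_right oD (f := fun t => S t U - U)); last exact: h.
by move=> t t0; apply: PB => //; apply: semigroup_phase => //; exact: ltW.
Qed.

Lemma gen_wave U Z : P U -> P Z -> gen nrm S U Z <-> wave_operator D V U Z.
Proof.
move=> PU PZ; apply: iff_trans (HG PU PZ).
have Pq t : 0 < t -> P (scale_state t^-1 (S t U - U) - Z).
  move=> t0; apply: PB => //; apply: (phaseZ oD bD D0); apply: PB => //.
  by apply: semigroup_phase => //; exact: ltW.
apply: iff_trans (iff_sym (cvg_phase_right oD Pq)).
have e t : dq S t U + -1 *: Z = scale_state t^-1 (S t U - U) - Z by rewrite /dq !scaleN1r.
by split=> H e' e0; have [eta eta0 h] := H e' e0; exists eta => // t t1 t2; have := h t t1 t2; rewrite e.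
Qed.

Lemma gen_onto U : P U -> exists K, P K /\ gen nrm S K U.
Proof.
move=> PU; have PK := wave_inv_phase oD bD D0 N3 V PU; exists (wave_inv D V U); split=> //.
by apply/gen_wave => //; have [] := wave_invP oD bD D0 N3 V PU.
Qed.

Variables (T : R) (F : R -> E -> R) (w0 w1 : E -> R) (w w' : R -> E -> R).
Hypotheses (T0 : 0 < T) (hw0 : H10 D w0) (lw1 : L2 D w1) (cF : continuous_L2 D T F).
Hypotheses (cw : continuous_H10 D T w) (cw' : continuous_L2 D T w').
Hypothesis duhamel : forall t, 0 <= t <= T -> exists2 I : state,
  phase_integral D 0 t (fun s => S (t - s) (0, F s)) I &
  phase_eq D (w t, w' t) (S t (w0, w1) + I).

Definition force (s : R) : state := ((0 : E -> R), F s).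
Definition state_at (s : R) : state := (w s, w' s).

Lemma force_l2 s : 0 <= s -> s <= T -> l2 (F s).
Proof. by move=> s0 sT; have := cF (s := s); rewrite s0 sT => /(_ isT)[]. Qed.

Lemma force_phase s : 0 <= s -> s <= T -> P (force s).
Proof. by move=> s0 sT; apply: phase0r => //; exact: force_l2. Qed.

Lemma state_at_phase s : 0 <= s -> s <= T -> P (state_at s).
Proof.
move=> s0 sT; have := cw (s := s); have := cw' (s := s); rewrite s0 sT.
by move=> /(_ isT)[a _] /(_ isT)[b _]; split.
Qed.

Lemma force_cont s e : 0 <= s -> s <= T -> 0 < e -> exists2 eta, 0 < eta &
  forall r, 0 <= r -> r <= T -> `|r - s| < eta -> nrm (force r - force s) < e.
Proof.
move: s e; apply: (continuous_phase oD bD D0); first exact: force_phase.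
move=> s s0 sT; have := cF (s := s); rewrite s0 sT => /(_ isT)[_].
(* The first components cancel, and the gradient chosen for the zero function has zero norm
   ([H1_sq0]). *)
have -> // : (fun r => phase_sq D (force r - force s)) = (fun r => L2_sq D (F r - F s)).
by apply/funext => r; rewrite /phase_sq /= subr0 H1_sq0// add0e.
Qed.

Lemma state_at_cont s e : 0 <= s -> s <= T -> 0 < e -> exists2 eta, 0 < eta &
  forall r, 0 <= r -> r <= T -> `|r - s| < eta -> nrm (state_at r - state_at s) < e.
Proof.
move: s e; apply: (continuous_phase oD bD D0); first exact: state_at_phase.
move=> s s0 sT; have := cw (s := s); have := cw' (s := s); rewrite s0 sT.
move=> /(_ isT)[_ h1] /(_ isT)[_ h2].
by have := cvgeD _ h2 h1; rewrite adde0; apply.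
Qed.

(** [phase_integral] only places each tag between its neighbouring nodes. The nodes are then
    monotone, so the tags lie in [[0, t]], where the force is controlled. *)
Lemma partition_bounds n (p : nat -> R) (c : nat -> R) t : p 0%N = 0 -> p n = t ->
  (forall i, (i < n)%N -> p i <= c i <= p i.+1) -> forall i, (i < n)%N -> 0 <= c i <= t.
Proof.
move=> p0 pn H; have lo i : (i <= n)%N -> 0 <= p i.
  elim: i => [|i IH] hi; first by rewrite p0.
  by have /andP[h1 h2] := H i hi; rewrite (le_trans (IH (ltnW hi)))// (le_trans h1).
have hi_ k : (k <= n)%N -> p (n - k)%N <= t.
  elim: k => [|k IH] hk; first by rewrite subn0 pn.
  have kn : (n - k.+1 < n)%N by rewrite ltn_subrL/= (leq_trans _ hk).
  have /andP[h1 h2] := H _ kn; rewrite (le_trans h1)// (le_trans h2)//.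
  by rewrite -subSn// subSS IH// ltnW.
move=> i hi; have /andP[h1 h2] := H i hi; apply/andP; split.
  by rewrite (le_trans (lo i (ltnW hi))).
by rewrite (le_trans h2)//; have := hi_ (n - i.+1)%N (leq_subr _ _); rewrite subKn.
Qed.

Lemma duhamel_phase : exists I : R -> state, [/\ forall t, 0 <= t -> t <= T -> P (I t),
  forall t, 0 <= t -> t <= T -> forall e, 0 < e -> exists2 eta, 0 < eta &
  forall n (p c : nat -> R), p 0%N = 0 -> p n = t ->
    (forall i, (i < n)%N -> p i <= c i <= p i.+1 /\ p i.+1 - p i < eta) ->
    nrm (\sum_(i < n) (p i.+1 - p i) *: S (t - c i) (force (c i)) - I t) < e &
  forall t, 0 <= t -> t <= T -> eqv P nrm (state_at t) (S t (w0, w1) + I t)].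
Proof.
have ch t : exists I : state, 0 <= t <= T -> phase_integral D 0 t (fun s => S (t - s) (force s)) I /\
    phase_eq D (state_at t) (S t (w0, w1) + I).
  have [h|h] := boolP (0 <= t <= T); last by exists 0.
  by have [I h1 h2] := duhamel h; exists I.
have [I HI] := choice ch; have Pw : P (w0, w1) by [].
have h t : 0 <= t -> t <= T -> _ := fun a b => HI t (introT andP (conj a b)).
exists I; split.
- by move=> t t0 tT; have [[]] := h t t0 tT.
- move=> t t0 tT e e0; have [[PI HH] _] := h t t0 tT.
  have e1 : 0 < (e / N.+2%:R) ^+ 2 by rewrite exprn_gt0// divr_gt0.
  have [eta eta0 H] := HH _ e1; exists eta => // n p c p0 pn hc.
  have ci := partition_bounds p0 pn (fun i hi => (hc i hi).1).
  apply: (phase_lt_nrm oD) => //; last exact: H.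
  apply: PB => //; apply: (P_sum P0 PD (fun i => p i.+1 - p i) (F := fun i => S (t - c i) (force (c i)))) => i hi.
  have /andP[c0 ct] := ci i hi.
  by apply: semigroup_phase; [rewrite subr_ge0|apply: force_phase => //; exact: le_trans tT].
- move=> t t0 tT; have [[PI _] e] := h t t0 tT.
  have Pt := state_at_phase t0 tT.
  have PS : P (S t (w0, w1) + I t) by apply: (phaseDD oD bD D0) => //; exact: semigroup_phase.
  by split=> //; apply/(phase_eqP oD bD D0).
Qed.

Lemma form_continuous B (X : R -> state) : form_family P nrm T B ->
  (forall s, 0 <= s -> s <= T -> P (X s)) ->
  (forall s e, 0 <= s -> s <= T -> 0 < e -> exists2 eta, 0 < eta &
     forall r, 0 <= r -> r <= T -> `|r - s| < eta -> nrm (X r - X s) < e) ->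
  continuous_upto T (fun s => B s (X s) (X s)).
Proof.
move=> fB PX cX s e s0 sT e0.
have [r r0 rP] := form_near PD (@nrm_ge0 R N D) nD fB s0 sT (PX _ s0 sT) (PX _ s0 sT) e0.
have [a a0 aP] := cX s r s0 sT r0.
exists (Num.min r a); first by rewrite lt_min r0.
move=> q q0 qT; rewrite lt_min => /andP[qr qa]; have h := aP q q0 qT qa.
by apply: rP => //; exact: PX.
Qed.

(** [J] is the Lyapunov form evaluated along the solution. Dissipation and force enter its right
    Dini rate together, as [- d + 2 B (U, (0, F))], which the last clause of [lyapunov] bounds as a
    whole. *)
Lemma lyapunov_state_at lam m c C delta : lyapunov D T V lam m c C delta -> exists J : R -> R,
  [/\ continuous_upto T J,
    forall t, 0 <= t -> t <= T -> c * (Ig D t lam (m + 1) (state_at t) + Iv D t lam (m + 1) (state_at t).2) <= J t,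
    J 0 <= C * (Ig D 0 lam (m + 1) (state_at 0) + Iv D 0 lam (m + 1) (state_at 0).2) &
    forall s e, 0 <= s -> s < T -> 0 < e -> exists2 eta, 0 < eta & forall h, 0 < h -> h < eta ->
     s + h <= T -> J (s + h) <= J s + h * (- (delta * (Ig D s lam m (state_at s) + Iv D s lam m (state_at s).2)
       - C * Ie D s lam (m + 1) (F s)) + e)].
Proof.
move=> [B [B' [d /= [[fB fB' fd derB] diss bnd kick]]]].
exists (fun t => B t (state_at t) (state_at t)).
have [I [PI IP UP]] := duhamel_phase; have Pw : P (w0, w1) by [].
have diss' t U Z : 0 <= t -> t <= T -> P U -> P Z -> gen nrm S U Z ->
    B' t U U + 2 * B t U Z <= - d t U U.
  by move=> t0 tT PU PZ /(gen_wave PU PZ) a; exact: diss.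
split.
- by apply: form_continuous => //; [exact: state_at_phase|exact: state_at_cont].
- by move=> t t0 tT; have /andP[] := bnd t _ t0 tT (state_at_phase t0 tT).
- by have /andP[] := bnd 0 _ (lexx 0) (ltW T0) (state_at_phase (lexx 0) (ltW T0)).
- move=> s e s0 sT e0.
  have [eta eta0 H] := mild_dini P0 PD (@nrm_ge0 R N D) (nrm0 oD bD D0) nD (@phase_complete R N D oD bD D0)
    semigroup_phase semigroup_lin semigroup_bound semigroup0 semigroup_add semigroup_cont gen_onto
    fB fB' fd derB diss' force_phase force_cont PI IP Pw UP s0 sT e0.
  exists eta => // h h0 he hT; apply: le_trans (H h h0 he hT) _.
  rewrite lerD2l ler_pM2l// lerD2r.
  apply: le_trans (kick s _ _ s0 (ltW sT) (state_at_phase s0 (ltW sT)) (force_l2 s0 (ltW sT))) _.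
  by rewrite opprB addrC mulNr.
Qed.

End mild_solutions.

Lemma continuous_upto_eq (R : realType) (T : R) (f g : R -> R) : (forall s, 0 <= s -> s <= T -> f s = g s) ->
  continuous_upto T f -> continuous_upto T g.
Proof.
move=> fg cf s e s0 sT e0; have [eta eta0 H] := cf s e s0 sT e0; exists eta => // r r0 rT rs.
by rewrite -!fg//; exact: H.
Qed.

Lemma Rintegral_itv_comb (R : realType) (t p q : R) (g h : R -> R) :
  lebesgue_measure.-integrable `[0, t] (EFin \o g) -> lebesgue_measure.-integrable `[0, t] (EFin \o h) ->
  \int[lebesgue_measure]_(s in `[0, t]) (p * g s - q * h s) =
  p * \int[lebesgue_measure]_(s in `[0, t]) g s - q * \int[lebesgue_measure]_(s in `[0, t]) h s.
Proof.
move=> ig ih; have mI : measurable (`[0, t]%classic : set (measurableTypeR R)) by [].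
have jg := intgZ mI p ig; have jh := intgZ mI q ih.
by rewrite -(IntZ mI p ig) -(IntZ mI q ih) -(IntB mI jg jh).
Qed.

Lemma dini_arith (R : realFieldType) (r d C L j a a' b b' e : R) : 0 < r -> 0 < d -> 0 < C ->
  a <= a' -> b' <= L * b ->
  j + r * (- (d * a' - C * b') + e) <= j + r * (- (d * a - C * L * b) + e).
Proof.
move=> r0 d0 C0 aa bb; rewrite lerD2l ler_pM2l// lerD2r lerN2.
by apply: lerB; [rewrite ler_pM2l|rewrite -mulrA ler_pM2l].
Qed.

Lemma final_arith (R : realFieldType) (c C d E0 E1 J0 Jt a b : R) : 0 < c ->
  c * E1 <= Jt -> J0 <= C * E0 -> Jt + (d * a - C * b) <= J0 ->
  E1 + d / c * a <= C / c * (E0 + b).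
Proof.
move=> c0 h1 h2 h3; rewrite -(ler_pM2l c0).
rewrite (_ : c * (E1 + d / c * a) = c * E1 + d * a); last by field; rewrite gt_eqF.
rewrite (_ : c * (C / c * (E0 + b)) = C * (E0 + b)); last by field; rewrite gt_eqF.
lra.
Qed.

(** * Return from the slope lam to the weight Psi *)

Section unit_weight.
Context {R : realType} {N : nat}.
Local Notation E := 'rV[R]_N.
Local Notation leb := (@lebesgue_rV R N).
Local Notation state := (@state R N).
Variable D : set E.
Hypotheses (oD : open D) (bD : bounded_set D) (D0 : ~ closure D 0).
Implicit Types (U Z W : state) (f : E -> R).
Local Notation P := (phase_space D).
Local Notation Int := (Int leb D).
Local Notation intg := (intg leb D).
Local Notation l2 := (l2 leb D).
Let mD : measurable D := open_measurable_rV oD.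

Definition energy (k t : R) U : R := Ig D t 1 k U + Iv D t 1 k U.2.

(** From [1 + t + |x| <= 1 + t + lam |x| <= lam (1 + t + |x|)]. The factor [lam^k] does not involve
    [D], so the large slope costs no uniformity. *)
Lemma pw_compare (t lam k : R) (x : E) : 0 <= t -> 1 <= lam -> 0 <= k ->
  pw (1 + t) 1 k x <= pw (1 + t) lam k x <= lam `^ k * pw (1 + t) 1 k x.
Proof.
move=> t0 l1 k0; have r0 := enorm_ge0 x; have l0 : 0 <= lam := le_trans ler01 l1.
have t1 : 0 <= 1 + t by rewrite addr_ge0.
have lr : enorm x <= lam * enorm x by rewrite ler_peMl.
have lt : 1 + t <= lam * (1 + t) by rewrite ler_peMl.
rewrite /pw -powRM ?mul1r ?addr_ge0//; apply/andP; split; apply: ge0_ler_powR => //;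
  rewrite ?nnegrE ?mulr_ge0 ?addr_ge0 ?mulr_ge0//; first by rewrite lerD2l.
by rewrite mulrDr lerD2r.
Qed.

Lemma weight_compare (t lam k : R) (f : E -> R) : 0 <= t -> 1 <= lam -> 0 <= k ->
  (forall x, D x -> 0 <= f x) -> (forall l, 1 <= l -> intg (fun x => pw (1 + t) l k x * f x)) ->
  Int (fun x => pw (1 + t) 1 k x * f x) <= Int (fun x => pw (1 + t) lam k x * f x) <=
  lam `^ k * Int (fun x => pw (1 + t) 1 k x * f x).
Proof.
move=> t0 l1 k0 f0 fi; have i1 := fi 1 (lexx 1); have il := fi lam l1.
rewrite -(IntZ mD _ i1); apply/andP; split; apply: le_Int => //; try exact: (intgZ mD).
  by move=> x Dx; rewrite ler_wpM2r ?f0//; have /andP[] := pw_compare x t0 l1 k0.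
by move=> x Dx; rewrite mulrA ler_wpM2r ?f0//; have /andP[] := pw_compare x t0 l1 k0.
Qed.

Lemma energy_compare (t lam k : R) U : 0 <= t -> 1 <= lam -> 0 <= k -> P U ->
  energy k t U <= Ig D t lam k U + Iv D t lam k U.2 <= lam `^ k * energy k t U.
Proof.
move=> t0 l1 k0 PU; have [_ lU] := PU.
have /andP[a b] := weight_compare t0 l1 k0 (fun x _ => gsq_ge0 D U x)
  (fun l h => ig_g oD bD D0 t0 h k PU).
have /andP[a' b'] := weight_compare t0 l1 k0 (fun x _ => sqr_ge0 (U.2 x))
  (fun l h => ig_v oD bD D0 t0 h k lU).
by rewrite /energy mulrDr; apply/andP; split; exact: lerD.
Qed.

Lemma Ie_compare (t lam k : R) f : 0 <= t -> 1 <= lam -> 0 <= k -> l2 f ->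
  Ie D t lam k f <= lam `^ k * Ie D t 1 k f.
Proof.
move=> t0 l1 k0 lf.
have p0 x : D x -> 0 <= enorm x * f x ^+ 2 by move=> _; rewrite mulr_ge0 ?sqr_ge0 ?enorm_ge0.
have ie l : 1 <= l -> intg (fun x => pw (1 + t) l k x * (enorm x * f x ^+ 2)).
  by move=> h; apply: intg_eq (ig_e oD bD D0 t0 h k lf) => // x _; rewrite mulrA.
have /andP[_] := weight_compare t0 l1 k0 p0 ie.
have e l : Int (fun x => pw (1 + t) l k x * (enorm x * f x ^+ 2)) = Ie D t l k f.
  by apply: eq_Int => x _; rewrite mulrA.
by rewrite !e.
Qed.

Lemma PsiE (t k : R) (x : E) : Psi x t `^ k = pw (1 + t) 1 k x.
Proof. by rewrite /pw mul1r. Qed.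

Lemma weighted_energyE k (w w' : R -> E -> R) t : 0 <= t -> P (w t, w' t) ->
  weighted_energy D k w w' t = (energy k t (w t, w' t))%:E.
Proof.
move=> t0 PU; rewrite /energy -(IntgD_energy oD bD D0 (lexx 1) t0)//.
have [_ lU] := PU.
have i1 := ig_g oD bD D0 t0 (lexx 1) k PU; have i2 := ig_v oD bD D0 t0 (lexx 1) k lU.
rewrite Int_EFin; last 2 first.
- exact: mD.
- by apply: intg_eq (intgD mD i1 i2) => // x _; rewrite mulrDr.
apply: eq_integral => x _; rewrite PsiE mulrC sqr_enorm /gsq /dotg.
by congr (_ * (_ + _))%:E; apply: eq_bigr => i _; rewrite expr2.
Qed.

Lemma force_energyE k t f : 0 <= t -> l2 f ->
  (\int[leb]_(x in D) (f x ^+ 2 * Psi x t `^ k * enorm x)%:E)%E = (Ie D t 1 k f)%:E.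
Proof.
move=> t0 lf; rewrite Int_EFin; last exact: ig_e.
  by apply: eq_integral => x _; rewrite PsiE; congr EFin; ring.
exact: mD.
Qed.

Variable T : R.
Hypothesis T0 : 0 < T.

Lemma energy_continuous k (X : R -> state) :
  (forall s, 0 <= s -> s <= T -> P (X s)) ->
  (forall s e, 0 <= s -> s <= T -> 0 < e -> exists2 eta, 0 < eta &
     forall r, 0 <= r -> r <= T -> `|r - s| < eta -> nrm D (X r - X s) < e) ->
  continuous_upto T (fun s => energy k s (X s)).
Proof.
(* With slope 1, exponent [e = 0] and [mu = k - 1], [Eform] on the diagonal is [energy k], so its
   continuity is that of a bounded form. *)
move=> PX cX; have [f _ _] := Eform_family oD bD D0 (lexx 1) (k - 1) 0 T0.
apply: continuous_upto_eq (form_continuous oD bD D0 f PX cX) => s s0 sT.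
rewrite (Eform_diag oD bD D0 (lexx 1) s0)//; last exact: PX.
by rewrite powRr0 mul1r subr0 subrK.
Qed.

Lemma force_continuous k (F : R -> E -> R) : continuous_L2 D T F ->
  continuous_upto T (fun s => Ie D s 1 k (F s)).
Proof.
move=> cF; have z := tder_const D 0.
(* The force integral is likewise the value of a form at the state [(0, F s)]: only the weight of
   [v^2] is nonzero. *)
have d := tder_mul (tder_pw D k (@ler01 R)) (tder_cst (bmf_enorm oD bD D0)).
have [f _ _] := tder_wform oD bD D0 T0 z d z z.
have PX := force_phase oD bD D0 cF; have cX := force_cont oD bD D0 cF.
apply: continuous_upto_eq (form_continuous oD bD D0 f PX cX) => s s0 sT.
by apply: eq_Int => x _ /=; rewrite (_ : (0 : E -> R) x = 0)//; ring.
Qed.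

End unit_weight.

Theorem proposition3p1 (R : realType) (N : nat) (V0 m : R)
    (hN : (3 <= N)%N) (hV0 : 0 < V0)
    (hm0 : 0 < m) (hm : m < Num.min (N%:R - 1) (V0 - 1)) :
  exists delta K : R, [/\ 0 < delta, 0 < K &
    forall (T : R) (D : set 'rV[R]_N) (w0 w1 : 'rV[R]_N -> R)
      (F w w' : R -> 'rV[R]_N -> R),
      0 < T ->
      smooth_bounded_domain D -> ~ closure D 0 ->
      H10 D w0 -> L2 D w1 -> continuous_L2 D T F ->
      mild_solution D V0 T F w0 w1 w w' ->
      forall t : R, 0 <= t <= T ->
        (weighted_energy D (m + 1)%R w w' t
           + delta%:E * \int[lebesgue_measure]_(s in `[0%R, t])
                          weighted_energy D m w w' s
         <= K%:E * (weighted_energy D (m + 1)%R w w' 0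
             + \int[lebesgue_measure]_(s in `[0%R, t])
                 \int[lebesgue_rV N]_(x in D)
                   (F s x ^+ 2 * Psi x s `^ (m + 1) * enorm x)%:E))%E].
Proof.
have [mN mV] : m < N%:R - 1 /\ m + 1 < V0.
  by move: hm; rewrite lt_min => /andP[a b]; split=> //; rewrite -ltrBrDr.
have [lam [c [C [delta [l1 c0 C0 d0 H]]]]] := ex_lyapunov hN hV0 hm0 mN mV.
have lam0 : 0 < lam := lt_le_trans ltr01 l1.
have m1 : 0 <= m + 1 by rewrite addr_ge0// ltW.
(* Replacing [1 + t + lam |x|] by [Psi] costs [lam^(m + 1)] on the initial energy and on the force,
   and nothing on the left-hand side. *)
pose C' := C * lam `^ (m + 1).
have C'0 : 0 < C' by rewrite mulr_gt0// powR_gt0.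
exists (delta / c), (C' / c); split; [exact: divr_gt0|exact: divr_gt0|].
move=> T D w0 w1 F w w' T0 [_ oD _ bD _] D0 hw0 lw1 cF [cw cw' _ [S [HS HG duh]]] t /andP[t0 tT].
have [J [cJ Jlow Jup Jd]] := lyapunov_state_at oD bD D0 hN HS HG T0 hw0 lw1 cF cw cw' duh (H D T oD bD D0 T0).
have PX := state_at_phase cw cw'; have cX := state_at_cont oD bD D0 cw cw'.
have lF := force_l2 cF.
have ca := energy_continuous oD bD D0 T0 m PX cX.
have cb := force_continuous oD bD D0 T0 (m + 1) cF.
pose a s := energy D m s (state_at w w' s); pose b s := Ie D s 1 (m + 1) (F s).
have z0 : continuous_upto T (fun _ : R => 0 : R).
  by move=> s e _ _ e0; exists 1 => // r _ _ _; rewrite subrr normr0.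
have cg : continuous_upto T (fun s => delta * a s - C' * b s).
  have := continuous_uptoD (- C') (continuous_uptoD delta z0 ca) cb.
  by apply: continuous_upto_eq => s _ _; rewrite add0r mulNr.
have ia := continuous_upto_integrable ca t0 tT; have ib := continuous_upto_integrable cb t0 tT.
have HD s e : 0 <= s -> s < T -> 0 < e -> exists2 eta, 0 < eta & forall h, 0 < h -> h < eta ->
    s + h <= T -> J (s + h) <= J s + h * (- (delta * a s - C' * b s) + e).
  move=> s0 sT e0; have [eta eta0 h] := Jd s e s0 sT e0; exists eta; first exact: eta0.
  move=> r r0 re rT; apply: le_trans (h r r0 re rT) _.
  have /andP[h1 _] := energy_compare oD bD D0 s0 l1 (ltW hm0) (PX s s0 (ltW sT)).
  have h2 := Ie_compare oD bD D0 s0 l1 m1 (lF s s0 (ltW sT)).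
  exact: dini_arith r0 d0 C0 h1 h2.
have HJ := dini_integral cJ cg HD t0 tT.
rewrite (Rintegral_itv_comb _ _ ia ib) in HJ.
have low : c * energy D (m + 1) t (state_at w w' t) <= J t.
  apply: le_trans (Jlow t t0 tT); rewrite ler_pM2l; last exact: c0.
  by have /andP[] := energy_compare oD bD D0 t0 l1 m1 (PX t t0 tT).
have up : J 0 <= C' * energy D (m + 1) 0 (state_at w w' 0).
  apply: le_trans Jup _; rewrite /C' -mulrA ler_pM2l//.
  by have /andP[] := energy_compare oD bD D0 (lexx 0) l1 m1 (PX 0 (lexx 0) (ltW T0)).
have fin := final_arith c0 low up HJ.
rewrite (weighted_energyE oD bD D0 _ t0 (PX t t0 tT)).
rewrite (weighted_energyE oD bD D0 _ (lexx 0) (PX 0 (lexx 0) (ltW T0))).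
(* The energy and the force integral are real and continuous in time, so the extended-real integrals
   are finite and the real inequality can be lifted. *)
have -> : (\int[lebesgue_measure]_(s in `[0%R, t]) weighted_energy D m w w' s)%E =
    (\int[lebesgue_measure]_(s in `[0%R, t]) a s)%:E.
  rewrite /Rintegral fineK; last exact: integrable_fin_num.
  apply: eq_integral => s; rewrite inE/= in_itv/= => /andP[s0 st].
  exact: (weighted_energyE oD bD D0 _ s0 (PX s s0 (le_trans st tT))).
have -> : (\int[lebesgue_measure]_(s in `[0%R, t]) \int[lebesgue_rV N]_(x in D)
      (F s x ^+ 2 * Psi x s `^ (m + 1) * enorm x)%:E)%E = (\int[lebesgue_measure]_(s in `[0%R, t]) b s)%:E.
  rewrite /Rintegral fineK; last exact: integrable_fin_num.
  apply: eq_integral => s; rewrite inE/= in_itv/= => /andP[s0 st].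
  exact: (force_energyE oD bD D0 _ s0 (lF s s0 (le_trans st tT))).
by rewrite -EFinM -!EFinD -EFinM lee_fin.
Qed.
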